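(* Let $n=7$ or $n=8$, and put $\tilde b_{max,2}=\frac1{40}$ if $n=8$ and $\tilde b_{max,2}=\frac3{125}$ if $n=7$. Then, for each $0<b\le\tilde b_{max,2}$, the cone $\tilde C(b)\subset\mathcal{C}_B(\mathbb{R}^n)$ (defined in the context) is transversally invariant under the Hamilton ODE $\frac{\mathrm{d}}{\mathrm{d}t}R=Q(R)$.
   Context: $\mathcal{C}_B(\mathbb{R}^n)$ is the space of algebraic curvature operators: symmetric bilinear forms $R$ on $\Lambda^2\mathbb{R}^n$ satisfying the first Bianchi identity, with components $R_{ijkl}=R(e_i\wedge e_j,e_k\wedge e_l)$ in an orthonormal frame, $\mathrm{Ric}(R)_{ik}=\sum_p R_{ipkp}$, $\mathrm{scal}(R)=\sum_i\mathrm{Ric}(R)_{ii}$. Elements $T\in S^2(\mathfrak{so}(n))$ are symmetric bilinear forms on $\Lambda^2\mathbb{R}^n$ (Bianchi not required), with the same component notation. For symmetric two-tensors, $(A\wedge B)_{ijkl}=A_{ik}B_{jl}+A_{jl}B_{ik}-A_{il}B_{jk}-A_{jk}B_{il}$, so $(\mathrm{id}\wedge\mathrm{id})_{ijij}=2$ for $i\ne j$; $I=\frac12\,\mathrm{id}\wedge\mathrm{id}$. Hamilton's quadratic map is $Q(R)_{ijkl}=R_{ijpq}R_{klpq}+2R_{ipkq}R_{jplq}-2R_{iplq}R_{jpkq}$ (summation over $p,q$). A closed convex cone $C\subset\mathcal{C}_B(\mathbb{R}^n)$ is transversally invariant under $\frac{\mathrm{d}}{\mathrm{d}t}R=Q(R)$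 if for every $R\in C\setminus\{0\}$ the vector $Q(R)$ lies in the interior of the tangent cone of $C$ at $R$. For $0\le b\le a$, $l_{a,b}(R)=R+b\,\mathrm{Ric}(R)\wedge\mathrm{id}+\frac{2(a-b)}{n}\mathrm{scal}(R)\,I$. First cone family. Put $(\varepsilon,b_{max,2})=(10^{-3},\frac1{18})$ if $n=8$ and $(10^{-4},\frac{131}{2000})$ if $n=7$. For $0<b\le b_{max,2}$ let $$a(b)=\frac{(2+(n-2)b)^2}{2(2+(n-3)b)}b,\qquad \gamma(b)=\frac{b}{2+(n-3)b},$$ $$\rho(b)=b-\frac{2(n-1)\gamma(1-2b)}{n^2}-\frac{2(n-1)(1+\gamma)\bigl(n^2b^2-2(n-1)(a-b)(1-2b)\bigr)}{n^2(1+2(n-1)a)},$$ $$\omega(b)=(1-\varepsilon)\sqrt{\frac{27(2+(n-2)b)}{8}\,\frac{b(1+(n-2)b)^2}{n^2\rho^3(2+(n-3)b)^2}}.$$ A tensor $T\in S^2(\mathfrak{so}(n))$ lies in $C_{PIC}$ (relaxed sense) if $T_{1313}+T_{1414}+T_{2323}+T_{2424}+2T_{1342}+2T_{1423}\ge0$ for every orthonormal four-frame. $T\ge0$ means nonnegative definite on $\Lambda^2\mathbb{R}^n$. $\mathcal{E}(b)$ is the set of all $S\in\mathcal{C}_B(\mathbb{R}^n)$ for which there exists $T\in S^2(\mathfrak{so}(n))$ with: (1) $T\ge0$; (2) $S-T\in C_{PIC}$ in the relaxed sense; (3) $\mathrm{Ric}(S)_{11}+\mathrm{Ric}(S)_{22}+\frac{2\gamma(b)}{n}\mathrm{scal}(S)\ge0$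 for every orthonormal pair; (4) for every orthonormal frame, $\mathrm{Ric}(S)_{22}-\mathrm{Ric}(S)_{11}\le\omega(b)^{1/2}\mathrm{scal}(S)^{1/2}\bigl(\sum_{p=3}^n(T_{1p1p}+T_{2p2p})\bigr)^{1/2}$. Put $C(b)=l_{a(b),b}(\mathcal{E}(b))$. Second cone family. For $0<b\le\tilde b_{max,2}$ let $\tilde a=b+\frac{n-2}{2}b^2$. $\tilde{\mathcal{E}}(b)$ is the set of all $S\in\mathcal{C}_B(\mathbb{R}^n)$ such that (i) $l_{\tilde a,b}(S)\in C(b_{max,2})$, and (ii) $$S_{1313}+\lambda^2S_{1414}+S_{2323}+\lambda^2S_{2424}-2\lambda S_{1234}+\sqrt{2\tilde a}\,(1-\lambda^2)\bigl(\mathrm{Ric}(S)_{11}+\mathrm{Ric}(S)_{22}\bigr)\ge0$$ for every orthonormal four-frame $\{e_1,e_2,e_3,e_4\}$ and every $\lambda\in[0,1]$. Then $\tilde C(b)=l_{\tilde a,b}(\tilde{\mathcal{E}}(b))$. *)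

(* Defs.v *)
From mathcomp Require Import all_boot all_order all_algebra.
From mathcomp Require Import all_classical all_reals all_analysis.

Set Implicit Arguments.
Unset Strict Implicit.
Unset Printing Implicit Defensive.

Import Order.TTheory GRing.Theory Num.Theory.
Import numFieldNormedType.Exports.

Local Open Scope classical_set_scope.
Local Open Scope ring_scope.

(* A bilinear form T on R^n (x) R^n, given by its Gram matrix in the basis
   e_i (x) e_j, numbered by [mxvec_index i j].  A bilinear form on Lambda^2 R^n
   is one that is antisymmetric in each pair of slots, and then
   T(e_i /\ e_j, e_k /\ e_l) = T_ijkl, without a factor 1/4.
   The topology is the one of the library on matrices. *)
Notation tensor R n := 'M[R]_(n * n).

Definition coord4 (R : realType) (n : nat) (T : tensor R n)
    (i j k l : 'I_n) : R :=
  T (mxvec_index i j) (mxvec_index k l).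

Definition mktensor (R : realType) (n : nat)
    (f : 'I_n -> 'I_n -> 'I_n -> 'I_n -> R) : tensor R n :=
  \sum_(i < n) \sum_(j < n) \sum_(k < n) \sum_(l < n)
    f i j k l *: delta_mx (mxvec_index i j) (mxvec_index k l).

Lemma mxvec_index_inj (m n : nat) (i i' : 'I_m) (j j' : 'I_n) :
  (mxvec_index i j == mxvec_index i' j') = (i == i') && (j == j').
Proof.
apply/eqP/andP => [|[/eqP-> /eqP->] //].
by move=> /(f_equal (@enum_val _ _ \o cast_ord (esym (mxvec_cast m n))));
  rewrite /= /mxvec_index !cast_ordK !enum_rankK => -[-> ->].
Qed.

Lemma coord4_mktensor (R : realType) (n : nat)
    (f : 'I_n -> 'I_n -> 'I_n -> 'I_n -> R) (i j k l : 'I_n) :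
  coord4 (mktensor f) i j k l = f i j k l.
Proof.
rewrite /coord4 /mktensor summxE.
rewrite (bigD1 i) //= [X in _ + X]big1 ?addr0; last first.
  move=> i' ni; rewrite summxE big1 // => j' _; rewrite summxE big1 // => k' _.
  rewrite summxE big1 // => l' _.
  by rewrite !mxE mxvec_index_inj eq_sym (negPf ni) mulr0.
rewrite summxE (bigD1 j) //= [X in _ + X]big1 ?addr0; last first.
  move=> j' nj; rewrite summxE big1 // => k' _; rewrite summxE big1 // => l' _.
  by rewrite !mxE mxvec_index_inj [j == j']eq_sym (negPf nj) andbF mulr0.
rewrite summxE (bigD1 k) //= [X in _ + X]big1 ?addr0; last first.
  move=> k' nk; rewrite summxE big1 // => l' _.
  by rewrite !mxE [X in _ && X]mxvec_index_inj [k == k']eq_sym (negPf nk) andbF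
    mulr0.
rewrite summxE (bigD1 l) //= [X in _ + X]big1 ?addr0; last first.
  move=> l' nl.
  by rewrite !mxE [X in _ && X]mxvec_index_inj [l == l']eq_sym (negPf nl) !andbF
    mulr0.
by rewrite !mxE !eqxx mulr1.
Qed.

Definition S2so (R : realType) (n : nat) : set (tensor R n) :=
  [set T | forall i j k l : 'I_n,
    [/\ coord4 T i j k l = - coord4 T j i k l,
        coord4 T i j k l = - coord4 T i j l k &
        coord4 T i j k l = coord4 T k l i j]].

Definition CB (R : realType) (n : nat) : set (tensor R n) :=
  [set T | S2so T /\
    forall i j k l : 'I_n,
      coord4 T i j k l + coord4 T j k i l + coord4 T k i j l = 0].

(* T_{xyzw} for vectors x, y, z, w: the components of T in a frame. *)
Definition ev (R : realType) (n : nat) (T : tensor R n)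
    (x y z w : 'rV[R]_n) : R :=
  \sum_(i < n) \sum_(j < n) \sum_(k < n) \sum_(l < n)
    coord4 T i j k l * x 0 i * y 0 j * z 0 k * w 0 l.

Definition ric (R : realType) (n : nat) (T : tensor R n) : 'M[R]_n :=
  \matrix_(i < n, k < n) \sum_(p < n) coord4 T i p k p.

Definition Ric (R : realType) (n : nat) (T : tensor R n) (x y : 'rV[R]_n) : R :=
  (x *m ric T *m y^T) 0 0.

Definition scal (R : realType) (n : nat) (T : tensor R n) : R := \tr (ric T).

(* Two-vectors are antisymmetric matrices. *)
Definition nonneg_def (R : realType) (n : nat) (T : tensor R n) : Prop :=
  forall phi : 'M[R]_n, phi^T = - phi ->
    0 <= \sum_(i < n) \sum_(j < n) \sum_(k < n) \sum_(l < n)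
           coord4 T i j k l * phi i j * phi k l.

Definition orthonormal (R : realType) (n : nat) (s : seq 'rV[R]_n) : bool :=
  all (fun x => (x *m x^T) 0 0 == 1) s &&
  pairwise (fun x y => (x *m y^T) 0 0 == 0) s.

Definition wedge (R : realType) (n : nat) (A B : 'M[R]_n) : tensor R n :=
  mktensor (fun i j k l =>
    A i k * B j l + A j l * B i k - A i l * B j k - A j k * B i l).

Definition curvI (R : realType) (n : nat) : tensor R n :=
  2^-1 *: wedge 1%:M 1%:M.

Definition lab (R : realType) (n : nat) (a b : R) (T : tensor R n) :
    tensor R n :=
  T + b *: wedge (ric T) 1%:M + (2 * (a - b) / n%:R * scal T) *: curvI R n.

Definition hamQ (R : realType) (n : nat) (T : tensor R n) : tensor R n :=
  mktensor (fun i j k l =>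
    \sum_(p < n) \sum_(q < n)
      (coord4 T i j p q * coord4 T k l p q
       + 2 * (coord4 T i p k q * coord4 T j p l q)
       - 2 * (coord4 T i p l q * coord4 T j p k q))).

Definition closed_convex_cone (R : realType) (n : nat) (C : set (tensor R n)) :
    Prop :=
  [/\ closed C,
      convex_set (C : set (convex_lmodType (tensor R n))),
      C 0 &
      forall (t : R) (x : tensor R n), 0 <= t -> C x -> C (t *: x)].

Definition tangent_cone (R : realType) (n : nat) (C : set (tensor R n))
    (x : tensor R n) : set (tensor R n) :=
  closure [set v | exists (t : R) (y : tensor R n),
                     [/\ 0 <= t, C y & v = t *: (y - x)]].

(* The interior is taken relative to the vector space CB R n. *)
Definition transversally_invariant (R : realType) (n : nat)
    (C : set (tensor R n)) : Prop :=
  [/\ C `<=` @CB R n,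
      closed_convex_cone C &
      forall x : tensor R n, C x -> x <> 0 ->
        (tangent_cone C x : set (subspace (@CB R n)))^° (hamQ x)].

(* The parameters [eps] and [bmax2] are meant for n = 7 and n = 8 only. *)
Definition eps (R : realType) (n : nat) : R :=
  if n == 8%N then 1 / 1000 else 1 / 10000.

Definition bmax2 (R : realType) (n : nat) : R :=
  if n == 8%N then 1 / 18 else 131 / 2000.

Definition aC (R : realType) (n : nat) (b : R) : R :=
  (2 + (n%:R - 2) * b) ^+ 2 / (2 * (2 + (n%:R - 3) * b)) * b.

Definition gammaC (R : realType) (n : nat) (b : R) : R :=
  b / (2 + (n%:R - 3) * b).

Definition rhoC (R : realType) (n : nat) (b : R) : R :=
  let a := aC n b in
  let g := gammaC n b in
  b - 2 * (n%:R - 1) * g * (1 - 2 * b) / n%:R ^+ 2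
    - 2 * (n%:R - 1) * (1 + g)
      * (n%:R ^+ 2 * b ^+ 2 - 2 * (n%:R - 1) * (a - b) * (1 - 2 * b))
      / (n%:R ^+ 2 * (1 + 2 * (n%:R - 1) * a)).

Definition omegaC (R : realType) (n : nat) (b : R) : R :=
  (1 - eps R n) *
  Num.sqrt (27 * (2 + (n%:R - 2) * b) / 8
            * (b * (1 + (n%:R - 2) * b) ^+ 2
               / (n%:R ^+ 2 * rhoC n b ^+ 3 * (2 + (n%:R - 3) * b) ^+ 2))).

Definition PIC (R : realType) (n : nat) (T : tensor R n) : Prop :=
  forall e1 e2 e3 e4 : 'rV[R]_n, orthonormal [:: e1; e2; e3; e4] ->
    0 <= ev T e1 e3 e1 e3 + ev T e1 e4 e1 e4 + ev T e2 e3 e2 e3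
         + ev T e2 e4 e2 e4 + 2 * ev T e1 e3 e4 e2 + 2 * ev T e1 e4 e2 e3.

(* In the last clause e1, e2 is completed by s = (e3, ..., en) to an
   orthonormal frame of R^n. *)
Definition coneE (R : realType) (n : nat) (b : R) : set (tensor R n) :=
  [set S | CB S /\ exists T : tensor R n, S2so T /\
    [/\ nonneg_def T,
        PIC (S - T),
        forall e1 e2 : 'rV[R]_n, orthonormal [:: e1; e2] ->
          0 <= Ric S e1 e1 + Ric S e2 e2 + 2 * gammaC n b / n%:R * scal S &
        forall (e1 e2 : 'rV[R]_n) (s : seq 'rV[R]_n),
          size [:: e1, e2 & s] = n -> orthonormal [:: e1, e2 & s] ->
          Ric S e2 e2 - Ric S e1 e1 <=
            Num.sqrt (omegaC n b) * Num.sqrt (scal S)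
            * Num.sqrt (\sum_(p <- s) (ev T e1 p e1 p + ev T e2 p e2 p))]].

Definition coneC (R : realType) (n : nat) (b : R) : set (tensor R n) :=
  lab (aC n b) b @` @coneE R n b.

Definition tbmax2 (R : realType) (n : nat) : R :=
  if n == 8%N then 1 / 40 else 3 / 125.

Definition taC (R : realType) (n : nat) (b : R) : R :=
  b + (n%:R - 2) / 2 * b ^+ 2.

Definition tconeE (R : realType) (n : nat) (b : R) : set (tensor R n) :=
  [set S | [/\ CB S,
    coneC (bmax2 R n) (lab (taC n b) b S) &
    forall (e1 e2 e3 e4 : 'rV[R]_n) (lam : R),
      orthonormal [:: e1; e2; e3; e4] -> 0 <= lam <= 1 ->
      0 <= ev S e1 e3 e1 e3 + lam ^+ 2 * ev S e1 e4 e1 e4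
           + ev S e2 e3 e2 e3 + lam ^+ 2 * ev S e2 e4 e2 e4
           - 2 * lam * ev S e1 e2 e3 e4
           + Num.sqrt (2 * taC n b) * (1 - lam ^+ 2)
             * (Ric S e1 e1 + Ric S e2 e2)]].

Definition tconeC (R : realType) (n : nat) (b : R) : set (tensor R n) :=
  lab (taC n b) b @` @tconeE R n b.

(* Main.v *)
Require Import Defs.
From mathcomp Require Import all_boot all_order all_algebra.
From mathcomp Require Import all_classical all_reals all_analysis.
From mathcomp Require Import ring lra zify complex.
Import Defs.

Set Implicit Arguments.
Unset Strict Implicit.
Unset Printing Implicit Defensive.

Import Order.TTheory GRing.Theory Num.Theory.
Import numFieldNormedType.Exports.

Local Open Scope ring_scope.

(** The cone [tconeC n b] consists of the X for which some T makes a family of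
    inequalities, linear in (X, T) and indexed by a compact set, hold: T >= 0,
    S - T is PIC, the bound on Ric_11 + Ric_22, clause (4) of the first cone (in
    the form u^2 omega scal + v^2 N - 2 u v (Ric_22 - Ric_11) >= 0, which removes
    the roots), and the condition defining the second cone.  If X and T can be
    moved with velocities X' = Q(X) and T' so that each of these functions has
    positive derivative wherever it vanishes, compactness gives X + t Q(X) in
    the strict family for small t > 0, hence Q(X) is interior to the tangent cone.

    In the coordinates S with X = l_{a,b}(S) the velocity is Q(S) + D, where D
    depends on Ric(S) only.  For T the velocity is T' = S^2 + T # T + delta s^2 id /\ id.
    At a zero of the isotropic curvature U = S - T, Wilking's second variation
    argument gives U # U >= 0 and U # T >= 0 on the isotropic plane, so that
    S # S - T # T = U # U + 2 U # T is harmless and the PIC part of D decides.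
    The two Ricci conditions are elementary: a cubic inequality in the first case,
    where the constant omega comes from, and completed squares in the second.
    For the second cone the form is suspended to R^n + R with the new components
    sqrt(2a) Ric; a four-frame together with lambda is then an isotropic plane of
    the suspension, and Wilking's argument applies once more. *)

(** * Hermitian forms and the second variation *)

Section Hf.
Variables (C : numClosedFieldType) (J : finType).
Implicit Types (u : J -> J -> C) (M N : J -> C).

(** The constant [omegaC] is squeezed from two sides. The cubic inequality bounds it from above, the
    factor 1 - eps making that bound strict; the condition on Ric_22 - Ric_11 needs it large,
    because omega times scal' has to pay for the squares of the traceless Ricci tensor A. Both
    stages concern one and the same X, read through l_{a,b} for two pairs of parameters. The first
    cone enters the second stage through a lower bound on A, rescaled by a constant [tau]; the upper
    bound on b keeps [tau] small enough. The tensor T is existentially quantified, so even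
    closedness of the cone requires a bound of T by X, namely |T_ijkl| <= scal T <= scal S.
    Strictness at a nonzero X requires scal S > 0, which rests on the fact that nonnegative
    isotropic curvature with zero scalar curvature is flat. T need not satisfy the Bianchi identity,
    so Wilking's argument is carried out for arbitrary symmetric forms on bivectors, over an
    algebraically closed field and without derivatives. *)

Definition hf u M N := \sum_p \sum_q u p q * (M p * (N q)^*).

Lemma eq_hf u M M' N N' : M =1 M' -> N =1 N' -> hf u M N = hf u M' N'.
Proof. by move=> e e'; apply: eq_bigr => p _; apply: eq_bigr => q _; rewrite e e'. Qed.

Lemma hfZl u a M N : hf u (fun p => a * M p) N = a * hf u M N.
Proof.
rewrite /hf mulr_sumr; apply: eq_bigr => p _; rewrite mulr_sumr.
by apply: eq_bigr => q _; ring.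
Qed.

Lemma hfZr u a M N : hf u M (fun p => a * N p) = a^* * hf u M N.
Proof.
rewrite /hf mulr_sumr; apply: eq_bigr => p _; rewrite mulr_sumr.
by apply: eq_bigr => q _; rewrite rmorphM /=; ring.
Qed.

Lemma hf_suml u (K : finType) (F : K -> J -> C) N :
  hf u (fun p => \sum_k F k p) N = \sum_k hf u (F k) N.
Proof.
rewrite /hf [RHS]exchange_big /=; apply: eq_bigr => p _; rewrite [RHS]exchange_big /=.
by apply: eq_bigr => q _; rewrite mulr_suml mulr_sumr.
Qed.

Lemma hf_sumr u (K : finType) (F : K -> J -> C) M :
  hf u M (fun p => \sum_k F k p) = \sum_k hf u M (F k).
Proof.
rewrite /hf [RHS]exchange_big /=; apply: eq_bigr => p _; rewrite [RHS]exchange_big /=.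
by apply: eq_bigr => q _; rewrite rmorph_sum !mulr_sumr.
Qed.

Lemma hf_sym u M N : (forall p q, (u p q)^* = u q p) -> (hf u M N)^* = hf u N M.
Proof.
move=> hu; rewrite /hf exchange_big rmorph_sum /=; apply: eq_bigr => p _.
rewrite rmorph_sum /=; apply: eq_bigr => q _.
by rewrite !rmorphM /= conjCK hu [(M _)^* * _]mulrC.
Qed.

(** Orthogonality of the characters of Z/4, standing in for an integral over the circle. For a
    fourth root of unity w the conjugate is w^3, so w^j conj(w)^k is w^(j + 3k). *)
Lemma sum_unity4 (m : nat) :
  1 + (-1) ^+ m + 'i ^+ m + (- 'i) ^+ m = (if (4 %| m)%N then 4 else 0) :> C.
Proof.
have i4 : 'i ^+ 4 = 1 :> C by rewrite (exprM 'i 2 2) sqrCi sqrrN expr1n.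
have red (x : C) : x ^+ 4 = 1 -> x ^+ m = x ^+ (m %% 4)%N.
  by move=> e; rewrite {1}(divn_eq m 4) exprD mulnC exprM e expr1n mul1r.
rewrite !red ?i4 ?(exprM _ 2 2) ?sqrrN ?i4 ?sqrCi ?expr1n ?sqrrN ?expr1n // /dvdn.
have : (m %% 4 < 4)%N by rewrite ltn_mod.
case: (m %% 4)%N => [|[|[|[|//]]]] _ /=; rewrite ?expr0 ?expr1 ?exprS ?expr0.
- by ring.
- by ring.
- have := sqrCi C; rewrite expr2 => e; rewrite !(mulrN, mulNr, mulr1, opprK, e); ring.
- have := sqrCi C; rewrite expr2 => e; rewrite !(mulrN, mulNr, mulr1, opprK, e); ring.
Qed.

(* Averaging over the circle of radius t keeps only the terms z^j zbar^k with
   4 | j - k, so the coefficient of t^2 is hf (F 1) (F 1). *)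
Lemma hf_second_variation u (F : nat -> J -> C) :
  (forall p q, (u p q)^* = u q p) ->
  (forall z : C, 0 <= hf u (fun p => \sum_(k < 6) z ^+ k * F k p)
                          (fun p => \sum_(k < 6) z ^+ k * F k p)) ->
  hf u (F 0%N) (F 0%N) = 0 -> 0 <= hf u (F 1%N) (F 1%N).
Proof.
move=> hu pos z0; pose h j k := hf u (F j) (F k).
have hr j k : (h j k)^* = h k j by rewrite /h hf_sym.
have fE z : hf u (fun p => \sum_(k < 6) z ^+ k * F k p) (fun p => \sum_(k < 6) z ^+ k * F k p) =
   \sum_(j < 6) \sum_(k < 6) z ^+ j * (z^*) ^+ k * h j k.
  rewrite hf_suml; apply: eq_bigr => j _; rewrite hf_sumr; apply: eq_bigr => k _.
  by rewrite hfZl hfZr rmorphXn /= mulrA.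
have fw (w t : C) : w^* = w ^+ 3 -> t^* = t ->
   \sum_(j < 6) \sum_(k < 6) (w * t) ^+ j * ((w * t)^*) ^+ k * h j k =
   \sum_(j < 6) \sum_(k < 6) w ^+ (j + 3 * k) * (t ^+ (j + k) * h j k).
  move=> ew et; apply: eq_bigr => j _; apply: eq_bigr => k _.
  have -> : (w * t)^* = w ^+ 3 * t by rewrite rmorphM /= ew et.
  have -> : w ^+ (j + 3 * k) = w ^+ j * (w ^+ 3) ^+ k by rewrite exprD exprM.
  by rewrite (exprMn j w t) (exprMn k (w ^+ 3) t) (exprD t); ring.
(* The surviving coefficients of t^4 and t^6: pairs j, k < 6 with j congruent to k modulo 4 and sum
   4 or 6. *)
pose a := h 2%N 2%N + h 0%N 4%N + h 4%N 0%N.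
pose b := h 3%N 3%N + h 1%N 5%N + h 5%N 1%N.
have key (t : C) : 0 < t -> 0 <= h 1%N 1%N + t ^+ 2 * (a + t ^+ 2 * (b + t ^+ 2 *
      (h 4%N 4%N + t ^+ 2 * h 5%N 5%N))).
  move=> t0; have tc : t^* = t by apply/CrealP; rewrite gtr0_real.
  have i2 : 'i * 'i = -1 :> C by rewrite -expr2 sqrCi.
  have w1 : 'i^* = 'i ^+ 3 :> C by rewrite conjCi exprSr sqrCi mulN1r.
  have w2 : (- 'i)^* = (- 'i) ^+ 3 :> C.
    by rewrite rmorphN /= conjCi opprK exprSr sqrrN sqrCi mulN1r opprK.
  have w3 : (-1)^* = (-1) ^+ 3 :> C.
    by rewrite rmorphN rmorph1 exprSr sqrrN expr1n mul1r.
  have w4 : 1^* = 1 ^+ 3 :> C by rewrite rmorph1 expr1n.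
  have := pos (1 * t); have := pos (-1 * t); have := pos ('i * t); have := pos (- 'i * t).
  rewrite !fE (fw _ _ w1 tc) (fw _ _ w2 tc) (fw _ _ w3 tc) (fw _ _ w4 tc).
  move=> p1 p2 p3 p4; move: (addr_ge0 (addr_ge0 p4 p3) (addr_ge0 p2 p1)).
  rewrite -!big_split /=.
  under eq_bigr => j _.
    rewrite -!big_split /=.
    under eq_bigr => k _ do rewrite -!mulrDl addrA expr1n sum_unity4.
    over.
  rewrite !big_ord_recl !big_ord0 /= !mul0r ?addr0 ?add0r /bump /=.
  rewrite -[h 0%N 0%N]/(hf u _ _) z0 mulr0 ?add0r.
  set X := (X in 0 <= X -> _) => X0.
  have c0 : 0 <= (4 * t ^+ 2)^-1 by rewrite invr_ge0 mulr_ge0 // exprn_ge0 // ltW.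
  move: (mulr_ge0 c0 X0); congr (0 <= _).
  have tn : t != 0 by rewrite gt_eqF.
  rewrite /X /a /b /=; field; exact: tn.
have rl (x : C) : x^* = x -> x \is Num.real by move/CrealP.
have r1 : h 1%N 1%N \is Num.real by apply: rl; rewrite hr.
have ra : a \is Num.real by apply: rl; rewrite /a !rmorphD /= !hr; ring.
have rb : b \is Num.real by apply: rl; rewrite /b !rmorphD /= !hr; ring.
have r4 : h 4%N 4%N \is Num.real by apply: rl; rewrite hr.
have r5 : h 5%N 5%N \is Num.real by apply: rl; rewrite hr.
rewrite -/(h 1%N 1%N); case: (real_ge0P r1) => // n1.
pose B : C := `|a| + `|b| + `|h 4%N 4%N| + `|h 5%N 5%N| + 1.
have B0 : 0 < B by rewrite ltr_wpDl // !addr_ge0.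
(* Small enough that t <= 1 and t B < - h_11. The higher terms are at most t^2 B <= t B, so they
   cannot compensate a negative h_11. *)
pose t := - h 1%N 1%N / (B * (1 - h 1%N 1%N)).
have n1' : 0 < - h 1%N 1%N by rewrite oppr_gt0.
have t0 : 0 < t by rewrite divr_gt0 // mulr_gt0 // ltr_wpDl.
have tB : t * B < - h 1%N 1%N.
  have -> : t * B = - h 1%N 1%N / (1 - h 1%N 1%N).
    by rewrite /t; field; rewrite !gt_eqF // ltr_wpDl.
  rewrite ltr_pdivrMr ?ltr_wpDl // mulrDr mulr1 ltrDl.
  by rewrite mulr_gt0.
have t1 : t <= 1.
  rewrite /t ler_pdivrMr ?mulr_gt0 // ?ltr_wpDl // mul1r.
  apply: (@le_trans _ _ (1 * (1 - h 1%N 1%N))); first by rewrite mul1r lerDr.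
  rewrite ler_pM2r ?ltr_wpDl // /B lerDr !addr_ge0 //.
have t2 : t ^+ 2 <= t by rewrite expr2 -[X in _ <= X]mulr1 ler_pM2l.
have t21 : t ^+ 2 <= 1 by exact: le_trans t1.
have t20 : 0 <= t ^+ 2 by rewrite exprn_ge0 // ltW.
have bnd (x z y : C) : `|z| <= y -> `|x + t ^+ 2 * z| <= `|x| + y.
  move=> zy; apply: le_trans (ler_normD _ _) _; rewrite lerD2l normrM ger0_norm //.
  by apply: le_trans zy; rewrite -[X in _ <= X]mul1r ler_wpM2r.
have := key t t0; set Y := a + _ => kY.
have YB : `|Y| <= B.
  apply: (@le_trans _ _ (`|a| + (`|b| + (`|h 4%N 4%N| + `|h 5%N 5%N|)))).
    by do 3 (apply/bnd).
  by rewrite /B !addrA lerDl.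
have : h 1%N 1%N + t ^+ 2 * Y < 0.
  have YR : Y \is Num.real.
    have tr : t ^+ 2 \is Num.real by rewrite ger0_real.
    by rewrite /Y; do ?[done | apply: realD | apply: realM].
  rewrite -ltrBrDl sub0r; apply: le_lt_trans tB.
  apply: (@le_trans _ _ (t ^+ 2 * B)); last by rewrite ler_pM2r.
  rewrite ler_wpM2l //; apply: le_trans YB; exact: real_ler_norm.
by move=> l; have := le_lt_trans kY l; rewrite ltxx.
Qed.
End Hf.

(** * Complex isotropic planes and their deformations *)

Section Isotropic.
Variables (C : numClosedFieldType) (I : finType).
Implicit Types (x y v w : I -> C).

Definition bil x y := \sum_i x i * y i.
Definition cj x := fun i => (x i)^*.
Definition ot x y := fun p : I * I => x p.1 * y p.2.

Lemma bilC x y : bil x y = bil y x.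
Proof. by apply: eq_bigr => i _; rewrite mulrC. Qed.

Lemma bilDl x x' y : bil (fun i => x i + x' i) y = bil x y + bil x' y.
Proof. by rewrite /bil -big_split; apply: eq_bigr => i _; rewrite mulrDl. Qed.

Lemma bilZl a x y : bil (fun i => a * x i) y = a * bil x y.
Proof. by rewrite /bil mulr_sumr; apply: eq_bigr => i _; rewrite mulrA. Qed.

Lemma bilNl x y : bil (fun i => - x i) y = - bil x y.
Proof. by rewrite /bil -sumrN; apply: eq_bigr => i _; rewrite mulNr. Qed.

Lemma bilDr x x' y : bil y (fun i => x i + x' i) = bil y x + bil y x'.
Proof. by rewrite bilC bilDl !(bilC y). Qed.

Lemma bilZr a x y : bil y (fun i => a * x i) = a * bil y x.
Proof. by rewrite bilC bilZl !(bilC y). Qed.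

Lemma bilNr x y : bil y (fun i => - x i) = - bil y x.
Proof. by rewrite bilC bilNl !(bilC y). Qed.

Lemma cjK x : cj (cj x) =1 x. Proof. by move=> i; rewrite /cj conjCK. Qed.

Lemma bil_cj x y : bil (cj x) (cj y) = (bil x y)^*.
Proof. by rewrite /bil rmorph_sum; apply: eq_bigr => i _; rewrite rmorphM. Qed.

Definition bilE := (bilDl, bilDr, bilZl, bilZr, bilNl, bilNr).

Definition picC (u : I * I -> I * I -> C) := forall x y,
  bil x x = 0 -> bil x y = 0 -> bil y y = 0 -> 0 <= hf u (ot x y) (ot x y).

Definition null_pair z n := [/\ bil z z = 0, bil z n = 0 & bil n n = 0].
(** The value 2 is the squared length of e1 + i e2 for orthonormal e1, e2. *)
Definition unitary_pair z n :=
  [/\ bil z (cj z) = 2, bil z (cj n) = 0 & bil n (cj n) = 2].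

(** F is the velocity at 0 of X tensor Y along a polynomial curve of exactly isotropic planes, X =
    (1 + c t)(z + t P1 + t^2 P2) and Y = n + t Q1 + t^2 Q2. The opposite signs of y keep X.Y zero to
    first order; P2 and Q2, along the conjugate vectors, cancel the quadratic terms A.A, A.B and
    B.B. The total degree 5 is why [hf_second_variation] has six coefficients. *)
Lemma null_curve u z n A B (y c : C) :
  (forall p q, (u p q)^* = u q p) -> picC u ->
  null_pair z n -> unitary_pair z n ->
  [/\ bil A z = 0, bil A n = 0, bil A (cj z) = 0 & bil A (cj n) = 0] ->
  [/\ bil B z = 0, bil B n = 0, bil B (cj z) = 0 & bil B (cj n) = 0] ->
  hf u (ot z n) (ot z n) = 0 ->
  forall F, F = (fun p => (A p.1 + y * cj n p.1) * n p.2 +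
             z p.1 * (B p.2 - y * cj z p.2) + c * (z p.1 * n p.2)) ->
  0 <= hf u F F.
Proof.
move=> hu pu [zz zn nn] [zz' zn' nn'] [Az An Az' An'] [Bz Bn Bz' Bn'] h0 F eF.
have n'z : bil n (cj z) = 0.
  have <- : (bil z (cj n))^* = bil n (cj z).
    by rewrite -bil_cj bilC; apply: eq_bigr => i _; rewrite cjK.
  by rewrite zn' rmorph0.
have zz2 : bil (cj z) (cj z) = 0 by rewrite bil_cj zz rmorph0.
have zn2 : bil (cj z) (cj n) = 0 by rewrite bil_cj zn rmorph0.
have nn2 : bil (cj n) (cj n) = 0 by rewrite bil_cj nn rmorph0.
pose P1 i := A i + y * cj n i; pose Q1 i := B i + - y * cj z i.
pose P2 i := (- bil A A / 4) * cj z i + (- bil A B / 2) * cj n i.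
pose Q2 i := (- bil B B / 4) * cj n i.
pose G (k : nat) (p : I * I) := match k with
  | 0%N => z p.1 * n p.2
  | 1%N => F p
  | 2 => P2 p.1 * n p.2 + P1 p.1 * Q1 p.2 + z p.1 * Q2 p.2
         + c * (P1 p.1 * n p.2 + z p.1 * Q1 p.2)
  | 3 => P2 p.1 * Q1 p.2 + P1 p.1 * Q2 p.2
         + c * (P2 p.1 * n p.2 + P1 p.1 * Q1 p.2 + z p.1 * Q2 p.2)
  | 4 => P2 p.1 * Q2 p.2 + c * (P2 p.1 * Q1 p.2 + P1 p.1 * Q2 p.2)
  | _ => c * (P2 p.1 * Q2 p.2) end.
apply: (@hf_second_variation _ _ u G) => // t.
pose X i := (1 + c * t) * (z i + (t * P1 i + t ^+ 2 * P2 i)).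
pose Y i := n i + (t * Q1 i + t ^+ 2 * Q2 i).
have e p : \sum_(k < 6) t ^+ k * G k p = ot X Y p.
  rewrite !big_ord_recl big_ord0 /bump /= /ot /X /Y eF /P1 /Q1 /=; ring.
have -> := eq_hf u e e.
have sw x x' (v : C) : bil x x' = v -> bil x' x = v by rewrite bilC.
have rel := (zz, zn, nn, zz', zn', nn', n'z, zz2, zn2, nn2, Az, An, Az', An',
             Bz, Bn, Bz', Bn').
have rel' := (sw _ _ _ zn, sw _ _ _ zz', sw _ _ _ zn', sw _ _ _ nn', sw _ _ _ n'z,
  sw _ _ _ zn2, sw _ _ _ Az, sw _ _ _ An, sw _ _ _ Az', sw _ _ _ An',
  sw _ _ _ Bz, sw _ _ _ Bn, sw _ _ _ Bz', sw _ _ _ Bn', bilC B A).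
by apply: pu; rewrite /X /Y /P1 /P2 /Q1 /Q2 !bilE !rel !rel'; field.
Qed.

End Isotropic.

Section Antisym.
Variables (C : numClosedFieldType) (I : finType).
Implicit Types (M N : I * I -> C) (u t : I * I -> I * I -> C).

Definition tw (p : I * I) := (p.2, p.1).
Definition anti M p := (M p - M (tw p)) / 2.

Lemma twK : involutive tw. Proof. by case. Qed.

Lemma sum_tw (V : nmodType) (F : I * I -> V) : \sum_p F (tw p) = \sum_p F p.
Proof. by rewrite [RHS](reindex_inj (inv_inj twK)). Qed.

Lemma anti_tw M p : anti M (tw p) = - anti M p.
Proof. by rewrite /anti twK -mulNr opprB. Qed.

Lemma sum_anti (f M : I * I -> C) : (forall p, f (tw p) = - f p) ->
  \sum_p f p * anti M p = \sum_p f p * M p.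
Proof.
move=> fa; rewrite (eq_bigr (fun p => f p * M p / 2 + f (tw p) * M (tw p) / 2)); last first.
  by move=> p _; rewrite fa /anti; field.
rewrite big_split /= (sum_tw (fun p => f p * M p / 2)) -big_split /=.
by apply: eq_bigr => p _; field.
Qed.

Definition alt4 u := (forall p q, u (tw p) q = - u p q) /\
   (forall p q, (u p q)^* = u q p).

Lemma alt4r u : alt4 u -> forall p q, u p (tw q) = - u p q.
Proof. by case=> ua uh p q; rewrite -[LHS]uh ua rmorphN /= uh. Qed.

Lemma hf_antil u M N : alt4 u -> hf u (anti M) N = hf u M N.
Proof.
move=> au; rewrite /hf exchange_big [RHS]exchange_big /=; apply: eq_bigr => q _.
under eq_bigr do rewrite mulrA mulrAC.
under [RHS]eq_bigr do rewrite mulrA mulrAC.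
by rewrite sum_anti // => p; rewrite au.1 mulNr.
Qed.

Lemma hf_antir u M N : alt4 u -> hf u M (anti N) = hf u M N.
Proof. by move=> au; rewrite -(hf_sym _ _ au.2) hf_antil // hf_sym //; case: au. Qed.

Lemma hf_anti u M : alt4 u -> hf u (anti M) (anti M) = hf u M M.
Proof. by move=> au; rewrite hf_antil // hf_antir. Qed.

Definition mulf (f w : I * I -> C) (p : I * I) := \sum_j f (p.1, j) * w (j, p.2).

(** The antisymmetric part of the product f w is half the commutator [f, w], so this is the second
    variation of the plane spanned by z, n under the action of w in so(n, C). The velocities w z and
    w n are split along z, n, their conjugates and the complement. Antisymmetry of w ties the
    conjugate components together as [null_curve] demands, and the parts along z tensor z and n
    tensor n disappear under [anti]. *)
Lemma second_variation u (z n : I -> C) (w : I * I -> C) :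
  alt4 u -> picC u -> null_pair z n -> unitary_pair z n ->
  hf u (ot z n) (ot z n) = 0 -> (forall p, w (tw p) = - w p) ->
  0 <= hf u (mulf (anti (ot z n)) w) (mulf (anti (ot z n)) w).
Proof.
move=> au pu zn zn' h0 wa.
pose al i := \sum_j w (i, j) * z j; pose be i := \sum_j w (i, j) * n j.
have wba (x y : I -> C) : \sum_i x i * (\sum_j w (i, j) * y j) =
    - \sum_i y i * (\sum_j w (i, j) * x j).
  rewrite -sumrN; under eq_bigr do rewrite mulr_sumr.
  rewrite exchange_big; apply: eq_bigr => j _; rewrite mulr_sumr -sumrN.
  by apply: eq_bigr => i _; rewrite -[(i, j)]/(tw (j, i)) wa; ring.
have self (x : C) : x = - x -> x = 0 by move=> e; apply/eqP; rewrite -eqNr {2}e.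
have alz : bil al z = 0 by rewrite bilC; apply: self; exact: wba.
have ben : bil be n = 0 by rewrite bilC; apply: self; exact: wba.
have aln : bil al n = - bil be z by rewrite bilC [bil be _]bilC; exact: wba.
pose p := bil al (cj z) / 2; pose q := bil al (cj n) / 2; pose y := bil al n / 2.
pose r := bil be (cj z) / 2; pose s := bil be (cj n) / 2.
pose A i := al i + (- p * z i + (- q * n i + - y * cj n i)).
pose B i := be i + (- r * z i + (- s * n i + y * cj z i)).
case: (zn) (zn') => [zz znz nn] [zz' zn2 nn'].
have n'z : bil n (cj z) = 0.
  have <- : (bil z (cj n))^* = bil n (cj z).
    by rewrite -bil_cj bilC; apply: eq_bigr => i _; rewrite cjK.
  by rewrite zn2 rmorph0.
have zzc : bil (cj z) (cj z) = 0 by rewrite bil_cj zz rmorph0.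
have znc : bil (cj z) (cj n) = 0 by rewrite bil_cj znz rmorph0.
have nnc : bil (cj n) (cj n) = 0 by rewrite bil_cj nn rmorph0.
have rel := (zz, znz, nn, zz', zn2, nn', n'z, zzc, znc, nnc, bilC n z, bilC (cj n) z,
  bilC (cj z) z, bilC (cj n) n, bilC (cj z) n, bilC (cj n) (cj z), alz, ben).
have HA : [/\ bil A z = 0, bil A n = 0, bil A (cj z) = 0 & bil A (cj n) = 0].
  by rewrite /A !bilE !rel /p /q /y; split; field.
have HB : [/\ bil B z = 0, bil B n = 0, bil B (cj z) = 0 & bil B (cj n) = 0].
  by rewrite /B !bilE !rel /r /s /y aln; split; field.
have := @null_curve _ _ u z n A B y (p + s) au.2 pu zn zn' HA HB h0 _ erefl.
set F := fun _ => _; set M := mulf _ _.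
suff -> : hf u F F = 4 * hf u M M by rewrite pmulr_rge0.
rewrite -hf_anti // -[hf u M M]hf_anti //.
suff e : anti F =1 fun x => - 2 * anti M x.
  by rewrite (eq_hf _ e e) hfZl hfZr rmorphN rmorph_nat; ring.
have ME i j : M (i, j) = (n i * al j - z i * be j) / 2.
  rewrite /M /mulf /anti /ot /=.
  rewrite (eq_bigr (fun k => n i / 2 * (w (j, k) * z k) - z i / 2 * (w (j, k) * n k))).
    by rewrite sumrB -!mulr_sumr -/(al j) -/(be j); field.
  by move=> k _; rewrite -[(k, j)]/(tw (j, k)) wa; field.
by move=> [i j]; rewrite /anti /tw !ME /F /A /B /=; field.
Qed.

(** Polarized, and scaled so that for real u the diagonal value [sharp u u] is Q(u) minus the square
    of u. *)
Definition sharp u t (a b : I * I) : C := \sum_p \sum_q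
  (u (a.1, p) (b.1, q) * t (a.2, p) (b.2, q) + t (a.1, p) (b.1, q) * u (a.2, p) (b.2, q)
 - u (a.1, p) (b.2, q) * t (a.2, p) (b.1, q) - t (a.1, p) (b.2, q) * u (a.2, p) (b.1, q)).

Lemma alt4_sharp u t : alt4 u -> alt4 t -> alt4 (sharp u t).
Proof.
move=> [ua uh] [ta th]; split=> [a b|a b].
  rewrite /sharp -sumrN; apply: eq_bigr => p _; rewrite -sumrN; apply: eq_bigr => q _ /=.
  by ring.
rewrite /sharp exchange_big rmorph_sum /=; apply: eq_bigr => p _.
rewrite rmorph_sum /=; apply: eq_bigr => q _.
by rewrite !rmorphB !rmorphD !rmorphM /= !uh !th; ring.
Qed.

End Antisym.

(** * Factorization of positive semidefinite Hermitian matrices *)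

Section Psd.
Variable C : numClosedFieldType.
Local Open Scope sesquilinear_scope.

(** The factor is written A B in order to record that its columns lie in the column space of A. *)
Lemma psd_decomp n (A : 'M[C]_n) : A = A^t* ->
  (forall x : 'rV_n, 0 <= (x *m A *m x^t*) 0 0) ->
  exists B : 'M[C]_n, A = (A *m B) *m map_mx Num.conj (A *m B)^T.
Proof.
move=> hA pA.
have /orthomx_spectralP AE : A \is normalmx by apply/normalmxP; rewrite -hA.
have uP := spectral_unitarymx A; set P := spectralmx A in uP AE.
set d := spectral_diag A in AE.
rewrite invmx_unitary // in AE.
have PP : P *m P^t* = 1%:M by apply/unitarymxP.
have d0 k : 0 <= d 0 k.
  have := pA (row k P).
  rewrite (_ : _ 0 0 = (P *m A *m P^t*) k k); last first.
    by rewrite -row_mul !mxE; apply: eq_bigr => j _; rewrite !mxE.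
  by rewrite {1}AE -!mulmxA (mulmxA P) PP mul1mx mulmx1 !mxE eqxx mulr1n.
(* The inverse of zero is zero, so a zero eigenvalue contributes a zero column to A B. *)
pose e := map_mx (fun x => (sqrtC x)^-1) d.
exists (P^t* *m diag_mx e).
have AB : A *m (P^t* *m diag_mx e) = P^t* *m diag_mx (map_mx sqrtC d).
  rewrite {1}AE -!mulmxA (mulmxA P) PP mul1mx; congr (_ *m _).
  rewrite mulmx_diag; congr diag_mx; apply/rowP => k; rewrite !mxE.
  have [->|nz] := eqVneq (d 0 k) 0; first by rewrite sqrtC0 mul0r.
  by rewrite -{1}[d 0 k]sqrtCK expr2 mulfK // sqrtC_eq0.
rewrite AB trmx_mul map_mxM trmxCK !mulmxA -(mulmxA (P^t*)).
rewrite tr_diag_mx map_diag_mx mulmx_diag [LHS]AE; congr (_ *m diag_mx _ *m _).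
apply/rowP => k; rewrite !mxE.
have e' : (sqrtC (d 0 k))^* = sqrtC (d 0 k).
  by apply/CrealP; rewrite ger0_real // sqrtC_ge0.
by transitivity (sqrtC (d 0 k) * (sqrtC (d 0 k))^*); rewrite // e' -expr2 sqrtCK.
Qed.

Lemma psd_decomp_fin (J : finType) (Y : J -> J -> C) :
  (forall a b, (Y a b)^* = Y b a) ->
  (forall x : J -> C, 0 <= \sum_a \sum_b Y a b * ((x a)^* * x b)) ->
  exists (m : nat) (c : 'I_m -> J -> C), forall a b,
    Y a b = \sum_k (\sum_j Y a j * c k j) * (\sum_j Y b j * c k j)^*.
Proof.
move=> hY pY; pose A := \matrix_(i, j < #|J|) Y (enum_val i) (enum_val j).
have hA : A = A ^t* by apply/matrixP => i j; rewrite !mxE hY.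
have [x|B AE] := psd_decomp hA.
  have := pY (fun a => (x 0 (enum_rank a))^*); congr (0 <= _).
  rewrite -mulmxA mxE (reindex enum_rank) /=; last by apply: onW_bij; exact: enum_rank_bij.
  apply: eq_bigr => a _; rewrite mxE (reindex enum_rank) /=; last first.
    by apply: onW_bij; exact: enum_rank_bij.
  rewrite mulr_sumr; apply: eq_bigr => b _; rewrite !mxE !enum_rankK conjCK.
  by ring.
exists #|J|, (fun k a => B (enum_rank a) k) => a b.
have := AE; move/matrixP => /(_ (enum_rank a) (enum_rank b)).
rewrite !mxE !enum_rankK => ->; apply: eq_bigr => k _.
by rewrite !mxE; congr (_ * _^*); rewrite (reindex enum_rank) /=;
  [apply: eq_bigr => j _; rewrite !mxE !enum_rankK | apply: onW_bij; exact: enum_rank_bij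
  |apply: eq_bigr => j _; rewrite !mxE !enum_rankK | apply: onW_bij; exact: enum_rank_bij].
Qed.
End Psd.

(** * Nonnegativity of sharp products *)

Section SharpPos.
Variables (C : numClosedFieldType) (I : finType).
Implicit Types (f w : I * I -> C) (u t : I * I -> I * I -> C).

Definition pos_on f u := forall w, (forall p, w (tw p) = - w p) ->
  0 <= hf u (mulf f w) (mulf f w).

Lemma sum_pair (V : nmodType) (K L : finType) (F : K * L -> V) :
  \sum_p F p = \sum_i \sum_j F (i, j).
Proof. by rewrite pair_bigA; apply: eq_bigr => -[i j]. Qed.

Lemma sum_antiC (M N : I * I -> C) :
  \sum_p anti M p * N p = \sum_p M p * anti N p.
Proof.
transitivity (\sum_p anti M p * anti N p).
  by rewrite (sum_anti (f := anti M)) // => p; rewrite anti_tw.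
under eq_bigr do rewrite mulrC.
rewrite (sum_anti (f := anti N)); last by move=> p; rewrite anti_tw.
by apply: eq_bigr => p _; rewrite mulrC.
Qed.

Lemma sum3_shuffle (V : nmodType) (F : I -> I -> I -> I -> I -> I -> V) :
  \sum_a \sum_b \sum_(i : I) \sum_(k : I) F i a.1 k b.1 a.2 b.2 =
  \sum_(a : I * I) \sum_(b : I * I) \sum_p \sum_q F a.1 a.2 b.1 b.2 p q.
Proof.
pose P := ((I * I) * ((I * I) * (I * I)))%type.
transitivity (\sum_(x : P) F x.2.2.1 x.1.1 x.2.2.2 x.2.1.1 x.1.2 x.2.1.2).
  by rewrite !sum_pair; do 2 (apply: eq_bigr => ? _); rewrite !sum_pair; do 2 (apply: eq_bigr => ? _);
     rewrite sum_pair.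
transitivity (\sum_(x : P) F x.1.1 x.1.2 x.2.1.1 x.2.1.2 x.2.2.1 x.2.2.2); last first.
  by rewrite !sum_pair; do 2 (apply: eq_bigr => ? _); rewrite !sum_pair; do 2 (apply: eq_bigr => ? _);
     rewrite sum_pair.
pose h (x : P) : P := ((x.2.2.1, x.1.1), ((x.2.2.2, x.2.1.1), (x.1.2, x.2.1.2))).
pose g (x : P) : P := ((x.1.2, x.2.2.1), ((x.2.1.2, x.2.2.2), (x.1.1, x.2.1.1))).
by rewrite [RHS](reindex h) //; exists g => -[[? ?] [[? ?] [? ?]]].
Qed.

(* With Y the pull-back of u by mulf f, the double sum of sharp u t is the trace
   of t against Y; the vectors of a decomposition of Y into squares lie in the
   column space of Y, hence in the image of mulf f, where t is nonnegative. *)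
Lemma sharp_ge0 f u t : alt4 u -> alt4 t -> (forall p, f (tw p) = - f p) ->
  pos_on f u -> pos_on f t -> 0 <= hf (sharp u t) f f.
Proof.
move=> au at_ fa pu pt.
pose Y0 a b := \sum_i \sum_k u (i, a.2) (k, b.2) * (f (i, a.1) * (f (k, b.1))^*).
pose Y a b := (Y0 a b - Y0 (tw a) b - Y0 a (tw b) + Y0 (tw a) (tw b)) / 4.
have Y0h a b : (Y0 a b)^* = Y0 b a.
  rewrite /Y0 exchange_big rmorph_sum; apply: eq_bigr => i _.
  rewrite rmorph_sum; apply: eq_bigr => k _.
  by rewrite !rmorphM /= conjCK au.2; ring.
have Yh a b : (Y a b)^* = Y b a.
  by rewrite /Y rmorphM /= fmorphV rmorph_nat !(rmorphD, rmorphN) /= !Y0h; ring.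
have trY (x : I * I -> I * I -> C) : alt4 x ->
    \sum_a \sum_b x a b * Y a b = \sum_a \sum_b x a b * Y0 a b.
  move=> ax; transitivity (\sum_a \sum_b x a b * anti (fun c => anti (fun d => Y0 d c) a) b).
    by apply: eq_bigr => a _; apply: eq_bigr => b _; rewrite /Y /anti; field.
  transitivity (\sum_a \sum_b x a b * anti (fun d => Y0 d b) a).
    by apply: eq_bigr => a _; rewrite sum_anti // => b; rewrite alt4r.
  rewrite exchange_big [RHS]exchange_big; apply: eq_bigr => b _.
  by rewrite sum_anti // => a; rewrite ax.1.
(* The four terms of [sharp] contribute equally, by antisymmetry of f in both slots. *)
have sharpE : hf (sharp u t) f f = 4 * \sum_a \sum_b t a b * Y a b.
  rewrite trY //.
  pose G a b := \sum_p \sum_q u (a.1, p) (b.1, q) * t (a.2, p) (b.2, q).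
  pose X := \sum_a \sum_b G a b * (f a * (f b)^*).
  have X1 : X = \sum_a \sum_b G (tw a) b * (f (tw a) * (f b)^*).
    by rewrite (sum_tw (fun a => \sum_b G a b * (f a * (f b)^*))).
  have X2 : X = \sum_a \sum_b G a (tw b) * (f a * (f (tw b))^*).
    by apply: eq_bigr => a _; rewrite (sum_tw (fun b => G a b * (f a * (f b)^*))).
  have X3 : X = \sum_a \sum_b G (tw a) (tw b) * (f (tw a) * (f (tw b))^*).
    rewrite X2 (sum_tw (fun a => \sum_b G a (tw b) * (f a * (f (tw b))^*))) //.
  have -> : hf (sharp u t) f f = X + X + X + X.
    rewrite {2}X1 {2}X2 {2}X3 /X /hf -!big_split; apply: eq_bigr => a _.
    rewrite -!big_split; apply: eq_bigr => b _ /=.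
    have -> : sharp u t a b = G a b + G (tw a) (tw b) - G a (tw b) - G (tw a) b.
      rewrite /sharp /G -big_split -!sumrB; apply: eq_bigr => p _.
      by rewrite -big_split -!sumrB; apply: eq_bigr => q _ /=; ring.
    by rewrite !fa !rmorphN; ring.
  have -> : \sum_a \sum_b t a b * Y0 a b = X.
    rewrite /X /G /Y0.
    pose F i j k l p q := u (i, p) (k, q) * t (j, p) (l, q) * (f (i, j) * (f (k, l))^*).
    transitivity (\sum_(a : I * I) \sum_(b : I * I) \sum_i \sum_k F i a.1 k b.1 a.2 b.2).
      apply: eq_bigr => -[j p] _; apply: eq_bigr => -[l q] _ /=.
      rewrite mulr_sumr; apply: eq_bigr => i _; rewrite mulr_sumr.
      by apply: eq_bigr => k _; rewrite /F; ring.
    rewrite sum3_shuffle; apply: eq_bigr => -[i j] _; apply: eq_bigr => -[k l] _ /=.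
    rewrite mulr_suml; apply: eq_bigr => p _; rewrite mulr_suml.
    by apply: eq_bigr => q _; rewrite /F.
  by ring.
have pY (x : I * I -> C) : 0 <= \sum_a \sum_b Y a b * ((x a)^* * x b).
  pose w p := (anti x p)^*.
  have wa p : w (tw p) = - w p by rewrite /w anti_tw rmorphN.
  suff -> : \sum_a \sum_b Y a b * ((x a)^* * x b) = hf u (mulf f w) (mulf f w).
    exact: pu.
  transitivity (\sum_a \sum_b Y0 a b * (w a * (w b)^*)).
    transitivity (\sum_a (x a)^* * \sum_b anti (fun d => anti (fun c => Y0 c d) a) b * x b).
      apply: eq_bigr => a _; rewrite mulr_sumr; apply: eq_bigr => b _.
      by rewrite /Y /anti; field.
    transitivity (\sum_a (x a)^* * \sum_b anti (fun c => Y0 c b) a * anti x b).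
      by apply: eq_bigr => a _; rewrite sum_antiC.
    transitivity (\sum_b anti x b * \sum_a anti (fun c => Y0 c b) a * (x a)^*).
      under eq_bigr do rewrite mulr_sumr; rewrite exchange_big; apply: eq_bigr => b _.
      by rewrite mulr_sumr; apply: eq_bigr => a _; ring.
    transitivity (\sum_b anti x b * \sum_a Y0 a b * w a).
      apply: eq_bigr => b _; rewrite sum_antiC; congr (_ * _); apply: eq_bigr => a _.
      by rewrite /w /anti rmorphM fmorphV rmorph_nat rmorphB.
    under eq_bigr do rewrite mulr_sumr; rewrite exchange_big; apply: eq_bigr => a _.
    by apply: eq_bigr => b _; rewrite /w conjCK; ring.
  pose F j i l k p q := u (i, p) (k, q) * (f (i, j) * w (j, p) * (f (k, l) * w (l, q))^*).
  transitivity (\sum_(a : I * I) \sum_(b : I * I) \sum_i \sum_k F a.1 i b.1 k a.2 b.2).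
    apply: eq_bigr => -[j p] _; apply: eq_bigr => -[l q] _ /=; rewrite /Y0 mulr_suml.
    apply: eq_bigr => i _; rewrite mulr_suml; apply: eq_bigr => k _ /=.
    by rewrite /F rmorphM /=; ring.
  rewrite (sum3_shuffle (fun i j k l => F j i l k)).
  transitivity (\sum_(a : I * I) \sum_(b : I * I) \sum_j \sum_l F j a.1 l b.1 a.2 b.2).
    rewrite sum3_shuffle -sum_tw; apply: eq_bigr => a _ /=.
    by rewrite -sum_tw.
  apply: eq_bigr => -[i p] _; apply: eq_bigr => -[k q] _ /=; rewrite /mulf /=.
  rewrite mulr_suml mulr_sumr; apply: eq_bigr => j _.
  by rewrite rmorph_sum !mulr_sumr; apply: eq_bigr => l _.
have [m [c cE]] := psd_decomp_fin Yh pY.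
rewrite sharpE mulr_ge0 //.
pose y k a := \sum_j Y a j * c k j.
have -> : \sum_a \sum_b t a b * Y a b = \sum_k hf t (y k) (y k).
  rewrite /hf [RHS]exchange_big; apply: eq_bigr => a _; rewrite [RHS]exchange_big.
  by apply: eq_bigr => b _; rewrite cE mulr_sumr.
apply: sumr_ge0 => k _.
(* The k-th vector is Y applied to [c k]. Contracting with u first exhibits it, up to sign and
   antisymmetrization, as f w with w antisymmetric. *)
pose w p := \sum_j \sum_l u p (l, j.2) * (f (l, j.1))^* * anti (c k) j.
have yE : y k =1 anti (fun p => - mulf f w p).
  have yE0 a : \sum_b Y0 a b * anti (c k) b = - mulf f w a.
    rewrite /Y0 /mulf -sumrN; case: a => j p /=.
    under eq_bigr do rewrite mulr_suml.
    rewrite exchange_big; apply: eq_bigr => i _.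
    rewrite -mulNr -fa /tw /= /w mulr_sumr.
    apply: eq_bigr => b _; rewrite mulr_suml mulr_sumr; apply: eq_bigr => l _ /=.
    by ring.
  move=> a; rewrite /y.
  transitivity (\sum_b anti (fun d => anti (fun e => Y0 e d) a) b * c k b).
    by apply: eq_bigr => b _; rewrite /Y /anti; field.
  rewrite sum_antiC /anti -/(anti _ _) -!yE0 mulrBl !mulr_suml -sumrB.
  by apply: eq_bigr => b _; rewrite -/(anti _ _) /=; field.
have -> := eq_hf t yE yE; rewrite hf_anti //.
have e p : - mulf f w p = -1 * mulf f w p by rewrite mulN1r.
have -> := eq_hf t e e; rewrite hfZl hfZr rmorphN1 mulrA mulrNN !mul1r.
apply: pt => p; rewrite /w -sumrN; apply: eq_bigr => j _; rewrite -sumrN.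
by apply: eq_bigr => l _; rewrite au.1 !mulNr.
Qed.

End SharpPos.

(** * Normalized bases of isotropic planes *)

Section Normalize.
Variables (C : numClosedFieldType) (I : finType) (o : I).
Implicit Types (z e : I -> C) (u : I * I -> I * I -> C).

Lemma eq_hf_anti u M N : alt4 u -> anti M =1 anti N -> hf u M M = hf u N N.
Proof. by move=> au e; rewrite -(hf_anti M au) -(hf_anti N au); exact: eq_hf. Qed.

Lemma hf_scale u a c z e :
  hf u (ot (fun i => a * z i) (fun i => c * e i)) (ot (fun i => a * z i) (fun i => c * e i)) =
  `|a| ^+ 2 * `|c| ^+ 2 * hf u (ot z e) (ot z e).
Proof.
have E p : ot (fun i => a * z i) (fun i => c * e i) p = (a * c) * ot z e p.
  by rewrite /ot; ring.
by rewrite (eq_hf _ E E) hfZl hfZr !normCK rmorphM; ring.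
Qed.

Lemma norm_bil_ge0 z : 0 <= bil z (cj z).
Proof. by apply: sumr_ge0 => i _; exact: mul_conjC_ge0. Qed.

Lemma norm_bil_eq0 z : bil z (cj z) = 0 -> forall i, z i = 0.
Proof.
move=> /eqP; rewrite psumr_eq0; last by move=> i _; exact: mul_conjC_ge0.
move=> /allP h i; apply/eqP.
by have := h i (mem_index_enum _); rewrite /= mul_conjC_eq0.
Qed.

Lemma bil_eq (x x' y y' : I -> C) : x =1 x' -> y =1 y' -> bil x y = bil x' y'.
Proof. by move=> e f; apply: eq_bigr => i _; rewrite e f. Qed.

Lemma cjZ a (x : I -> C) : cj (fun i => a * x i) =1 fun i => a^* * cj x i.
Proof. by move=> i; rewrite /cj rmorphM. Qed.

(* Every isotropic plane has a basis as in the conclusion, and hf only depends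
   on the bivector z /\ e up to a positive factor. *)
Lemma picC_normalized u : alt4 u ->
  (forall z e, null_pair z e -> unitary_pair z e -> z o = 0 ->
     (exists2 mu, 0 <= mu & e o = 'i * mu) -> 0 <= hf u (ot z e) (ot z e)) ->
  picC u.
Proof.
move=> au H.
have step2 z e : null_pair z e -> z o = 0 -> 0 <= hf u (ot z e) (ot z e).
  move=> [zz ze ee] zo.
  have [hz0|hz0] := eqVneq (bil z (cj z)) 0.
    have E p : ot z e p = 0 * 0 by rewrite /ot (norm_bil_eq0 hz0) !mul0r.
    by rewrite (eq_hf _ E E) hfZl mul0r.
  have hz : 0 < bil z (cj z) by rewrite lt_def hz0 norm_bil_ge0.
  pose mu := bil e (cj z) / bil z (cj z).
  pose e1 i := e i + (- mu) * z i.
  have e1z : bil e1 (cj z) = 0 by rewrite /e1 bilDl bilZl /mu; field.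
  have E1 : hf u (ot z e) (ot z e) = hf u (ot z e1) (ot z e1).
    by apply: eq_hf_anti => // p; rewrite /anti /ot /e1 /tw /=; field.
  have ze1 : bil z e1 = 0 by rewrite /e1 bilDr bilZr zz ze mulr0 addr0.
  have ee1 : bil e1 e1 = 0.
    by rewrite {2}/e1 bilDr bilZr [bil e1 z]bilC ze1 mulr0 addr0 /e1 bilDl bilZl ee ze mulr0 addr0.
  rewrite E1; have [he0|he0] := eqVneq (bil e1 (cj e1)) 0.
    have E p : ot z e1 p = 0 * 0 by rewrite /ot (norm_bil_eq0 he0) mulr0 mul0r.
    by rewrite (eq_hf _ E E) hfZl mul0r.
  have he : 0 < bil e1 (cj e1) by rewrite lt_def he0 norm_bil_ge0.
  pose a := sqrtC (2 / bil z (cj z)).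
  (* A phase turns the o-component of e1 into i times a nonnegative number. After splitting into
     real and imaginary parts, only the last of the four real vectors then has a component at o, and
     it is nonnegative. *)
  have [ph ph1 [mu' mu0 emu]] : exists2 ph : C, `|ph| = 1 &
      exists2 mu, 0 <= mu & ph * e1 o = 'i * mu.
    have [eo|eo] := eqVneq (e1 o) 0.
      by exists 1; rewrite ?normr1 //; exists 0; rewrite // eo !mulr0.
    exists ('i * (e1 o)^* / `|e1 o|).
      by rewrite !normrM normfV normr_id norm_conjC normCi mul1r divff // normr_eq0.
    exists `|e1 o| => //; have n0 : `|e1 o| != 0 by rewrite normr_eq0.
    apply: (mulIf n0); rewrite -!mulrA; congr (_ * _).
    rewrite [X in _ * (_ * X)]mulrC [X in _ * X]mulrA mulVf // mul1r -[RHS]expr2 normCK.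
    by rewrite mulrC.
  pose c := ph * sqrtC (2 / bil e1 (cj e1)).
  have a2 : `|a| ^+ 2 = 2 / bil z (cj z).
    by rewrite ger0_norm ?sqrtCK // sqrtC_ge0 divr_ge0 // ltW.
  have c2 : `|c| ^+ 2 = 2 / bil e1 (cj e1).
    rewrite normrM ph1 mul1r ger0_norm ?sqrtCK // sqrtC_ge0 divr_ge0 // ltW //.
  suff : 0 <= `|a| ^+ 2 * `|c| ^+ 2 * hf u (ot z e1) (ot z e1).
    by rewrite a2 c2 pmulr_rge0 // mulr_gt0 // divr_gt0.
  rewrite -hf_scale; apply: H.
  - by split; rewrite bilZl bilZr ?zz ?ze1 ?ee1 !mulr0.
  - split.
    + rewrite (bil_eq (frefl _) (cjZ a z)) bilZl bilZr mulrA -normCK a2; field; exact: hz0.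
    + rewrite (bil_eq (frefl _) (cjZ c e1)) bilZl bilZr.
      have -> : bil z (cj e1) = (bil e1 (cj z))^*.
        rewrite -bil_cj bilC; apply: bil_eq => //; move=> i; rewrite cjK //.
      by rewrite e1z rmorph0 !mulr0.
    + rewrite (bil_eq (frefl _) (cjZ c e1)) bilZl bilZr mulrA -normCK c2; field; exact: he0.
  - by rewrite zo mulr0.
  - exists (sqrtC (2 / bil e1 (cj e1)) * mu').
      by rewrite mulr_ge0 // sqrtC_ge0 divr_ge0 // ltW.
    by rewrite /c mulrAC emu; ring.
move=> z e zz ze ee.
have [eo|eo] := eqVneq (e o) 0.
  have -> : hf u (ot z e) (ot z e) = hf u (ot e z) (ot e z).
    have E p : anti (ot z e) p = -1 * anti (ot e z) p by rewrite /anti /ot /tw /=; field.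
    rewrite -(hf_anti (ot z e)) // (eq_hf _ E E) hfZl hfZr hf_anti // rmorphN1; ring.
  by apply: step2 => //; split=> //; rewrite bilC.
(* The plane contains a vector with vanishing o-component. *)
pose z1 i := z i + (- (z o / e o)) * e i.
have -> : hf u (ot z e) (ot z e) = hf u (ot z1 e) (ot z1 e).
  by apply: eq_hf_anti => // p; rewrite /anti /ot /z1 /tw /=; field.
apply: step2; last by rewrite /z1; field.
by rewrite /z1; split; rewrite ?bilDl ?bilDr ?bilZl ?bilZr ?[bil e z]bilC ?zz ?ze ?ee; ring.
Qed.

End Normalize.

(** * Real forms and orthonormal four-frames *)

Section RealForms.
Variables (R : rcfType) (I : finType).
Implicit Types (u t : I * I -> I * I -> R) (f g : I * I -> R) (a b c d : I -> R).

Definition rb u f g := \sum_p \sum_q u p q * (f p * g q).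
Definition qf u f := rb u f f.
Definition rt a b := fun p : I * I => a p.1 * b p.2.
Definition rdot a b := \sum_i a i * b i.
Definition ralt4 u := (forall p q, u (tw p) q = - u p q) /\ (forall p q, u p q = u q p).
Definition emb u p q : R[i] := real_complex R (u p q).
Definition rsharp u t (a b : I * I) : R := \sum_p \sum_q
  (u (a.1, p) (b.1, q) * t (a.2, p) (b.2, q) + t (a.1, p) (b.1, q) * u (a.2, p) (b.2, q)
 - u (a.1, p) (b.2, q) * t (a.2, p) (b.1, q) - t (a.1, p) (b.2, q) * u (a.2, p) (b.1, q)).

(* The isotropic curvature of u on the plane spanned by a + ib and c + id. *)
Definition picR u a b c d :=
  qf u (fun p => rt a c p - rt b d p) + qf u (fun p => rt a d p + rt b c p).

Definition ortho4 a b c d :=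
  [/\ [/\ rdot a a = 1, rdot b b = 1, rdot c c = 1 & rdot d d = 1],
      [/\ rdot a b = 0, rdot a c = 0 & rdot a d = 0] &
      [/\ rdot b c = 0, rdot b d = 0 & rdot c d = 0]].

Lemma eq_rb u f f' g g' : f =1 f' -> g =1 g' -> rb u f g = rb u f' g'.
Proof. by move=> e e'; do 2 (apply: eq_bigr => ? _); rewrite e e'. Qed.

Lemma rbC u f g : ralt4 u -> rb u f g = rb u g f.
Proof.
move=> [_ us]; rewrite /rb exchange_big; do 2 (apply: eq_bigr => ? _).
by rewrite us; ring.
Qed.

Lemma rbDl u f f' g : rb u (fun p => f p + f' p) g = rb u f g + rb u f' g.
Proof.
by rewrite /rb -big_split; apply: eq_bigr => p _; rewrite -big_split; apply: eq_bigr => q _ /=; ring.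
Qed.

Lemma rbZl u k f g : rb u (fun p => k * f p) g = k * rb u f g.
Proof.
by rewrite /rb mulr_sumr; apply: eq_bigr => p _; rewrite mulr_sumr; apply: eq_bigr => q _ /=; ring.
Qed.

Lemma qf_lin u k l f g : ralt4 u -> qf u (fun p => k * f p + l * g p) =
  k ^+ 2 * qf u f + 2 * k * l * rb u f g + l ^+ 2 * qf u g.
Proof.
move=> ua; set h := fun p => _; have H e : rb u e h = k * rb u e f + l * rb u e g.
  by rewrite rbC // rbDl !rbZl ![rb u _ e]rbC.
by rewrite /qf {1}/h rbDl !rbZl !H [rb u g f]rbC //; ring.
Qed.

Lemma rb_twl u f g : ralt4 u -> rb u (fun p => f (tw p)) g = - rb u f g.
Proof.
move=> [ua _]; rewrite /rb -[LHS](sum_tw) -sumrN; apply: eq_bigr => p _.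
rewrite -sumrN; apply: eq_bigr => q _; rewrite ua.
by case: p => ? ?; rewrite /tw /=; ring.
Qed.

Lemma qf_antisym u f : ralt4 u -> exists2 g, (forall p, g (tw p) = - g p) & qf u f = qf u g.
Proof.
move=> ua; exists (fun p => 2^-1 * f p + - 2^-1 * f (tw p)).
  by case=> ? ?; rewrite /tw /=; ring.
set f' := fun p => f (tw p); have tl g : rb u f' g = - rb u f g by exact: rb_twl.
by rewrite qf_lin // /qf [rb u f f']rbC // !tl [rb u f f']rbC // tl; field.
Qed.

Lemma alt4_emb u : ralt4 u -> alt4 (emb u).
Proof.
move=> [ua us]; split=> p q; first by rewrite /emb ua rmorphN.
by rewrite /emb us; apply/eqP; rewrite eq_complex /= oppr0 !eqxx.
Qed.

Lemma hf_emb u (M : I * I -> R[i]) : ralt4 u -> hf (emb u) M M =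
  real_complex R (qf u (fun p => complex.Re (M p)) + qf u (fun p => complex.Im (M p))).
Proof.
move=> ua; pose A p := complex.Re (M p); pose B p := complex.Im (M p).
transitivity (\sum_p \sum_q (real_complex R (u p q * (A p * A q) + u p q * (B p * B q)) +
   Complex 0 1 * real_complex R (u p q * (B p * A q) - u p q * (A p * B q)))).
  apply: eq_bigr => p _; apply: eq_bigr => q _; rewrite /emb /A /B.
  by case: (M p) => x y; case: (M q) => z w; apply/eqP; rewrite eq_complex /=; apply/andP; split; apply/eqP; ring.
have bs K : (\sum_p \sum_q K p q) = \sum_(p : I * I) (\sum_(q : I * I) (K p q : R[i])) by [].
transitivity (real_complex R (qf u A + qf u B) + Complex 0 1 * real_complex R (rb u B A - rb u A B)).
  rewrite /qf /rb -!big_split /= -sumrB !rmorph_sum mulr_sumr -big_split; apply: eq_bigr => p _.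
  rewrite /= -big_split /= -sumrB !rmorph_sum mulr_sumr -big_split; apply: eq_bigr => q _ //.
by rewrite rbC // subrr rmorph0 mulr0 addr0.
Qed.

Definition cpx a b : I -> R[i] := fun i => Complex (a i) (b i).

Lemma bil_cpx a b c d : bil (cpx a b) (cpx c d) =
  Complex (rdot a c - rdot b d) (rdot a d + rdot b c).
Proof.
rewrite /bil /rdot -sumrB -big_split /=.
elim/big_rec3: _ => [|i x y z _ ->]; first by [].
by apply/eqP; rewrite eq_complex /=; apply/andP; split; apply/eqP; ring.
Qed.

Lemma cj_cpx a b i : cj (cpx a b) i = cpx a (fun i => - b i) i.
Proof. by []. Qed.

Lemma hf_cpx u a b c d : ralt4 u ->
  hf (emb u) (ot (cpx a b) (cpx c d)) (ot (cpx a b) (cpx c d)) = real_complex R (picR u a b c d).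
Proof. by move=> ua; rewrite hf_emb. Qed.

Lemma rdotNr a b : rdot a (fun i => - b i) = - rdot a b.
Proof. by rewrite /rdot -sumrN; apply: eq_bigr => i _; rewrite mulrN. Qed.
Lemma rdotC a b : rdot a b = rdot b a.
Proof. by apply: eq_bigr => i _; rewrite mulrC. Qed.

Lemma bil_cpx_cj a b c d : bil (cpx a b) (cj (cpx c d)) =
  Complex (rdot a c + rdot b d) (rdot b c - rdot a d).
Proof.
rewrite (bil_eq (frefl _) (@cj_cpx c d)) bil_cpx !rdotNr.
by apply/eqP; rewrite eq_complex /= opprK addrC eqxx addrC eqxx.
Qed.

Lemma ortho4_pair a b c d : ortho4 a b c d ->
  null_pair (cpx a b) (cpx c d) /\ unitary_pair (cpx a b) (cpx c d).
Proof.
move=> [[aa bb cc dd] [ab ac ad] [bc bd cd]].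
split; split; rewrite ?bil_cpx_cj ?bil_cpx ?[rdot b a]rdotC ?[rdot d c]rdotC ?aa ?bb ?cc ?dd ?ab ?ac ?ad ?bc ?bd ?cd;
 apply/eqP; rewrite eq_complex /=; apply/andP; split; apply/eqP; rewrite ?raddfD /=; ring.
Qed.

Lemma cpx_of (z : I -> R[i]) : z =1 cpx (fun i => complex.Re (z i)) (fun i => complex.Im (z i)).
Proof. by move=> i; rewrite /cpx; case: (z i). Qed.

Lemma complex_eq (x y x' y' : R) : Complex x y = Complex x' y' -> x = x' /\ y = y'.
Proof. by case. Qed.

(** A normalized basis splits into an orthonormal four-frame whose first three vectors vanish at o.
    For the suspension o is the added direction, and the frame condition with lambda covers
    precisely such frames; for tensors on R^n any index serves as o. *)
Lemma picC_emb (o : I) u : ralt4 u ->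
  (forall a b c d, ortho4 a b c d -> a o = 0 -> b o = 0 -> c o = 0 -> 0 <= d o ->
     0 <= picR u a b c d) -> picC (emb u).
Proof.
move=> ua H; apply: (@picC_normalized _ _ o) => [|z e]; first exact: alt4_emb.
have [a [b Ez]] : exists a b, z =1 cpx a b by exists (fun i => complex.Re (z i)), (fun i => complex.Im (z i)); exact: cpx_of.
have [c [d Ee]] : exists c d, e =1 cpx c d by exists (fun i => complex.Re (e i)), (fun i => complex.Im (e i)); exact: cpx_of.
have cjE (x y : I -> R[i]) : x =1 y -> cj x =1 cj y by move=> h i; rewrite /cj h.
rewrite /null_pair /unitary_pair !(bil_eq Ez Ez, bil_eq Ez Ee, bil_eq Ee Ee, bil_eq Ez (cjE _ _ Ez), bil_eq Ez (cjE _ _ Ee), bil_eq Ee (cjE _ _ Ee)).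
rewrite !bil_cpx_cj !bil_cpx Ez Ee.
have E p : ot z e p = ot (cpx a b) (cpx c d) p by rewrite /ot Ez Ee.
rewrite (eq_hf _ E E) hf_cpx //.
have T2 : (2 : R[i]) = Complex 2 0 by apply/eqP; rewrite eq_complex /=; apply/andP; split; apply/eqP; ring.
rewrite T2 => -[/complex_eq [n1 n2] /complex_eq [n3 n4] /complex_eq [n5 n6]].
move=> [/complex_eq [m1 m2] /complex_eq [m3 m4] /complex_eq [m5 m6]] /complex_eq [zo1 zo2].
move=> [[mu mu']]; rewrite lecE /= => /andP [/eqP mu'0 mu0].
rewrite mu'0 /cpx => /eqP; rewrite eq_complex /= => /andP [/eqP co /eqP do_].
rewrite ler0c; move: n2 n6 m2 m6; rewrite [rdot b a]rdotC [rdot d c]rdotC => n2 n6 _ _; apply: H => //.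
- by split; split; lra.
- by rewrite co; ring.
- by rewrite do_; lra.
Qed.

Lemma emb_sharp u t p q : emb (rsharp u t) p q = sharp (emb u) (emb t) p q.
Proof.
rewrite /emb /rsharp /sharp rmorph_sum; apply: eq_bigr => i _.
rewrite rmorph_sum; apply: eq_bigr => j _.
by rewrite !rmorphB rmorphD !rmorphM.
Qed.

Lemma ralt4_sharp u t : ralt4 u -> ralt4 t -> ralt4 (rsharp u t).
Proof.
move=> ua ta; have [h1 h2] := alt4_sharp (alt4_emb ua) (alt4_emb ta).
by split=> p q; apply: (@complexI R); [have := h1 p q|have := h2 p q];
  rewrite -!emb_sharp /emb ?rmorphN // => <-; apply/eqP; rewrite eq_complex /= oppr0 !eqxx.
Qed.

Lemma hf_eq_u (u u' : I * I -> I * I -> R[i]) M N : (forall p q, u p q = u' p q) -> hf u M N = hf u' M N.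
Proof. by move=> e; do 2 (apply: eq_bigr => ? _); rewrite e. Qed.

(* Positivity of t near the fixed isotropic plane: either t is nonnegative
   definite, or it has nonnegative isotropic curvature and the plane is a zero. *)
Definition near_pos (o : I) t a b c d :=
  (forall g, (forall p, g (tw p) = - g p) -> 0 <= qf t g) \/
  ((forall a b c d, ortho4 a b c d -> a o = 0 -> b o = 0 -> c o = 0 -> 0 <= d o ->
     0 <= picR t a b c d) /\ picR t a b c d = 0).

Lemma near_pos_on o t a b c d : ralt4 t -> ortho4 a b c d -> near_pos o t a b c d ->
  pos_on (anti (ot (cpx a b) (cpx c d))) (emb t).
Proof.
move=> ta h [tp|[tp t0]] w ws.
  rewrite hf_emb // ler0c addr_ge0 //.
    by have [g ga ->] := qf_antisym (fun p => complex.Re (mulf (anti (ot (cpx a b) (cpx c d))) w p)) ta; exact: tp.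
  by have [g ga ->] := qf_antisym (fun p => complex.Im (mulf (anti (ot (cpx a b) (cpx c d))) w p)) ta; exact: tp.
have [h1 h2] := ortho4_pair h.
apply: second_variation => //; [exact: alt4_emb|exact: (picC_emb (o := o))|].
by rewrite hf_cpx // t0.
Qed.

Lemma picR_sharp o u t a b c d : ralt4 u -> ralt4 t -> ortho4 a b c d ->
  near_pos o u a b c d -> near_pos o t a b c d -> 0 <= picR (rsharp u t) a b c d.
Proof.
move=> ua ta h hu ht; rewrite -ler0c -hf_cpx; last exact: ralt4_sharp.
rewrite (hf_eq_u _ _ (emb_sharp u t)).
rewrite -hf_anti; last by apply: alt4_sharp; exact: alt4_emb.
apply: sharp_ge0; [exact: alt4_emb|exact: alt4_emb| | |].
- by move=> p; rewrite anti_tw.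
- exact: near_pos_on hu.
- exact: near_pos_on ht.
Qed.

(** For nonnegative definite factors the trace argument of [sharp_ge0] works at every bivector. This
    keeps T >= 0 under T # T. *)
Lemma qf_sharp u t f : ralt4 u -> ralt4 t -> (forall p, f (tw p) = - f p) ->
  (forall g, (forall p, g (tw p) = - g p) -> 0 <= qf u g) ->
  (forall g, (forall p, g (tw p) = - g p) -> 0 <= qf t g) -> 0 <= qf (rsharp u t) f.
Proof.
move=> ua ta fa hu ht; pose F p : R[i] := real_complex R (f p).
have pos v : ralt4 v -> (forall g, (forall p, g (tw p) = - g p) -> 0 <= qf v g) -> pos_on F (emb v).
  move=> va hv w _; rewrite hf_emb // ler0c addr_ge0 //.
    by have [g ga ->] := qf_antisym (fun p => complex.Re (mulf F w p)) va; exact: hv.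
  by have [g ga ->] := qf_antisym (fun p => complex.Im (mulf F w p)) va; exact: hv.
have := @sharp_ge0 _ _ F (emb u) (emb t) (alt4_emb ua) (alt4_emb ta) _ (pos _ ua hu) (pos _ ta ht).
rewrite -(hf_eq_u _ _ (emb_sharp u t)) hf_emb; last exact: ralt4_sharp.
have -> : qf (rsharp u t) (fun p => complex.Im (F p)) = 0.
  by rewrite /qf /rb big1 // => p _; rewrite big1 // => q _ /=; ring.
rewrite addr0 ler0c; apply => p; rewrite /F fa rmorphN //.
Qed.

End RealForms.

(** * Components of tensors and change of frame *)

Section Coordinates.
Variables (R : realType) (n : nat).
Implicit Types (S T : tensor R n) (i j k l p q : 'I_n) (A B E : 'M[R]_n).

Lemma sum_delta (f : 'I_n -> R) i : \sum_p f p * (p == i)%:R = f i.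
Proof.
rewrite (bigD1 i) //= eqxx mulr1 big1 ?addr0 // => p ni.
by rewrite (negPf ni) mulr0.
Qed.

Lemma sum_delta' (f : 'I_n -> R) i : \sum_p f p * (i == p)%:R = f i.
Proof. by under eq_bigr do rewrite eq_sym; exact: sum_delta. Qed.

Lemma mxvec_index_ex (I : 'I_(n * n)) : exists i j, I = mxvec_index i j.
Proof. by case/mxvec_indexP: I => i j; exists i, j. Qed.

Lemma ext4 S T : (forall i j k l, coord4 S i j k l = coord4 T i j k l) -> S = T.
Proof.
move=> e; apply/matrixP => I J.
have [i [j ->]] := mxvec_index_ex I; have [k [l ->]] := mxvec_index_ex J.
exact: e.
Qed.

Lemma coord4D S T i j k l : coord4 (S + T) i j k l = coord4 S i j k l + coord4 T i j k l.
Proof. by rewrite /coord4 mxE. Qed.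

Lemma coord4N S i j k l : coord4 (- S) i j k l = - coord4 S i j k l.
Proof. by rewrite /coord4 mxE. Qed.

Lemma coord4Z a S i j k l : coord4 (a *: S) i j k l = a * coord4 S i j k l.
Proof. by rewrite /coord4 mxE. Qed.

Lemma coord40 i j k l : coord4 (0 : tensor R n) i j k l = 0.
Proof. by rewrite /coord4 mxE. Qed.

Lemma coord4_wedge A B i j k l : coord4 (wedge A B) i j k l =
  A i k * B j l + A j l * B i k - A i l * B j k - A j k * B i l.
Proof. by rewrite coord4_mktensor. Qed.

Definition coord4E := (coord4D, coord4N, coord4Z, coord40, coord4_wedge).

Lemma sum_mxvec (V : nmodType) (F : 'I_(n * n) -> V) :
  \sum_I F I = \sum_i \sum_j F (mxvec_index i j).
Proof.
rewrite pair_bigA (reindex _ (curry_mxvec_bij n n)) /=.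
by apply: eq_bigr => -[i j] _.
Qed.

Lemma coord4_mul S T i j k l : coord4 (S *m T) i j k l =
  \sum_p \sum_q coord4 S i j p q * coord4 T p q k l.
Proof. by rewrite /coord4 mxE sum_mxvec. Qed.

Lemma coord4_tr S i j k l : coord4 S^T i j k l = coord4 S k l i j.
Proof. by rewrite /coord4 mxE. Qed.

(** Exchanging the two middle slots turns the contraction S_ipkq T_jplq into a matrix product, so
    that its invariance under change of frame is that of a product. *)
Definition reshuf S : tensor R n := mktensor (fun i j k l => coord4 S i k j l).
Definition flip S : tensor R n := mktensor (fun i j k l => coord4 S i j l k).
Lemma coord4_flip S i j k l : coord4 (flip S) i j k l = coord4 S i j l k.
Proof. exact: coord4_mktensor. Qed.

Definition square S : tensor R n := S *m S^T.
Definition contr S T : tensor R n := reshuf (reshuf S *m (reshuf T)^T).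

Lemma coord4_contr S T i j k l : coord4 (contr S T) i j k l =
  \sum_p \sum_q coord4 S i p k q * coord4 T j p l q.
Proof.
rewrite coord4_mktensor coord4_mul; apply: eq_bigr => p _; apply: eq_bigr => q _.
by rewrite coord4_tr !coord4_mktensor.
Qed.

Lemma coord4_square S i j k l : coord4 (square S) i j k l =
  \sum_p \sum_q coord4 S i j p q * coord4 S k l p q.
Proof.
by rewrite coord4_mul; do 2 apply: eq_bigr => ? _; rewrite coord4_tr.
Qed.

Definition sharp2 S T : tensor R n :=
  contr S T + contr T S - flip (contr S T) - flip (contr T S).

Lemma coord4_sharp2 S T i j k l : coord4 (sharp2 S T) i j k l =
  \sum_p \sum_q (coord4 S i p k q * coord4 T j p l q
   + coord4 T i p k q * coord4 S j p l q - coord4 S i p l q * coord4 T j p k q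
   - coord4 T i p l q * coord4 S j p k q).
Proof.
rewrite !(coord4D, coord4N) !coord4_flip !coord4_contr.
rewrite -big_split -!sumrB; apply: eq_bigr => p _ /=.
by rewrite -big_split -!sumrB.
Qed.

Lemma hamQE S : hamQ S = square S + sharp2 S S.
Proof.
apply: ext4 => i j k l; rewrite coord4_mktensor coord4D coord4_square coord4_sharp2.
rewrite -big_split; apply: eq_bigr => p _ /=; rewrite -big_split.
by apply: eq_bigr => q _ /=; ring.
Qed.

Definition kron A B : tensor R n := mktensor (fun i j k l => A i k * B j l).

Lemma coord4_kron A B i j k l : coord4 (kron A B) i j k l = A i k * B j l.
Proof. exact: coord4_mktensor. Qed.

Lemma kron_mul A B A' B' : kron A B *m kron A' B' = kron (A *m A') (B *m B').
Proof.
apply: ext4 => i j k l; rewrite coord4_mul coord4_kron !mxE mulr_suml.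
apply: eq_bigr => p _; rewrite mulr_sumr; apply: eq_bigr => q _.
by rewrite !coord4_kron; ring.
Qed.

Lemma kron_tr A B : (kron A B)^T = kron A^T B^T.
Proof. by apply: ext4 => i j k l; rewrite coord4_tr !coord4_kron !mxE. Qed.

Lemma kron1 : kron 1%:M 1%:M = 1%:M.
Proof.
apply: ext4 => i j k l.
by rewrite coord4_kron /coord4 !mxE mxvec_index_inj -natrM mulnb.
Qed.

Lemma wedgeE A B :
  wedge A B = kron A B + kron B A - flip (kron A B) - flip (kron B A).
Proof.
apply: ext4 => i j k l; rewrite !(coord4D, coord4N) !coord4_flip !coord4_kron.
by rewrite coord4_wedge; ring.
Qed.

(* Components in another orthonormal frame, given by the rows of O. *)
Definition rot (O : 'M[R]_n) S : tensor R n := kron O O *m S *m (kron O O)^T.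
Definition rotm (O : 'M[R]_n) E : 'M[R]_n := O *m E *m O^T.

Lemma coord4_rot (O : 'M[R]_n) S i j k l :
  coord4 (rot O S) i j k l = ev S (row i O) (row j O) (row k O) (row l O).
Proof.
rewrite /rot -mulmxA coord4_mul /ev; apply: eq_bigr => a _; apply: eq_bigr => b _.
rewrite coord4_mul mulr_sumr; apply: eq_bigr => c _; rewrite mulr_sumr.
by apply: eq_bigr => d _; rewrite coord4_tr !coord4_mktensor !mxE; ring.
Qed.

Lemma rotD O S T : rot O (S + T) = rot O S + rot O T.
Proof. by rewrite /rot mulmxDr mulmxDl. Qed.

Lemma rotN O S : rot O (- S) = - rot O S.
Proof. by rewrite /rot mulmxN mulNmx. Qed.

Lemma rotZ O a S : rot O (a *: S) = a *: rot O S.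
Proof. by rewrite /rot -scalemxAr -scalemxAl. Qed.

Lemma rot_mul O S T : O^T *m O = 1%:M -> rot O (S *m T) = rot O S *m rot O T.
Proof.
move=> OO; rewrite /rot -!mulmxA; congr (_ *m (_ *m _)).
by rewrite (mulmxA (kron O O)^T) kron_tr kron_mul OO kron1 mul1mx.
Qed.

Lemma rot_tr O S : rot O S^T = (rot O S)^T.
Proof. by rewrite /rot !trmx_mul trmxK mulmxA. Qed.

Lemma rot_reshuf O S : rot O (reshuf S) = reshuf (rot O S).
Proof.
apply: ext4 => i j k l; rewrite coord4_mktensor !coord4_rot /ev.
apply: eq_bigr => a _; rewrite exchange_big; do 3 apply: eq_bigr => ? _.
by rewrite coord4_mktensor; ring.
Qed.

Lemma rot_flip O S : rot O (flip S) = flip (rot O S).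
Proof.
apply: ext4 => i j k l; rewrite coord4_mktensor !coord4_rot /ev.
apply: eq_bigr => a _; apply: eq_bigr => b _; rewrite exchange_big.
by do 2 apply: eq_bigr => ? _; rewrite coord4_mktensor; ring.
Qed.

Lemma rot_square O S : O^T *m O = 1%:M -> rot O (square S) = square (rot O S).
Proof. by move=> OO; rewrite /square rot_mul // rot_tr. Qed.

Lemma rot_sharp2 O S T : O^T *m O = 1%:M ->
  rot O (sharp2 S T) = sharp2 (rot O S) (rot O T).
Proof.
move=> OO; rewrite /sharp2 !(rotD, rotN) !rot_flip.
by rewrite /contr !rot_reshuf !rot_mul // !rot_tr !rot_reshuf.
Qed.

Lemma rot_hamQ O S : O^T *m O = 1%:M -> rot O (hamQ S) = hamQ (rot O S).
Proof. by move=> OO; rewrite !hamQE rotD rot_square // rot_sharp2. Qed.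

Lemma rotmE O E i j : rotm O E i j = (row i O *m E *m (row j O)^T) 0 0.
Proof. by rewrite /rotm -row_mul mxE [RHS]mxE; apply: eq_bigr => k _; rewrite !mxE. Qed.

Lemma rot_wedge O A B : rot O (wedge A B) = wedge (rotm O A) (rotm O B).
Proof.
have e X Y : rot O (kron X Y) = kron (rotm O X) (rotm O Y).
  by rewrite /rot /rotm kron_tr !kron_mul.
by rewrite !wedgeE !(rotD, rotN) !rot_flip !e.
Qed.

End Coordinates.

(** * Algebraic curvature tensors and the Ricci tensor of Q *)

Section Curvature.
Variables (R : realType) (n : nat).
Implicit Types (S T : tensor R n) (i j k l p q : 'I_n) (A B E : 'M[R]_n) (x y z w : 'rV[R]_n).

Lemma ev_antil S x y z w : S2so S -> ev S y x z w = - ev S x y z w.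
Proof.
move=> hS; rewrite /ev exchange_big -sumrN; apply: eq_bigr => i _; rewrite -sumrN.
apply: eq_bigr => j _; rewrite -sumrN; apply: eq_bigr => k _; rewrite -sumrN.
by apply: eq_bigr => l _; case: (hS i j k l) => -> _ _; ring.
Qed.

Lemma rot_S2so (O : 'M[R]_n) S : S2so S -> S2so (rot O S).
Proof.
move=> hS i j k l.
have tS : S^T = S by apply: ext4 => a b c d; rewrite coord4_tr; case: (hS a b c d).
have fS : flip S = - S.
  by apply: ext4 => a b c d; rewrite coord4_flip coord4N; case: (hS a b c d) => _ -> _; rewrite opprK.
have e1 : coord4 (rot O S) i j k l = coord4 (rot O S) k l i j.
  by rewrite -coord4_tr -rot_tr tS.
have e2 a b c d : coord4 (rot O S) a b c d = - coord4 (rot O S) a b d c.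
  by rewrite -coord4N -rotN -fS rot_flip coord4_flip.
split=> //; rewrite e1 e2; congr (- _).
by rewrite -coord4_tr -rot_tr tS.
Qed.

Lemma rot_bianchi (O : 'M[R]_n) S :
  (forall i j k l, coord4 S i j k l + coord4 S j k i l + coord4 S k i j l = 0) ->
  forall i j k l,
  coord4 (rot O S) i j k l + coord4 (rot O S) j k i l + coord4 (rot O S) k i j l = 0.
Proof.
move=> bS i j k l; rewrite !coord4_rot /ev.
under [X in _ + X + _]eq_bigr do rewrite exchange_big.
rewrite [X in _ + X + _]exchange_big [X in _ + X]exchange_big /=.
under [X in _ + X]eq_bigr do rewrite exchange_big.
rewrite -!big_split /= big1 // => a _; rewrite -!big_split /= big1 // => b _.
rewrite -!big_split /= big1 // => c _; rewrite -!big_split /= big1 // => d _.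
transitivity ((coord4 S a b c d + coord4 S b c a d + coord4 S c a b d) *
  (O i a * O j b * O k c * O l d)); last by rewrite bS mul0r.
by rewrite !mxE; ring.
Qed.

Lemma rot_CB (O : 'M[R]_n) S : CB S -> CB (rot O S).
Proof. by move=> [hS bS]; split; [exact: rot_S2so | exact: rot_bianchi]. Qed.

Lemma ric_rot (O : 'M[R]_n) S : O^T *m O = 1%:M -> ric (rot O S) = rotm O (ric S).
Proof.
move=> OO; apply/matrixP => i k; rewrite mxE rotmE mxE.
under eq_bigr do rewrite coord4_rot /ev.
under [RHS]eq_bigr do rewrite !mxE mulr_suml.
rewrite [RHS]exchange_big [LHS]exchange_big; apply: eq_bigr => a _ /=.
rewrite [LHS]exchange_big /=.
under eq_bigr do rewrite exchange_big /=.
rewrite [LHS]exchange_big; apply: eq_bigr => c _ /=.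
under eq_bigr do rewrite exchange_big /=.
rewrite [ric _ _ _]mxE mulr_sumr mulr_suml; apply: eq_bigr => b _.
transitivity (\sum_d coord4 S a b c d * (O i a * O k c) * (O^T *m O) b d).
  apply: eq_bigr => d _; rewrite [(O^T *m O) _ _]mxE mulr_sumr; apply: eq_bigr => p _.
  by rewrite !mxE; ring.
rewrite OO; under eq_bigr do rewrite !mxE.
by rewrite sum_delta' !mxE; ring.
Qed.

Lemma rotm1 (O : 'M[R]_n) : O *m O^T = 1%:M -> rotm O 1%:M = 1%:M.
Proof. by rewrite /rotm mulmx1. Qed.

Lemma rotm_mul (O : 'M[R]_n) A B : O^T *m O = 1%:M -> rotm O (A *m B) = rotm O A *m rotm O B.
Proof. by move=> OO; rewrite /rotm -!mulmxA (mulmxA O^T) OO mul1mx. Qed.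

Lemma tr_rotm (O : 'M[R]_n) A : O^T *m O = 1%:M -> \tr (rotm O A) = \tr A.
Proof. by move=> OO; rewrite /rotm mxtrace_mulC mulmxA OO mul1mx. Qed.

Lemma scal_rot (O : 'M[R]_n) S : O^T *m O = 1%:M -> scal (rot O S) = scal S.
Proof. by move=> OO; rewrite /scal ric_rot // tr_rotm. Qed.

Lemma ric_sym S : S2so S -> (ric S)^T = ric S.
Proof.
move=> hS; apply/matrixP => i k; rewrite !mxE; apply: eq_bigr => p _.
by case: (hS k p i p).
Qed.

Lemma ricD S T : ric (S + T) = ric S + ric T.
Proof.
by apply/matrixP => i k; rewrite !mxE -big_split; apply: eq_bigr => p _; rewrite coord4D.
Qed.

Lemma ricZ a S : ric (a *: S) = a *: ric S.
Proof.
by apply/matrixP => i k; rewrite !mxE mulr_sumr; apply: eq_bigr => p _; rewrite coord4Z.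
Qed.

Lemma scalD S T : scal (S + T) = scal S + scal T.
Proof. by rewrite /scal ricD mxtraceD. Qed.

Lemma scalZ a S : scal (a *: S) = a * scal S.
Proof. by rewrite /scal ricZ mxtraceZ. Qed.

Lemma wedgeC A B : wedge A B = wedge B A.
Proof. by apply: ext4 => i j k l; rewrite !coord4_wedge; ring. Qed.

Lemma wedgeDl A A' B : wedge (A + A') B = wedge A B + wedge A' B.
Proof. by apply: ext4 => i j k l; rewrite !coord4E !mxE; ring. Qed.

Lemma wedgeZl a A B : wedge (a *: A) B = a *: wedge A B.
Proof. by apply: ext4 => i j k l; rewrite !coord4E !mxE; ring. Qed.

Lemma CB_wedge A B : A^T = A -> B^T = B -> CB (wedge A B).
Proof.
move=> /matrixP sA /matrixP sB.
have eA i j : A i j = A j i by rewrite -[LHS]sA mxE.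
have eB i j : B i j = B j i by rewrite -[LHS]sB mxE.
split=> i j k l; last first.
  by rewrite !coord4_wedge (eA j i) (eB j i) (eA k j) (eB k j) (eA k i) (eB k i); ring.
rewrite !coord4_wedge; split; try ring.
by rewrite (eA k i) (eB k i) (eA l j) (eB l j) (eA k j) (eB k j) (eA l i) (eB l i); ring.
Qed.

Lemma ric_wedge A B :
  ric (wedge A B) = \tr B *: A + \tr A *: B - A *m B - B *m A.
Proof.
apply/matrixP => i k; rewrite !mxE.
under eq_bigr do rewrite coord4_wedge.
rewrite !sumrB big_split /= /mxtrace -!mulr_suml -mulr_sumr.
congr (_ + _ - _ - _); first by rewrite mulrC.
by apply: eq_bigr => p _; rewrite mulrC.
Qed.

Lemma CBD S T : CB S -> CB T -> CB (S + T).
Proof.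
move=> [h b] [h' b']; split=> i j k l; rewrite !coord4D.
  case: (h i j k l) => e1 e2 e3; case: (h' i j k l) => f1 f2 f3.
  by split; lra.
by move: (b i j k l) (b' i j k l) => e e'; lra.
Qed.

Lemma CBZ a S : CB S -> CB (a *: S).
Proof.
move=> [h b]; split=> i j k l; rewrite !coord4Z.
  case: (h i j k l) => e1 e2 e3; split.
  - by rewrite e1 mulrN.
  - by rewrite e2 mulrN.
  - by rewrite e3.
by rewrite -!mulrDr b mulr0.
Qed.

(* The contraction S * E of Hamilton's evolution equation of the Ricci tensor. *)
Definition act S E : 'M[R]_n := \matrix_(i, k) \sum_p \sum_q coord4 S i p k q * E p q.

Lemma bianchi_sub S : CB S -> forall i j p q,
  coord4 S i j p q = coord4 S i p j q - coord4 S i q j p.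
Proof.
move=> [h b] i j p q; have := b i j p q.
by case: (h p i j q) => -> _ _; case: (h j p i q) => _ _ ->; lra.
Qed.

(** The contractions X, Y, Z of S with itself satisfy X - Y = Z and 2 Z = X by the Bianchi identity.
    Hence X - 2 Y = 0 and only the term contracting S with Ric survives. *)
Lemma ric_hamQ S : CB S -> ric (hamQ S) = 2 *: act S (ric S).
Proof.
move=> cS; have [hS bS] := cS; have sub := bianchi_sub cS.
apply/matrixP => i k; rewrite !mxE.
pose X := \sum_j \sum_p \sum_q coord4 S i p j q * coord4 S k p j q.
pose Y := \sum_j \sum_p \sum_q coord4 S i p j q * coord4 S k q j p.
pose Z := \sum_j \sum_p \sum_q coord4 S i p j q * coord4 S k j p q.
have e1 : \sum_j \sum_p \sum_q coord4 S i j p q * coord4 S k j p q = X.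
  by rewrite exchange_big.
have e2 : X - Y = Z.
  rewrite /X /Y /Z -sumrB; apply: eq_bigr => j _; rewrite -sumrB; apply: eq_bigr => p _.
  by rewrite -sumrB; apply: eq_bigr => q _; rewrite (sub k j p q); ring.
have e3 : 2 * Z = X.
  rewrite -e1 mulr2n mulrDl mul1r {2}/Z.
  under [X in _ + X]eq_bigr do rewrite exchange_big.
  rewrite /Z -big_split; apply: eq_bigr => j _; rewrite -big_split; apply: eq_bigr => p _ /=.
  rewrite -big_split; apply: eq_bigr => q _ /=; rewrite (sub i j p q).
  by case: (hS k j q p) => _ -> _; ring.
have e4 : \sum_j coord4 (hamQ S) i j k j =
    X + 2 * (\sum_p \sum_q coord4 S i p k q * ric S p q) - 2 * Y.
  rewrite -e1 /Y.
  have -> : \sum_p \sum_q coord4 S i p k q * ric S p q =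
      \sum_j \sum_p \sum_q coord4 S i p k q * coord4 S j p j q.
    rewrite [RHS]exchange_big; apply: eq_bigr => p _; rewrite [RHS]exchange_big; apply: eq_bigr => q _.
    rewrite mxE mulr_sumr; apply: eq_bigr => j _; congr (_ * _).
    by case: (hS p j q j) => e _ _; case: (hS j p q j) => _ f _; lra.
  rewrite !mulr_sumr -!big_split -sumrB; apply: eq_bigr => j _ /=.
  rewrite coord4_mktensor !mulr_sumr -!big_split -sumrB; apply: eq_bigr => p _ /=.
  rewrite !mulr_sumr -!big_split -sumrB; apply: eq_bigr => q _ /=.
  by case: (hS k q j p) => _ _ ->; ring.
by rewrite e4; lra.
Qed.

(** The Bianchi identity expresses Q through Hamilton's quadratic tensor B_ijkl, here P; its
    symmetries P1 and P2 yield those of Q. *)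
Lemma CB_hamQ S : CB S -> CB (hamQ S).
Proof.
move=> cS; have [hS bS] := cS; have sub := bianchi_sub cS.
pose P i j k l := \sum_p \sum_q coord4 S i p j q * coord4 S k p l q.
have P1 i j k l : P i j k l = P k l i j.
  by apply: eq_bigr => p _; apply: eq_bigr => q _; rewrite mulrC.
have P2 i j k l : P i j k l = P j i l k.
  rewrite /P exchange_big; apply: eq_bigr => p _; apply: eq_bigr => q _.
  by case: (hS i q j p) => _ _ ->; case: (hS k q l p) => _ _ ->.
have QE i j k l : coord4 (hamQ S) i j k l =
    2 * P i j k l - 2 * P i j l k + 2 * P i k j l - 2 * P i l j k.
  have -> : 2 * P i j k l = P i j k l + \sum_p \sum_q coord4 S i q j p * coord4 S k q l p.
    by rewrite mulr2n mulrDl mul1r {2}/P [X in _ + X]exchange_big.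
  have -> : 2 * P i j l k = P i j l k + \sum_p \sum_q coord4 S i q j p * coord4 S l q k p.
    by rewrite mulr2n mulrDl mul1r {2}/P [X in _ + X]exchange_big.
  rewrite coord4_mktensor /P !mulr_sumr opprD addrA -!big_split -!sumrB -big_split -sumrB.
  apply: eq_bigr => p _ /=; rewrite !mulr_sumr -!big_split -!sumrB -big_split -sumrB.
  apply: eq_bigr => q _ /=; rewrite (sub i j p q) (sub k l p q).
  by case: (hS l p k q) => _ _ ->; case: (hS l q k p) => _ _ ->; ring.
split=> i j k l; last first.
  rewrite !QE (P1 k l i j) (P2 j i k l) (P1 i l j k) (P2 k j i l) (P1 j l k i).
  by rewrite (P2 k i l j); ring.
rewrite !QE; split.
- by rewrite (P2 j i k l) (P2 j i l k) (P1 j k i l) (P1 j l i k); ring.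
- by ring.
- by rewrite (P1 k l i j) (P1 k l j i) (P2 j i k l) (P2 k i l j) (P2 k j l i) (P1 j k i l); ring.
Qed.

End Curvature.

(** * Conjugation of Q by the maps l_{a,b} *)

Section Evolution.
Variables (R : realType) (n : nat).
Implicit Types (S T W : tensor R n) (i j k l p q : 'I_n) (A B E : 'M[R]_n).

Definition cross S W : tensor R n := S *m W^T + W *m S^T + 2 *: sharp2 S W.

Lemma coord4_cross S W i j k l : coord4 (cross S W) i j k l =
  \sum_p \sum_q coord4 S i j p q * coord4 W k l p q
  + \sum_p \sum_q coord4 W i j p q * coord4 S k l p q
  + 2 * (\sum_p \sum_q coord4 S i p k q * coord4 W j p l q
       + \sum_p \sum_q coord4 W i p k q * coord4 S j p l q
       - \sum_p \sum_q coord4 S i p l q * coord4 W j p k q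
       - \sum_p \sum_q coord4 W i p l q * coord4 S j p k q).
Proof.
rewrite !coord4E !coord4_flip !coord4_contr !coord4_mul.
congr (_ + _ + _ * (_ + _ - _ - _)); apply: eq_bigr => p _; apply: eq_bigr => q _;
  by rewrite ?coord4_tr.
Qed.

Lemma hamQD S W : hamQ (S + W) = hamQ S + cross S W + hamQ W.
Proof.
apply: ext4 => i j k l; rewrite coord4D coord4D coord4_cross !coord4_mktensor.
rewrite -!(big_split, sumrB) mulr_sumr -!big_split; apply: eq_bigr => p _ /=.
rewrite -!(big_split, sumrB) mulr_sumr -!big_split; apply: eq_bigr => q _ /=.
by rewrite !coord4D; ring.
Qed.

Lemma cross_self S : cross S S = 2 *: hamQ S.
Proof.
apply: ext4 => i j k l; rewrite coord4_cross coord4Z coord4_mktensor.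
rewrite -!(big_split, sumrB) !mulr_sumr -!big_split; apply: eq_bigr => p _ /=.
rewrite -!(big_split, sumrB) !mulr_sumr -!big_split; apply: eq_bigr => q _ /=.
by ring.
Qed.

Lemma actD S E E' : act S (E + E') = act S E + act S E'.
Proof.
apply/matrixP => i k; rewrite !mxE -big_split; apply: eq_bigr => p _ /=.
by rewrite -big_split; apply: eq_bigr => q _; rewrite !mxE mulrDr.
Qed.

Lemma actZ S a E : act S (a *: E) = a *: act S E.
Proof.
apply/matrixP => i k; rewrite !mxE mulr_sumr; apply: eq_bigr => p _ /=.
by rewrite mulr_sumr; apply: eq_bigr => q _; rewrite !mxE; ring.
Qed.

Lemma act1 S : act S 1%:M = ric S.
Proof.
apply/matrixP => i k; rewrite !mxE; apply: eq_bigr => p _.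
by under eq_bigr do rewrite mxE; rewrite sum_delta'.
Qed.

(** The terms [a4], in which E meets a single slot of S, cancel by antisymmetry and the Bianchi
    identity. What remains are Ric(S) and the double contraction [act S E]. *)
Lemma cross_wedge S E : CB S -> E^T = E ->
  cross S (wedge E 1%:M) = 2 *: (wedge (ric S) E + wedge (act S E) 1%:M).
Proof.
move=> [hS bS] /matrixP sE.
have eE i j : E i j = E j i by rewrite -[LHS]sE mxE.
pose a4 i j k l := \sum_q coord4 S i j k q * E q l.
have a4a i j k l : a4 i j k l = - a4 j i k l.
  by rewrite /a4 -sumrN; apply: eq_bigr => q _; case: (hS i j k q) => -> _ _; ring.
have a4b i j k l : a4 i j k l + a4 j k i l + a4 k i j l = 0.
  rewrite /a4 -!big_split big1 // => q _ /=.
  by rewrite -!mulrDl bS mul0r.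
pose WE i j k l : R := E i k * (j == l)%:R + E j l * (i == k)%:R
   - E i l * (j == k)%:R - E j k * (i == l)%:R.
have eW i j k l : coord4 (wedge E 1%:M) i j k l = WE i j k l.
  by rewrite coord4_wedge !mxE.
have c1 i j k l : \sum_p \sum_q coord4 S i j p q * WE k l p q =
    2 * a4 i j k l - 2 * a4 i j l k.
  transitivity (\sum_p (coord4 S i j p l * E k p) + \sum_q coord4 S i j k q * E l q
     - \sum_q coord4 S i j l q * E k q - \sum_p coord4 S i j p k * E l p).
    rewrite -[in RHS](sum_delta' (fun p => \sum_q coord4 S i j p q * E l q) k).
    rewrite -[in RHS](sum_delta' (fun p => \sum_q coord4 S i j p q * E k q) l).
    rewrite -big_split -!sumrB; apply: eq_bigr => p _ /=.
    rewrite -[in RHS](sum_delta' (fun q => coord4 S i j p q * E k p) l).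
    rewrite -[in RHS](sum_delta' (fun q => coord4 S i j p q * E l p) k).
    rewrite !mulr_suml -big_split -!sumrB; apply: eq_bigr => q _ /=.
    by rewrite /WE; ring.
  rewrite /a4 !mulr_sumr -big_split -!sumrB; apply: eq_bigr => q _ /=.
  rewrite (eE q l) (eE q k); case: (hS i j q l) => _ -> _; case: (hS i j q k) => _ -> _; ring.
have d1 i j k l : \sum_p \sum_q coord4 S i p k q * WE j p l q =
    E j l * ric S i k + (j == l)%:R * act S E i k - a4 i l k j - a4 k j i l.
  transitivity (\sum_p \sum_q coord4 S i p k q * E p q * (j == l)%:R
     + \sum_p coord4 S i p k p * E j l
     - \sum_q coord4 S i l k q * E j q - \sum_p coord4 S i p k j * E p l).
    rewrite -[in RHS](sum_delta (fun p => \sum_q coord4 S i p k q * E j q) l).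
    rewrite -big_split -!sumrB; apply: eq_bigr => p _ /=.
    rewrite -[in RHS](sum_delta' (fun q => coord4 S i p k q * E p l) j).
    rewrite -[in RHS](sum_delta' (fun q => coord4 S i p k q * E j l) p).
    rewrite !mulr_suml -big_split -!sumrB; apply: eq_bigr => q _ /=.
    by rewrite /WE; ring.
  rewrite !mxE /a4; congr (_ - _ - _).
  - rewrite addrC -mulr_suml; congr (_ + _); first by rewrite mulrC.
    by rewrite mulr_sumr; apply: eq_bigr => p _; rewrite -mulr_suml mulrC.
  - by apply: eq_bigr => q _; rewrite eE.
  - by apply: eq_bigr => p _; case: (hS i p k j) => _ _ ->.
apply: ext4 => i j k l; rewrite coord4_cross !coord4E.
have sw (f g : 'I_n -> 'I_n -> R) : \sum_p \sum_q f p q * g p q = \sum_p \sum_q g p q * f p q.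
  by apply: eq_bigr => p _; apply: eq_bigr => q _; rewrite mulrC.
under [X in X + _ + _]eq_bigr do under eq_bigr do rewrite eW.
under [X in _ + X + _]eq_bigr do under eq_bigr do rewrite eW mulrC.
under [X in X + _ - _ - _]eq_bigr do under eq_bigr do rewrite eW.
under [X in _ + X - _ - _]eq_bigr do under eq_bigr do rewrite eW mulrC.
under [X in _ - X - _]eq_bigr do under eq_bigr do rewrite eW.
under [X in _ * (_ - X)]eq_bigr do under eq_bigr do rewrite eW mulrC.
rewrite !c1 !d1 ![1%:M _ _]mxE.
have h1 := a4b i j k l; have h2 := a4b i j l k; have h3 := a4b k l i j.
have h4 := a4b k l j i; have e1 := a4a k j i l; have e2 := a4a l j i k.
by have e3 := a4a i l k j; have e4 := a4a j l k i; lra.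
Qed.

Lemma wedgeDr A B B' : wedge A (B + B') = wedge A B + wedge A B'.
Proof. by rewrite wedgeC wedgeDl !(wedgeC _ A). Qed.

Lemma wedgeZr a A B : wedge A (a *: B) = a *: wedge A B.
Proof. by rewrite wedgeC wedgeZl (wedgeC B). Qed.

Definition smean S : R := scal S / n%:R.
Definition tfric S : 'M[R]_n := ric S - (smean S)%:M.
(** The factor by which l_{a,b} multiplies the scalar curvature. *)
Definition coefm (a : R) : R := 1 + 2 * (n%:R - 1) * a.
Definition coefc (a b : R) : R :=
  (n%:R * b ^+ 2 * (1 - 2 * b) - 2 * (a - b) * (1 - 2 * b + n%:R * b ^+ 2))
  / (n%:R * coefm a).
(** The term D of Boehm and Wilking, that is l^-1 Q(l S) - Q(S) for l = l_{a,b}, written with A and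
    s. The denominator in [coefc] comes from inverting l on the scalar part. *)
Definition defect (a b : R) S : tensor R n :=
  let A := tfric S in let s := smean S in
  (2 * b + (n%:R - 2) * b ^+ 2) *: wedge A A + (4 * a * s) *: wedge A 1%:M
  + (2 * a * s ^+ 2 + coefc a b * \tr (A *m A)) *: wedge 1%:M 1%:M
  + (2 * b ^+ 2) *: wedge (A *m A) 1%:M.

Lemma ricE S : ric S = tfric S + (smean S)%:M.
Proof. by rewrite /tfric subrK. Qed.

Lemma tr_tfric S : n != 0%N -> \tr (tfric S) = 0.
Proof.
move=> n0; rewrite /tfric linearB /= mxtrace_scalar -mulr_natr /smean divfK ?pnatr_eq0 //.
by rewrite subrr.
Qed.

Lemma tfric_sym S : S2so S -> (tfric S)^T = tfric S.
Proof. by move=> hS; rewrite /tfric linearB /= ric_sym // tr_scalar_mx. Qed.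

Lemma tr_act_ric S : S2so S -> \tr (act S (ric S)) = \tr (ric S *m ric S).
Proof.
move=> hS; rewrite /mxtrace; under eq_bigr do rewrite mxE.
under [RHS]eq_bigr do rewrite mxE.
rewrite exchange_big; apply: eq_bigr => p _ /=; rewrite exchange_big; apply: eq_bigr => q _ /=.
have sy a b : ric S a b = ric S b a by rewrite -{1}(ric_sym hS) mxE.
rewrite -mulr_suml; congr (_ * _); last exact: sy.
rewrite mxE; apply: eq_bigr => r _; case: (hS r p r q) => -> _ _.
by case: (hS p r r q) => _ -> _; rewrite opprK.
Qed.

Lemma tr_ric2 S : n != 0%N ->
  \tr (ric S *m ric S) = \tr (tfric S *m tfric S) + n%:R * smean S ^+ 2.
Proof.
move=> n0; rewrite ricE; move: (tfric S) (tr_tfric S n0) => A tA.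
rewrite mulmxDl !mulmxDr !mxtraceD -scalar_mxM mxtrace_scalar.
rewrite scalar_mxC !mul_scalar_mx !mxtraceZ tA // !mulr0 add0r addr0.
by rewrite mulr_natl expr2.
Qed.

Lemma labE a b S : lab a b S =
  S + wedge (b *: ric S + ((a - b) * smean S)%:M) 1%:M.
Proof.
apply: ext4 => i j k l; rewrite /lab /curvI !coord4E !mxE /smean.
have n0 : n%:R != 0 :> R by rewrite pnatr_eq0 -lt0n (leq_ltn_trans (leq0n i)).
by rewrite -!(mulr_natr ((a - b) * _)); field.
Qed.

Lemma ric_defect a b S : n != 0%N -> coefm a != 0 ->
  ric (defect a b S) = (- 4 * b) *: (tfric S *m tfric S)
   + (4 * a * (n%:R - 2) * smean S) *: tfric S
   + (4 * a * (n%:R - 1) * smean S ^+ 2 + 2 * (n%:R ^+ 2 * b ^+ 2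
      - 2 * (n%:R - 1) * (a - b) * (1 - 2 * b)) / (n%:R * coefm a)
      * \tr (tfric S *m tfric S))%:M.
Proof.
move=> n0 m0; have n0' : n%:R != 0 :> R by rewrite pnatr_eq0.
rewrite /defect /= !(ricD, ricZ) !ric_wedge !mulmx1 !mul1mx !mxtrace1 tr_tfric //.
set A := tfric S; set s := smean S; set t := \tr (A *m A).
apply/matrixP => i j; rewrite !mxE.
move: m0; rewrite /coefc /coefm => m0.
by case: (i == j); rewrite ?mulr1n ?mulr0n; field; rewrite n0' m0.
Qed.

Lemma scal_evolution a b S : CB S -> n != 0%N -> coefm a != 0 ->
  scal (hamQ S + defect a b S) =
    2 * (1 + (n%:R - 2) * b) ^+ 2 / coefm a * \tr (tfric S *m tfric S)
    + 2 * n%:R * coefm a * smean S ^+ 2.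
Proof.
move=> cS n0 m0; have n0' : n%:R != 0 :> R by rewrite pnatr_eq0.
rewrite scalD /scal ric_hamQ // ric_defect // mxtraceZ tr_act_ric; last by case: cS.
rewrite tr_ric2 // !mxtraceD !mxtraceZ mxtrace_scalar tr_tfric // -mulr_natr.
move: m0; rewrite /coefm => m0; field.
by rewrite n0' m0.
Qed.

Lemma ric_wedge1 E : ric (wedge E 1%:M) = (n%:R - 2) *: E + (\tr E)%:M.
Proof.
  rewrite ric_wedge mxtrace1 mulmx1 mul1mx; apply/matrixP => i j; rewrite !mxE.
  by rewrite -(mulr_natr (\tr E)); ring.
Qed.

Lemma act_wedge1 E : E^T = E -> act (wedge E 1%:M) E = \tr E *: E + (\tr (E *m E))%:M - 2 *: (E *m E).
Proof.
move=> ET.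
  apply/matrixP => i k; rewrite !mxE.
  have eE p q : E p q = E q p by rewrite -{1}ET mxE.
  transitivity (\sum_p \sum_q (E i k * E p q * (p == q)%:R + E p q * E p q * (i == k)%:R
    - E i q * E p q * (p == k)%:R - E p k * E p q * (i == q)%:R)).
    by apply: eq_bigr => p _; apply: eq_bigr => q _; rewrite coord4_wedge !mxE; ring.
  transitivity (\sum_p (E i k * E p p + (\sum_q E p q * E q p) * (i == k)%:R
     - (\sum_q E i q * E p q) * (p == k)%:R - E p k * E p i)).
    apply: eq_bigr => p _.
    rewrite -[in RHS](sum_delta' (fun q => E i k * E p q) p).
    rewrite -[in RHS](sum_delta' (fun q => E p k * E p q) i) !mulr_suml.
    rewrite -big_split -!sumrB; apply: eq_bigr => q _ /=.
    by rewrite (eE q p); ring.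
  rewrite !sumrB big_split /= -mulr_sumr -mulr_suml sum_delta.
  have -> : \sum_p \sum_q E p q * E q p = \tr (E *m E).
    by apply: eq_bigr => p _; rewrite mxE.
  have -> : \sum_p E p k * E p i = \sum_j E i j * E j k.
    by apply: eq_bigr => p _; rewrite (eE p i); ring.
  have -> : \sum_q E i q * E k q = \sum_j E i j * E j k.
    by apply: eq_bigr => p _; rewrite (eE p k).
  have -> : \sum_p E p p = \tr E by [].
  rewrite -(mulr_natr (\tr (E *m E))).
  move: (\tr (E *m E)) (\tr E) (\sum_j _) => x1 x2 x3; ring.
Qed.

Lemma hamQ_lab a b S : CB S -> n != 0%N -> coefm a != 0 ->
  hamQ (lab a b S) = lab a b (hamQ S + defect a b S).
Proof.
move=> cS n0 m0; have n0' : n%:R != 0 :> R by rewrite pnatr_eq0.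
have hS : S2so S by case: cS.
pose s := smean S; pose A := tfric S; pose E := b *: A + (a * s)%:M.
have AT : A^T = A by exact: tfric_sym.
have ET : E^T = E by rewrite /E linearD linearZ /= AT tr_scalar_mx.
have rE : b *: ric S + ((a - b) * s)%:M = E.
  rewrite /E /A /s ricE; move: (tfric S) (smean S) => X x.
  by apply/matrixP => i j; rewrite !mxE; case: (i == j); rewrite ?mulr1n ?mulr0n; ring.
rewrite !labE -/s rE hamQD cross_wedge //.
have cW : CB (wedge E 1%:M) by apply: CB_wedge => //; rewrite tr_scalar_mx.
(* The perturbation is itself of the form E /\ id, so polarizing it against itself gives its Q. *)
have QW : hamQ (wedge E 1%:M) = wedge (ric (wedge E 1%:M)) E
     + wedge (act (wedge E 1%:M) E) 1%:M.
  have := cross_self (wedge E 1%:M); rewrite cross_wedge //.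
  by move/(scalerI _) => -> //; rewrite pnatr_eq0.
have trE : \tr E = n%:R * a * s.
  by rewrite mxtraceD mxtraceZ tr_tfric // mxtrace_scalar mulr0 add0r -mulrA mulr_natl.
have rW := ric_wedge1 E; have aW := act_wedge1 ET.
have E2 : E *m E = b ^+ 2 *: (A *m A) + (2 * a * b * s) *: A + ((a * s) ^+ 2)%:M.
  rewrite /E; clearbody A; rewrite mulmxDl !mulmxDr -!scalemxAl -!scalemxAr -scalar_mxM scalar_mxC !mul_scalar_mx.
  by apply/matrixP => i j; rewrite !mxE; case: (i == j); rewrite ?mulr1n ?mulr0n; ring.
have trE2 : \tr (E *m E) = b ^+ 2 * \tr (A *m A) + n%:R * (a * s) ^+ 2.
  by rewrite E2 !mxtraceD !mxtraceZ tr_tfric // mxtrace_scalar [n%:R * _]mulr_natl mulr0 addr0.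
have aE : act S E = b *: act S (ric S) + ((a - b) * s) *: ric S.
  by rewrite -rE actD actZ -scalemx1 actZ act1.
have -> : smean (hamQ S + defect a b S) = (2 * (1 + (n%:R - 2) * b) ^+ 2 / coefm a * \tr (A *m A)
    + 2 * n%:R * coefm a * s ^+ 2) / n%:R by rewrite /smean scal_evolution.
rewrite ricD ric_hamQ // ric_defect // -/A -/s QW rW aW trE aE trE2 E2.
rewrite (ricE S) -/A -/s /defect -/A -/s; set M := act S _.
(* With the identity matrix opaque, both sides become linear combinations of the same few wedge
   products, and coefficients can be compared. *)
have [I1 eI] : exists X : 'M[R]_n, X = 1%:M by exists 1%:M.
have sc x : x%:M = x *: I1 by rewrite eI scalemx1.
rewrite /E -!eI !sc.
move: {E rE trE rW aW cW QW ET trE2 E2 aE} (A *m A) M (hamQ S) => A2 M QS.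
clearbody A s.
have sN (x : R) (X : 'M[R]_n) : - (x *: X) = (- x) *: X by rewrite scaleNr.
rewrite !sN !(scalerDr, scalerA, wedgeDl, wedgeZl, wedgeDr, wedgeZr).
apply: ext4 => i j k l; rewrite !(coord4D, coord4Z).
rewrite !(wedgeC I1).
move: (\tr A2) (coord4 (wedge A2 I1) i j k l) (coord4 (wedge M I1) i j k l) => t w1 w2.
move: (coord4 (wedge A A) i j k l) (coord4 (wedge A I1) i j k l) => w3 w4.
move: (coord4 (wedge I1 I1) i j k l) (coord4 QS i j k l) => w5 w6.
rewrite /coefc; move: m0; rewrite /coefm => m0; clear -n0' m0.
move: m0; move: n%:R n0' => N n0 m0.
field.
by rewrite n0 m0.
Qed.
End Evolution.

(** * Finite sums over an index set *)

Section Sums.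
Variables (R : realType) (I : finType).

Lemma cauchy_sum (P : pred I) (f : I -> R) :
  (\sum_(i | P i) f i) ^+ 2 <= #|P|%:R * \sum_(i | P i) f i ^+ 2.
Proof.
suff : 0 <= \sum_(i | P i) \sum_(j | P j) (f i - f j) ^+ 2.
  have -> : \sum_(i | P i) \sum_(j | P j) (f i - f j) ^+ 2 =
     2 * (#|P|%:R * (\sum_(i | P i) f i ^+ 2) - (\sum_(i | P i) f i) ^+ 2).
    transitivity (\sum_(i | P i) (#|P|%:R * f i ^+ 2 - 2 * f i * \sum_(j | P j) f j
        + \sum_(j | P j) f j ^+ 2)).
      apply: eq_bigr => i _; rewrite mulr_sumr mulr_natl.
      rewrite (eq_bigr (fun j => f i ^+ 2 - 2 * f i * f j + f j ^+ 2)); last by move=> j _; ring.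
      by rewrite big_split sumrB /= sumr_const.
    rewrite big_split sumrB /= sumr_const -mulr_sumr -mulr_suml -mulr_sumr -mulr_natl; ring.
  by lra.
by apply: sumr_ge0 => i _; apply: sumr_ge0 => j _; rewrite sqr_ge0.
Qed.

Lemma sum_row_col (P : pred I) (f : I -> I -> R) p : P p -> (forall q r, 0 <= f q r) ->
  f p p = 0 ->
  \sum_(q | P q) f q p + \sum_(q | P q) f p q <= \sum_(q | P q) \sum_(r | P r) f q r.
Proof.
move=> Pp f0 fp; rewrite [X in _ <= X](bigD1 p) //= [X in X <= _]addrC lerD2l.
rewrite (bigD1 p) //= fp add0r; apply: ler_sum => q /andP[_ _].
by rewrite (bigD1 p) //= lerDl sumr_ge0.
Qed.

End Sums.

Section Rest.
Variables (R : realType) (n : nat).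
Definition rest (i1 i2 : 'I_n) := [pred p : 'I_n | (p != i1) && (p != i2)].

Lemma sum_rest (V : nmodType) (i1 i2 : 'I_n) (F : 'I_n -> V) : i1 != i2 ->
  \sum_p F p = F i1 + (F i2 + \sum_(p | rest i1 i2 p) F p).
Proof.
move=> ne; rewrite (bigD1 i1) //= (bigD1 i2) /= 1?eq_sym //.
Qed.

Lemma sum2_rest (i1 i2 : 'I_n) (F : 'I_n -> 'I_n -> R) : i1 != i2 ->
  \sum_p \sum_q F p q =
   F i1 i1 + F i2 i2 + F i1 i2 + F i2 i1 + \sum_(p | rest i1 i2 p) (F i1 p + F p i1)
   + \sum_(p | rest i1 i2 p) (F i2 p + F p i2)
   + \sum_(p | rest i1 i2 p) \sum_(q | rest i1 i2 q) F p q.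
Proof.
move=> ne; rewrite (sum_rest _ ne) !(sum_rest (F _) ne).
have -> : \sum_(p | rest i1 i2 p) \sum_q F p q =
   \sum_(p | rest i1 i2 p) (F p i1 + (F p i2 + \sum_(q | rest i1 i2 q) F p q)).
  by apply: eq_bigr => p _; rewrite (sum_rest (F p) ne).
rewrite !big_split /=; ring.
Qed.

Lemma card_rest (i1 i2 : 'I_n) : i1 != i2 -> #|rest i1 i2|%:R = n%:R - 2 :> R.
Proof.
move=> ne; rewrite -[n in RHS]card_ord -!sum1_card natr_sum [in RHS]natr_sum.
by rewrite [in RHS](sum_rest _ ne); ring.
Qed.
End Rest.

(** * Evolution of the Ricci conditions *)

Section DifferenceEvolution.
Variables (R : realType) (n : nat).
Implicit Types (S : tensor R n).

Definition plane_sum S (i1 i2 : 'I_n) : R :=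
  \sum_(p | rest i1 i2 p) (coord4 S i1 p i1 p + coord4 S i2 p i2 p).

Variables (S : tensor R n) (i1 i2 : 'I_n).
Hypothesis (cS : CB S) (ne : i1 != i2).
Let P := rest i1 i2.
Let B p q := coord4 S i1 p i1 q.
Let C p q := coord4 S i2 p i2 q.
Let y p := coord4 S i2 i1 i2 p.
Let z p := coord4 S i1 i2 i1 p.
Let K := coord4 S i1 i2 i1 i2.
Let A := tfric S.

Let hS : S2so S. Proof. by case: cS. Qed.
Let Sa i j k l : coord4 S i j k l = - coord4 S j i k l. Proof. by case: (hS i j k l). Qed.
Let Sb i j k l : coord4 S i j k l = - coord4 S i j l k. Proof. by case: (hS i j k l). Qed.
Let Sc i j k l : coord4 S i j k l = coord4 S k l i j. Proof. by case: (hS i j k l). Qed.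
Let S0 i k l : coord4 S i i k l = 0. Proof. by have := Sa i i k l; lra. Qed.
Let S0' i k l : coord4 S k l i i = 0. Proof. by rewrite Sc S0. Qed.

Lemma act_split (E : 'M[R]_n) : E^T = E ->
  act S E i2 i2 - act S E i1 i1 = K * (E i1 i1 - E i2 i2)
   + 2 * \sum_(p | P p) (y p * E i1 p - z p * E i2 p)
   + \sum_(p | P p) \sum_(q | P q) (C p q - B p q) * E p q.
Proof.
move=> ET; have eE p q : E p q = E q p by rewrite -{1}ET mxE.
rewrite !mxE !(sum2_rest _ ne) !S0 !S0' !(mul0r, addr0, add0r).
have -> : \sum_(p | P p) (coord4 S i2 i2 i2 p * E i2 p + coord4 S i2 p i2 i2 * E p i2) = 0.
  by rewrite big1 // => p _; rewrite S0 S0' !mul0r addr0.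
have -> : \sum_(p | P p) (coord4 S i1 i1 i1 p * E i1 p + coord4 S i1 p i1 i1 * E p i1) = 0.
  by rewrite big1 // => p _; rewrite S0 S0' !mul0r addr0.
have -> : \sum_(p | P p) (coord4 S i2 i1 i2 p * E i1 p + coord4 S i2 p i2 i1 * E p i1)
   = 2 * \sum_(p | P p) y p * E i1 p.
  rewrite mulr_sumr; apply: eq_bigr => p _.
  by rewrite (eE p i1) (Sc i2 p i2 i1) /y; ring.
have -> : \sum_(p | P p) (coord4 S i1 i2 i1 p * E i2 p + coord4 S i1 p i1 i2 * E p i2)
   = 2 * \sum_(p | P p) z p * E i2 p.
  rewrite mulr_sumr; apply: eq_bigr => p _.
  by rewrite (eE p i2) (Sc i1 p i1 i2) /z; ring.
have -> : coord4 S i2 i1 i2 i1 = K by rewrite Sa Sb opprK.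
rewrite -/K sumrB.
have -> : \sum_(p | P p) \sum_(q | P q) (C p q - B p q) * E p q =
  \sum_(p | P p) \sum_(q | P q) C p q * E p q - \sum_(p | P p) \sum_(q | P q) B p q * E p q.
  rewrite -sumrB; apply: eq_bigr => p _; rewrite -sumrB; apply: eq_bigr => q _; ring.
by rewrite /B /C; ring.
Qed.

Lemma ric_split1 : ric S i1 i1 = K + \sum_(p | P p) B p p.
Proof. by rewrite mxE (sum_rest _ ne) S0 add0r. Qed.

Lemma ric_split2 : ric S i2 i2 = K + \sum_(p | P p) C p p.
Proof. by rewrite mxE (sum_rest _ ne) S0 add0r /K Sa Sb opprK. Qed.

Lemma ric_split1p p : ric S i1 p = y p + \sum_(q | P q) coord4 S i1 q p q.
Proof. by rewrite mxE (sum_rest _ ne) S0 add0r /y [in RHS]Sa [in RHS]Sb opprK. Qed.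

Lemma ric_split2p p : ric S i2 p = z p + \sum_(q | P q) coord4 S i2 q p q.
Proof. by rewrite mxE (sum_rest _ ne) S0 add0r /z [in RHS]Sa [in RHS]Sb opprK. Qed.

(* In the sum of squares giving the components of S^2 keep only those whose
   contractions occur in the evolution of Ric_22 - Ric_11. *)
Lemma plane_sum_square (k : R) : k = n%:R - 2 -> 0 < k ->
  \sum_(p | P p) \sum_(q | P q) (2 * B p q ^+ 2 + 2 * C p q ^+ 2)
  + \sum_(p | P p) (2 * y p ^+ 2 + 2 * z p ^+ 2
     + 2 / k * (ric S i1 p - y p) ^+ 2 + 2 / k * (ric S i2 p - z p) ^+ 2)
  <= plane_sum (square S) i1 i2.
Proof.
move=> ek k0; rewrite /plane_sum.
have key a b p : P p -> (a, b) = (i1, i2) \/ (a, b) = (i2, i1) ->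
   2 * \sum_(q | P q) coord4 S a p a q ^+ 2 + 2 * coord4 S a p a b ^+ 2
   + 2 * \sum_(q | P q) coord4 S a p q p ^+ 2 <= coord4 (square S) a p a p.
  move=> Pp ab; rewrite coord4_square.
  have -> : \sum_q \sum_r coord4 S a p q r * coord4 S a p q r =
     \sum_q \sum_r coord4 S a p q r ^+ 2.
    by apply: eq_bigr => q _; apply: eq_bigr => r _; rewrite expr2.
  rewrite (sum2_rest _ ne) !S0' !expr0n /=.
  have f0 q r : 0 <= coord4 S a p q r ^+ 2 by rewrite sqr_ge0.
  have := sum_row_col Pp f0; rewrite S0' expr0n /= => /(_ erefl).
  have e1 : \sum_(q | P q) coord4 S a p p q ^+ 2 = \sum_(q | P q) coord4 S a p q p ^+ 2.
    by apply: eq_bigr => q _; rewrite Sb sqrrN.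
  have e2 c : \sum_(q | P q) (coord4 S a p c q ^+ 2 + coord4 S a p q c ^+ 2) =
      2 * \sum_(q | P q) coord4 S a p c q ^+ 2.
    by rewrite mulr_sumr; apply: eq_bigr => q _; rewrite (Sb a p q c) sqrrN; ring.
  have p1 : 0 <= \sum_(q | P q) coord4 S a p i1 q ^+ 2 by rewrite sumr_ge0.
  have p2 : 0 <= \sum_(q | P q) coord4 S a p i2 q ^+ 2 by rewrite sumr_ge0.
  rewrite e1 !e2 (Sb a p i2 i1) sqrrN.
  by case: ab => -[ea eb]; rewrite {}ea {}eb in p1 p2 *; rewrite ?(Sb i2 p i2 i1) ?sqrrN; lra.
have cs' a p : 2 / k * (\sum_(q | P q) coord4 S a q p q) ^+ 2 <=
    2 * \sum_(q | P q) coord4 S a q p q ^+ 2.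
  have := cauchy_sum P (fun q => coord4 S a q p q); rewrite card_rest // -ek.
  by rewrite mulrAC ler_pdivrMr // => le; rewrite -mulrA ler_pM2l // mulrC.
have ex a : \sum_(p | P p) \sum_(q | P q) coord4 S a p q p ^+ 2 =
   \sum_(p | P p) \sum_(q | P q) coord4 S a q p q ^+ 2 by rewrite exchange_big.
have sumP (f g : 'I_n -> R) : (forall p, P p -> f p <= g p) ->
  \sum_(p | P p) f p <= \sum_(p | P p) g p by move=> h; apply: ler_sum.
have l1 := sumP _ _ (fun p (Pp : P p) => key i1 i2 p Pp (or_introl erefl)).
have l2 := sumP _ _ (fun p (Pp : P p) => key i2 i1 p Pp (or_intror erefl)).
have l3 := sumP _ _ (fun p (Pp : P p) => cs' i1 p).
have l4 := sumP _ _ (fun p (Pp : P p) => cs' i2 p).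
have E1 : \sum_(p | P p) 2 / k * (ric S i1 p - y p) ^+ 2 =
   \sum_(p | P p) 2 / k * (\sum_(q | P q) coord4 S i1 q p q) ^+ 2.
  by apply: eq_bigr => p _; rewrite ric_split1p addrC addKr.
have E2 : \sum_(p | P p) 2 / k * (ric S i2 p - z p) ^+ 2 =
   \sum_(p | P p) 2 / k * (\sum_(q | P q) coord4 S i2 q p q) ^+ 2.
  by apply: eq_bigr => p _; rewrite ric_split2p addrC addKr.
have E3 : \sum_(p | P p) \sum_(q | P q) (2 * B p q ^+ 2 + 2 * C p q ^+ 2) =
   \sum_(p | P p) 2 * \sum_(q | P q) coord4 S i1 p i1 q ^+ 2 +
   \sum_(p | P p) 2 * \sum_(q | P q) coord4 S i2 p i2 q ^+ 2.
  rewrite -big_split; apply: eq_bigr => p _ /=; rewrite !mulr_sumr -big_split.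
  by apply: eq_bigr.
have E4 : \sum_(p | P p) 2 * y p ^+ 2 = \sum_(p | P p) 2 * coord4 S i2 p i2 i1 ^+ 2.
  by apply: eq_bigr => p _; rewrite /y Sc.
have E5 : \sum_(p | P p) 2 * z p ^+ 2 = \sum_(p | P p) 2 * coord4 S i1 p i1 i2 ^+ 2.
  by apply: eq_bigr => p _; rewrite /z Sc.
move: l1 l2 l3 l4; rewrite !big_split /= E1 E2 E3 E4 E5 -!mulr_sumr.
have := ex i1; have := ex i2; rewrite -/P; lra.
Qed.

(** At an interior zero of clause (4) the ratio r = u / v is fixed by r omega scal = d, and the
    conclusion is the derivative divided by v^2. With q = A_11 + A_22 the contributions fall into
    the block orthogonal to the plane, the mixed components, for which the two quadratic forms in x
    and y are assumed nonnegative, and scalars in d, q, s. Of G + 4, which is omega times the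
    coefficient of |A|^2 in scal', the share 4 completes the squares in the block and G is left
    over. *)
Lemma difference_evolution (a b r om k G d q s : R) :
  coefm n a != 0 -> k = n%:R - 2 -> 0 < k ->
  d = ric S i2 i2 - ric S i1 i1 -> s = smean S -> q + 2 * s = ric S i1 i1 + ric S i2 i2 ->
  om * (2 * (1 + (n%:R - 2) * b) ^+ 2 / coefm n a) = G + 4 -> 0 <= G ->
  r * om * n%:R * s = d ->
  (forall x y, 0 <= 2 * y ^+ 2 + 2 / k * (x - y) ^+ 2 - 8 * r * y * x - 8 * r * b * x ^+ 2
     + 2 * (G + 4) * r ^+ 2 * x ^+ 2) ->
  (forall x y, 0 <= 2 * y ^+ 2 + 2 / k * (x - y) ^+ 2 + 8 * r * y * x + 8 * r * b * x ^+ 2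
     + 2 * (G + 4) * r ^+ 2 * x ^+ 2) ->
  0 < (d + 2 * r * q) ^+ 2 / k + G * r ^+ 2 * (q ^+ 2 / k) - k * r ^+ 2 * d ^+ 2
      + (G + 4) * r ^+ 2 * ((q ^+ 2 + d ^+ 2) / 2) + 2 * r * d * (q + 2 * s)
      - 4 * r * s * d + 8 * r * b * q * d - 8 * r * a * (n%:R - 2) * s * d
      + 2 * coefm n a * r * s * d ->
  0 < plane_sum (square S) i1 i2 + r ^+ 2 * om * scal (hamQ S + defect a b S)
      - 2 * r * (ric (hamQ S + defect a b S) i2 i2 - ric (hamQ S + defect a b S) i1 i1).
Proof.
move=> m0 ek k0 ed es eq eG G0 er hq1 hq2 hM.
have n0 : n != 0%N by rewrite -lt0n (leq_ltn_trans (leq0n i1)).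
have AT : A^T = A by exact: tfric_sym.
have eA p p' : A p p' = A p' p by rewrite -{1}AT mxE.
have A11 : A i1 i1 = ric S i1 i1 - s by rewrite /A /tfric !mxE eqxx mulr1n es.
have A22 : A i2 i2 = ric S i2 i2 - s by rewrite /A /tfric !mxE eqxx mulr1n es.
have A1 p : P p -> ric S i1 p = A i1 p.
  by case/andP => np _; rewrite /A /tfric !mxE eq_sym (negPf np) mulr0n subr0.
have A2 p : P p -> ric S i2 p = A i2 p.
  by case/andP => _ np; rewrite /A /tfric !mxE eq_sym (negPf np) mulr0n subr0.
have -> : ric (hamQ S + defect a b S) i2 i2 - ric (hamQ S + defect a b S) i1 i1 =
   2 * (act S A i2 i2 - act S A i1 i1) + 2 * s * d
   - 4 * b * ((A *m A) i2 i2 - (A *m A) i1 i1) + 4 * a * (n%:R - 2) * s * d.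
  have -> : ric (hamQ S + defect a b S) = 2 *: (act S A + s *: ric S) +
      ((- 4 * b) *: (A *m A) + (4 * a * (n%:R - 2) * s) *: A +
       (4 * a * (n%:R - 1) * smean S ^+ 2 + 2 * (n%:R ^+ 2 * b ^+ 2
      - 2 * (n%:R - 1) * (a - b) * (1 - 2 * b)) / (n%:R * coefm n a)
      * \tr (tfric S *m tfric S))%:M).
    rewrite ricD ric_hamQ // ric_defect // -es; congr (_ *: _ + _).
    by rewrite -[in RHS](act1 S) -actZ -actD scalemx1 es -ricE.
  have ent (X Y Z W : 'M[R]_n) (c1 c2 c3 : R) i :
    (2 *: (X + s *: Y) + (c1 *: Z + c2 *: W + c3%:M)) i i =
    2 * (X i i + s * Y i i) + (c1 * Z i i + c2 * W i i + c3).
    by rewrite !mxE eqxx mulr1n.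
  by rewrite !ent A11 A22 ed; ring.
have sq i : (A *m A) i i = A i i1 ^+ 2 + (A i i2 ^+ 2 + \sum_(p | P p) A i p ^+ 2).
  rewrite mxE (eq_bigr (fun p => A i p ^+ 2)) ?(sum_rest _ ne) // => p _.
  by rewrite (eA p i) expr2.
have trA : \tr (A *m A) = A i1 i1 ^+ 2 + A i2 i2 ^+ 2 + 2 * A i1 i2 ^+ 2
   + 2 * \sum_(p | P p) A i1 p ^+ 2 + 2 * \sum_(p | P p) A i2 p ^+ 2
   + \sum_(p | P p) \sum_(q | P q) A p q ^+ 2.
  have -> : \tr (A *m A) = \sum_p \sum_q A p q ^+ 2.
    by apply: eq_bigr => p _; rewrite mxE; apply: eq_bigr => p' _; rewrite (eA p' p) expr2.
  rewrite (sum2_rest _ ne) (eA i2 i1).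
  have e i : \sum_(p | P p) (A i p ^+ 2 + A p i ^+ 2) = 2 * \sum_(p | P p) A i p ^+ 2.
    by rewrite mulr_sumr; apply: eq_bigr => p _; rewrite (eA p i); ring.
  by rewrite !e; ring.
have scV := scal_evolution b cS n0 m0.
have PS := plane_sum_square ek k0.
have r1 := ric_split1; have r2 := ric_split2.
have act2 := act_split AT.
have trA0 := tr_tfric S n0.
have trP : \sum_(p | P p) A p p = - q.
  have : \tr A = A i1 i1 + (A i2 i2 + \sum_(p | P p) A p p) by rewrite /mxtrace (sum_rest _ ne).
  by rewrite trA0 A11 A22; lra.
rewrite scV -/A -es trA act2 !sq (eA i2 i1).
set SA1 := \sum_(p | P p) A i1 p ^+ 2; set SA2 := \sum_(p | P p) A i2 p ^+ 2.
set SA := \sum_(p | P p) \sum_(q | P q) A p q ^+ 2.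
set tB := \sum_(p | P p) B p p in r1; set tC := \sum_(p | P p) C p p in r2.
set SY := \sum_(p | P p) (y p * _ - _); set SC := \sum_(p | P p) \sum_(q | P q) (C p q - _) * _.
pose X p p' := (C p p' - B p p') - 2 * r * A p p'.
(* completed squares in the block orthogonal to the plane *)
have b1 : (d + 2 * r * q) ^+ 2 / k <= \sum_(p | P p) \sum_(p' | P p') X p p' ^+ 2.
  have <- : \sum_(p | P p) X p p = d + 2 * r * q.
    rewrite !sumrB -mulr_sumr trP -/tB -/tC ed r1 r2; ring.
  rewrite ler_pdivrMr // mulrC.
  apply: le_trans (cauchy_sum P (fun p => X p p)) _; rewrite card_rest // -ek ler_pM2l //.
  by apply: ler_sum => p Pp; rewrite (bigD1 p) //= lerDl sumr_ge0 // => p' _; rewrite sqr_ge0.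
have b2 : (tC + tB) ^+ 2 / k <= \sum_(p | P p) \sum_(p' | P p') (C p p' + B p p') ^+ 2.
  rewrite -big_split ler_pdivrMr // mulrC.
  apply: le_trans (cauchy_sum P (fun p => C p p + B p p)) _; rewrite card_rest // -ek ler_pM2l //.
  by apply: ler_sum => p Pp; rewrite (bigD1 p) //= lerDl sumr_ge0 // => p' _; rewrite sqr_ge0.
have b3 : q ^+ 2 / k <= SA.
  have -> : q ^+ 2 = (\sum_(p | P p) A p p) ^+ 2 by rewrite trP sqrrN.
  rewrite ler_pdivrMr // mulrC.
  apply: le_trans (cauchy_sum P (fun p => A p p)) _; rewrite card_rest // -ek ler_pM2l //.
  by apply: ler_sum => p Pp; rewrite (bigD1 p) //= lerDl sumr_ge0 // => p' _; rewrite sqr_ge0.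
have b4 : \sum_(p | P p) \sum_(q | P q) (2 * B p q ^+ 2 + 2 * C p q ^+ 2) - 4 * r * SC
    + 4 * r ^+ 2 * SA =
   \sum_(p | P p) \sum_(p' | P p') X p p' ^+ 2 +
   \sum_(p | P p) \sum_(p' | P p') (C p p' + B p p') ^+ 2.
  rewrite /SC /SA !mulr_sumr -big_split -sumrB -big_split; apply: eq_bigr => p _ /=.
  rewrite !mulr_sumr -big_split -sumrB -big_split; apply: eq_bigr => p' _ /=.
  by rewrite /X; ring.
have b5 : 0 <= \sum_(p | P p) (2 * y p ^+ 2 + 2 * z p ^+ 2
     + 2 / k * (ric S i1 p - y p) ^+ 2 + 2 / k * (ric S i2 p - z p) ^+ 2)
   - 8 * r * SY - 8 * r * b * SA1 + 8 * r * b * SA2 + 2 * (G + 4) * r ^+ 2 * (SA1 + SA2).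
  rewrite /SY /SA1 /SA2 -[X in _ + _ * X]big_split /= !mulr_sumr -!sumrB -!big_split.
  apply: sumr_ge0 => p Pp /=; rewrite A1 // A2 //.
  have := hq1 (A i1 p) (y p); have := hq2 (A i2 p) (z p); lra.
(* Absorbs the term linear in [tC + tB] which the sectional curvature K of the plane brings in
   through [eK]; the price is k r^2 d^2. *)
have b6 : 0 <= ((tC + tB) / k - r * d) ^+ 2 * k by rewrite mulr_ge0 ?sqr_ge0 // ltW.
have b7 : 0 <= G * r ^+ 2 * (SA - q ^+ 2 / k) by rewrite mulr_ge0 ?subr_ge0 // mulr_ge0 // sqr_ge0.
have b8 : 0 <= (G + 4) * r ^+ 2 * A i1 i2 ^+ 2 by rewrite mulr_ge0 ?sqr_ge0 // mulr_ge0 ?sqr_ge0 // addr_ge0.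
have b6' : 0 <= (tC + tB) ^+ 2 / k - 2 * r * d * (tC + tB) + k * r ^+ 2 * d ^+ 2.
  move: b6; congr (0 <= _); field; by rewrite gt_eqF.
have eK : 2 * K = q + 2 * s - tC - tB by rewrite eq r1 r2; ring.
have sq11 : A i1 i1 ^+ 2 + A i2 i2 ^+ 2 = (q ^+ 2 + d ^+ 2) / 2.
  have -> : A i1 i1 = (q - d) / 2 by rewrite A11; lra.
  have -> : A i2 i2 = (q + d) / 2 by rewrite A22; lra.
  by field.
have sq12 : A i2 i2 ^+ 2 - A i1 i1 ^+ 2 = q * d.
  have -> : A i1 i1 = (q - d) / 2 by rewrite A11; lra.
  have -> : A i2 i2 = (q + d) / 2 by rewrite A22; lra.
  by field.
have eA12 : A i1 i1 - A i2 i2 = - d by rewrite A11 A22 ed; ring.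
rewrite eA12.
have t1 : r ^+ 2 * om * (2 * (1 + (n%:R - 2) * b) ^+ 2 / coefm n a *
    (A i1 i1 ^+ 2 + A i2 i2 ^+ 2 + 2 * A i1 i2 ^+ 2 + 2 * SA1 + 2 * SA2 + SA)
    + 2 * n%:R * coefm n a * s ^+ 2) =
   (G + 4) * r ^+ 2 * ((q ^+ 2 + d ^+ 2) / 2) + 2 * ((G + 4) * r ^+ 2 * A i1 i2 ^+ 2)
   + 2 * (G + 4) * r ^+ 2 * (SA1 + SA2) + (G + 4) * r ^+ 2 * SA + 2 * coefm n a * r * s * d.
  rewrite mulrDr -sq11 -eG -er; ring.
rewrite t1.
have t2 : 2 * r * (2 * (K * - d + 2 * SY + SC) + 2 * s * d - 4 * b *
     (A i1 i2 ^+ 2 + (A i2 i2 ^+ 2 + SA2) - (A i1 i1 ^+ 2 + (A i1 i2 ^+ 2 + SA1)))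
     + 4 * a * (n%:R - 2) * s * d) =
   - 2 * r * d * (q + 2 * s) + 2 * r * d * (tC + tB) + 8 * r * SY + 4 * r * SC + 4 * r * s * d
   - 8 * r * b * (q * d) - 8 * r * b * SA2 + 8 * r * b * SA1 + 8 * r * a * (n%:R - 2) * s * d.
  rewrite -sq12; have -> : q + 2 * s = 2 * K + tC + tB by rewrite eK; ring.
  by ring.
rewrite t2; clear t1 t2 scV act2 r1 r2 trA trA0 sq11 sq12 eA12 hq1 hq2 er eG sq trP.
by lra.
Qed.

End DifferenceEvolution.

(** At most one u p is negative. Every other u q is then at least - u p, and the other weights
    together outweigh h p. *)
Lemma weighted_pair_sum (R : realType) (I : finType) (P : pred I) (u h : I -> R) :
  (forall p q, P p -> P q -> p != q -> 0 <= u p + u q) ->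
  (forall p, P p -> 0 <= h p) ->
  (forall p, P p -> 2 * h p <= \sum_(q | P q) h q) ->
  0 <= \sum_(p | P p) u p * h p.
Proof.
move=> hu hh hm.
have [/existsP[p /andP[Pp up]]|/existsPn all] := boolP [exists p, P p && (u p < 0)].
  have := hm p Pp; rewrite (bigD1 p) //= [X in _ -> 0 <= X](bigD1 p) //= => le.
  apply: (@le_trans _ _ (u p * h p + \sum_(q | P q && (q != p)) (- u p) * h q)).
    by rewrite -mulr_sumr; nra.
  rewrite lerD2l; apply: ler_sum => q /andP[Pq nq].
  by apply: ler_wpM2r; [exact: hh | have := hu q p Pq Pp nq; lra].
apply: sumr_ge0 => p Pp; apply: mulr_ge0; last exact: hh.
by have := all p; rewrite Pp /= -leNgt.
Qed.

Section SumEvolution.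
Variables (R : realType) (n : nat).

(** Half the coefficient of |A|^2 in the multiple of the identity contained in Ric(D). *)
Definition ricbeta (a b : R) : R :=
  (n%:R ^+ 2 * b ^+ 2 - 2 * (n%:R - 1) * (a - b) * (1 - 2 * b)) / (n%:R * coefm n a).

(** With h_p = Ric_pp + g s equal to -x and x on the plane, the derivative is 2 sum N_p h_p - 8 b
    x^2 + 4 beta |A|^2 + c s^2, where N_p = S_1p1p + S_2p2p. Clause (4) yields sum N_p h_p >= 4 x^3
    / W for W = omega n s. The bound |A|^2 >= 4 (n - 1) x^2 / n turns - 8 b x^2 + 4 beta |A|^2 into
    - 8 rho x^2, which is the origin of [rhoC]. The last hypothesis keeps the minimum of the
    resulting cubic above - c s^2. *)
Lemma sum_evolution (S : tensor R n) (i1 i2 : 'I_n) (tN : 'I_n -> R) (a b g om rho x s : R) :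
  CB S -> i1 != i2 -> 0 < coefm n a -> (2 < n)%N ->
  (forall p q, p != q -> ric S p q = 0) ->
  s = smean S -> 0 < s -> 0 <= g ->
  let h p := ric S p p + g * s in
  (forall p q, rest i1 i2 p -> rest i1 i2 q -> p != q -> tN p + tN q <=
    (coord4 S i1 p i1 p + coord4 S i2 p i2 p) + (coord4 S i1 q i1 q + coord4 S i2 q i2 q)) ->
  (forall p, rest i1 i2 p -> 0 <= tN p) ->
  (forall p q, p != q -> 0 <= h p + h q) ->
  h i1 = - x -> h i2 = x -> 0 <= x ->
  (forall p, 2 * ric S p p <= n%:R * s) ->
  (2 * x) ^+ 2 <= om * (n%:R * s) * \sum_(p | rest i1 i2 p) tN p ->
  0 < om -> 0 < rho ->
  (2 + (n%:R - 3) * b) * g = b -> 2 * a = (2 * b + (n%:R - 2) * b ^+ 2) * (1 + g) ->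
  0 <= g * (1 - 2 * b) / n%:R + (1 + g) * ricbeta a b ->
  rho = b - 2 * (n%:R - 1) / n%:R * (g * (1 - 2 * b) / n%:R + (1 + g) * ricbeta a b) ->
  32 / 27 * rho ^+ 3 * om ^+ 2 * n%:R ^+ 2 <
    4 * (1 + g) * (g + (n%:R - 2) * b ^+ 2 * (1 + g)) ->
  0 < ric (hamQ S + defect a b S) i1 i1 + ric (hamQ S + defect a b S) i2 i2
     + 2 * g / n%:R * scal (hamQ S + defect a b S).
Proof.
move=> cS ne m0 n2 diag es s0 g0 h hU htN hh h1 h2 x0 hmax h4 om0 rho0 eg ea beta0 erho hom.
have N2 : 2 < n%:R :> R by rewrite ltr_nat.
have n0 : n != 0%N by rewrite -lt0n (leq_trans _ n2).
set N : R := n%:R in N2 *.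
have N0 : 0 < N by rewrite (lt_trans _ N2).
have Nn : N != 0 by rewrite gt_eqF.
have mn : coefm n a != 0 by rewrite gt_eqF.
set beta := g * (1 - 2 * b) / N + _ in beta0 erho.
have [hS _] := cS.
set P := rest i1 i2 in hU htN h4.
set A := tfric S.
have Ad p q : p != q -> A p q = 0.
  by move=> npq; rewrite /A /tfric !mxE (negPf npq) mulr0n subr0 -[RHS](diag p q npq) mxE.
have App p : A p p = h p - (1 + g) * s.
  by rewrite /A /tfric /h !mxE eqxx mulr1n -es; ring.
have A2 i : (A *m A) i i = A i i ^+ 2.
  rewrite mxE (bigD1 i) //= big1 ?addr0 ?expr2 // => q nq.
  by rewrite (Ad i q) ?mul0r // eq_sym.
have trA2 : \tr (A *m A) = \sum_p A p p ^+ 2 by apply: eq_bigr => p _; rewrite A2.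
have trA : \sum_p A p p = 0 by exact: tr_tfric.
have sumh : \sum_p h p = N * (1 + g) * s.
  have : \sum_p (A p p + (1 + g) * s) = \sum_p h p.
    by apply: eq_bigr => p _; rewrite App subrK.
  by rewrite big_split /= trA add0r sumr_const card_ord -mulr_natl mulrA => <-.
pose Np p := coord4 S i1 p i1 p + coord4 S i2 p i2 p.
have S0 i k l : coord4 S i i k l = 0 by case: (hS i i k l) => e _ _; lra.
pose K := coord4 S i1 i2 i1 i2.
have K' : coord4 S i2 i1 i2 i1 = K.
  by case: (hS i2 i1 i2 i1) => -> _ _; case: (hS i1 i2 i2 i1) => _ -> _; rewrite opprK.
have actE i : act S (ric S) i i = \sum_p coord4 S i p i p * ric S p p.
  rewrite mxE; apply: eq_bigr => p _; rewrite (bigD1 p) //= big1 ?addr0 // => q nq.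
  by rewrite diag 1?eq_sym // mulr0.
have actS : act S (ric S) i1 i1 + act S (ric S) i2 i2 =
    \sum_(p | P p) Np p * h p + 2 * g ^+ 2 * s ^+ 2.
  have r1 : ric S i1 i1 = - x - g * s by rewrite -h1 /h; ring.
  have r2 : ric S i2 i2 = x - g * s by rewrite -h2 /h; ring.
  have rs : ric S i1 i1 + ric S i2 i2 = 2 * K + \sum_(p | P p) Np p.
    rewrite [ric S i1 i1]mxE [ric S i2 i2]mxE !(sum_rest _ ne) !S0 K' -/K big_split /=; ring.
  have -> : \sum_(p | P p) Np p * h p = \sum_(p | P p) Np p * ric S p p
      + g * s * \sum_(p | P p) Np p.
    by rewrite mulr_sumr -big_split; apply: eq_bigr => p _ /=; rewrite /h; ring.
  have -> : \sum_(p | P p) Np p = - 2 * g * s - 2 * K by move: rs; rewrite r1 r2 => rs; lra.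
  rewrite !actE !(sum_rest _ ne) !S0 K' -/K /Np.
  under [X in _ = X + _ + _]eq_bigr do rewrite mulrDl.
  by rewrite big_split /= r1 r2; ring.
have hP p : P p -> x <= h p.
  by case/andP => np _; have := hh p i1 np; rewrite h1; lra.
have nx : (N - 2) * x <= N * (1 + g) * s.
  rewrite -sumh (sum_rest _ ne) h1 h2 addrA addNr add0r -(card_rest R ne) mulr_natl -sumr_const.
  exact: ler_sum.
(* Isotropic curvature of S - T makes the pairwise sums of Np - tN nonnegative, and Ric_pp <= scal /
   2 says that no weight h p exceeds half of the total. *)
have pos1 : 0 <= \sum_(p | P p) (Np p - tN p) * h p.
  apply: weighted_pair_sum => [p q Pp Pq npq|p Pp|p Pp].
  - by have := hU p q Pp Pq npq; rewrite /Np; lra.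
  - exact: le_trans (hP p Pp).
  have -> : \sum_(q | P q) h q = N * (1 + g) * s.
    by rewrite -sumh (sum_rest _ ne) h1 h2 addrA addNr add0r.
  have := hmax p; rewrite /h -/N.
  have : 0 <= (N - 2) * (g * s) by apply: mulr_ge0; [lra | apply: mulr_ge0 => //; exact: ltW].
  by lra.
have pos2 : x * \sum_(p | P p) tN p <= \sum_(p | P p) tN p * h p.
  rewrite mulr_sumr; apply: ler_sum => p Pp; rewrite mulrC.
  by apply: ler_wpM2l; [exact: htN | exact: hP].
have pos : x * \sum_(p | P p) tN p <= \sum_(p | P p) Np p * h p.
  apply: le_trans pos2 _; rewrite -subr_ge0 -sumrB.
  by under eq_bigr do rewrite -mulrBl.
have A1 : A i1 i1 = - (x + (1 + g) * s) by rewrite App h1; ring.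
have A22 : A i2 i2 = x - (1 + g) * s by rewrite App h2; ring.
(* Cauchy's inequality over the indices other than i1, where the diagonal of A sums to y = x + (1 +
   g) s, combined with n y >= 2 (n - 1) x from [nx]. *)
have nA : 4 * (N - 1) / N * x ^+ 2 <= \tr (A *m A).
  have c1 : #|(fun p => p != i1) : pred 'I_n|%:R = N - 1 :> R.
    rewrite /N -[n in RHS]card_ord -!sum1_card !natr_sum [in RHS](bigD1 i1) //=.
    by rewrite addrC addrK.
  have := cauchy_sum (fun p => p != i1) (fun p => A p p); rewrite c1.
  have e1 : \sum_(p | p != i1) A p p = x + (1 + g) * s.
    by have := trA; rewrite (bigD1 i1) //= A1; lra.
  rewrite e1; have -> : \sum_(p | p != i1) A p p ^+ 2 = \tr (A *m A) - (x + (1 + g) * s) ^+ 2.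
    by rewrite trA2 [in RHS](bigD1 i1) //= A1; ring.
  set t := \tr _; set y := x + _ => le.
  have yx : 2 * (N - 1) * x <= N * y by rewrite /y; lra.
  have le1 : N * y ^+ 2 <= (N - 1) * t by lra.
  have N1 : 0 < N - 1 by lra.
  have le2 : 4 * (N - 1) ^+ 2 * x ^+ 2 <= N ^+ 2 * y ^+ 2.
    have -> : 4 * (N - 1) ^+ 2 * x ^+ 2 = (2 * (N - 1) * x) ^+ 2 by ring.
    rewrite -exprMn; rewrite lerXn2r // ?nnegrE; last by apply: le_trans yx; rewrite !mulr_ge0 // ltW.
    by rewrite !mulr_ge0 // ltW.
  rewrite mulrAC ler_pdivrMr // -(ler_pM2l N1).
  apply: le_trans (_ : N ^+ 2 * y ^+ 2 <= _); first by move: le2; congr (_ <= _); ring.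
  by rewrite expr2 -mulrA [X in _ <= X](_ : _ = N * ((N - 1) * t)) ?ler_pM2l //; ring.
have E : ric (hamQ S + defect a b S) i1 i1 + ric (hamQ S + defect a b S) i2 i2
     + 2 * g / N * scal (hamQ S + defect a b S) =
   2 * \sum_(p | P p) Np p * h p - 8 * b * x ^+ 2 + 4 * beta * \tr (A *m A)
   + 4 * (1 + g) * (g + (N - 2) * b ^+ 2 * (1 + g)) * s ^+ 2.
  have ent (X Z W : 'M[R]_n) (c1 c2 c3 : R) i : (2 *: X + (c1 *: Z + c2 *: W + c3%:M)) i i =
    2 * X i i + (c1 * Z i i + c2 * W i i + c3).
    by rewrite !mxE eqxx mulr1n.
  rewrite scal_evolution // ricD ric_hamQ // ric_defect // !ent -/A -es !A2 A1 A22.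
  move: actS; set t1 := act _ _ _ _; set t2 := act _ _ _ _ => actS.
  have -> : t1 = \sum_(p | P p) Np p * h p + 2 * g ^+ 2 * s ^+ 2 - t2 by rewrite -actS; ring.
  clear actS pos.
  move: (\sum_(p | P p) Np p * h p) (\tr (A *m A)) t2 => u t t2'.
  rewrite /beta /ricbeta -/N; have ea' : a = (2 * b + (N - 2) * b ^+ 2) * (1 + g) / 2 by rewrite -ea; field.
  have mn' : 1 + 2 * (N - 1) * a != 0 by exact: mn.
  rewrite /coefm -/N; move: mn'; rewrite ea' => mn'; field.
  rewrite -/N Nn andbT; apply: contra_neq mn'; rewrite -/N => e.
  by rewrite -[RHS]e; field.
rewrite E; set v := \sum_(p | P p) Np p * h p in pos *; set c3 := 4 * (1 + g) * _ in hom *.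
set tt := \sum_(p | P p) tN p in pos h4 pos2; set t := \tr (A *m A) in nA *.
have W0 : 0 < om * (N * s) by rewrite !mulr_gt0.
set W := om * (N * s) in W0 h4.
have v1 : 4 * x ^+ 3 / W <= v.
  apply: le_trans pos; rewrite ler_pdivrMr //.
  have -> : x * tt * W = x * (W * tt) by ring.
  have -> : 4 * x ^+ 3 = x * (2 * x) ^+ 2 by ring.
  exact: ler_wpM2l.
have v2 : - (8 * b * x ^+ 2) + 4 * beta * t >= - (8 * rho * x ^+ 2).
  have le : 4 * beta * (4 * (N - 1) / N * x ^+ 2) <= 4 * beta * t.
    by apply: ler_wpM2l => //; rewrite mulr_ge0.
  have -> : 8 * rho * x ^+ 2 = 8 * b * x ^+ 2 - 4 * beta * (4 * (N - 1) / N * x ^+ 2).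
    by rewrite erho; field.
  by lra.
(* the cubic x^3 - rho W x^2 + 4/27 (rho W)^3 has a double root at 2 rho W / 3 *)
have v3 : - (32 / 27 * rho ^+ 3 * W ^+ 2) <= 8 * x ^+ 3 / W - 8 * rho * x ^+ 2.
  rewrite -subr_ge0.
  have -> : 8 * x ^+ 3 / W - 8 * rho * x ^+ 2 - - (32 / 27 * rho ^+ 3 * W ^+ 2) =
    8 / W * ((x - 2 / 3 * rho * W) ^+ 2 * (x + rho * W / 3)).
    by field; rewrite gt_eqF.
  have rW : 0 <= rho * W by rewrite mulr_ge0 // ltW.
  have xW : 0 <= x + rho * W / 3 by rewrite addr_ge0 // divr_ge0.
  by apply: mulr_ge0; [rewrite divr_ge0 // ltW | rewrite mulr_ge0 // sqr_ge0].
have v4 : 32 / 27 * rho ^+ 3 * W ^+ 2 < c3 * s ^+ 2.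
  have -> : 32 / 27 * rho ^+ 3 * W ^+ 2 = 32 / 27 * rho ^+ 3 * om ^+ 2 * N ^+ 2 * s ^+ 2.
    by rewrite /W; ring.
  by rewrite ltr_pM2r // exprn_gt0.
have e8 : 8 * x ^+ 3 / W = 2 * (4 * x ^+ 3 / W) by ring.
move: v1 v2 v3 v4; rewrite e8; lra.
Qed.
End SumEvolution.

(** * Orthonormal frames and the real spectral theorem *)

Section Frames.
Variable R : realType.

Definition dot n (x y : 'rV[R]_n) : R := (x *m y^T) 0 0.

Lemma dotE n (x y : 'rV[R]_n) : dot x y = \sum_i x 0 i * y 0 i.
Proof. by rewrite /dot mxE; apply: eq_bigr => i _; rewrite mxE. Qed.

Lemma dotC n (x y : 'rV[R]_n) : dot x y = dot y x.
Proof. by rewrite !dotE; apply: eq_bigr => i _; rewrite mulrC. Qed.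

Lemma dotDl n (x x' y : 'rV[R]_n) : dot (x + x') y = dot x y + dot x' y.
Proof. by rewrite /dot mulmxDl mxE. Qed.

Lemma dotZl n a (x y : 'rV[R]_n) : dot (a *: x) y = a * dot x y.
Proof. by rewrite /dot -scalemxAl mxE. Qed.

Lemma dotDr n (x x' y : 'rV[R]_n) : dot y (x + x') = dot y x + dot y x'.
Proof. by rewrite dotC dotDl !(dotC y). Qed.

Lemma dotZr n a (x y : 'rV[R]_n) : dot y (a *: x) = a * dot y x.
Proof. by rewrite dotC dotZl dotC. Qed.

Lemma dot_ge0 n (x : 'rV[R]_n) : 0 <= dot x x.
Proof. by rewrite dotE sumr_ge0 // => i _; rewrite -expr2 sqr_ge0. Qed.

Lemma dot_eq0 n (x : 'rV[R]_n) : (dot x x == 0) = (x == 0).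
Proof.
apply/eqP/eqP => [|->]; last by rewrite /dot mul0mx mxE.
rewrite dotE => /eqP; rewrite psumr_eq0; last by move=> i _; rewrite -expr2 sqr_ge0.
move=> /allP h; apply/rowP => i; rewrite mxE; apply/eqP.
by have := h i (mem_index_enum _); rewrite /= mulf_eq0 orbb.
Qed.

Lemma orthonormalP n (s : seq 'rV[R]_n) : orthonormal s <->
  forall i j, (i < size s)%N -> (j < size s)%N ->
   dot (nth 0 s i) (nth 0 s j) = (i == j)%:R.
Proof.
rewrite /orthonormal; split=> [/andP[/all_nthP al /(pairwiseP 0) pw] i j si sj|h].
  case: ltngtP => ij.
  - by apply/eqP; exact: pw.
  - by rewrite dotC; apply/eqP; exact: pw.
  - by rewrite ij; apply/eqP; exact: al.
apply/andP; split; first by apply/(all_nthP 0) => i si; rewrite -/(dot _ _) h // eqxx.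
by apply/(pairwiseP 0) => i j si sj ij; rewrite -/(dot _ _) h // (ltn_eqF ij).
Qed.

Lemma orthonormal_normalize n (x : 'rV[R]_n) : x != 0 ->
  dot ((Num.sqrt (dot x x))^-1 *: x) ((Num.sqrt (dot x x))^-1 *: x) = 1.
Proof.
move=> nx; have d0 : 0 < dot x x by rewrite lt_def dot_eq0 nx dot_ge0.
rewrite dotZl dotZr mulrA -expr2 exprVn sqr_sqrtr ?dot_ge0 //.
by rewrite mulVf // gt_eqF.
Qed.

Lemma orthonormal_extend n (s : seq 'rV[R]_n) : orthonormal s -> (size s < n)%N ->
  exists w, orthonormal (rcons s w).
Proof.
move=> /orthonormalP os sn; pose M := \matrix_(i < size s) nth 0 s i.
have /rowV0Pn[x /sub_kermxP xM nx] : kermx M^T != 0.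
  rewrite -mxrank_eq0 mxrank_ker -lt0n subn_gt0.
  exact: leq_ltn_trans (rank_leq_col _) sn.
have xs i : (i < size s)%N -> dot x (nth 0 s i) = 0.
  move=> si; have /matrixP/(_ 0 (Ordinal si)) := xM.
  rewrite mxE [RHS]mxE => e; rewrite dotE -[RHS]e; apply: eq_bigr => k _.
  by rewrite !mxE.
pose w := (Num.sqrt (dot x x))^-1 *: x; exists w.
apply/orthonormalP => i j; rewrite size_rcons !ltnS !nth_rcons => si sj.
move: si sj; rewrite leq_eqVlt => /predU1P[->|si]; rewrite leq_eqVlt => /predU1P[->|sj];
  rewrite ?ltnn ?eqxx ?si ?sj.
- exact: orthonormal_normalize.
- by rewrite dotZl xs // mulr0 gtn_eqF.
- by rewrite dotC dotZl xs // mulr0 ltn_eqF.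
- exact: os.
Qed.

Lemma orthonormal_complete n (s : seq 'rV[R]_n) : orthonormal s -> (size s <= n)%N ->
  exists t, orthonormal (s ++ t) /\ size (s ++ t) = n.
Proof.
move=> os; rewrite leq_eqVlt; have [k] := ubnP (n - size s).
elim: k s os => // k IH s os nk /predU1P[e|sn]; first by exists [::]; rewrite cats0.
have [w ow] := orthonormal_extend os sn.
have [||t [ot st]] := IH _ ow; first by rewrite size_rcons; lia.
  by rewrite size_rcons; case: ltngtP sn => //; lia.
by exists (w :: t); rewrite -cat_rcons.
Qed.

Lemma orth_of_seq n (s : seq 'rV[R]_n) : orthonormal s -> size s = n ->
  let O := \matrix_(i < n) nth 0 s i in O *m O^T = 1%:M.
Proof.
move=> /orthonormalP os sn O; apply/matrixP => i j.
rewrite [RHS]mxE -(os i j) ?sn // dotE mxE; apply: eq_bigr => k _.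
by rewrite !mxE.
Qed.

Lemma orthV n (O : 'M[R]_n) : O *m O^T = 1%:M -> O^T *m O = 1%:M.
Proof. exact: mulmx1C. Qed.

Lemma orth_dot n (O : 'M[R]_n) i j : O *m O^T = 1%:M -> dot (row i O) (row j O) = (i == j)%:R.
Proof.
move=> OO; have /matrixP/(_ i j) := OO; rewrite [RHS]mxE => <-.
by rewrite dotE mxE; apply: eq_bigr => k _; rewrite !mxE.
Qed.

(** A complex eigenvalue is real by symmetry, hence a root of the real characteristic polynomial,
    and so it has a real eigenvector. *)
Lemma symmetric_eigenvector n (E : 'M[R]_n) : E^T = E -> (0 < n)%N ->
  exists (a : R) (v : 'rV[R]_n), v *m E = a *: v /\ v != 0.
Proof.
move=> ET n0; pose EC := map_mx (real_complex R) E.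
have [a /eigenvalueP[v vE nv]] := eigenvalue_closed EC n0.
have cM (x y : R[i]) : (x * y)^* = x^* * y^* by rewrite rmorphM.
have hEC i j : (EC j i)^* = EC i j.
  rewrite !mxE; have -> : E j i = E i j by rewrite -{1}ET mxE.
  by apply/eqP; rewrite eq_complex /= oppr0 !eqxx.
have ar : a^* = a.
  have nv' : \sum_i v 0 i * (v 0 i)^* != 0.
    apply: contra nv; rewrite psumr_eq0; last by move=> i _; exact: mul_conjC_ge0.
    move=> /allP h; apply/eqP/rowP => i; rewrite mxE; apply/eqP.
    by have := h i (mem_index_enum _); rewrite /= mul_conjC_eq0.
  have e1 : \sum_j \sum_i v 0 i * EC i j * (v 0 j)^* = a * \sum_i v 0 i * (v 0 i)^*.
    rewrite mulr_sumr; apply: eq_bigr => j _; rewrite -mulr_suml mulrA.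
    by have /matrixP/(_ 0 j) := vE; rewrite mxE [X in _ = X -> _]mxE => ->.
  have e2 : (\sum_j \sum_i v 0 i * EC i j * (v 0 j)^*)^* = \sum_j \sum_i v 0 i * EC i j * (v 0 j)^*.
    rewrite rmorph_sum exchange_big; apply: eq_bigr => j _.
    rewrite rmorph_sum; apply: eq_bigr => i _ /=.
    by rewrite !cM conjCK hEC mulrC mulrA mulrAC [X in X * _]mulrC.
  have := e2; rewrite e1 cM rmorph_sum.
  have -> : \sum_i (v 0 i * (v 0 i)^*)^* = \sum_i v 0 i * (v 0 i)^*.
    by apply: eq_bigr => i _; rewrite cM conjCK mulrC.
  by move/(mulIf nv').
have [ra ea] : exists ra : R, a = real_complex R ra.
  move: ar; case: a {vE} => x y ar; exists x; apply/eqP; rewrite eq_complex /= eqxx /=.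
  by have := congr1 (@complex.Im R) ar => /= e; apply/eqP; lra.
have : root (char_poly EC) a.
  by rewrite -eigenvalue_root_char; apply/eigenvalueP; exists v.
rewrite ea /EC -map_char_poly fmorph_root -eigenvalue_root_char.
by move=> /eigenvalueP[w wE nw]; exists ra, w.
Qed.

Lemma real_spectral n (E : 'M[R]_n) : E^T = E ->
  exists O : 'M[R]_n, O *m O^T = 1%:M /\ forall i j, i != j -> rotm O E i j = 0.
Proof.
elim: n E => [|n IH] E ET; first by exists 1%:M; split=> [|[]//]; rewrite trmx1 mulmx1.
have [a [v [vE nv]]] := symmetric_eigenvector ET isT.
pose v1 := (Num.sqrt (dot v v))^-1 *: v.
have ov : orthonormal [:: v1].
  by apply/orthonormalP => -[|//] [|//] _ _; rewrite /= orthonormal_normalize.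
have [t [ot st]] := orthonormal_complete ov isT.
have OO := orth_of_seq ot st; set O := (\matrix_i _) in OO.
have r0 : row 0 O = v1 by rewrite rowK.
have v1E : v1 *m E = a *: v1 by rewrite -scalemxAl vE scalerA mulrC -scalerA.
pose G : 'M[R]_(1 + n) := rotm O E.
have GT : G^T = G by rewrite /G /rotm !trmx_mul trmxK ET mulmxA.
have G0 j : j != 0 -> G 0 j = 0.
  move=> nj; rewrite /G rotmE r0 v1E -scalemxAl mxE -r0.
  by have := orth_dot 0 j OO; rewrite /dot => ->; rewrite eq_sym (negPf nj) mulr0.
have GrT : (drsubmx G)^T = drsubmx G by rewrite trmx_drsub GT.
have [V [VV dV]] := IH _ GrT.
pose U : 'M[R]_(1 + n) := block_mx 1%:M 0 0 V.
have UU : U *m U^T = 1%:M.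
  rewrite /U tr_block_mx mulmx_block !trmx0 !mulmx0 !mul0mx !addr0 !add0r trmx1 mulmx1 VV.
  by rewrite -scalar_mx_block.
exists (U *m O); split; first by rewrite trmx_mul mulmxA -(mulmxA U) OO mulmx1.
have -> : rotm (U *m O) E = U *m G *m U^T by rewrite /rotm trmx_mul !mulmxA.
clearbody G.
have u0 : ursubmx G = 0.
  apply/matrixP => i j; rewrite !mxE ord1 [lshift _ _](_ : _ = 0); last exact/val_inj.
  exact: G0.
have d0 : dlsubmx G = 0 by rewrite -GT -trmx_ursub u0 trmx0.
rewrite -(submxK G) u0 d0 /U tr_block_mx !trmx0 trmx1 !mulmx_block.
rewrite !(mulmx0, mul0mx, mulmx1, mul1mx, addr0, add0r).
have key (i j : 'I_(1 + n)) : i != j ->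
    (block_mx (ulsubmx G) 0 0 (V *m drsubmx G *m V^T)) i j = 0.
  case: (split_ordP i) => i' ->; case: (split_ordP j) => j' -> nij.
  - by case/negP: nij; rewrite !ord1.
  - by rewrite block_mxEur mxE.
  - by rewrite block_mxEdl mxE.
  - rewrite block_mxEdr; apply: dV; apply/eqP => e.
    by case/eqP: nij; rewrite e.
exact: key.
Qed.

End Frames.

(** * Compact families of linear inequalities *)

Section Continuity.
Local Open Scope classical_set_scope.
Local Open Scope ring_scope.
Variables (R : realType) (P : topologicalType).

Lemma continuous_add (f g : P -> R) : continuous f -> continuous g ->
  continuous (fun p => f p + g p).
Proof. by move=> cf cg p; apply: cvgD; [exact: cf | exact: cg]. Qed.

Lemma continuous_mul (f g : P -> R) : continuous f -> continuous g ->
  continuous (fun p => f p * g p).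
Proof. by move=> cf cg p; apply: cvgM; [exact: cf | exact: cg]. Qed.

Lemma continuous_const (c : R) : continuous (fun _ : P => c).
Proof. by move=> p; exact: cvg_cst. Qed.

Lemma continuous_bigsum (I : finType) (Q : pred I) (f : I -> P -> R) :
  (forall i, continuous (f i)) -> continuous (fun p => \sum_(i | Q i) f i p).
Proof.
move=> cf; suff : forall s : seq I, continuous (fun p => \sum_(i <- s | Q i) f i p) by [].
elim=> [|i s IH].
  rewrite (_ : (fun p => _) = fun=> 0); first exact: continuous_const.
  by apply/funext => p; rewrite big_nil.
rewrite (_ : (fun p => _) = fun p => (if Q i then f i p else 0) + \sum_(j <- s | Q j) f j p).
  by apply: continuous_add => //; case: (Q i) => //; exact: continuous_const.
by apply/funext => p; rewrite big_cons; case: (Q i); rewrite ?add0r.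
Qed.

(** Only points with g <= 0 are at risk. They form a compact set on which f is positive, hence
    bounded away from zero. *)
Lemma compact_variation (K : set P) (f g : P -> R) :
  compact K -> continuous f -> continuous g ->
  (forall p, K p -> 0 <= f p) -> (forall p, K p -> f p = 0 -> 0 < g p) ->
  exists2 t0, 0 < t0 & forall t, 0 < t -> t <= t0 -> forall p, K p -> 0 < f p + t * g p.
Proof.
move=> cK cf cg f0 g0; pose Z := K `&` [set p | g p <= 0].
have cZ : compact Z.
  by apply: compact_closedI => //; exact: (closed_comp (fun x _ => cg x) (@closed_le R 0)).
have [Z0|/set0P/negP] := pselect (Z !=set0); last first.
  rewrite negbK => /eqP Ze; exists 1 => // t t0 _ p Kp.
  have gp : 0 < g p.
    rewrite ltNge; apply/negP => gp; have : Z p by split.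
    by rewrite Ze.
  by apply: ltr_wpDl; [exact: f0 | exact: mulr_gt0].
have [c /set_mem[Kc gc] mf] := compact_EVT_min Z0 cZ (continuous_subspaceT cf).
have [d /set_mem[Kd gd] mg] := compact_EVT_min Z0 cZ (continuous_subspaceT cg).
have fc : 0 < f c.
  by rewrite lt_def f0 // andbT; apply/eqP => e; have := g0 c Kc e; rewrite ltNge gc.
have pd : 0 < 1 - g d by move: gd => /=; lra.
exists (f c / (1 - g d)); first exact: divr_gt0.
move=> t t0; rewrite ler_pdivlMr // => le p Kp.
have [gp|gp] := ltP 0 (g p).
  by apply: ltr_wpDl; [exact: f0 | exact: mulr_gt0].
have Zp : p \in Z by rewrite inE; split.
have := mf p Zp; have := mg p Zp => l1 l2.
have : t * g d <= t * g p by rewrite ler_pM2l.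
by lra.
Qed.

Lemma compact_pos_lower (K : set P) (f : P -> R) : compact K -> continuous f ->
  (forall p, K p -> 0 < f p) -> exists2 d, 0 < d & forall p, K p -> d <= f p.
Proof.
move=> cK cf f0; have [K0|/set0P/negP] := pselect (K !=set0); last first.
  by rewrite negbK => /eqP Ke; exists 1 => // p; rewrite Ke.
have [c /set_mem Kc mf] := compact_EVT_min K0 cK (continuous_subspaceT cf).
by exists (f c); [exact: f0 | move=> p Kp; apply: mf; rewrite inE].
Qed.

Lemma compact_upper (K : set P) (f : P -> R) : compact K -> continuous f ->
  exists2 d, 0 <= d & forall p, K p -> `|f p| <= d.
Proof.
move=> cK cf; have [K0|/set0P/negP] := pselect (K !=set0); last first.
  by rewrite negbK => /eqP Ke; exists 0 => // p; rewrite Ke.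
have cn : continuous (fun p => `|f p|).
  by move=> p; apply: (@cvg_norm _ R); exact: cf.
have [c /set_mem Kc mf] := compact_EVT_max K0 cK (continuous_subspaceT cn).
by exists `|f c| => // p Kp; apply: mf; rewrite inE.
Qed.
End Continuity.

Section MatrixBoxes.
Local Open Scope classical_set_scope.
Local Open Scope ring_scope.
Variables (R : realType) (a b : nat).

Lemma box_compact (c : 'M[R]_(a, b)) (r : R) :
  compact [set X : 'M[R]_(a, b) | forall i j, `|X i j - c i j| <= r].
Proof.
pose A (k : 'I_(a * b)) := [set` `[mxvec c 0 k - r, mxvec c 0 k + r]] : set R.
have cA : compact [set v : 'rV[R]_(a * b) | forall k, A k (v ord0 k)].
  by apply: rV_compact => k; exact: segment_compact.
have -> : [set X : 'M[R]_(a, b) | forall i j, `|X i j - c i j| <= r] =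
    vec_mx @` [set v : 'rV[R]_(a * b) | forall k, A k (v ord0 k)].
  apply/seteqP; split => [X /= hX|X /= [v hv <-] i j].
    exists (mxvec X); last by rewrite mxvecK.
    move=> k; case/mxvec_indexP: k => i j; rewrite /A /= mxvecE in_itv /=.
    by have := hX i j; rewrite ler_distl mxvecE.
  have := hv (mxvec_index i j); rewrite /A /= in_itv /= mxvecE => h.
  by rewrite ler_distl mxE.
apply: continuous_compact => //; apply: continuous_subspaceT => v.
move=> B /= [Q hQ QB]; have hQ' i j : nbhs (v 0 (mxvec_index i j)) (Q i j).
  by have := hQ i j; rewrite mxE.
exists (fun _ k => \bigcap_(ij in [set ij | mxvec_index ij.1 ij.2 = k]) Q ij.1 ij.2).
  move=> i0 k; case/mxvec_indexP: k => i j; rewrite ord1.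
  apply: filterS (hQ' i j) => y Qy [i' j'] /= /eqP; rewrite /=.
  move=> /eqP/(f_equal (@enum_val _ _ \o cast_ord (esym (mxvec_cast a b)))).
  by rewrite /= /mxvec_index !cast_ordK !enum_rankK => -[-> ->].
move=> w hw; apply: QB => i j; rewrite mxE.
exact: (hw 0 (mxvec_index i j) (i, j)).
Qed.

End MatrixBoxes.

Section LinearFunctionals.
Local Open Scope classical_set_scope.
Local Open Scope ring_scope.
Variables (R : realType) (n : nat).
Notation W := (tensor R n).

(** Linearity in the pair (X, T), as a function on the product space; a product of a form in X and a
    form in T is excluded. *)
Definition bilinear_form (f : W -> W -> R) :=
  forall (c : R) X T X' T', f (c *: X + X') (c *: T + T') = c * f X T + f X' T'.

Lemma form0 f : bilinear_form f -> f 0 0 = 0.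
Proof. by move=> lf; have := lf 1 0 0 0 0; rewrite scaler0 addr0 mul1r => e; lra. Qed.

Lemma formD f X T X' T' : bilinear_form f -> f (X + X') (T + T') = f X T + f X' T'.
Proof. by move=> lf; have := lf 1 X T X' T'; rewrite !scale1r mul1r. Qed.

Lemma formZ f c X T : bilinear_form f -> f (c *: X) (c *: T) = c * f X T.
Proof. by move=> lf; have := lf c X T 0 0; rewrite !addr0 form0 // addr0. Qed.

Lemma form_split f X T : bilinear_form f -> f X T =
  \sum_i \sum_j X i j * f (delta_mx i j) 0 + \sum_i \sum_j T i j * f 0 (delta_mx i j).
Proof.
move=> lf; have m0 := form0 lf.
have mX : {morph f^~ 0 : x y / x + y >-> x + y} by move=> x y; rewrite -formD // addr0.
have mT : {morph f 0 : x y / x + y >-> x + y} by move=> x y; rewrite -formD // addr0.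
rewrite -{1}[X]addr0 -{1}[T]add0r formD //; congr (_ + _).
  rewrite {1}(matrix_sum_delta X) (big_morph (f^~ 0) mX m0); apply: eq_bigr => i _.
  rewrite (big_morph (f^~ 0) mX m0); apply: eq_bigr => j _.
  by rewrite -formZ // scaler0.
rewrite {1}(matrix_sum_delta T) (big_morph (f 0) mT m0); apply: eq_bigr => i _.
rewrite (big_morph (f 0) mT m0); apply: eq_bigr => j _.
by rewrite -formZ // scaler0.
Qed.

Lemma form_continuous f : bilinear_form f -> continuous (fun XT : W * W => f XT.1 XT.2).
Proof.
move=> lf; rewrite (_ : (fun XT => _) = fun XT : W * W =>
  \sum_i \sum_j XT.1 i j * f (delta_mx i j) 0 + \sum_i \sum_j XT.2 i j * f 0 (delta_mx i j)).
  have c1 i j : continuous (fun XT : W * W => XT.1 i j).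
    move=> XT; apply: (@continuous_comp _ _ _ fst (fun M : W => M i j)).
      exact: cvg_fst.
    exact: coord_continuous.
  have c2 i j : continuous (fun XT : W * W => XT.2 i j).
    move=> XT; apply: (@continuous_comp _ _ _ snd (fun M : W => M i j)).
      exact: cvg_snd.
    exact: coord_continuous.
  by apply: continuous_add; apply: continuous_bigsum => i; apply: continuous_bigsum => j;
    apply: continuous_mul => //; exact: continuous_const.
by apply/funext => XT; rewrite -form_split.
Qed.

Lemma closed_form_ge0 f : bilinear_form f -> closed [set XT : W * W | 0 <= f XT.1 XT.2].
Proof.
move=> lf; exact: (closed_comp (fun x _ => @form_continuous f lf x) (@closed_ge R 0)).
Qed.

Lemma closed_form_eq0 f : bilinear_form f -> closed [set XT : W * W | f XT.1 XT.2 = 0].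
Proof.
move=> lf; exact: (closed_comp (fun x _ => @form_continuous f lf x) (@closed_eq R 0)).
Qed.

Lemma closed_S2so : closed [set XT : W * W | S2so XT.2].
Proof.
have -> : [set XT : W * W | S2so XT.2] =
  \bigcap_(q : 'I_n * 'I_n * 'I_n * 'I_n)
   ([set XT : W * W | coord4 XT.2 q.1.1.1 q.1.1.2 q.1.2 q.2 + coord4 XT.2 q.1.1.2 q.1.1.1 q.1.2 q.2 = 0]
   `&` [set XT : W * W | coord4 XT.2 q.1.1.1 q.1.1.2 q.1.2 q.2 + coord4 XT.2 q.1.1.1 q.1.1.2 q.2 q.1.2 = 0]
   `&` [set XT : W * W | coord4 XT.2 q.1.1.1 q.1.1.2 q.1.2 q.2 - coord4 XT.2 q.1.2 q.2 q.1.1.1 q.1.1.2 = 0]).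
  apply/seteqP; split => [XT hT [[[i j] k] l] _ /=|XT hT i j k l].
    by case: (hT i j k l) => e1 e2 e3; split; first split; move=> /=; lra.
  have [[/= e1 e2] e3] := hT (i, j, k, l) I.
  by split; [apply/eqP; rewrite -addr_eq0 e1 | apply/eqP; rewrite -addr_eq0 e2
    | apply/eqP; rewrite -subr_eq0 e3].
apply: closed_bigI => q _; apply: closedI; first apply: closedI.
- apply: (@closed_form_eq0 (fun _ T => coord4 T q.1.1.1 q.1.1.2 q.1.2 q.2 + coord4 T q.1.1.2 q.1.1.1 q.1.2 q.2)).
  by move=> c X T X' T'; rewrite !coord4E; ring.
- apply: (@closed_form_eq0 (fun _ T => coord4 T q.1.1.1 q.1.1.2 q.1.2 q.2 + coord4 T q.1.1.1 q.1.1.2 q.2 q.1.2)).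
  by move=> c X T X' T'; rewrite !coord4E; ring.
- apply: (@closed_form_eq0 (fun _ T => coord4 T q.1.1.1 q.1.1.2 q.1.2 q.2 - coord4 T q.1.2 q.2 q.1.1.1 q.1.1.2)).
  by move=> c X T X' T'; rewrite !coord4E; ring.
Qed.

Lemma closed_CB : closed [set XT : W * W | CB XT.1].
Proof.
have swap : continuous (fun XT : W * W => (XT.2, XT.1)).
  exact: swap_continuous.
have -> : [set XT : W * W | CB XT.1] = [set XT | S2so XT.1] `&`
  \bigcap_(q : 'I_n * 'I_n * 'I_n * 'I_n)
   [set XT : W * W | coord4 XT.1 q.1.1.1 q.1.1.2 q.1.2 q.2
     + coord4 XT.1 q.1.1.2 q.1.2 q.1.1.1 q.2 + coord4 XT.1 q.1.2 q.1.1.1 q.1.1.2 q.2 = 0].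
  apply/seteqP; split => [XT [h1 h2]|XT [h1 h2]]; split=> //.
    by move=> [[[i j] k] l] _ /=; exact: h2.
  by move=> i j k l; exact: (h2 (i, j, k, l) I).
apply: closedI; first exact: (closed_comp (fun x _ => swap x) closed_S2so).
apply: closed_bigI => q _.
apply: (@closed_form_eq0 (fun X _ => coord4 X q.1.1.1 q.1.1.2 q.1.2 q.2
     + coord4 X q.1.1.2 q.1.2 q.1.1.1 q.2 + coord4 X q.1.2 q.1.1.1 q.1.1.2 q.2)).
by move=> c X T X' T'; rewrite !coord4E; ring.
Qed.

Lemma S2so_comb c (T T' : W) : S2so T -> S2so T' -> S2so (c *: T + T').
Proof.
move=> h h' i j k l; rewrite !coord4E.
by case: (h i j k l) => e1 e2 e3; case: (h' i j k l) => f1 f2 f3; split;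
  [rewrite e1 f1; ring | rewrite e2 f2; ring | rewrite e3 f3].
Qed.

Lemma CB_comb c (T T' : W) : CB T -> CB T' -> CB (c *: T + T').
Proof. by move=> h h'; apply: CBD => //; exact: CBZ. Qed.

End LinearFunctionals.

(** The witness, the inverse of one plus a sum of inverses, also covers the empty family. *)
Lemma finite_pos_lower (R : realType) (N : nat) (f : 'I_N -> R) : (forall i, 0 < f i) ->
  exists2 t, 0 < t & forall i, t <= f i.
Proof.
move=> f0; have s0 : 0 < 1 + \sum_i (f i)^-1.
  by rewrite ltr_pwDl // sumr_ge0 // => i _; rewrite invr_ge0 ltW.
exists (1 + \sum_i (f i)^-1)^-1; first by rewrite invr_gt0.
move=> i; rewrite -[X in _ <= X]invrK lef_pV2 ?posrE ?invr_gt0 //.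
rewrite (bigD1 i) //= addrCA lerDl addr_ge0 // sumr_ge0 // => j _.
by rewrite invr_ge0 ltW.
Qed.

Section ParametrizedCone.
Local Open Scope classical_set_scope.
Local Open Scope ring_scope.
Variables (R : realType) (n N : nat) (P : topologicalType).
Notation W := (tensor R n).
Variables (K : 'I_N -> set P) (F : 'I_N -> P -> W -> W -> R).
Hypothesis compactK : forall i, compact (K i).
Hypothesis linF : forall i p, bilinear_form (F i p).
Hypothesis contF : forall i X T, continuous (fun p => F i p X T).

Definition family X T := forall i p, K i p -> 0 <= F i p X T.
Definition pcone : set W := [set X | CB X /\ exists T, S2so T /\ family X T].

Variable C : R.
Hypothesis C0 : 0 <= C.
Hypothesis boundT : forall X T, CB X -> S2so T -> family X T ->
  forall i j, `|T i j| <= C * \sum_k \sum_l `|X k l|.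

Lemma pcone_convex c d X Y : 0 <= c -> 0 <= d -> pcone X -> pcone Y -> pcone (c *: X + d *: Y).
Proof.
move=> c0 d0 [cX [T [hT fT]]] [cY [T' [hT' fT']]]; split.
  by apply: CBD; exact: CBZ.
exists (c *: T + d *: T'); split.
  apply: S2so_comb => //; rewrite -[_ *: T']addr0; apply: S2so_comb => //.
  by move=> i j k l; rewrite !coord40 oppr0.
move=> i p Kp; rewrite formD // !formZ //.
by apply: addr_ge0; apply: mulr_ge0 => //; [exact: fT | exact: fT'].
Qed.

Lemma pcone0 : pcone 0.
Proof.
have S0 : S2so (0 : W) by move=> i j k l; rewrite !coord40 oppr0.
split; first by split=> // i j k l; rewrite !coord40 !addr0.
by exists 0; split=> // i p _; rewrite form0.
Qed.

(** The cone is the projection of a closed set along T. Over a box around X0 the bound [boundT]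
    confines T to a compact box, so this piece of the cone is a continuous image of a compact
    set. *)
Lemma pcone_closed : closed pcone.
Proof.
move=> X0 clX; pose B := [set X : W | forall i j, `|X i j - X0 i j| <= 1].
pose M := C * \sum_k \sum_l (`|X0 k l| + 1).
pose BT := [set T : W | forall i j, `|T i j - (0 : W) i j| <= M].
pose Z := [set XT : W * W | [/\ CB XT.1, S2so XT.2 & family XT.1 XT.2]].
have cZ : closed Z.
  have -> : Z = [set XT | CB XT.1] `&` [set XT | S2so XT.2] `&`
     \bigcap_i \bigcap_(p in K i) [set XT : W * W | 0 <= F i p XT.1 XT.2].
    apply/seteqP; split => [XT [h1 h2 h3]|XT [[h1 h2] h3]].
      by split=> // i _ p Kp; exact: h3.
    by split=> // i p Kp; exact: h3.
  apply: closedI; first by apply: closedI; [exact: closed_CB | exact: closed_S2so].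
  by apply: closed_bigI => i _; apply: closed_bigI => p _; exact: closed_form_ge0.
have compZ : compact ((B `*` BT) `&` Z).
  by apply: compact_closedI => //; apply: compact_setX; exact: box_compact.
have cim : compact (fst @` ((B `*` BT) `&` Z)).
  apply: continuous_compact => //; apply: continuous_subspaceT => XT; exact: cvg_fst.
have im : fst @` ((B `*` BT) `&` Z) = pcone `&` B.
  apply/seteqP; split => [X [[Y T] /= [[BY _] [h1 h2 h3]] <-]|X [[cX [T [hT fT]]] BX]].
    by split=> //; split=> //; exists T.
  exists (X, T) => //; split=> //; split=> //= i j; rewrite mxE subr0.
  apply: le_trans (boundT cX hT fT i j) _; apply: ler_wpM2l => //.
  apply: ler_sum => k _; apply: ler_sum => l _.
  have := BX k l; have := ler_normD (X k l - X0 k l) (X0 k l); rewrite subrK; lra.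
have hW : hausdorff_space W.
  move=> X Y clXY; apply/matrixP => i j; apply: Rhausdorff => U V nU nV.
  by have [Z' [ZU ZV]] := clXY _ _ (coord_continuous nU) (coord_continuous nV); exists (Z' i j).
have cl : closed (pcone `&` B) by rewrite -im; exact: compact_closed.
suff : (pcone `&` B) X0 by case.
apply: cl => A nA; have nB : nbhs X0 B.
  exists (fun i j => [set x : R | `|x - X0 i j| <= 1]) => // i j.
  apply/nbhs_ballP; exists 1 => //= y; rewrite /ball /= distrC => /ltW //.
have [Y [pY [AY BY]]] := clX _ (filterI nA nB).
by exists Y.
Qed.

Lemma pcone_closed_convex_cone : closed_convex_cone pcone.
Proof.
split; [exact: pcone_closed| |exact: pcone0|].
  move=> x y l; rewrite !inE => px py.
  by apply: pcone_convex => //; rewrite /unstable.onem subr_ge0 le1.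
move=> t x t0 px; rewrite -[t *: x]addr0 -[0](scale0r (0 : W)).
by apply: pcone_convex => //; exact: pcone0.
Qed.

(** X' is perturbed within CB while T' is kept. At a suitable time t all functions are at least some
    d > 0, and moving X' by e changes them by at most t M n^4 e; hence X + t Y stays in the cone for
    all Y near X'. *)
Lemma pcone_transversal X T X' T' : CB X -> S2so T -> family X T -> CB X' -> S2so T' ->
  (forall i p, K i p -> F i p X T = 0 -> 0 < F i p X' T') ->
  (tangent_cone pcone X : set (subspace (@CB R n)))^° X'.
Proof.
move=> cX hT fT cX' hT' pos.
have [t t0 ht] : exists2 t, 0 < t & forall i p, K i p -> 0 < F i p X T + t * F i p X' T'.
  have ex i : exists2 t0, 0 < t0 & forall t, 0 < t -> t <= t0 -> forall p, K i p ->
      0 < F i p X T + t * F i p X' T'.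
    apply: compact_variation => //; [exact: fT | by move=> p Kp; apply: pos].
  pose tf i := projT1 (cid2 (ex i)).
  have tf0 i : 0 < tf i by rewrite /tf; case: cid2.
  have tfP i : forall t, 0 < t -> t <= tf i -> forall p, K i p ->
      0 < F i p X T + t * F i p X' T' by rewrite /tf; case: cid2.
  have [t t0 tle] := finite_pos_lower tf0; exists t => // i p Kp.
  exact: tfP.
pose G i p := F i p X T + t * F i p X' T'.
have cG i : continuous (G i).
  by apply: continuous_add => //; apply: continuous_mul => //; exact: continuous_const.
have [d d0 hd] : exists2 d, 0 < d & forall i p, K i p -> d <= G i p.
  have ex i := @compact_pos_lower _ _ (K i) (G i) (@compactK i) (@cG i) (ht i).
  pose df i := projT1 (cid2 (ex i)).
  have df0 i : 0 < df i by rewrite /df; case: cid2.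
  have dfP i : forall p, K i p -> df i <= G i p by rewrite /df; case: cid2.
  have [d d0 dle] := finite_pos_lower df0; exists d => // i p Kp.
  exact: le_trans (dfP i p Kp).
have [M M0 hM] : exists2 M, 0 <= M & forall i p k l, K i p -> `|F i p (delta_mx k l) 0| <= M.
  have ex i k l := compact_upper (@compactK i) (@contF i (delta_mx k l) 0).
  pose mf i k l := projT1 (cid2 (ex i k l)).
  have mf0 i k l : 0 <= mf i k l by rewrite /mf; case: cid2.
  have mfP i k l : forall p, K i p -> `|F i p (delta_mx k l) 0| <= mf i k l.
    by rewrite /mf; case: cid2.
  exists (\sum_i \sum_k \sum_l mf i k l).
    by do 3 (apply: sumr_ge0 => ? _).
  move=> i p k l Kp; apply: le_trans (mfP i k l p Kp) _.
  rewrite (bigD1 i) //= (bigD1 k) //= (bigD1 l) //= -!addrA lerDl.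
  by rewrite !addr_ge0 // ?sumr_ge0 // => ? _; do ?(apply: sumr_ge0 => ? _).
pose e := d / (t * (M + 1) * (n * n)%:R ^+ 2 + 1).
have den : 0 < t * (M + 1) * (n * n)%:R ^+ 2 + 1.
  have M1 : 0 <= M + 1 by rewrite addr_ge0.
  apply: ltr_wpDl => //; apply: mulr_ge0; last by rewrite exprn_ge0.
  by apply: mulr_ge0 => //; exact: ltW.
have e0 : 0 < e by exact: divr_gt0.
change (nbhs_subspace (X' : subspace (@CB R n)) (tangent_cone pcone X)).
rewrite -nbhs_subspace_in //.
have nb : nbhs X' [set Y : W | forall i j, `|Y i j - X' i j| <= e].
  exists (fun i j => [set x : R | `|x - X' i j| <= e]) => // i j.
  by apply/nbhs_ballP; exists e => //= y; rewrite /ball /= distrC => /ltW.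
apply: filterS nb => Y hY cY; apply: subset_closure.
exists t^-1, (t *: Y + X); split.
- by rewrite invr_ge0 ltW.
- split; first exact: CB_comb.
  exists (t *: T' + T); split; first exact: S2so_comb.
  move=> i p Kp.
  have -> : t *: Y + X = t *: (Y - X') + (t *: X' + X) by rewrite scalerBr addrA subrK.
  have -> : t *: T' + T = t *: (0 : W) + (t *: T' + T) by rewrite scaler0 add0r.
  rewrite linF linF [t * F i p X' T' + _]addrC -/(G i p) .
  have hF : `|F i p (Y - X') 0| <= M * (n * n)%:R ^+ 2 * e.
    rewrite form_split // [X in _ + X]big1 ?addr0; last first.
      by move=> k _; rewrite big1 // => l _; rewrite mxE mul0r.
    apply: le_trans (ler_norm_sum _ _ _) _.
    have -> : M * (n * n)%:R ^+ 2 * e = \sum_(k < n * n) \sum_(l < n * n) (M * e).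
      by rewrite !sumr_const !card_ord -mulrnA -[RHS]mulr_natr natrM; ring.
    apply: ler_sum => k _; apply: le_trans (ler_norm_sum _ _ _) _.
    apply: ler_sum => l _; rewrite normrM mulrC; apply: ler_pM => //; first exact: hM.
    by have := hY k l; rewrite !mxE.
  have : t * (M * (n * n)%:R ^+ 2 * e) <= d.
    have t2 : 0 <= t * (n * n)%:R ^+ 2 by rewrite mulr_ge0 ?exprn_ge0 // ltW.
    rewrite (_ : _ * _ = t * (M * (n * n)%:R ^+ 2) * d / (t * (M + 1) * (n * n)%:R ^+ 2 + 1)).
      rewrite ler_pdivrMr // [X in _ <= X]mulrC ler_pM2r //.
      have -> : t * (M + 1) * (n * n)%:R ^+ 2 + 1 =
         t * (M * (n * n)%:R ^+ 2) + (t * (n * n)%:R ^+ 2 + 1) by ring.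
      by rewrite lerDl addr_ge0.
    by rewrite /e; ring.
  have := hd i p Kp; have : - (t * (M * (n * n)%:R ^+ 2 * e)) <= t * F i p (Y - X') 0.
    rewrite -mulrN ler_pM2l // lerNl; apply: le_trans hF.
    by rewrite -normrN ler_norm.
  lra.
- by rewrite addrK scalerA mulVf ?scale1r // gt_eqF.
Qed.

End ParametrizedCone.

(** * Isotropic curvature of tensors in orthonormal frames *)

Section FramesAndTensors.
Variables (R : realType) (n : nat).
Implicit Types (S T U V : tensor R n) (x y z w : 'rV[R]_n).

Lemma frame_of (s : seq 'rV[R]_n) : orthonormal s -> (size s <= n)%N ->
  exists2 O : 'M[R]_n, O *m O^T = 1%:M & forall i : 'I_n, (i < size s)%N -> row i O = nth 0 s i.
Proof.
move=> os sn; have [t [ot st]] := orthonormal_complete os sn.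
exists (\matrix_(i < n) nth 0 (s ++ t) i); first exact: orth_of_seq.
by move=> i si; rewrite rowK nth_cat si.
Qed.

Definition forms S (p q : 'I_n * 'I_n) : R := coord4 S p.1 p.2 q.1 q.2.

Lemma forms_alt S : S2so S -> ralt4 (forms S).
Proof.
by move=> h; split=> -[i j] [k l]; rewrite /forms /=; [case: (h j i k l)|case: (h i j k l)].
Qed.

Lemma ev_rb S x y z w : ev S x y z w = rb (forms S) (rt (x 0) (y 0)) (rt (z 0) (w 0)).
Proof.
rewrite /ev /rb sum_pair; do 2 (apply: eq_bigr => ? _); rewrite sum_pair.
by do 2 (apply: eq_bigr => ? _); rewrite /forms /rt /=; ring.
Qed.

Definition picv S x y z w : R :=
  ev S x z x z + ev S x w x w + ev S y z y z + ev S y w y w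
  + 2 * ev S x z w y + 2 * ev S x w y z.

Lemma ev_antir S x y z w : S2so S -> ev S x y w z = - ev S x y z w.
Proof.
move=> h; rewrite /ev -sumrN; apply: eq_bigr => i _; rewrite -sumrN; apply: eq_bigr => j _.
rewrite exchange_big -sumrN; apply: eq_bigr => k _; rewrite -sumrN; apply: eq_bigr => l _.
by case: (h i j k l) => _ -> _; ring.
Qed.

Lemma picR_forms S x y z w : S2so S ->
  picR (forms S) (x 0) (y 0) (z 0) (w 0) = picv S x y z w.
Proof.
move=> h; have ha := forms_alt h.
have E (f g k : 'I_n * 'I_n -> R) (e : R) : e = 1 \/ e = -1 -> (forall p, k p = f p + e * g p) ->
    qf (forms S) k = qf (forms S) f + 2 * e * rb (forms S) f g + qf (forms S) g.
  move=> he ek; have -> : qf (forms S) k = qf (forms S) (fun p => 1 * f p + e * g p).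
    by apply: eq_rb => p; rewrite ek mul1r.
  rewrite qf_lin //; set A := qf _ f; set B := rb _ f g; set D := qf _ g.
  by case: he => ->; ring.
rewrite /picR [X in _ + X](E (rt (x 0) (w 0)) (rt (y 0) (z 0)) _ 1); [|by left|by move=> p; rewrite mul1r].
rewrite [X in X + _](E (rt (x 0) (z 0)) (rt (y 0) (w 0)) _ (-1)); [|by right|by move=> p; rewrite mulN1r].
rewrite /qf -!ev_rb /picv (ev_antir x z y w) //; ring.
Qed.

Lemma rdot_dot x y : rdot (x 0) (y 0) = dot x y.
Proof. by rewrite dotE. Qed.

Lemma ortho4_orthonormal x y z w :
  orthonormal [:: x; y; z; w] <-> ortho4 (x 0) (y 0) (z 0) (w 0).
Proof.
rewrite /orthonormal /ortho4 !rdot_dot /dot /= !andbT; split.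
  move=> /andP[/and4P[/eqP-> /eqP-> /eqP-> /eqP->]].
  by move=> /and3P[/and3P[/eqP-> /eqP-> /eqP->] /andP[/eqP-> /eqP->] /eqP->].
by move=> [[-> -> -> ->] [-> -> ->] [-> -> ->]]; rewrite !eqxx.
Qed.

Lemma PIC_picv S x y z w : PIC S -> ortho4 (x 0) (y 0) (z 0) (w 0) -> 0 <= picv S x y z w.
Proof. by move=> pS /ortho4_orthonormal; exact: pS. Qed.

Lemma rdot_row (a b : 'I_n -> R) : rdot ((\row_i a i) 0) ((\row_i b i) 0) = rdot a b.
Proof. by apply: eq_bigr => i _; rewrite !mxE. Qed.

Lemma PIC_forms S : S2so S -> PIC S -> forall a b c d, ortho4 a b c d -> 0 <= picR (forms S) a b c d.
Proof.
move=> h pS a b c d o4.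
have -> : picR (forms S) a b c d =
  picR (forms S) ((\row_i a i) 0) ((\row_i b i) 0) ((\row_i c i) 0) ((\row_i d i) 0).
  by congr (_ + _); apply: eq_rb => p; rewrite /rt !mxE.
rewrite picR_forms //; apply: PIC_picv => //.
by move: o4; rewrite /ortho4 !rdot_row.
Qed.

Lemma nonneg_forms T : nonneg_def T <->
  (forall g, (forall p, g (tw p) = - g p) -> 0 <= qf (forms T) g).
Proof.
have E (phi : 'M[R]_n) : \sum_(i < n) \sum_(j < n) \sum_(k < n) \sum_(l < n)
    coord4 T i j k l * phi i j * phi k l = qf (forms T) (fun p => phi p.1 p.2).
  rewrite /qf /rb sum_pair; do 2 (apply: eq_bigr => ? _); rewrite sum_pair.
  by do 2 (apply: eq_bigr => ? _); rewrite /forms /rt /=; ring.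
split=> h.
  move=> g ga; have := h (\matrix_(i, j) g (i, j)); rewrite E.
  have -> : qf (forms T) (fun p => (\matrix_(i, j) g (i, j)) p.1 p.2) = qf (forms T) g.
    by apply: eq_rb => -[i j]; rewrite mxE.
  by apply; apply/matrixP => i j; rewrite !mxE; exact: (ga (i, j)).
move=> phi ph; rewrite E; apply: h => -[i j] /=.
by have /matrixP/(_ i j) := ph; rewrite !mxE.
Qed.

Lemma forms_sharp S T p q : forms (sharp2 S T) p q = rsharp (forms S) (forms T) p q.
Proof. by rewrite /forms coord4_sharp2. Qed.

Lemma eq_picR (u u' : 'I_n * 'I_n -> 'I_n * 'I_n -> R) a b c d :
  (forall p q, u p q = u' p q) -> picR u a b c d = picR u' a b c d.
Proof. by move=> e; congr (_ + _); do 2 (apply: eq_bigr => ? _); rewrite e. Qed.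

Definition PICat S x y z w := nonneg_def S \/ (PIC S /\ picv S x y z w = 0).

(* Wilking's argument: the sharp product keeps the isotropic curvature
   nonnegative at a zero. *)
Lemma picv_sharp S T x y z w : S2so S -> S2so T -> orthonormal [:: x; y; z; w] ->
  PICat S x y z w -> PICat T x y z w -> S2so (sharp2 S T) ->
  0 <= picv (sharp2 S T) x y z w.
Proof.
move=> hS hT /ortho4_orthonormal o4 pS pT hST.
have [k0 _] : exists k0 : 'I_n, True.
  case: (pickP (fun _ : 'I_n => true)) => [k0 _|e]; first by exists k0.
  case: o4 => -[]; rewrite /rdot big1 => [/eqP|i]; first by rewrite eq_sym oner_eq0.
  by have := e i.
have near U : S2so U -> PICat U x y z w -> near_pos k0 (forms U) (x 0) (y 0) (z 0) (w 0).
  move=> hU [/nonneg_forms|[pU e]]; [by left|right]; split.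
    by move=> a b c d h4 _ _ _ _; exact: PIC_forms.
  by rewrite picR_forms.
rewrite -picR_forms // (eq_picR _ _ _ _ (forms_sharp S T)).
by apply: (picR_sharp (o := k0)) => //; [exact: forms_alt|exact: forms_alt|exact: near|exact: near].
Qed.

Lemma nonneg_sharp S T : S2so S -> S2so T -> nonneg_def S -> nonneg_def T ->
  nonneg_def (sharp2 S T).
Proof.
move=> hS hT /nonneg_forms pS /nonneg_forms pT; apply/nonneg_forms => g ga.
have -> : qf (forms (sharp2 S T)) g = qf (rsharp (forms S) (forms T)) g.
  by do 2 (apply: eq_bigr => ? _); rewrite forms_sharp.
by apply: qf_sharp => //; exact: forms_alt.
Qed.

Lemma S2so_square S : S2so S -> S2so (square S).
Proof.
move=> h i j k l; rewrite !coord4_square; split.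
- by rewrite -sumrN; apply: eq_bigr => p _; rewrite -sumrN; apply: eq_bigr => q _; case: (h i j p q) => -> _ _; ring.
- by rewrite -sumrN; apply: eq_bigr => p _; rewrite -sumrN; apply: eq_bigr => q _; case: (h k l p q) => -> _ _; ring.
- by do 2 (apply: eq_bigr => ? _); ring.
Qed.

Lemma S2so_sharp S T : S2so S -> S2so T -> S2so (sharp2 S T).
Proof.
move=> hS hT; have [h1 h2] := ralt4_sharp (forms_alt hS) (forms_alt hT).
have h3 p q : rsharp (forms S) (forms T) p (tw q) = - rsharp (forms S) (forms T) p q.
  by rewrite h2 h1 h2.
move=> i j k l; rewrite -![coord4 _ _ _ _ _]/(forms _ (_, _) (_, _)) !forms_sharp; split.
- by have := h1 (j, i) (k, l).
- by have := h3 (i, j) (l, k).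
- exact: h2.
Qed.

Lemma nonneg_square S : nonneg_def (square S).
Proof.
apply/nonneg_forms => g _.
have -> : qf (forms (square S)) g = \sum_q (\sum_p g p * forms S p q) ^+ 2.
  rewrite /qf /rb (eq_bigr (fun p => \sum_q \sum_r (g p * forms S p r) * (g q * forms S q r))).
    transitivity (\sum_r \sum_p \sum_q (g p * forms S p r) * (g q * forms S q r)).
      by rewrite [RHS]exchange_big; apply: eq_bigr => p _; rewrite [RHS]exchange_big.
    apply: eq_bigr => r _; rewrite expr2 mulr_suml; apply: eq_bigr => p _.
    by rewrite mulr_sumr.
  move=> p _; apply: eq_bigr => q _; rewrite /forms coord4_square mulr_suml sum_pair.
  by apply: eq_bigr => i _; rewrite mulr_suml; apply: eq_bigr => j _ /=; ring.
by apply: sumr_ge0 => q _; exact: sqr_ge0.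
Qed.

Lemma picvD S T x y z w : picv (S + T) x y z w = picv S x y z w + picv T x y z w.
Proof.
have E a b c d : ev (S + T) a b c d = ev S a b c d + ev T a b c d.
  rewrite /ev -big_split; apply: eq_bigr => i _; rewrite -big_split; apply: eq_bigr => j _.
  rewrite -big_split; apply: eq_bigr => k _; rewrite -big_split; apply: eq_bigr => l _ /=.
  by rewrite coord4D; ring.
by rewrite /picv !E; ring.
Qed.

Lemma nonneg_picv T x y z w : S2so T -> nonneg_def T -> 0 <= picv T x y z w.
Proof.
move=> hT /nonneg_forms pT; rewrite -picR_forms // addr_ge0 //.
  by have [g ga ->] := qf_antisym (fun p => rt (x 0) (z 0) p - rt (y 0) (w 0) p) (forms_alt hT); exact: pT.
by have [g ga ->] := qf_antisym (fun p => rt (x 0) (w 0) p + rt (y 0) (z 0) p) (forms_alt hT); exact: pT.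
Qed.

End FramesAndTensors.

(** * Suspension by the Ricci tensor *)

Section Suspension.
Variables (R : realType) (n : nat).
Implicit Types (S U : tensor R n) (x y z w : 'rV[R]_n) (E : 'M[R]_n).

Lemma sum_option (V : nmodType) (I : finType) (F : option I -> V) :
  \sum_p F p = F None + \sum_i F (Some i).
Proof.
rewrite (bigD1 None) //=; congr (_ + _).
rewrite (reindex_omap Some id) /=; last by case.
by apply: eq_bigl => i; rewrite eqxx.
Qed.

(* S extended to R^n + R with the components E_ik = hat_{i0k0} along the new direction. *)
Definition hat S E (p q : option 'I_n * option 'I_n) : R :=
  match p, q with
  | (Some i, Some j), (Some k, Some l) => coord4 S i j k l
  | (Some i, None), (Some k, None) => E i k
  | (None, Some i), (None, Some k) => E i k
  | (Some i, None), (None, Some k) => - E i k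
  | (None, Some i), (Some k, None) => - E i k
  | _, _ => 0
  end.

Lemma hat_alt S E : S2so S -> E^T = E -> ralt4 (hat S E).
Proof.
move=> hS ET; have es i k : E i k = E k i by rewrite -[in LHS]ET mxE.
split=> -[[i|] [j|]] [[k|] [l|]]; rewrite /hat /= ?opprK ?oppr0 //; try by rewrite es.
- by case: (hS j i k l).
- by case: (hS i j k l).
Qed.

Definition ext x (t : R) (p : option 'I_n) : R := if p is Some i then x 0 i else t.

Definition qform E x : R := (x *m E *m x^T) 0 0.

Lemma qformE E x : qform E x = \sum_i \sum_k E i k * (x 0 i * x 0 k).
Proof.
rewrite /qform mxE exchange_big; apply: eq_bigr => k _; rewrite !mxE mulr_suml.
by apply: eq_bigr => i _; ring.
Qed.

(** A property rather than a construction, so that it also applies to the sharp square of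
    [hat S E]. *)
Definition suspended U E (v : option 'I_n * option 'I_n -> option 'I_n * option 'I_n -> R) :=
  [/\ ralt4 v, forall i j k l, v (Some i, Some j) (Some k, Some l) = coord4 U i j k l,
      forall i j k, v (Some i, Some j) (Some k, None) = 0 &
      forall i k, v (Some i, None) (Some k, None) = E i k].

Lemma qf_suspended U E v f : suspended U E v -> (forall q, f (None, q) = 0) ->
  qf v f = qf (forms U) (fun p => f (Some p.1, Some p.2))
    + \sum_i \sum_k E i k * (f (Some i, None) * f (Some k, None)).
Proof.
move=> [[va vs] vU v0 vE] f0.
rewrite /qf /rb sum_pair sum_option big1 ?add0r; last first.
  by move=> q _; rewrite big1 // => p _; rewrite f0; ring.
rewrite [in RHS]sum_pair -big_split; apply: eq_bigr => i _ /=.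
rewrite sum_option addrC; congr (_ + _).
  apply: eq_bigr => j _; rewrite sum_pair sum_option big1 ?add0r; last first.
    by move=> q _; rewrite f0; ring.
  rewrite [in RHS]sum_pair; apply: eq_bigr => k _.
  by rewrite sum_option v0 mul0r add0r; apply: eq_bigr => l _; rewrite vU.
rewrite sum_pair sum_option big1 ?add0r; last by move=> q _; rewrite f0; ring.
apply: eq_bigr => k _; rewrite sum_option vE big1 ?addr0 //.
by move=> l _; rewrite vs v0 mul0r.
Qed.

Lemma picR_suspended U E v x y z w mu : suspended U E v -> S2so U ->
  picR v (ext x 0) (ext y 0) (ext z 0) (ext w mu) =
  picv U x y z w + mu ^+ 2 * (qform E x + qform E y).
Proof.
move=> sv hU; rewrite /picR !(qf_suspended sv); try by move=> q; rewrite /rt /=; ring.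
rewrite -picR_forms // /picR.
have -> : \sum_i \sum_k E i k * ((rt (ext x 0) (ext z 0) (Some i, None) - rt (ext y 0) (ext w mu) (Some i, None)) *
    (rt (ext x 0) (ext z 0) (Some k, None) - rt (ext y 0) (ext w mu) (Some k, None))) =
   mu ^+ 2 * qform E y.
  rewrite qformE mulr_sumr; apply: eq_bigr => i _; rewrite mulr_sumr; apply: eq_bigr => k _.
  by rewrite /rt /=; ring.
have -> : \sum_i \sum_k E i k * ((rt (ext x 0) (ext w mu) (Some i, None) + rt (ext y 0) (ext z 0) (Some i, None)) *
    (rt (ext x 0) (ext w mu) (Some k, None) + rt (ext y 0) (ext z 0) (Some k, None))) =
   mu ^+ 2 * qform E x.
  rewrite qformE mulr_sumr; apply: eq_bigr => i _; rewrite mulr_sumr; apply: eq_bigr => k _.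
  by rewrite /rt /=; ring.
by rewrite /rt /=; ring.
Qed.

Lemma suspended_hat S E : S2so S -> E^T = E -> suspended S E (hat S E).
Proof. by move=> hS ET; split=> //; exact: hat_alt. Qed.

(** Summation over the added direction contributes exactly E /\ E. For E = sqrt(2a) Ric this is the
    term 2a Ric /\ Ric of D, while 2 [act S E] is sqrt(2a) Ric(Q(S)). This is why the second cone
    carries the weight sqrt(2a). *)
Lemma suspended_sharp S E : S2so S -> E^T = E ->
  suspended (sharp2 S S + wedge E E) (2 *: act S E) (rsharp (hat S E) (hat S E)).
Proof.
move=> hS ET; split; first by apply: ralt4_sharp; exact: hat_alt.
- move=> i j k l; rewrite /rsharp sum_option coord4D coord4_sharp2 coord4_wedge addrC.
  congr (_ + _).
    apply: eq_bigr => p _; rewrite sum_option /=.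
    by rewrite -[RHS]add0r; congr (_ + _); ring.
  rewrite sum_option /= big1 => [|q _]; ring.
- move=> i j k; rewrite /rsharp sum_option sum_option /= big1 => [|q _]; last by ring.
  rewrite big1 => [|p _]; first by ring.
  by rewrite sum_option /= big1 => [|q _]; ring.
- move=> i k; rewrite /rsharp sum_option sum_option /= big1 => [|q _]; last by ring.
  rewrite !mxE mulr_sumr (eq_bigr (fun p => 2 * \sum_q coord4 S i p k q * E p q)).
    by ring.
  move=> p _; rewrite sum_option /= mulr_sumr.
  rewrite (eq_bigr (fun q => 2 * (coord4 S i p k q * E p q))); first by ring.
  by move=> q _; ring.
Qed.

Lemma rdot_option (f g : option 'I_n -> R) :
  rdot f g = rdot (fun i => f (Some i)) (fun i => g (Some i)) + f None * g None.
Proof. by rewrite /rdot sum_option addrC. Qed.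

Lemma evZ2 a S x y z w : ev S x (a *: y) z w = a * ev S x y z w.
Proof.
rewrite /ev mulr_sumr; apply: eq_bigr => i _; rewrite mulr_sumr; apply: eq_bigr => j _.
rewrite mulr_sumr; apply: eq_bigr => k _; rewrite mulr_sumr; apply: eq_bigr => l _.
by rewrite mxE; ring.
Qed.

Lemma evZ4 a S x y z w : ev S x y z (a *: w) = a * ev S x y z w.
Proof.
rewrite /ev mulr_sumr; apply: eq_bigr => i _; rewrite mulr_sumr; apply: eq_bigr => j _.
rewrite mulr_sumr; apply: eq_bigr => k _; rewrite mulr_sumr; apply: eq_bigr => l _.
by rewrite mxE; ring.
Qed.

Lemma evZ3 a S x y z w : S2so S -> ev S x y (a *: z) w = a * ev S x y z w.
Proof. by move=> h; rewrite (ev_antir _ _ w) // evZ4 (ev_antir _ _ w z) // mulrN. Qed.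

Lemma ev_bianchi S x y z w : (3 < n)%N -> CB S -> ev S x y z w + ev S y z x w + ev S z x y w = 0.
Proof.
move=> n4 [hS hB]; pose O : 'M[R]_n := \matrix_(i < n) nth 0 [:: x; y; z; w] i.
have r k (kn : (k < n)%N) : row (Ordinal kn) O = nth 0 [:: x; y; z; w] k by rewrite rowK.
have := rot_bianchi O hB (Ordinal (ltn_trans (isT : 0 < 3)%N n4)) (Ordinal (ltn_trans (isT : 1 < 3)%N n4))
  (Ordinal (ltn_trans (isT : 2 < 3)%N n4)) (Ordinal n4).
by rewrite !coord4_rot !r.
Qed.

(** The Bianchi identity merges the two mixed terms of isotropic curvature into the single term - 2
    lambda S_1234 of the second cone. *)
Lemma picv_scaled S x y z w lam : (3 < n)%N -> CB S -> picv S x y z (lam *: w) =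
  ev S x z x z + lam ^+ 2 * ev S x w x w + ev S y z y z + lam ^+ 2 * ev S y w y w
  - 2 * lam * ev S x y z w.
Proof.
move=> n4 cS; have hS : S2so S by case: cS.
have pair a b c d : ev S a b c d = ev S c d a b.
  rewrite !ev_rb rbC //; exact: forms_alt.
have := ev_bianchi x y z w n4 cS.
rewrite (pair y z x w) (ev_antil x z y w) // (ev_antir x z w y) // opprK.
rewrite /picv !evZ4 !evZ2 evZ3 // => h.
have -> : ev S x y z w = - ev S x w y z - ev S x z w y by lra.
by ring.
Qed.

Definition picl S E x y z w lam : R :=
  picv S x y z (lam *: w) + (1 - lam ^+ 2) * (qform E x + qform E y).

Lemma ext_eq (f : option 'I_n -> R) : f =1 ext (\row_i f (Some i)) (f None).
Proof. by case=> [i|] //=; rewrite mxE. Qed.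

Lemma eq_picR' (v : option 'I_n * option 'I_n -> option 'I_n * option 'I_n -> R) a a' b b' c c' d d' :
  a =1 a' -> b =1 b' -> c =1 c' -> d =1 d' -> picR v a b c d = picR v a' b' c' d'.
Proof.
by move=> ea eb ec ed; congr (_ + _); apply: eq_rb => p; rewrite /rt ?ea ?eb ?ec ?ed.
Qed.

(** The last vector of the frame is (w, mu) with |w|^2 + mu^2 = 1. Taking lambda = |w| turns mu^2
    into 1 - lambda^2 and w into lambda times a unit vector. *)
Lemma suspension_pic S E a b c d : (3 < n)%N -> CB S -> E^T = E ->
  (forall x y z w lam, orthonormal [:: x; y; z; w] -> 0 <= lam <= 1 -> 0 <= picl S E x y z w lam) ->
  ortho4 a b c d -> a None = 0 -> b None = 0 -> c None = 0 -> 0 <= d None ->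
  0 <= picR (hat S E) a b c d.
Proof.
move=> n4 cS ET H o4 a0 b0 c0 d0; have hS : S2so S by case: cS.
rewrite (eq_picR' _ (ext_eq a) (ext_eq b) (ext_eq c) (ext_eq d)) a0 b0 c0.
rewrite (picR_suspended _ _ _ _ _ (suspended_hat hS ET)) //.
move: o4; rewrite /ortho4 !rdot_option a0 b0 c0 !mulr0 !mul0r !addr0.
set mu := d None in d0 *.
set x := \row_i a _; set y := \row_i b _; set z := \row_i c _; set w := \row_i d _.
have rd (f g : 'I_n -> R) : rdot f g = dot (\row_i f i) (\row_i g i).
  by rewrite dotE; apply: eq_bigr => i _; rewrite !mxE.
rewrite !rd -/x -/y -/z -/w => -[[xx yy zz ww] [xy xz xw] [yz yw zw]].
have dw := dot_ge0 w.
pose lam := Num.sqrt (dot w w).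
have lam0 : 0 <= lam by exact: sqrtr_ge0.
have lam2 : lam ^+ 2 = dot w w by rewrite sqr_sqrtr.
have lam1 : 0 <= lam <= 1 by rewrite lam0 /=; nra.
have mu2 : mu ^+ 2 = 1 - lam ^+ 2 by rewrite lam2 -ww; ring.
rewrite mu2; have on3 w' : dot x w' = 0 -> dot y w' = 0 -> dot z w' = 0 -> dot w' w' = 1 ->
    orthonormal [:: x; y; z; w'].
  move=> xw' yw' zw' ww'; rewrite /orthonormal /= !andbT -!/(dot _ _).
  by rewrite xx yy zz xy xz yz xw' yw' zw' ww' !eqxx.
(* For w = 0 any unit vector orthogonal to x, y, z serves, since it is multiplied by lambda = 0. *)
have [w0|w0] := eqVneq w 0.
  have : orthonormal [:: x; y; z].
    by rewrite /orthonormal /= !andbT -!/(dot _ _) xx yy zz xy xz yz !eqxx.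
  move=> /orthonormal_extend; case=> // w' ow'.
  by have := H _ _ _ _ _ ow' lam1; rewrite /picl lam2 /lam w0 /dot mul0mx mxE sqrtr0 !scale0r.
have [w' ow' ->] : exists2 w', orthonormal [:: x; y; z; w'] & w = lam *: w'.
  have lamn0 : lam != 0 by rewrite sqrtr_eq0 -ltNge lt_def dot_eq0 w0 dot_ge0.
  exists (lam^-1 *: w); last by rewrite scalerA divff // scale1r.
  apply: on3; [by rewrite dotZr xw mulr0|by rewrite dotZr yw mulr0|by rewrite dotZr zw mulr0|].
  exact: orthonormal_normalize.
exact: H.
Qed.

Lemma picl_sharp S E x y z w lam : (3 < n)%N -> CB S -> E^T = E ->
  (forall x y z w lam, orthonormal [:: x; y; z; w] -> 0 <= lam <= 1 -> 0 <= picl S E x y z w lam) ->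
  orthonormal [:: x; y; z; w] -> 0 <= lam <= 1 -> picl S E x y z w lam = 0 ->
  0 <= picl (sharp2 S S + wedge E E) (2 *: act S E) x y z w lam.
Proof.
move=> n4 cS ET H o4 /andP[lam0 lam1] e0; have hS : S2so S by case: cS.
have [mu mu0 mu2] : exists2 mu : R, 0 <= mu & mu ^+ 2 = 1 - lam ^+ 2.
  by exists (Num.sqrt (1 - lam ^+ 2)); rewrite ?sqrtr_ge0 // sqr_sqrtr //; nra.
have hs : S2so (sharp2 S S + wedge E E).
  have [h _] := CB_wedge ET ET; have := S2so_comb 1 (S2so_sharp hS hS) h.
  by rewrite scale1r.
rewrite /picl -mu2 -(picR_suspended _ _ _ _ _ (suspended_sharp hS ET)) //.
have o4' : ortho4 (ext x 0) (ext y 0) (ext z 0) (ext (lam *: w) mu).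
  have rdE (u v : 'rV[R]_n) s t : rdot (ext u s) (ext v t) = dot u v + s * t.
    by rewrite rdot_option dotE.
  have /ortho4_orthonormal := o4; rewrite /ortho4 !rdot_dot !rdE !dotZr dotZl.
  move=> [[-> -> -> ->] [-> -> ->] [-> -> ->]]; rewrite !mulr0 !mul0r !addr0.
  by rewrite mulr1 -!expr2 mu2; split=> //; split=> //; ring.
have near : near_pos None (hat S E) (ext x 0) (ext y 0) (ext z 0) (ext (lam *: w) mu).
  right; split; first by move=> a b c d; exact: suspension_pic.
  by rewrite (picR_suspended _ _ _ _ _ (suspended_hat hS ET)) // mu2.
by apply: (picR_sharp _ _ o4' near near); exact: hat_alt.
Qed.

End Suspension.

(** * Quadratic forms on frames, and the defect on isotropic planes *)

Section Forms.
Variables (R : realType) (n : nat).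
Implicit Types (S T : tensor R n) (x y z w : 'rV[R]_n) (A B E : 'M[R]_n).

Definition bform E x y : R := (x *m E *m y^T) 0 0.

Lemma bformE E x y : bform E x y = \sum_i \sum_k E i k * (x 0 i * y 0 k).
Proof.
rewrite /bform mxE exchange_big; apply: eq_bigr => k _; rewrite !mxE mulr_suml.
by apply: eq_bigr => i _; ring.
Qed.

Lemma bformDl E x x' y : bform E (x + x') y = bform E x y + bform E x' y.
Proof. by rewrite /bform !mulmxDl mxE. Qed.
Lemma bformDr E x y y' : bform E x (y + y') = bform E x y + bform E x y'.
Proof. by rewrite /bform linearD mulmxDr mxE. Qed.
Lemma bformZl E a x y : bform E (a *: x) y = a * bform E x y.
Proof. by rewrite /bform -!scalemxAl mxE. Qed.
Lemma bformZr E a x y : bform E x (a *: y) = a * bform E x y.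
Proof. by rewrite /bform linearZ -scalemxAr mxE. Qed.
Lemma bformDm A B x y : bform (A + B) x y = bform A x y + bform B x y.
Proof. by rewrite /bform mulmxDr mulmxDl mxE. Qed.
Lemma bformZm a A x y : bform (a *: A) x y = a * bform A x y.
Proof. by rewrite /bform -scalemxAr -scalemxAl mxE. Qed.
Lemma bform1 x y : bform 1%:M x y = dot x y.
Proof. by rewrite /bform mulmx1. Qed.
Lemma bform_sym E x y : E^T = E -> bform E x y = bform E y x.
Proof.
move=> ET; rewrite !bformE exchange_big; apply: eq_bigr => i _; apply: eq_bigr => j _.
by rewrite -[in LHS]ET mxE; ring.
Qed.
Lemma bform_row E (O : 'M[R]_n) i j : bform E (row i O) (row j O) = rotm O E i j.
Proof.
rewrite /bform /rotm -row_mul !mxE; apply: eq_bigr => k _.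
by rewrite !mxE.
Qed.

Lemma bform_sq A x : A^T = A -> bform (A *m A) x x = dot (x *m A) (x *m A).
Proof. by move=> AT; rewrite /bform /dot trmx_mul AT !mulmxA. Qed.

Lemma bform_mul A B x y z w : bform A x z * bform B y w =
  \sum_i \sum_j \sum_k \sum_l A i k * B j l * x 0 i * y 0 j * z 0 k * w 0 l.
Proof.
rewrite !bformE mulr_suml; apply: eq_bigr => i _; rewrite mulr_sumr; apply: eq_bigr => j _.
rewrite mulr_suml; apply: eq_bigr => k _; rewrite mulr_sumr; apply: eq_bigr => l _; ring.
Qed.

Lemma ev_wedge A B x y z w : ev (wedge A B) x y z w =
  bform A x z * bform B y w + bform A y w * bform B x z
  - bform A x w * bform B y z - bform A y z * bform B x w.
Proof.
rewrite [bform A y w * _]mulrC [bform A y z * _]mulrC !bform_mul.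
have ex (M N : 'M[R]_n) : \sum_i \sum_j \sum_k \sum_l M i k * N j l * x 0 i * y 0 j * w 0 k * z 0 l =
   \sum_i \sum_j \sum_k \sum_l M i l * N j k * x 0 i * y 0 j * z 0 k * w 0 l.
  apply: eq_bigr => i _; apply: eq_bigr => j _; rewrite exchange_big.
  by do 2 (apply: eq_bigr => ? _); ring.
rewrite !ex /ev -big_split -!sumrB; apply: eq_bigr => i _ /=.
rewrite -big_split -!sumrB; apply: eq_bigr => j _ /=.
rewrite -big_split -!sumrB; apply: eq_bigr => k _ /=.
rewrite -big_split -!sumrB; apply: eq_bigr => l _ /=.
rewrite coord4_wedge; ring.
Qed.

Lemma evD S T x y z w : ev (S + T) x y z w = ev S x y z w + ev T x y z w.
Proof.
rewrite /ev -big_split; apply: eq_bigr => i _; rewrite -big_split; apply: eq_bigr => j _.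
rewrite -big_split; apply: eq_bigr => k _; rewrite -big_split; apply: eq_bigr => l _ /=.
by rewrite coord4D; ring.
Qed.

Lemma evZ a S x y z w : ev (a *: S) x y z w = a * ev S x y z w.
Proof.
rewrite /ev mulr_sumr; apply: eq_bigr => i _; rewrite mulr_sumr; apply: eq_bigr => j _.
rewrite mulr_sumr; apply: eq_bigr => k _; rewrite mulr_sumr; apply: eq_bigr => l _.
by rewrite coord4Z; ring.
Qed.

Lemma picvZ a S x y z w : picv (a *: S) x y z w = a * picv S x y z w.
Proof. by rewrite /picv !evZ; ring. Qed.

Lemma picv_wedge A B x y z w : A^T = A -> B^T = B -> picv (wedge A B) x y z w =
  (bform A x x + bform A y y) * (bform B z z + bform B w w)
  + (bform A z z + bform A w w) * (bform B x x + bform B y y)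
  - 2 * (bform A x z + bform A y w) * (bform B x z + bform B y w)
  - 2 * (bform A x w - bform A y z) * (bform B x w - bform B y z).
Proof.
move=> AT BT; rewrite /picv !ev_wedge.
rewrite (bform_sym z x AT) (bform_sym z x BT) (bform_sym w x AT) (bform_sym w x BT).
rewrite (bform_sym z y AT) (bform_sym z y BT) (bform_sym w y AT) (bform_sym w y BT).
rewrite (bform_sym w z AT) (bform_sym w z BT); ring.
Qed.

Definition two_nonneg E := forall x y, dot x x = 1 -> dot y y = 1 -> dot x y = 0 ->
  0 <= bform E x x + bform E y y.

(* The Hermitian form induced by E on the isotropic plane spanned by x + iy and
   z + iw is nonnegative, hence so is its determinant. *)
Lemma two_nonneg_det E x y z w : E^T = E -> two_nonneg E -> orthonormal [:: x; y; z; w] ->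
  let m1 := bform E x x + bform E y y in let m2 := bform E z z + bform E w w in
  [/\ 0 <= m1, 0 <= m2 &
   (bform E x z + bform E y w) ^+ 2 + (bform E x w - bform E y z) ^+ 2 <= m1 * m2].
Proof.
move=> ET H2 /ortho4_orthonormal; rewrite /ortho4 !rdot_dot.
move=> [[xx yy zz ww] [xy xz xw] [yz yw zw]] /=.
set m1 := bform E x x + _; set m2 := bform E z z + _.
set p := bform E x z + _; set q := _ - bform E y z.
have m10 : 0 <= m1 by exact: H2.
have m20 : 0 <= m2 by exact: H2.
split=> //.
have key a c : 0 < a -> 0 <= a ^+ 2 * m1 + c ^+ 2 * (p ^+ 2 + q ^+ 2) * m2
    - 2 * a * c * (p ^+ 2 + q ^+ 2).
  (* Here f1 + i f2 = a (x + i y) - c (p - i q)(z + i w), whence f1 and f2 are orthogonal of equal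
     squared length N. *)
  move=> a0; pose f1 := a *: x + ((- c * p) *: z + (- c * q) *: w).
  pose f2 := a *: y + ((- c * p) *: w + (c * q) *: z).
  pose N := a ^+ 2 + c ^+ 2 * (p ^+ 2 + q ^+ 2).
  have N0 : 0 < N by rewrite /N ltr_wpDr ?exprn_gt0 // mulr_ge0 ?addr_ge0 ?sqr_ge0.
  have n1 : dot f1 f1 = N.
    rewrite /f1 !(dotDl, dotDr, dotZl, dotZr) xx zz ww (dotC z x) (dotC w x) (dotC w z) xz xw zw /N; ring.
  have n2 : dot f2 f2 = N.
    rewrite /f2 !(dotDl, dotDr, dotZl, dotZr) yy zz ww (dotC z y) (dotC w y) (dotC w z) yz yw zw /N; ring.
  have n3 : dot f1 f2 = 0.
    rewrite /f1 /f2 !(dotDl, dotDr, dotZl, dotZr) xy zz ww (dotC z y) (dotC w y) (dotC w z) yz yw zw xz xw; ring.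
  have sN : Num.sqrt N != 0 by rewrite sqrtr_eq0 -ltNge.
  have sN2 : Num.sqrt N * Num.sqrt N = N by rewrite -expr2 sqr_sqrtr // ltW.
  have := H2 ((Num.sqrt N)^-1 *: f1) ((Num.sqrt N)^-1 *: f2).
  rewrite !dotZl !dotZr n1 n2 n3 !mulr0 => h.
  have u : (Num.sqrt N)^-1 * ((Num.sqrt N)^-1 * N) = 1 by rewrite -{3}sN2; field.
  have := h u u erefl; rewrite !bformZl !bformZr -!mulrDr pmulr_rge0 ?invr_gt0 ?sqrtr_gt0 //.
  rewrite pmulr_rge0 ?invr_gt0 ?sqrtr_gt0 //.
  rewrite /f1 /f2 !(bformDl, bformDr, bformZl, bformZr).
  rewrite (bform_sym z x ET) (bform_sym w x ET) (bform_sym z y ET) (bform_sym w y ET) (bform_sym w z ET).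
  by congr (_ <= _); rewrite /m1 /m2 /p /q; ring.
set h := p ^+ 2 + q ^+ 2 in key *.
have h0 : 0 <= h by rewrite addr_ge0 ?sqr_ge0.
have [->|hn] := eqVneq h 0; first exact: mulr_ge0.
have hp : 0 < h by rewrite lt_def hn.
have [m1e|m1n] := eqVneq m1 0.
  have a0 : 0 < (h * m2 + 1) / (2 * h) by rewrite divr_gt0 ?mulr_gt0 // ltr_wpDl // mulr_ge0.
  have := key _ 1 a0; rewrite m1e.
  have -> : ((h * m2 + 1) / (2 * h)) ^+ 2 * 0 + 1 ^+ 2 * h * m2 - 2 * ((h * m2 + 1) / (2 * h)) * 1 * h = -1.
    by field; rewrite hn.
  by rewrite ler0N1.
have m1p : 0 < m1 by rewrite lt_def m1n.
have := key h m1 hp.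
have -> : h ^+ 2 * m1 + m1 ^+ 2 * h * m2 - 2 * h * m1 * h = h * m1 * (m1 * m2 - h) by ring.
by rewrite pmulr_rge0 ?mulr_gt0 // subr_ge0.
Qed.

Lemma bessel v x y z w : orthonormal [:: x; y; z; w] ->
  dot v x ^+ 2 + dot v y ^+ 2 + dot v z ^+ 2 + dot v w ^+ 2 <= dot v v.
Proof.
move=> /ortho4_orthonormal; rewrite /ortho4 !rdot_dot.
move=> [[xx yy zz ww] [xy xz xw] [yz yw zw]].
have := dot_ge0 (v + ((- dot v x) *: x + ((- dot v y) *: y + ((- dot v z) *: z + (- dot v w) *: w)))).
rewrite !(dotDl, dotDr, dotZl, dotZr) xx yy zz ww (dotC y x) (dotC z x) (dotC w x) (dotC z y) (dotC w y) (dotC w z).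
rewrite xy xz xw yz yw zw (dotC x v) (dotC y v) (dotC z v) (dotC w v) => h.
by rewrite -subr_ge0; apply: le_trans h _; rewrite le_eqVlt; apply/orP; left; apply/eqP; ring.
Qed.

Lemma tr_rows E (O : 'M[R]_n) : O *m O^T = 1%:M -> \tr E = \sum_i bform E (row i O) (row i O).
Proof.
move=> OO; rewrite -(tr_rotm E (orthV OO)) /mxtrace; apply: eq_bigr => i _.
by rewrite bform_row.
Qed.

Lemma tr_square_ge A x y z w : A^T = A -> (3 < n)%N -> orthonormal [:: x; y; z; w] ->
  bform (A *m A) x x + bform (A *m A) y y + bform (A *m A) z z + bform (A *m A) w w <= \tr (A *m A).
Proof.
move=> AT n4 o4; have [Q QQ rQ] := frame_of o4 n4.
rewrite (tr_rows _ QQ).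
pose i0 := Ordinal (ltn_trans (isT : 0 < 3)%N n4); pose i1 := Ordinal (ltn_trans (isT : 1 < 3)%N n4).
pose i2 := Ordinal (ltn_trans (isT : 2 < 3)%N n4); pose i3 := Ordinal n4.
have r0 : row i0 Q = x by rewrite rQ. have r1 : row i1 Q = y by rewrite rQ.
have r2 : row i2 Q = z by rewrite rQ. have r3 : row i3 Q = w by rewrite rQ.
rewrite (bigD1 i0) //= (bigD1 i1) //= (bigD1 i2) //= (bigD1 i3) //= r0 r1 r2 r3 !addrA lerDl.
by apply: sumr_ge0 => i _; rewrite bform_sq // dot_ge0.
Qed.

Lemma square_form_ge A x y z w : A^T = A -> orthonormal [:: x; y; z; w] ->
  ((bform A x x + bform A y y) ^+ 2 + (bform A z z + bform A w w) ^+ 2) / 2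
  + (bform A x z + bform A y w) ^+ 2 + (bform A x w - bform A y z) ^+ 2 <=
  bform (A *m A) x x + bform (A *m A) y y + bform (A *m A) z z + bform (A *m A) w w.
Proof.
move=> AT o4; rewrite !bform_sq //.
have e u v : dot (u *m A) v = bform A u v by [].
have := bessel (x *m A) o4; have := bessel (y *m A) o4; have := bessel (z *m A) o4; have := bessel (w *m A) o4.
rewrite !e (bform_sym z x AT) (bform_sym w x AT) (bform_sym z y AT) (bform_sym w y AT).
move: (dot (x *m A) (x *m A)) (dot (y *m A) (y *m A)) (dot (z *m A) (z *m A)) (dot (w *m A) (w *m A)).
move: (bform A x x) (bform A y y) (bform A z z) (bform A w w) (bform A x y) (bform A y x)
  (bform A x z) (bform A x w) (bform A y z) (bform A y w) (bform A z w) (bform A w z).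
move=> xx yy zz ww xy yx xz xw yz yw zw wz dx dy dz dw.
have := sqr_ge0 xy; have := sqr_ge0 yx; have := sqr_ge0 zw; have := sqr_ge0 wz.
have := sqr_ge0 (xx - yy); have := sqr_ge0 (zz - ww); have := sqr_ge0 (xz - yw); have := sqr_ge0 (xw + yz).
nra.
Qed.

Lemma bform_frame1 x y z w : orthonormal [:: x; y; z; w] ->
  [/\ bform 1%:M x x + bform 1%:M y y = 2, bform 1%:M z z + bform 1%:M w w = 2,
     bform 1%:M x z + bform 1%:M y w = 0 & bform 1%:M x w - bform 1%:M y z = 0].
Proof.
move=> /ortho4_orthonormal; rewrite /ortho4 !rdot_dot !bform1.
by move=> [[-> -> -> ->] [_ -> ->] [-> -> _]]; split; ring.
Qed.

Lemma bformA_scalar A (k : R) x y : bform (A + k%:M) x y = bform A x y + k * dot x y.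
Proof. by rewrite bformDm -scalemx1 bformZm bform1. Qed.

(** For sg = (1 + g) s the relations 2a = kap (1 + g) and kap g = b^2 (1 + g) make D equal to kap (A
    + sg id) /\ (A + sg id) - b^2 sg^2 id /\ id plus the terms in A^2 and |A|^2. The first product
    is controlled by [two_nonneg_det]; a share of it and the A^2 term absorb the negative term into
    a square. The strict margin 2 c s^2 is what T' will spend on its multiple of id /\ id. *)
Lemma defect_pic (a b g : R) S x y z w : S2so S -> (3 < n)%N -> orthonormal [:: x; y; z; w] ->
  let s := smean S in let c := coefc n a b in
  two_nonneg (ric S + (g * s)%:M) -> 0 < s -> 0 <= g -> 0 <= b -> 0 < c -> c <= b ^+ 2 ->
  let kap := 2 * b + (n%:R - 2) * b ^+ 2 in
  2 * a = kap * (1 + g) -> kap * g = b ^+ 2 * (1 + g) -> 0 <= kap - 2 * b ^+ 2 ->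
  2 * c * s ^+ 2 < picv (defect a b S) x y z w.
Proof.
move=> hS n4 o4 s c H2 s0 g0 b0 c0 cb kap ea eg k2.
have AT := tfric_sym hS; set A := tfric S in AT *.
have AAT : (A *m A)^T = A *m A by rewrite trmx_mul AT.
have HE : ric S + (g * s)%:M = A + ((1 + g) * s)%:M.
  by rewrite ricE -/A -/s -addrA -raddfD /=; congr (_ + _%:M); ring.
have HT : (A + ((1 + g) * s)%:M)^T = A + ((1 + g) * s)%:M by rewrite linearD /= tr_scalar_mx AT.
have o4' := o4; move/ortho4_orthonormal: o4'; rewrite /ortho4 !rdot_dot.
move=> [[xx yy zz ww] [xy xz xw] [yz yw zw]].
rewrite HE in H2; have [] := two_nonneg_det HT H2 o4.
rewrite !bformA_scalar xx yy zz ww xz yw xw yz.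
have sq := square_form_ge AT o4; have tg := tr_square_ge AT n4 o4.
have [e1 e2 e3 e4] := bform_frame1 o4.
rewrite /defect -/A -/s -/c !picvD !picvZ !picv_wedge ?trmx1 // e1 e2 e3 e4.
move: sq tg; set m1 := bform A x x + bform A y y; set m2 := bform A z z + bform A w w.
set p := bform A x z + _; set q := bform A x w - _; set t := \tr _.
set n1 := bform _ x x; set n2 := bform _ y y; set n3 := bform _ z z; set n4' := bform _ w w.
rewrite -/kap; set sg := (1 + g) * s => sq tg m10 m20.
have -> : bform A x x + sg * 1 + (bform A y y + sg * 1) = m1 + 2 * sg by rewrite /m1; ring.
have -> : bform A z z + sg * 1 + (bform A w w + sg * 1) = m2 + 2 * sg by rewrite /m2; ring.
rewrite !mulr0 !addr0 -/p -/q => hd.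
clear -sq tg hd ea eg k2 c0 cb s0 g0 b0.
apply: (@lt_le_trans _ _ (2 * b ^+ 2 * (m1 + m2 + 2 * sg) ^+ 2 + (2 * kap - 4 * b ^+ 2) *
   ((m1 + 2 * sg) * (m2 + 2 * sg) - p ^+ 2 - q ^+ 2)
   + 4 * b ^+ 2 * (n1 + n2 + n3 + n4' - (m1 ^+ 2 + m2 ^+ 2) / 2 - p ^+ 2 - q ^+ 2) + 8 * c * t)).
  have u1 : 0 <= (2 * kap - 4 * b ^+ 2) * ((m1 + 2 * sg) * (m2 + 2 * sg) - p ^+ 2 - q ^+ 2).
    by apply: mulr_ge0; lra.
  have u2 : 0 <= b ^+ 2 * (n1 + n2 + n3 + n4' - (m1 ^+ 2 + m2 ^+ 2) / 2 - p ^+ 2 - q ^+ 2).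
    by apply: mulr_ge0; [exact: sqr_ge0|lra].
  have pq : 0 <= p ^+ 2 + q ^+ 2 by rewrite addr_ge0 ?sqr_ge0.
  have u3 : 0 <= c * (t - (m1 ^+ 2 + m2 ^+ 2) / 2) by apply: mulr_ge0; lra.
  have u4 : 0 <= (b ^+ 2 - c) * (m1 + m2 + 2 * sg) ^+ 2 by rewrite mulr_ge0 ?sqr_ge0 ?subr_ge0.
  have u5 : 0 <= c * (m1 - m2) ^+ 2 by rewrite mulr_ge0 ?sqr_ge0 // ltW.
  have u5' : 0 <= c * (m1 + m2 + sg) ^+ 2 by rewrite mulr_ge0 ?sqr_ge0 // ltW.
  have u6 : 0 <= c * (sg ^+ 2 - s ^+ 2).
    rewrite mulr_ge0 ?(ltW c0) // /sg -[X in _ - X]mul1r exprMn -mulrBl mulr_ge0 ?sqr_ge0 //; nra.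
  have u7 : 0 < c * s ^+ 2 by rewrite mulr_gt0 ?exprn_gt0.
  lra.
have k1 : 4 * a * s = 2 * kap * sg by rewrite /sg; nra.
have k3 : 2 * a * s ^+ 2 = (kap - b ^+ 2) * sg ^+ 2.
  transitivity (kap * (1 + g) * s ^+ 2 ); first by rewrite -ea.
  have -> : (kap - b ^+ 2) * sg ^+ 2 = kap * (1 + g) * s ^+ 2 + (1 + g) * s ^+ 2 * (kap * g - b ^+ 2 * (1 + g)).
    by rewrite /sg; ring.
  by rewrite eg; ring.
by rewrite k1 k3 le_eqVlt; apply/orP; left; apply/eqP; field.
Qed.

(* At the second stage a = b + (n - 2) b^2 / 2, so 2a is the coefficient of A /\ A. *)
Lemma defectE2 (a b : R) S : 2 * a = 2 * b + (n%:R - 2) * b ^+ 2 ->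
  defect a b S = (2 * a) *: wedge (ric S) (ric S) + (2 * b ^+ 2) *: wedge (tfric S *m tfric S) 1%:M
    + (coefc n a b * \tr (tfric S *m tfric S)) *: wedge 1%:M 1%:M.
Proof.
move=> ea; apply: ext4 => i j k l; rewrite /defect /= -ea !coord4E.
have er p q : ric S p q = tfric S p q + smean S * (1%:M : 'M[R]_n) p q.
  by rewrite [in LHS]ricE mxE; congr (_ + _); rewrite !mxE mulr_natr.
rewrite !er; move: (tfric S) (smean S) (1%:M : 'M[R]_n) => A s I1; ring.
Qed.

Lemma tr_square_eq0 A : A^T = A -> (\tr (A *m A) <= 0) -> A = 0.
Proof.
move=> AT; have -> : \tr (A *m A) = \sum_i \sum_j A i j ^+ 2.
  apply: eq_bigr => i _; rewrite mxE; apply: eq_bigr => j _.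
  by rewrite -[in X in _ * X]AT mxE expr2.
move=> h; have p i : 0 <= \sum_j A i j ^+ 2 by apply: sumr_ge0 => j _; exact: sqr_ge0.
have /eqP : \sum_i \sum_j A i j ^+ 2 = 0 by apply/eqP; rewrite eq_le h sumr_ge0.
rewrite psumr_eq0 // => /allP h1; apply/matrixP => i j; rewrite mxE.
have /eqP := h1 i (mem_index_enum _) => /=; move/eqP.
rewrite psumr_eq0; last by move=> k _; exact: sqr_ge0.
by move=> /allP/(_ j (mem_index_enum _)) /=; rewrite sqrf_eq0 => /eqP.
Qed.

Lemma tr_square_ge0 A : A^T = A -> 0 <= \tr (A *m A).
Proof.
move=> AT; apply: sumr_ge0 => i _; rewrite mxE; apply: sumr_ge0 => j _.
by rewrite -[in X in _ * X]AT mxE -expr2 sqr_ge0.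
Qed.

Lemma square_form_ge0 A x : A^T = A -> 0 <= bform (A *m A) x x.
Proof. by move=> AT; rewrite bform_sq // dot_ge0. Qed.

(* The part of the defect that is not absorbed by the suspension. *)
Lemma remainder_pic A (b k lam : R) x y z w : A^T = A -> 0 <= k -> orthonormal [:: x; y; z; w] ->
  k * 4 <= picv ((2 * b ^+ 2) *: wedge (A *m A) 1%:M + k *: wedge 1%:M 1%:M) x y z (lam *: w).
Proof.
move=> AT k0 o4; have AAT : (A *m A)^T = A *m A by rewrite trmx_mul AT.
have /ortho4_orthonormal := o4; rewrite /ortho4 !rdot_dot.
move=> [[xx yy zz ww] [xy xz xw] [yz yw zw]].
rewrite picvD !picvZ !picv_wedge ?trmx1 // !bform1 !dotZr !dotZl xx yy zz ww xz xw yz yw !mulr0 !mulr1.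
have qx := square_form_ge0 x AT; have qy := square_form_ge0 y AT.
have qz := square_form_ge0 z AT; have qw := square_form_ge0 (lam *: w) AT.
have pos : 0 <= 2 * b ^+ 2 * ((bform (A *m A) x x + bform (A *m A) y y) * (1 + lam ^+ 2) +
     (bform (A *m A) z z + bform (A *m A) (lam *: w) (lam *: w)) * 2) + 4 * k * lam ^+ 2.
  have l2 := sqr_ge0 lam.
  apply: addr_ge0; last by apply: mulr_ge0 => //; apply: mulr_ge0.
  apply: mulr_ge0; first by apply: mulr_ge0 => //; exact: sqr_ge0.
  by apply: addr_ge0; apply: mulr_ge0 => //; apply: addr_ge0.
rewrite -subr_ge0; apply: le_trans pos _; rewrite le_eqVlt; apply/orP; left; apply/eqP; ring.
Qed.

End Forms.

(** * Consequences of nonnegative isotropic curvature *)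

Section Averages.
Variables (R : realType) (I : finType).

Lemma pair_average (P : pred I) (u : I -> R) :
  (forall p q, P p -> P q -> p != q -> 0 <= u p + u q) -> (1 < #|P|)%N ->
  0 <= \sum_(p | P p) u p.
Proof.
move=> hu P2; have <- : \sum_(p | P p) u p * 1 = \sum_(p | P p) u p by apply: eq_bigr => i _; exact: mulr1.
apply: (@weighted_pair_sum R I P u (fun=> 1)) => // p _.
by rewrite mulr1 sumr_const ler_nat.
Qed.

Variables (P : pred I) (K : I -> I -> R).
Hypothesis K0 : forall i, K i i = 0.
Hypothesis Ks : forall i j, K i j = K j i.
Hypothesis P4 : (3 < #|P|)%N.
Hypothesis quad : forall i j k l, P i -> P j -> P k -> P l -> uniq [:: i; j; k; l] ->
  0 <= K i k + K i l + K j k + K j l.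

Let r i := \sum_(p | P p) K i p.

(** For u_p = K_ip + K_jp the four-frame condition says that pairwise sums of u are nonnegative. So
    the sum of u_p over p other than i, j, which is r_i + r_j - 2 K_ij, is nonnegative. *)
Lemma quad_pair i j : P i -> P j -> i != j -> 2 * K i j <= r i + r j.
Proof.
move=> Pi Pj ij; pose Q := [pred p | [&& P p, p != i & p != j]].
have E m : (m == i) || (m == j) -> r m = K m i + K m j + \sum_(p | Q p) K m p.
  move=> _; rewrite /r (bigD1 i) //= (bigD1 j) /=; last by rewrite Pj eq_sym.
  rewrite addrA; congr (_ + _); apply: eq_bigl => p; by rewrite -andbA.
have Q2 : (1 < #|Q|)%N.
  have iP : (i \in P) = true by exact: Pi. have jP : (j \in P) = true by exact: Pj.
  have e : #|[predD1 [predD1 P & i] & j]| = #|Q|.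
    by apply: eq_card => p; rewrite !inE -[p \in P]/(P p); case: (P p) (p != i) (p != j) => [] [] [].
  have := P4; rewrite (cardD1 i) iP (cardD1 j) e inE /= jP eq_sym ij /=; lia.
have : 0 <= \sum_(p | Q p) (K i p + K j p).
  apply: pair_average => // p q /and3P[Pp pi pj] /and3P[Pq qi qj] pq.
  have := @quad i j p q Pi Pj Pp Pq; rewrite /= !inE !negb_or ij pq.
  by rewrite ![i == _]eq_sym ![j == _]eq_sym pi pj qi qj => /(_ isT); lra.
rewrite big_split /= (E i) ?eqxx // (E j) ?eqxx ?orbT // !K0 (Ks j i); lra.
Qed.

Lemma quad_single i : P i -> 0 <= (#|P|%:R - 4) * r i + \sum_(j | P j) r j.
Proof.
move=> Pi; have : 0 <= \sum_(j | P j && (j != i)) (r i + r j - 2 * K i j).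
  apply: sumr_ge0 => j /andP[Pj ji]; rewrite subr_ge0; apply: quad_pair => //; by rewrite eq_sym.
rewrite sumrB big_split /= -mulr_sumr sumr_const.
have -> : \sum_(j | P j && (j != i)) K i j = r i by rewrite /r [RHS](bigD1 i) //= K0 add0r.
have -> : \sum_(j | P j) r j = r i + \sum_(j | P j && (j != i)) r j by rewrite (bigD1 i).
have -> : #|[pred j | P j && (j != i)]| = #|P|.-1.
  have iP : (i \in P) = true by exact: Pi.
  by rewrite [in RHS](cardD1 i) iP /=; apply: eq_card => p; rewrite !inE andbC.
rewrite -[r i *+ _]mulr_natr -subn1 natrB; last by lia.
lra.
Qed.

Lemma quad_total : 0 <= \sum_(i | P i) r i.
Proof.
have : 0 <= \sum_(i | P i) ((#|P|%:R - 4) * r i + \sum_(j | P j) r j).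
  by apply: sumr_ge0 => i; exact: quad_single.
rewrite big_split /= -mulr_sumr sumr_const -[(\sum_(i | P i) r i) *+ _]mulr_natr => h.
have N4 : 4 <= #|P|%:R :> R by rewrite ler_nat.
move: h; set t := \sum_(i | _) _; set N := #|P|%:R in N4 *; move=> h.
have : 0 <= (2 * N - 4) * t by lra.
by rewrite pmulr_rge0 //; lra.
Qed.

End Averages.

Section Consequences.
Variables (R : realType) (n : nat).
Implicit Types (S T U : tensor R n) (x y z w : 'rV[R]_n).

(** As the l p sum to zero, lower bounds on the remaining entries give upper bounds on l i + l j:
    they are paired with one another for the first estimate, and each with l j for the second. *)
Lemma pair_bounds (l : 'I_n -> R) (sg : R) : (3 < n)%N -> \sum_i l i = 0 ->
  (forall i j, i != j -> - 2 * sg <= l i + l j) -> forall i j, i != j ->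
  l i + l j <= (n%:R - 2) * sg /\ l i + l j <= (n%:R - 2) * (l j + 2 * sg).
Proof.
move=> n4 l0 h i j ij; move: l0; rewrite (sum_rest _ ij) => l0.
have c := card_rest R ij; have cn : #|rest i j| = (n - 2)%N.
  by apply/eqP; rewrite -(eqr_nat R) c natrB //; lia.
split.
  have : 0 <= \sum_(p | rest i j p) (l p + sg).
    apply: pair_average => [p q _ _ pq|]; last by rewrite cn; lia.
    by have := h p q pq; lra.
  rewrite big_split /= sumr_const -[sg *+ _]mulr_natr c; lra.
have : 0 <= \sum_(p | rest i j p) (l p + (l j + 2 * sg)).
  by apply: sumr_ge0 => p /andP[_ pj]; have := h p j pj; lra.
rewrite big_split /= sumr_const -[(l j + 2 * sg) *+ _]mulr_natr c; lra.
Qed.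

(** Adding the conditions for (x, y, z, w) and (x, y, z, -w) cancels the mixed terms. *)
Lemma PIC_quad U x y z w : S2so U -> PIC U -> orthonormal [:: x; y; z; w] ->
  0 <= ev U x z x z + ev U x w x w + ev U y z y z + ev U y w y w.
Proof.
move=> hU pU o4; have p1 := pU _ _ _ _ o4.
have o4' : orthonormal [:: x; y; z; -1 *: w].
  have /ortho4_orthonormal := o4; move=> h; apply/ortho4_orthonormal; move: h.
  rewrite /ortho4 !rdot_dot !dotZr !dotZl => -[[-> -> -> ->] [-> -> ->] [-> -> ->]].
  by split; split; rewrite ?mulr0 //; ring.
have := pU _ _ _ _ o4'; rewrite !(evZ4, evZ2) (evZ3 _ _ _ _ _ hU); lra.
Qed.

Lemma rb_delta S i j k l : rb (forms S) (fun p => (p == (i, j))%:R) (fun p => (p == (k, l))%:R) = coord4 S i j k l.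
Proof.
rewrite /rb (bigD1 (i, j)) //= [X in _ + X]big1 ?addr0; last first.
  by move=> p /negPf np; rewrite big1 // => q _; rewrite np mul0r mulr0.
rewrite (bigD1 (k, l)) //= [X in _ + X]big1 ?addr0; last first.
  by move=> p /negPf np; rewrite np !mulr0.
by rewrite !eqxx !mulr1.
Qed.

Lemma nonneg_qf T f : S2so T -> nonneg_def T -> 0 <= qf (forms T) f.
Proof.
by move=> hT /nonneg_forms pT; have [g ga ->] := qf_antisym f (forms_alt hT); exact: pT.
Qed.

Lemma nonneg_diag T i j : S2so T -> nonneg_def T -> 0 <= coord4 T i j i j.
Proof. by move=> hT pT; rewrite -rb_delta; exact: nonneg_qf. Qed.

(** A discriminant bounds an off-diagonal entry by diagonal ones, and nonnegative diagonal entries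
    are bounded by their sum. *)
Lemma nonneg_bound T i j k l : S2so T -> nonneg_def T -> `|coord4 T i j k l| <= scal T.
Proof.
move=> hT pT; have d a b : coord4 T a b a b <= scal T.
  rewrite /scal /mxtrace (bigD1 a) //= mxE (bigD1 b) //= -addrA lerDl addr_ge0 //.
    by apply: sumr_ge0 => p _; exact: nonneg_diag.
  by apply: sumr_ge0 => p _; rewrite mxE; apply: sumr_ge0 => q _; exact: nonneg_diag.
have E e : 0 <= 1 ^+ 2 * coord4 T i j i j + 2 * 1 * e * coord4 T i j k l + e ^+ 2 * coord4 T k l k l.
  by have := nonneg_qf (fun p => 1 * (p == (i, j))%:R + e * (p == (k, l))%:R) hT pT;
    rewrite qf_lin ?[qf _ _]rb_delta ?rb_delta //; exact: forms_alt.
have := d i j; have := d k l; have := E 1; have := E (-1); rewrite ler_norml => *.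
by apply/andP; split; lra.
Qed.

Lemma ev_pair S x y z w : S2so S -> ev S x y z w = ev S z w x y.
Proof. by move=> hS; rewrite !ev_rb rbC //; exact: forms_alt. Qed.

Lemma evD4 S x y z w w' : ev S x y z (w + w') = ev S x y z w + ev S x y z w'.
Proof.
rewrite /ev -big_split; apply: eq_bigr => i _; rewrite -big_split; apply: eq_bigr => j _.
rewrite -big_split; apply: eq_bigr => k _; rewrite -big_split; apply: eq_bigr => l _ /=.
by rewrite mxE; ring.
Qed.

Lemma evD3 S x y z z' w : S2so S -> ev S x y (z + z') w = ev S x y z w + ev S x y z' w.
Proof. by move=> hS; rewrite (ev_antir _ _ w) // evD4 opprD -!(ev_antir _ _ w). Qed.

Lemma evD2 S x y y' z w : S2so S -> ev S x (y + y') z w = ev S x y z w + ev S x y' z w.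
Proof. by move=> hS; rewrite ev_pair // evD4 ![ev S z w _ _]ev_pair. Qed.

Lemma evD1 S x x' y z w : S2so S -> ev S (x + x') y z w = ev S x y z w + ev S x' y z w.
Proof. by move=> hS; rewrite ev_pair // evD3 // ![ev S z w _ _]ev_pair. Qed.

Lemma evZ1 a S x y z w : S2so S -> ev S (a *: x) y z w = a * ev S x y z w.
Proof. by move=> hS; rewrite ev_pair // evZ3 // [ev S z w _ _]ev_pair. Qed.

Lemma ev_same S x z w : S2so S -> ev S x x z w = 0.
Proof. by move=> hS; have := ev_antil x x z w hS; lra. Qed.

Lemma ev_delta S i j k l : ev S (delta_mx 0 i) (delta_mx 0 j) (delta_mx 0 k) (delta_mx 0 l) = coord4 S i j k l.
Proof.
rewrite ev_rb -rb_delta; apply: eq_rb => -[a b]; rewrite /rt /= !mxE !eqxx /=;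
  by rewrite -natrM mulnb.
Qed.

Lemma flat_of_sectional S : (3 < n)%N -> CB S ->
  (forall x y, orthonormal [:: x; y] -> ev S x y x y = 0) -> S = 0.
Proof.
move=> n4 cS sec; have hS : S2so S by case: cS.
have sec' x y : ev S x y x y = 0.
  have [x0|x0] := eqVneq x 0; first by rewrite x0 -(scale0r y) evZ1 // mul0r.
  pose y' := y + (- (dot x y / dot x x)) *: x.
  have -> : ev S x y x y = ev S x y' x y'.
    rewrite /y' !(evD2, evD4) // !evZ2 !evZ4 ev_same // (ev_antir x y x x) // ev_pair // ev_same //.
    by rewrite (ev_antir x x x x) // ev_same //; ring.
  have [y0|y0] := eqVneq y' 0; first by rewrite y0 -(scale0r x) evZ2 mul0r.
  have dx : dot x x != 0 by rewrite dot_eq0.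
  have xy : dot x y' = 0 by rewrite /y' dotDr dotZr; field.
  have px : Num.sqrt (dot x x) != 0 by rewrite sqrtr_eq0 -ltNge lt_def dx dot_ge0.
  have py : Num.sqrt (dot y' y') != 0 by rewrite sqrtr_eq0 -ltNge lt_def dot_eq0 y0 dot_ge0.
  have : orthonormal [:: (Num.sqrt (dot x x))^-1 *: x; (Num.sqrt (dot y' y'))^-1 *: y'].
    rewrite /orthonormal /= -!/(dot _ _) !orthonormal_normalize // dotZl dotZr xy !mulr0.
    by rewrite !eqxx.
  move=> /sec; rewrite evZ1 // evZ2 evZ3 // evZ4 => /eqP.
  by rewrite !mulf_eq0 !invr_eq0 (negPf px) (negPf py) /= => /eqP.
have s2 x y z : ev S x y x z = 0.
  have := sec' x (y + z); rewrite evD2 // !evD4 !sec' (ev_pair x z x y hS); lra.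
have s3 x w y z : ev S x y w z + ev S w y x z = 0.
  have := s2 (x + w) y z; rewrite evD1 // !evD3 // !s2; lra.
apply: ext4 => i j k l; rewrite coord40 -ev_delta.
set x := delta_mx 0 i; set y := delta_mx 0 j; set z := delta_mx 0 k; set w := delta_mx 0 l.
have := ev_bianchi x y z w n4 cS; have := s3 x z y w; have := s3 y x z w; have := s3 x y z w.
have := ev_antil z y x w hS; have := ev_antil x z y w hS; have := ev_antil y x z w hS.
have := ev_antil y z x w hS; lra.
Qed.

Variable S : tensor R n.
Hypothesis (hS : S2so S) (pS : PIC S) (n5 : (4 < n)%N).
Variable Q : 'M[R]_n.
Hypothesis QQ : Q *m Q^T = 1%:M.
Let K i j := coord4 (rot Q S) i j i j.

Let hr : S2so (rot Q S). Proof. exact: rot_S2so. Qed.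
Let K0 i : K i i = 0.
Proof. by have [h _ _] := hr i i i i; rewrite /K; lra. Qed.
Let Ks i j : K i j = K j i.
Proof. by rewrite /K; have [-> _ _] := hr i j i j; have [_ -> _] := hr j i i j; rewrite opprK. Qed.

Lemma frame4 i j k l : uniq [:: i; j; k; l] -> orthonormal [:: row i Q; row j Q; row k Q; row l Q].
Proof.
rewrite /= !inE !negb_or => /and4P[/and3P[ij ik il] /andP[jk jl] kl _].
by rewrite /orthonormal /= -!/(dot _ _) !orth_dot // !eqxx (negPf ij) (negPf ik) (negPf il) (negPf jk) (negPf jl) (negPf kl) !eqxx.
Qed.

Lemma sectional_quad i j k l : uniq [:: i; j; k; l] -> 0 <= K i k + K i l + K j k + K j l.
Proof. by move=> /frame4 o4; rewrite /K !coord4_rot; exact: PIC_quad. Qed.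

Let rE i : ric (rot Q S) i i = \sum_p K i p.
Proof. by rewrite mxE. Qed.
Let scE : scal S = \sum_i \sum_p K i p.
Proof. by rewrite -(scal_rot _ (orthV QQ)) /scal /mxtrace; apply: eq_bigr => i _; exact: rE. Qed.

Let quadT i j k l : predT i -> predT j -> predT k -> predT l -> uniq [:: i; j; k; l] ->
  0 <= K i k + K i l + K j k + K j l.
Proof. by move=> _ _ _ _; exact: sectional_quad. Qed.

Let cT : #|(predT : pred 'I_n)| = n. Proof. by rewrite cardT size_enum_ord. Qed.

Lemma PIC_scal_ge0 : 0 <= scal S.
Proof. by rewrite scE; apply: (quad_total K0 Ks _ quadT); rewrite cT; lia. Qed.

Lemma PIC_sectional_le i j : i != j -> 2 * K i j <= ric (rot Q S) i i + ric (rot Q S) j j.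
Proof. by move=> ij; rewrite !rE; apply: (quad_pair K0 Ks _ quadT) => //; rewrite cT; lia. Qed.

Lemma PIC_ric_ge i : 0 <= (n%:R - 4) * ric (rot Q S) i i + scal S.
Proof. by rewrite scE rE -{1}cT; apply: (quad_single K0 Ks _ quadT) => //; rewrite cT; lia. Qed.

(** The hyperplane orthogonal to e_i has dimension at least 4, so [quad_total] applies to it: its
    scalar curvature scal S - 2 Ric_ii is nonnegative. *)
Lemma PIC_ric_le i : 2 * ric (rot Q S) i i <= scal S.
Proof.
have cP : #|predC1 i| = n.-1 by rewrite cardC1 card_ord.
have := @quad_total R 'I_n (predC1 i) K K0 Ks; rewrite cP.
have n4 : (3 < n.-1)%N by lia.
move=> /(_ n4) /(_ (fun a b c d _ _ _ _ => @sectional_quad a b c d)).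
have -> : \sum_(j | predC1 i j) \sum_(p | predC1 i p) K j p =
   \sum_(j | j != i) (\sum_p K j p - K j i).
  by apply: eq_bigr => j _; rewrite [in RHS](bigD1 i) //=; ring.
rewrite sumrB scE rE [X in _ -> _ <= X](bigD1 i) //=.
have -> : \sum_(j | j != i) K j i = \sum_p K i p.
  by rewrite [RHS](bigD1 i) //= K0 add0r; apply: eq_bigr => j _; rewrite Ks.
by lra.
Qed.

End Consequences.

Section Flat.
Variables (R : realType) (n : nat).
Implicit Types (S : tensor R n).

(** Ricci curvatures are nonnegative by [PIC_ric_ge] and sum to zero, so they vanish; sectional
    curvatures are then nonpositive by [PIC_sectional_le], with vanishing sums Ric_ii. *)
Lemma PIC_flat S : (4 < n)%N -> CB S -> PIC S -> scal S = 0 -> S = 0.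
Proof.
move=> n5 cS pS s0; have hS : S2so S by case: cS.
apply: flat_of_sectional => //; first by lia.
move=> x y oxy; have n2 : (2 <= n)%N by lia.
have [Q QQ rQ] := frame_of oxy n2.
have n0 : (0 < n)%N by lia. have n1 : (1 < n)%N by lia.
pose i := Ordinal n0; pose j := Ordinal n1.
have <- : row i Q = x by rewrite rQ.
have <- : row j Q = y by rewrite rQ.
rewrite -coord4_rot.
have ric0 p : ric (rot Q S) p p = 0.
  have r0 q : 0 <= ric (rot Q S) q q.
    have := PIC_ric_ge hS pS n5 QQ q; rewrite s0 addr0 pmulr_rge0 //.
    by rewrite subr_gt0 ltr_nat.
  have /eqP : \sum_q ric (rot Q S) q q = 0.
    by apply: etrans s0; rewrite -(scal_rot S (orthV QQ)).
  by rewrite psumr_eq0 // => /allP/(_ p (mem_index_enum _))/eqP.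
have hr := rot_S2so Q hS.
have Kle p q : coord4 (rot Q S) p q p q <= 0.
  have [->|pq] := eqVneq p q; first by have [] := hr q q q q; lra.
  by have := PIC_sectional_le hS pS n5 QQ pq; rewrite !ric0; lra.
have := ric0 i; rewrite mxE => /eqP; rewrite -oppr_eq0 -sumrN psumr_eq0; last first.
  by move=> p _; rewrite oppr_ge0.
by move=> /allP/(_ j (mem_index_enum _)); rewrite oppr_eq0 => /eqP.
Qed.

End Flat.

(** * Relations between the constants of the first cone *)

Section General.
Variables (R : realType) (n : nat) (b : R).
Hypothesis (n4 : (3 < n)%N) (b0 : 0 < b).
Let N : R := n%:R.
Let N4 : 4 <= N. Proof. by rewrite /N ler_nat. Qed.
Let g := gammaC n b.
Let a := aC n b.

Let d0 : 0 < 2 + (N - 3) * b.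
Proof. by have h : 0 <= (N - 3) * b; [apply: mulr_ge0; [have := N4; lra|exact: ltW]|lra]. Qed.
Let u0 : 0 < 2 + (N - 2) * b.
Proof. by have h : 0 <= (N - 2) * b; [apply: mulr_ge0; [have := N4; lra|exact: ltW]|lra]. Qed.
Let d1 : 2 + (N - 3) * b != 0. Proof. by rewrite gt_eqF. Qed.

Lemma gamma_eq : (2 + (N - 3) * b) * g = b.
Proof. by rewrite /g /gammaC -/N; field; exact: d1. Qed.

Lemma gamma_gt0 : 0 < g.
Proof. by rewrite /g /gammaC divr_gt0. Qed.

Lemma a_eq : 2 * a = (2 * b + (N - 2) * b ^+ 2) * (1 + g).
Proof. by rewrite /a /aC /g /gammaC -/N; field; exact: d1. Qed.

Lemma kappa_gamma : (2 * b + (N - 2) * b ^+ 2) * g = b ^+ 2 * (1 + g).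
Proof. by rewrite /g /gammaC -/N; field; exact: d1. Qed.

Lemma a_gt0 : 0 < a.
Proof.
have : 0 < 2 * a; last by rewrite pmulr_rgt0.
rewrite a_eq mulr_gt0 //; last by rewrite addr_gt0 // gamma_gt0.
have h : 0 <= (N - 2) * b ^+ 2 by apply: mulr_ge0; [have := N4; lra|exact: sqr_ge0].
by rewrite ltr_pwDl // mulr_gt0.
Qed.

Lemma m_gt0 : 0 < coefm n a.
Proof.
have h : 0 <= (N - 1) * a by apply: mulr_ge0; [have := N4; lra|exact: ltW a_gt0].
by rewrite /coefm -/N; lra.
Qed.

Lemma rho_eq : rhoC n b = b - 2 * (N - 1) / N * (g * (1 - 2 * b) / N + (1 + g) * ricbeta n a b).
Proof.
have m0 := m_gt0; have mn0 : coefm n a != 0 by rewrite gt_eqF.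
have Nn0 : N != 0 by rewrite gt_eqF //; have := N4; lra.
rewrite /rhoC /ricbeta -/N -/a -/g; move: mn0; rewrite /coefm -/N => mn0.
by field; rewrite Nn0 mn0.
Qed.

Let c3 : R := 4 * (1 + g) * (g + (N - 2) * b ^+ 2 * (1 + g)).

(** Thus [omegaC] is 1 - eps times the value at which the last hypothesis of [sum_evolution] becomes
    an equality. *)
Lemma omega_sq : 0 < rhoC n b ->
  32 / 27 * rhoC n b ^+ 3 * omegaC n b ^+ 2 * N ^+ 2 = (1 - eps R n) ^+ 2 * c3.
Proof.
move=> r0; have rn0 : rhoC n b != 0 by rewrite gt_eqF.
have Nn0 : N != 0 by rewrite gt_eqF //; have := N4; lra.
rewrite /omegaC -/N exprMn sqr_sqrtr; last first.
  apply: mulr_ge0; first by have := u0; lra.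
  rewrite divr_ge0 //; first exact: mulr_ge0 (ltW b0) (sqr_ge0 _).
  by apply: mulr_ge0 (sqr_ge0 _); apply: mulr_ge0 (sqr_ge0 _) (exprn_ge0 _ (ltW r0)).
rewrite /c3 /g /gammaC -/N; move: (rhoC n b) rn0 (1 - eps R n) => r rn0 e.
by field; rewrite Nn0 d1 rn0.
Qed.

Lemma omega_lower (w : R) : 0 < rhoC n b -> 0 < w -> 0 <= 1 - eps R n ->
  32 / 27 * rhoC n b ^+ 3 * w ^+ 2 * N ^+ 2 <= (1 - eps R n) ^+ 2 * c3 -> w <= omegaC n b.
Proof.
move=> r0 w0 e0; rewrite -omega_sq // => h.
have om0 : 0 <= omegaC n b by rewrite /omegaC mulr_ge0 ?sqrtr_ge0.
rewrite -(@ler_sqr R) ?nnegrE ?(ltW w0) //.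
have p : 0 < 32 / 27 * rhoC n b ^+ 3 by rewrite mulr_gt0 ?exprn_gt0 //; lra.
have N0 : 0 < N ^+ 2 by rewrite exprn_gt0 //; have := N4; lra.
by move: h; rewrite ler_pM2r // ler_pM2l.
Qed.

Lemma c3_gt0 : 0 < c3.
Proof.
have g0 := gamma_gt0; rewrite /c3 mulr_gt0 //; first lra.
have h : 0 <= (N - 2) * b ^+ 2 * (1 + g).
  apply: mulr_ge0; last lra.
  by apply: mulr_ge0; [have := N4; lra|exact: sqr_ge0].
by rewrite ltr_pwDl.
Qed.

Lemma omega_upper : 0 < rhoC n b -> 0 < eps R n -> eps R n < 1 ->
  32 / 27 * rhoC n b ^+ 3 * omegaC n b ^+ 2 * N ^+ 2 < c3.
Proof.
move=> r0 e0 e1; rewrite omega_sq // -[X in _ < X]mul1r ltr_pM2r ?c3_gt0 //.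
by move: (eps R n) e0 e1 => e e0 e1; nra.
Qed.

End General.

(** The rationals w, e, G replace omega in the difference estimate: w bounds omega from below, G
    bounds omega times the coefficient of |A|^2 in scal' from below, and e is the amount by which G
    / 2 may fall short of n - 2. *)
Definition stage1 (R : realType) (n : nat) (b a g rho om w e G : R) :=
  [/\ [/\ 0 < b, 0 < g, 0 < coefm n a & 0 < rho],
      0 < coefc n a b /\ coefc n a b <= b ^+ 2,
      0 <= ricbeta n a b, 0 <= 1 - 2 * b &
      [/\ w <= om, 0 < w, 0 <= e, G <= om * (2 * (1 + (n%:R - 2) * b) ^+ 2 / coefm n a) &
          n%:R - 2 - e <= G / 2]].

(** * Numerical values in dimensions 8 and 7 *)

Section Numerics.
Variable R : realType.

(** Of the two trailing bounds, the one on a serves the linear inequality of the first stage, and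
    the other supplies the factor 177/250 in the bound on [tau]. *)
Lemma stage1_8 : let b := bmax2 R 8 in
  stage1 8 b (aC 8 b) (gammaC 8 b) (rhoC 8 b) (omegaC 8 b) (53 / 10) (6 / 5) (97 / 10)
  /\ aC 8 b <= 67 / 1000 /\ (1 + gammaC 8 b) * (1 + 6 * b) <= 177 / 250 * coefm 8 (aC 8 b).
Proof.
have -> : bmax2 R 8 = 1 / 18 by [].
move=> b; have b0 : 0 < b by rewrite /b; lra.
have hg : gammaC 8 b = 1 / 41.
  have := gamma_eq (isT : (3 < 8)%N) b0; rewrite /b; lra.
have ha : aC 8 b = 49 / 738.
  have := a_eq (isT : (3 < 8)%N) b0; rewrite hg /b; lra.
have hm : coefm 8 (aC 8 b) = 712 / 369 by rewrite ha /coefm; lra.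
have hb : ricbeta 8 (aC 8 b) b = 13 / 3204.
  by rewrite /ricbeta hm ha /b; field.
have hr : rhoC 8 b = 31 / 712.
  by rewrite (rho_eq (isT : (3 < 8)%N) b0) hb hg /b; field.
have he : eps R 8 = 1 / 1000 by [].
have r0 : 0 < rhoC 8 b by rewrite hr; clear; lra.
have hw : 53 / 10 <= omegaC 8 b.
  by apply: (omega_lower (isT : (3 < 8)%N) b0); rewrite ?he ?hr ?hg /b; clear; lra.
have hc : coefc 8 (aC 8 b) b * (8 * (712 / 369)) = 8 * b ^+ 2 * (1 - 2 * b) - 2 * (49 / 738 - b) * (1 - 2 * b + 8 * b ^+ 2).
  by rewrite /coefc hm ha; field.
split; first split.
- by rewrite hg hm; split; clear -b0 r0; lra.
- by clear -hc; move: hc; rewrite /b => hc; split; lra.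
- by rewrite hb; clear; lra.
- by rewrite /b; clear; lra.
- by rewrite hm /b; split; clear -hw; lra.
- by rewrite hg hm ha /b; clear; split; lra.
Qed.

Lemma stage1_7 : let b := bmax2 R 7 in
  stage1 7 b (aC 7 b) (gammaC 7 b) (rhoC 7 b) (omegaC 7 b) (27 / 5) (1 / 5) (97 / 10)
  /\ aC 7 b <= 785 / 1000 / 10 /\ (1 + gammaC 7 b) * (1 + 5 * b) <= 3519 / 5000 * coefm 7 (aC 7 b).
Proof.
have -> : bmax2 R 7 = 131 / 2000 by [].
move=> b; have b0 : 0 < b by rewrite /b; lra.
have hg : gammaC 7 b = 131 / 4524.
  have := gamma_eq (isT : (3 < 7)%N) b0; rewrite /b; lra.
have ha := a_eq (isT : (3 < 7)%N) b0.
have hm := m_gt0 (isT : (3 < 7)%N) b0.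
have hM : coefm 7 (aC 7 b) = 1 + 12 * aC 7 b by rewrite /coefm; lra.
have hrho := rho_eq (isT : (3 < 7)%N) b0.
have hbe : ricbeta 7 (aC 7 b) b * (7 * coefm 7 (aC 7 b)) =
  49 * b ^+ 2 - 12 * (aC 7 b - b) * (1 - 2 * b).
  by rewrite /ricbeta; field; rewrite gt_eqF.
have hc : coefc 7 (aC 7 b) b * (7 * coefm 7 (aC 7 b)) =
    7 * b ^+ 2 * (1 - 2 * b) - 2 * (aC 7 b - b) * (1 - 2 * b + 7 * b ^+ 2).
  by rewrite /coefc; field; rewrite gt_eqF.
(* The exact fractions are unwieldy for n = 7; a short interval for a suffices to bound all other
   constants. *)
have a1 : (784 + 3 / 10) / 1000 / 10 <= aC 7 b <= 785 / 1000 / 10.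
  by move: ha; rewrite hg /b => ha; apply/andP; split; lra.
rewrite /stage1; move: (aC 7 b) a1 ha hm hM hrho hbe hc => a /andP[a1 a2] ha hm hM.
have M7 : 0 < 7 * coefm 7 a by lra.
move: (coefc 7 a b) (ricbeta 7 a b) => c be hrho hbe hc.
have b1 : 549 / 1000 / 100 <= be.
  by rewrite -(ler_pM2r M7) hbe hM /b; clear -a1 a2; lra.
have b2 : be <= 6 / 1000.
  by rewrite -(ler_pM2r M7) hbe hM /b; clear -a1 a2; lra.
have c1 : 0 < c by rewrite -(pmulr_lgt0 _ M7) hc /b; clear -a1 a2; lra.
have c2 : c <= b ^+ 2 by rewrite -(ler_pM2r M7) hc hM /b; clear -a1 a2; lra.
have r0 : 0 < rhoC 7 b by rewrite hrho hg /b; clear -b2; lra.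
have r1 : rhoC 7 b <= 497 / 1000 / 10.
  by rewrite hrho hg /b; clear -b1; lra.
have r3 : rhoC 7 b ^+ 3 <= (497 / 1000 / 10) ^+ 3.
  by apply: lerXn2r; rewrite ?nnegrE; [exact: ltW|clear; lra|exact: r1].
have he : eps R 7 = 1 / 10000 by [].
have hw : 27 / 5 <= omegaC 7 b.
  apply: (omega_lower (isT : (3 < 7)%N) b0); rewrite ?he ?hg; [exact: r0|by clear; lra|by clear; lra|].
  by rewrite /b; move: r3; rewrite /b; clear; lra.
split; first split.
- by rewrite hg; split; [exact: b0|clear; lra|exact: hm|exact: r0].
- exact: conj c1 c2.
- by clear -b1; lra.
- by rewrite /b; clear; lra.
- have mu : (2 * (1 + (7 - 2) * b) ^+ 2 / coefm 7 a) * coefm 7 a = 2 * (1 + (7 - 2) * b) ^+ 2.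
    by rewrite divfK // gt_eqF.
  split; [exact: hw|by clear; lra|by clear; lra| |by clear; lra].
  have x0 : 0 < coefm 7 a by exact: hm.
  move: (omegaC 7 b) hw => om hw.
  rewrite -(ler_pM2r x0) -[X in _ <= X]mulrA mu mulrC [om * _]mulrC.
  rewrite hM; apply: (@le_trans _ _ (2 * (1 + (7 - 2) * b) ^+ 2 * (27 / 5))).
    by rewrite /b; clear -a2; lra.
  rewrite ler_pM2l; first exact: hw.
  by rewrite /b; clear; lra.
- by rewrite hg hM /b; clear -a1 a2; split; lra.
Qed.

End Numerics.

(** * Scalar inequalities behind the Ricci conditions *)

Section DifferenceArithmetic.
Variable R : realType.

(** Applied with z = r x and z = - r x to the mixed components. Completing the square in y leaves a
    form in x and z that is nonnegative once G >= 97/10. *)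
Lemma mixed_form8 (G x y z : R) : 97 / 10 <= G ->
  0 <= 2 * y ^+ 2 + 2 / 6 * (x - y) ^+ 2 - 8 * y * z - 8 * (1 / 18) * x * z + 2 * G * z ^+ 2.
Proof.
move=> hG; have h1 := sqr_ge0 (7 * y - x - 12 * z); have h2 := sqr_ge0 (x - 3 * z).
have h3 := sqr_ge0 x; have h4 := sqr_ge0 z.
have h5 : 0 <= (G - 97 / 10) * z ^+ 2 by rewrite mulr_ge0 // subr_ge0.
lra.
Qed.

Lemma mixed_form7 (G x y z : R) : 97 / 10 <= G ->
  0 <= 2 * y ^+ 2 + 2 / 5 * (x - y) ^+ 2 - 8 * y * z - 8 * (131 / 2000) * x * z + 2 * G * z ^+ 2.
Proof.
move=> hG; have h1 := sqr_ge0 (6 * y - x - 10 * z); have h2 := sqr_ge0 (x - 3 * z).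
have h3 := sqr_ge0 x; have h4 := sqr_ge0 z.
have h5 : 0 <= (G - 97 / 10) * z ^+ 2 by rewrite mulr_ge0 // subr_ge0.
lra.
Qed.

(** Substituting d = r omega N s for one factor of d^2 / k makes every term a multiple of r d or a
    square with nonnegative coefficient. After division by r d only the summand e r d is not linear
    in q and s; [difference_linear] bounds it. *)
Lemma difference_arith (k N b a om e G r s q d m : R) :
  0 < k -> 0 < r -> 0 < d -> r * om * N * s = d -> 0 <= G -> k - e <= (G + 4) / 2 ->
  0 < om * N * s / k + q * (4 / k + 2 + 8 * b) + s * (2 * m - 8 * a * k) - e * r * d ->
  0 < (d + 2 * r * q) ^+ 2 / k + G * r ^+ 2 * (q ^+ 2 / k) - k * r ^+ 2 * d ^+ 2
      + (G + 4) * r ^+ 2 * ((q ^+ 2 + d ^+ 2) / 2) + 2 * r * d * (q + 2 * s)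
      - 4 * r * s * d + 8 * r * b * q * d - 8 * r * a * k * s * d
      + 2 * m * r * s * d.
Proof.
move=> k0 r0 d0 er G0 he L0.
have kn : k != 0 by rewrite gt_eqF.
have h1 := mulr_gt0 (mulr_gt0 r0 d0) L0.
have h2 : 0 <= ((G + 4) / 2 - (k - e)) * (r * d) ^+ 2 by rewrite mulr_ge0 ?sqr_ge0 // subr_ge0.
have h3 : 0 <= (4 / k + G / k + (G + 4) / 2) * (r * q) ^+ 2.
  rewrite mulr_ge0 ?sqr_ge0 //.
  have i0 : 0 < k^-1 by rewrite invr_gt0.
  by have := mulr_ge0 G0 (ltW i0); lra.
have e1 : d ^+ 2 / k = r * d * (om * N * s / k) by rewrite -[d ^+ 2]/(d * d) -{1}er; field.
have -> : (d + 2 * r * q) ^+ 2 / k = d ^+ 2 / k + r * d * q * (4 / k) + 4 / k * (r * q) ^+ 2 by field.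
rewrite e1; apply: lt_le_trans h1 _; rewrite -subr_ge0; apply: le_trans (addr_ge0 h2 h3) _.
by rewrite le_eqVlt; apply/orP; left; apply/eqP; field.
Qed.

(** From d <= N (1 + g) s follows r omega <= 1 + g, hence r <= (1 + g) / w; the remaining factor d
    is bounded by D. *)
Lemma difference_linear (N om w g e r s d D : R) : 0 < w -> w <= om -> 0 <= e -> 0 < s -> 0 < N -> 0 < r ->
  r * om * N * s = d -> d <= N * ((1 + g) * s) -> 0 <= 1 + g -> d <= D ->
  e * r * d <= e * ((1 + g) / w) * D.
Proof.
move=> w0 wo e0 s0 N0 r0 er dN g0 dD.
have o0 := lt_le_trans w0 wo.
have d0 : 0 <= d by rewrite -er !mulr_ge0 // ltW.
have rw : r <= (1 + g) / w.
  rewrite ler_pdivlMr //; apply: (@le_trans _ _ (r * om)); first by rewrite ler_pM2l.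
  rewrite -(ler_pM2r (mulr_gt0 N0 s0)); move: dN; rewrite -er; lra.
have g1 : 0 <= (1 + g) / w by rewrite divr_ge0 // ltW.
rewrite -mulrA -[X in _ <= X]mulrA; apply: ler_wpM2l => //.
by apply: ler_pM => //; exact: ltW.
Qed.

(** The eigenvalue of Ric(D), without its |A|^2 term, on an eigenvector of A with eigenvalue l, for
    k = n - 2 and a = b + k b^2 / 2. *)
Definition ric_symbol (k N b s l : R) : R :=
  - 4 * b * l ^+ 2 + 4 * (b + k / 2 * b ^+ 2) * k * s * l + 4 * (b + k / 2 * b ^+ 2) * (N - 1) * s ^+ 2.

(** Put v = p1 + p2 + 2 tau s, which lies in [0, N tau s]. The squares of v and of p1 - p2 are
    bounded by expressions affine in v, so the whole estimate becomes affine in v: the penultimate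
    hypothesis is positivity at v = 0, the last one controls the slope. *)
Lemma second_pair (k N b tau s p1 p2 : R) : 0 < b -> 0 < s -> 0 <= tau -> N = k + 2 -> 2 <= k ->
  - 2 * tau * s <= p1 + p2 -> p1 + p2 <= k * (tau * s) ->
  p1 + p2 <= k * (p2 + 2 * (tau * s)) -> p1 + p2 <= k * (p1 + 2 * (tau * s)) ->
  0 < (1 + k * b / 2) * (8 * (N - 1) - 8 * k * tau) - 2 * (4 + 4 * N ^+ 2 / k ^+ 2) * tau ^+ 2 ->
  2 * tau * (k - 2) + 2 * N * tau * (1 - 4 / k ^+ 2) <= 4 * k ->
  0 < ric_symbol k N b s p1 + ric_symbol k N b s p2.
Proof.
move=> b0 s0 t0 eN k2 lo hi h2 h1 A0 B0.
have k0 : 0 < k by lra. have kn : k != 0 by rewrite gt_eqF.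
set q := p1 + p2 in lo hi h2 h1; pose v := q + 2 * tau * s; pose d := p1 - p2.
pose S := tau * s. have S0 : 0 <= S by rewrite mulr_ge0 // ltW.
have v0 : 0 <= v by rewrite /v; lra.
have v1 : v <= N * S by rewrite /v /S eN; lra.
pose D := 2 * N * S + (k - 2) * v.
have D0 : 0 <= D by rewrite /D addr_ge0 // mulr_ge0 //; [rewrite eN; lra|lra].
have dd : k * d <= D by rewrite /D /v /d /S eN; move: h2; rewrite /q /S; lra.
have dd' : - D <= k * d by rewrite /D /v /d /S eN; move: h1; rewrite /q /S; lra.
have kd2 : (k * d) ^+ 2 <= D ^+ 2.
  by rewrite -subr_ge0 subr_sqr mulr_ge0 //; lra.
have vv : v * v <= N * S * v by rewrite ler_wpM2r.
have D2 : D ^+ 2 <= 4 * N ^+ 2 * S ^+ 2 + N * S * v * (k ^+ 2 - 4).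
  have := mulr_ge0 (sqr_ge0 (k - 2)) (_ : 0 <= N * S * v - v * v); rewrite subr_ge0 => /(_ vv).
  rewrite /D; lra.
have q2 : q ^+ 2 <= 4 * S ^+ 2 + v * S * (k - 2).
  have -> : q = v - 2 * S by rewrite /v /S; ring.
  by move: vv; rewrite eN; lra.
have d2 : d ^+ 2 <= (4 * N ^+ 2 * S ^+ 2 + N * S * v * (k ^+ 2 - 4)) / k ^+ 2.
  rewrite ler_pdivlMr ?exprn_gt0 //; apply: le_trans D2; apply: le_trans kd2.
  by rewrite exprMn mulrC.
have -> : ric_symbol k N b s p1 + ric_symbol k N b s p2 = b * (- 2 * (q ^+ 2 + d ^+ 2) + (1 + k * b / 2) * (4 * k * s * q + 8 * (N - 1) * s ^+ 2)).
  by rewrite /ric_symbol /q /d; field.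
rewrite pmulr_rgt0 //.
have B1 : 0 <= v * s * (4 * k - (2 * tau * (k - 2) + 2 * N * tau * (1 - 4 / k ^+ 2))).
  by rewrite !mulr_ge0 ?(ltW s0) // subr_ge0.
have B2 : 0 <= v * s * (k ^+ 2 * b) by exact: mulr_ge0 (mulr_ge0 v0 (ltW s0)) (mulr_ge0 (sqr_ge0 k) (ltW b0)).
have A1 := mulr_gt0 (exprn_gt0 2 s0) A0.
have -> : q = v - 2 * S by rewrite /v /S; ring.
have q2' : (v - 2 * S) ^+ 2 <= 4 * S ^+ 2 + v * S * (k - 2).
  by have -> : v - 2 * S = q by rewrite /v /S; ring.
apply: (@lt_le_trans _ _ (- 2 * (4 * S ^+ 2 + v * S * (k - 2) + (4 * N ^+ 2 * S ^+ 2 + N * S * v * (k ^+ 2 - 4)) / k ^+ 2)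
   + (1 + k * b / 2) * (4 * k * s * (v - 2 * S) + 8 * (N - 1) * s ^+ 2))); last by lra.
apply: lt_le_trans A1 _; rewrite -subr_ge0; apply: le_trans (addr_ge0 B1 (_ : 0 <= 2 * (v * s * (k ^+ 2 * b)))) _; first by rewrite mulr_ge0.
by rewrite le_eqVlt; apply/orP; left; apply/eqP; rewrite /S; field.
Qed.

(** In the bound on [tau] the factor 1 + 8 b is the estimate of [coef_ratio] and 177/250 comes from
    [stage1_8]. The restriction b <= 1/40 keeps this bound within reach of [second_pair]. *)
Lemma second_cond8 (b tau : R) : 0 < b -> b <= 1 / 40 -> 0 <= tau -> tau <= 177 / 250 * (1 + 8 * b) ->
  [/\ tau <= 1, 0 < (1 + 6 * b / 2) * (8 * (8 - 1) - 8 * 6 * tau) - 2 * (4 + 4 * 8 ^+ 2 / 6 ^+ 2) * tau ^+ 2 &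
  2 * tau * (6 - 2) + 2 * 8 * tau * (1 - 4 / 6 ^+ 2) <= 4 * 6].
Proof.
move=> b0 b1 t0 t1; set T := 177 / 250 * (1 + 8 * b) in t1.
have T1 : T <= 177 / 250 * (1 + 8 / 40) by rewrite /T; lra.
split; [lra| |lra].
have t2 : tau ^+ 2 <= T ^+ 2 by rewrite lerXn2r ?nnegrE //; lra.
have m : b * tau <= b * T by rewrite ler_pM2l.
have bb : 0 <= b * (1 / 40 - b) by rewrite mulr_ge0 ?(ltW b0) // subr_ge0.
by move: t2 m; rewrite /T in t1 *; lra.
Qed.

Lemma second_cond7 (b tau : R) : 0 < b -> b <= 3 / 125 -> 0 <= tau -> tau <= 3519 / 5000 * (1 + 7 * b) ->
  [/\ tau <= 1, 0 < (1 + 5 * b / 2) * (8 * (7 - 1) - 8 * 5 * tau) - 2 * (4 + 4 * 7 ^+ 2 / 5 ^+ 2) * tau ^+ 2 &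
  2 * tau * (5 - 2) + 2 * 7 * tau * (1 - 4 / 5 ^+ 2) <= 4 * 5].
Proof.
move=> b0 b1 t0 t1; set T := 3519 / 5000 * (1 + 7 * b) in t1.
have T1 : T <= 3519 / 5000 * (1 + 21 / 125) by rewrite /T; lra.
split; [lra| |lra].
have t2 : tau ^+ 2 <= T ^+ 2 by rewrite lerXn2r ?nnegrE //; lra.
have m : b * tau <= b * T by rewrite ler_pM2l.
have bb : 0 <= b * (3 / 125 - b) by rewrite mulr_ge0 ?(ltW b0) // subr_ge0.
by move: t2 m; rewrite /T in t1 *; lra.
Qed.

End DifferenceArithmetic.

(** * Planes minimizing the trace of a quadratic form *)

Section Planes.
Variable R : realType.

(** First variation: the plane attains the minimum 0, and rotating x towards v with y fixed cannot
    go below it. *)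
Lemma two_nonneg_minimal n (E : 'M[R]_n) x y v : E^T = E -> two_nonneg E ->
  orthonormal [:: x; y; v] -> bform E x x + bform E y y = 0 -> bform E x v = 0.
Proof.
move=> ET H2; rewrite /orthonormal /= !andbT -!/(dot _ _).
move=> /andP[/and3P[/eqP xx /eqP yy /eqP vv] /andP[/andP[/eqP xy /eqP xv] /eqP yv]] e0.
have P0 : 0 <= bform E v v + bform E y y by apply: H2 => //; rewrite dotC.
set P := _ + _ in P0; set c := bform E x v.
have key t : 0 <= 2 * t * c + t ^+ 2 * P.
  pose N := 1 + t ^+ 2; have N0 : 0 < N by rewrite /N ltr_pwDl // sqr_ge0.
  pose f := x + t *: v.
  have ff : dot f f = N by rewrite /f !(dotDl, dotDr, dotZl, dotZr) xx vv (dotC v x) xv /N; ring.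
  have f0 : f != 0 by rewrite -dot_eq0 ff gt_eqF.
  have := H2 ((Num.sqrt (dot f f))^-1 *: f) y (orthonormal_normalize f0) yy.
  rewrite dotZl [dot f y]dotDl dotZl xy (dotC v y) yv !mulr0 addr0 mulr0 => /(_ erefl).
  rewrite bformZl bformZr ff mulrA -invfM -expr2 sqr_sqrtr ?(ltW N0) //.
  have e : bform E f f = bform E x x + 2 * t * c + t ^+ 2 * bform E v v.
    by rewrite /f !(bformDl, bformDr, bformZl, bformZr) (bform_sym v x ET) -/c; ring.
  rewrite e -(pmulr_rge0 _ N0) mulrDr mulrA mulfV ?gt_eqF // mul1r.
  have -> : bform E x x = - bform E y y by lra.
  by have -> : - bform E y y + 2 * t * c + t ^+ 2 * bform E v v + N * bform E y y = 2 * t * c + t ^+ 2 * P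
    by rewrite /N /P; ring.
have [//|cn] := eqVneq c 0.
have := key (- c / (P + 1)).
have Pn : P + 1 != 0 by rewrite gt_eqF //; lra.
have -> : 2 * (- c / (P + 1)) * c + (- c / (P + 1)) ^+ 2 * P = - (c ^+ 2 * (P + 2) / (P + 1) ^+ 2).
  by field.
rewrite oppr_ge0 leNgt divr_gt0 ?exprn_gt0 //; try lra.
by rewrite mulr_gt0 //; [rewrite lt_def sqrf_eq0 cn sqr_ge0|lra].
Qed.

(** By [two_nonneg_minimal] the plane is invariant under E, so E is block diagonal and each block is
    diagonalized separately. Rotating within the plane preserves traces over it. *)
Lemma plane_diagonal n (E : 'M[R]_n) x y : (2 < n)%N -> E^T = E -> two_nonneg E ->
  orthonormal [:: x; y] -> bform E x x + bform E y y = 0 ->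
  exists (Q : 'M[R]_n) (i j : 'I_n), [/\ Q *m Q^T = 1%:M, i != j,
    forall p q, p != q -> rotm Q E p q = 0 &
    forall M : 'M[R]_n, rotm Q M i i + rotm Q M j j = bform M x x + bform M y y].
Proof.
move=> n2; have [k ek] : exists k, n = (2 + k)%N by exists (n - 2)%N; lia.
move: n2 E x y; rewrite {n}ek => n2 E x y ET H2 oxy e0.
have [Q0 QQ rQ] := frame_of oxy (ltnW n2).
pose i : 'I_(2 + k) := lshift k 0; pose j : 'I_(2 + k) := lshift k 1.
have ri : row i Q0 = x by rewrite rQ. have rj : row j Q0 = y by rewrite rQ.
have Q0T := orthV QQ.
set M := rotm Q0 E.
have MT : M^T = M by rewrite /M /rotm !trmx_mul trmxK ET mulmxA.
have off (a : 'I_2) (p : 'I_k) : M (lshift k a) (rshift 2 p) = 0.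
  rewrite /M -bform_row; have np u : rshift 2 p != lshift k u by rewrite eq_sym eq_lrshift.
  have or3 u v : (u, v) = (i, j) \/ (u, v) = (j, i) -> orthonormal [:: row u Q0; row v Q0; row (rshift 2 p) Q0].
    move=> uv; rewrite /orthonormal /= !andbT -!/(dot _ _) !orth_dot // !eqxx /=.
    by case: uv => -[-> ->]; rewrite ?(eq_sym _ (rshift 2 p)) ?(negPf (np _)) /= eqxx.
  have [->|->] : a = 0 \/ a = 1 by case: a => [[|[|?]] ?] //; [left|right]; exact: val_inj.
    by apply: (two_nonneg_minimal ET H2 (or3 i j (or_introl erefl))); rewrite ri rj.
  by apply: (two_nonneg_minimal ET H2 (or3 j i (or_intror erefl))); rewrite ri rj addrC.
have Mdef : rotm Q0 E = M by [].
clearbody M.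
have ur0 : ursubmx M = 0 by apply/matrixP => u v; rewrite !mxE off.
have dl0 : dlsubmx M = 0 by rewrite -[M]MT -trmx_ursub ur0 trmx0.
have ulT : (ulsubmx M)^T = ulsubmx M by rewrite -{2}[M]MT trmx_ulsub.
have drT : (drsubmx M)^T = drsubmx M by rewrite -{2}[M]MT trmx_drsub.
have [Q2 [QQ2 d1]] := real_spectral ulT.
have [Q3 [QQ3 d2]] := real_spectral drT.
pose Q1 := block_mx Q2 0 0 Q3.
have QQ1 : Q1 *m Q1^T = 1%:M.
  by rewrite /Q1 tr_block_mx !trmx0 mulmx_block !mulmx0 !mul0mx !addr0 !add0r QQ2 QQ3 -scalar_mx_block.
have rotmM (A : 'M[R]_(2 + k)) : rotm (Q1 *m Q0) A = rotm Q1 (rotm Q0 A).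
  by rewrite /rotm trmx_mul !mulmxA.
have blk (A : 'M[R]_(2 + k)) : rotm Q1 A = block_mx (rotm Q2 (ulsubmx A)) (Q2 *m ursubmx A *m Q3^T)
    (Q3 *m dlsubmx A *m Q2^T) (rotm Q3 (drsubmx A)).
  rewrite -{1}[A]submxK /rotm /Q1 tr_block_mx !trmx0 !mulmx_block.
  by rewrite !mulmx0 !mul0mx !addr0 !add0r.
exists (Q1 *m Q0), i, j; split.
- by rewrite trmx_mul mulmxA -(mulmxA Q1) QQ mulmx1.
- by rewrite eq_lshift.
- move=> p q; rewrite rotmM Mdef blk ur0 dl0 !mulmx0 !mul0mx.
  case: (split_ordP p) => p' ->; case: (split_ordP q) => q' -> pq.
  + by rewrite block_mxEul d1 //; apply: contraNneq pq => ->.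
  + by rewrite block_mxEur mxE.
  + by rewrite block_mxEdl mxE.
  + by rewrite block_mxEdr d2 //; apply: contraNneq pq => ->.
- move=> A; rewrite rotmM blk !block_mxEul -ri -rj !bform_row.
  have := tr_rotm (ulsubmx (rotm Q0 A)) (orthV QQ2).
  rewrite /mxtrace !big_ord_recl !big_ord0 !addr0.
  have -> : lift ord0 ord0 = 1 :> 'I_2 by exact: val_inj.
  have -> : ord0 = 0 :> 'I_2 by [].
  by move=> ->; rewrite !mxE.
Qed.

End Planes.

Section PlaneSums.
Variables (R : realType) (n : nat).
Implicit Types (S T U : tensor R n) (x y z w : 'rV[R]_n).

(* The sum over p >= 3 of T_1p1p + T_2p2p, without the frame. *)
Definition nplane T x y : R :=
  bform (ric T) x x + bform (ric T) y y - 2 * ev T x y x y.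

Lemma bform_ric_row T (Q : 'M[R]_n) i j : Q *m Q^T = 1%:M ->
  bform (ric T) (row i Q) (row j Q) = ric (rot Q T) i j.
Proof. by move=> QQ; rewrite bform_row ric_rot // orthV. Qed.

Lemma nplane_frame T (Q : 'M[R]_n) i j : S2so T -> Q *m Q^T = 1%:M -> i != j ->
  nplane T (row i Q) (row j Q) = plane_sum (rot Q T) i j.
Proof.
move=> hT QQ ij; rewrite /nplane !bform_ric_row // -coord4_rot /plane_sum.
rewrite ![ric _ _ _]mxE !(sum_rest _ ij) big_split /=.
have h := rot_S2so Q hT; have [h1 _ _] := h i i i i; have [h2 _ _] := h j j j j.
have [h3 _ _] := h i j i j; have [_ h4 _] := h j i i j; lra.
Qed.

Lemma nplane_ge0 T x y : (1 < n)%N -> S2so T -> nonneg_def T -> orthonormal [:: x; y] ->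
  0 <= nplane T x y.
Proof.
move=> n2 hT pT oxy; have [Q QQ rQ] := frame_of oxy n2.
pose i : 'I_n := Ordinal (ltnW n2); pose j : 'I_n := Ordinal n2.
have <- : row i Q = x by rewrite rQ. have <- : row j Q = y by rewrite rQ.
rewrite nplane_frame //; apply: sumr_ge0 => p _.
have d a b : 0 <= coord4 (rot Q T) a b a b.
  by rewrite coord4_rot ev_rb; exact: nonneg_qf.
by rewrite addr_ge0.
Qed.

Lemma nplaneD T U x y : nplane (T + U) x y = nplane T x y + nplane U x y.
Proof. by rewrite /nplane ricD !bformDm evD; ring. Qed.

Lemma nplaneZ a T x y : nplane (a *: T) x y = a * nplane T x y.
Proof. by rewrite /nplane ricZ !bformZm evZ; ring. Qed.

Lemma nplane_unit x y : (2 < n)%N -> orthonormal [:: x; y] -> 0 < nplane (wedge 1%:M 1%:M) x y.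
Proof.
move=> n3; rewrite /orthonormal /= !andbT -!/(dot _ _).
move=> /andP[/andP[/eqP xx /eqP yy] /eqP xy].
have tn (v : 'rV[R]_n) : bform n%:R%:M v v = n%:R * dot v v by rewrite -scalemx1 bformZm bform1.
rewrite /nplane ric_wedge1 !bformDm !bformZm ev_wedge mxtrace1 !tn !bform1.
rewrite xx yy xy (dotC y x) xy.
have : 3 <= n%:R :> R by rewrite ler_nat.
lra.
Qed.

Lemma rot_tfric (Q : 'M[R]_n) S : Q *m Q^T = 1%:M -> tfric (rot Q S) = rotm Q (tfric S).
Proof.
move=> QQ; rewrite /tfric /smean (scal_rot _ (orthV QQ)) (ric_rot _ (orthV QQ)).
by rewrite /rotm mulmxBr mulmxBl mul_mx_scalar -scalemxAl QQ scalemx1.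
Qed.

Lemma rot_defect (Q : 'M[R]_n) a b S : Q *m Q^T = 1%:M -> rot Q (defect a b S) = defect a b (rot Q S).
Proof.
move=> QQ; rewrite /defect /= rot_tfric // /smean (scal_rot _ (orthV QQ)).
rewrite !(rotD, rotZ) !rot_wedge ?(orthV QQ) // rotm1 // -(rotm_mul _ _ (orthV QQ)).
by rewrite (tr_rotm _ (orthV QQ)).
Qed.

Lemma sharp2_split U T : sharp2 (U + T) (U + T) - sharp2 T T = sharp2 U U + 2 *: sharp2 U T.
Proof.
apply: ext4 => i j k l; rewrite [LHS]coord4D coord4N [RHS]coord4D coord4Z !coord4_sharp2 mulr_sumr -sumrB -big_split.
apply: eq_bigr => p _ /=; rewrite mulr_sumr -sumrB -big_split; apply: eq_bigr => q _ /=.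
by rewrite !coord4D; ring.
Qed.

Lemma nonneg_add S T : nonneg_def S -> nonneg_def T -> nonneg_def (S + T).
Proof.
move=> hS hT phi ph; have := addr_ge0 (hS _ ph) (hT _ ph).
rewrite -big_split /= (eq_bigr (fun i => \sum_j \sum_k \sum_l coord4 (S + T) i j k l * phi i j * phi k l)) // => i _.
rewrite -big_split; apply: eq_bigr => j _; rewrite -big_split; apply: eq_bigr => k _.
by rewrite -big_split; apply: eq_bigr => l _ /=; rewrite coord4D; ring.
Qed.

Lemma form_unit (phi : 'M[R]_n) : phi^T = - phi ->
  \sum_(i < n) \sum_(j < n) \sum_(k < n) \sum_(l < n)
    coord4 (wedge 1%:M 1%:M : tensor R n) i j k l * phi i j * phi k l = 4 * \sum_i \sum_j phi i j ^+ 2.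
Proof.
move=> ph; rewrite mulr_sumr; apply: eq_bigr => i _; rewrite mulr_sumr; apply: eq_bigr => j _.
have e : phi j i = - phi i j by have /matrixP/(_ i j) := ph; rewrite !mxE.
transitivity (\sum_k \sum_l ((2 * phi i j * (i == k)%:R) * (phi k l * (j == l)%:R)
    - (2 * phi i j * (j == k)%:R) * (phi k l * (i == l)%:R))).
  by apply: eq_bigr => k _; apply: eq_bigr => l _; rewrite coord4_wedge !mxE; ring.
under eq_bigr do rewrite sumrB -!mulr_sumr !sum_delta'.
rewrite sumrB.
rewrite (eq_bigr (fun k => (2 * phi i j * phi k j) * (i == k)%:R)) => [|k _]; last by ring.
rewrite [X in _ - X](eq_bigr (fun k => (2 * phi i j * phi k i) * (j == k)%:R)) => [|k _]; last by ring.
by rewrite !sum_delta' e; ring.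
Qed.

Lemma wedge1_S2so : S2so (wedge 1%:M 1%:M : tensor R n).
Proof. by have [] := @CB_wedge R n 1%:M 1%:M (trmx1 _ _) (trmx1 _ _). Qed.

Lemma picv_unit x y z w : orthonormal [:: x; y; z; w] -> picv (wedge 1%:M 1%:M) x y z w = 8.
Proof.
move=> /bform_frame1 [e1 e2 e3 e4].
by rewrite picv_wedge ?trmx1 // e1 e2 e3 e4; ring.
Qed.

(** Tested at the minimum, where t and 1 - t are proportional to d and W. *)
Lemma quadratic_disc (W N d : R) : 0 < W -> 0 <= d ->
  (forall t, 0 <= t <= 1 -> 0 <= t ^+ 2 * W + (1 - t) ^+ 2 * N - 2 * t * (1 - t) * d) -> d ^+ 2 <= W * N.
Proof.
move=> W0 d0 h; have s0 : 0 < d + W by rewrite ltr_wpDl.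
have sn : d + W != 0 by rewrite gt_eqF.
have := h (d / (d + W)); rewrite divr_ge0 ?(ltW s0) // ler_pdivrMr // mul1r lerDl (ltW W0) => /(_ isT).
have -> : (d / (d + W)) ^+ 2 * W + (1 - d / (d + W)) ^+ 2 * N - 2 * (d / (d + W)) * (1 - d / (d + W)) * d =
  W * (W * N - d ^+ 2) / (d + W) ^+ 2 by field.
by rewrite pmulr_lge0 ?invr_gt0 ?exprn_gt0 // pmulr_rge0 // subr_ge0.
Qed.

End PlaneSums.

(** * Velocities for the two cones *)

Section FirstStage.
Variables (R : realType) (n : nat) (b w e G : R).
Let a := aC n b.
Let g := gammaC n b.
Let om := omegaC n b.
Let N : R := n%:R.
Hypothesis n5 : (5 < n)%N.
Hypothesis st : stage1 n b a g (rhoC n b) om w e G.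
Hypothesis omu : 32 / 27 * rhoC n b ^+ 3 * om ^+ 2 * N ^+ 2 <
   4 * (1 + g) * (g + (N - 2) * b ^+ 2 * (1 + g)).
Hypothesis mixed : forall H x y z : R, G <= H ->
  0 <= 2 * y ^+ 2 + 2 / (N - 2) * (x - y) ^+ 2 - 8 * y * z - 8 * b * x * z + 2 * H * z ^+ 2.
Hypothesis linear : forall s q : R, 0 < s -> 0 <= q ->
  0 < w * N * s / (N - 2) + (q - 2 * ((1 + g) * s)) * (4 / (N - 2) + 2 + 8 * b)
    + s * (2 * coefm n a - 8 * a * (N - 2))
    - e * ((1 + g) / w) * ((2 * N * ((1 + g) * s) + (N - 4) * q) / (N - 2)).
Hypothesis G4 : 4 <= G.

Variables (S T : tensor R n).
Hypotheses (cS : CB S) (hT : S2so T) (pT : nonneg_def T) (pU : PIC (S - T)).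
Let s := smean S.
Hypothesis s0 : 0 < s.
Hypothesis ricS : forall x y, orthonormal [:: x; y] ->
  0 <= bform (ric S) x x + bform (ric S) y y + 2 * g / N * scal S.
Hypothesis diffS : forall x y t, orthonormal [:: x; y] -> 0 <= t <= 1 ->
  0 <= t ^+ 2 * (om * scal S) + (1 - t) ^+ 2 * nplane T x y
       - 2 * t * (1 - t) * (bform (ric S) y y - bform (ric S) x x).

Let hS : S2so S. Proof. by case: cS. Qed.
Let hU : S2so (S - T). Proof. by have := S2so_comb (-1) hT hS; rewrite scaleN1r addrC. Qed.
Let N6 : 6 <= N. Proof. by rewrite /N ler_nat. Qed.
Let b0 : 0 < b. Proof. by case: st => -[]. Qed.
Let g0 : 0 < g. Proof. by case: st => -[]. Qed.
Let m0 : 0 < coefm n a. Proof. by case: st => -[]. Qed.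
Let mn0 : coefm n a != 0. Proof. by rewrite gt_eqF. Qed.
Let rho0 : 0 < rhoC n b. Proof. by case: st => -[]. Qed.
Let c0 : 0 < coefc n a b. Proof. by case: st => _ []. Qed.
Let n0 : n != 0%N. Proof. by rewrite -lt0n; apply: ltn_trans n5. Qed.
Let n3 : (3 < n)%N. Proof. by apply: ltn_trans n5. Qed.
Let n1 : (1 < n)%N. Proof. by apply: ltn_trans n5. Qed.
Let w0 : 0 < w. Proof. by case: st => _ _ _ _ []. Qed.
Let wom : w <= om. Proof. by case: st => _ _ _ _ []. Qed.
Let om0 : 0 < om. Proof. exact: lt_le_trans w0 wom. Qed.
Let e0 : 0 <= e. Proof. by case: st => _ _ _ _ []. Qed.
Let scalE : scal S = N * s.
Proof. by rewrite /s /smean mulrC divfK // pnatr_eq0. Qed.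
Let sc0 : 0 < scal S. Proof. by rewrite scalE mulr_gt0 //; have := N6; lra. Qed.

Definition first_velocity : tensor R n := hamQ S + defect a b S.
(* The velocity of T; the last term makes the inequality T >= 0 strict. *)
Definition auxiliary_velocity : tensor R n :=
  square S + (sharp2 T T + (coefc n a b / 4 * s ^+ 2) *: wedge 1%:M 1%:M).
Let d0 : 0 < coefc n a b / 4 * s ^+ 2.
Proof. by rewrite mulr_gt0 ?exprn_gt0 // divr_gt0. Qed.

Lemma auxiliary_S2so : S2so auxiliary_velocity.
Proof.
have h1 := S2so_comb 1 (S2so_sharp hT hT) (S2so_comb (coefc n a b / 4 * s ^+ 2) (@wedge1_S2so R n) (S2so_sharp hT hT)).
have h2 := S2so_comb (coefc n a b / 4 * s ^+ 2) (@wedge1_S2so R n) (S2so_sharp hT hT).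
have := S2so_comb 1 (S2so_square hS) h2; rewrite scale1r.
by rewrite /auxiliary_velocity [X in _ + X]addrC.
Qed.

Let psd2 : nonneg_def (square S + sharp2 T T).
Proof. by apply: nonneg_add; [exact: nonneg_square|exact: nonneg_sharp]. Qed.

Lemma auxiliary_pos (phi : 'M[R]_n) : phi^T = - phi -> \sum_i \sum_j phi i j ^+ 2 = 1 ->
  0 < \sum_(i < n) \sum_(j < n) \sum_(k < n) \sum_(l < n) coord4 auxiliary_velocity i j k l * phi i j * phi k l.
Proof.
move=> ph p1; have eA : auxiliary_velocity = square S + sharp2 T T + (coefc n a b / 4 * s ^+ 2) *: wedge 1%:M 1%:M.
  by rewrite /auxiliary_velocity addrA.
have h := psd2 ph; have h2 := form_unit ph; rewrite p1 mulr1 in h2.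
have -> : \sum_(i < n) \sum_(j < n) \sum_(k < n) \sum_(l < n) coord4 auxiliary_velocity i j k l * phi i j * phi k l =
   \sum_(i < n) \sum_(j < n) \sum_(k < n) \sum_(l < n) coord4 (square S + sharp2 T T) i j k l * phi i j * phi k l
   + (coefc n a b / 4 * s ^+ 2) * \sum_(i < n) \sum_(j < n) \sum_(k < n) \sum_(l < n)
    coord4 (wedge 1%:M 1%:M : tensor R n) i j k l * phi i j * phi k l.
  rewrite mulr_sumr -big_split; apply: eq_bigr => i _; rewrite mulr_sumr -big_split; apply: eq_bigr => j _.
  rewrite mulr_sumr -big_split; apply: eq_bigr => k _; rewrite mulr_sumr -big_split; apply: eq_bigr => l _ /=.
  rewrite eA coord4D coord4Z; ring.
by rewrite h2 ltr_wpDl // mulr_gt0.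
Qed.

Lemma nplane_auxiliary x y : orthonormal [:: x; y] -> 
  nplane (square S) x y < nplane auxiliary_velocity x y.
Proof.
move=> oxy; rewrite /auxiliary_velocity nplaneD [nplane (sharp2 T T + _) x y]nplaneD nplaneZ ltrDl ltr_wpDl //.
  by apply: nplane_ge0 => //; [exact: S2so_sharp|exact: nonneg_sharp].
by rewrite mulr_gt0 // nplane_unit //; apply: ltn_trans n5.
Qed.

Let two_nonnegH : two_nonneg (ric S + (g * s)%:M).
Proof.
move=> x y xx yy xy; rewrite !bformA_scalar xx yy.
have := ricS (x := x) (y := y); rewrite /orthonormal /= -!/(dot _ _) xx yy xy !eqxx => /(_ isT).
rewrite scalE; have -> : 2 * g / N * (N * s) = 2 * (g * s) by field; rewrite gt_eqF //; have := N6; lra.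
lra.
Qed.

(** The squares S^2 cancel between S' and T'. As id /\ id has isotropic curvature 8, the coefficient
    c s^2 / 4 in T' costs 2 c s^2, exactly the margin of [defect_pic]. *)
Lemma pic_velocity x y z v : orthonormal [:: x; y; z; v] -> picv (S - T) x y z v = 0 ->
  0 < picv (first_velocity - auxiliary_velocity) x y z v.
Proof.
move=> o4 u0; have -> : first_velocity - auxiliary_velocity =
   (sharp2 S S - sharp2 T T) + (defect a b S + (- (coefc n a b / 4 * s ^+ 2)) *: wedge 1%:M 1%:M).
  rewrite /first_velocity /auxiliary_velocity hamQE scaleNr.
  by apply/matrixP => i j; rewrite !mxE; ring.
have eS : S = (S - T) + T by rewrite subrK.
rewrite {1 2}eS sharp2_split picvD [picv (sharp2 _ _ + _) _ _ _ _]picvD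
  [picv (defect a b S + _) _ _ _ _]picvD !picvZ picv_unit //.
have aU : PICat (S - T) x y z v by right.
have aT : PICat T x y z v by left.
have h1 := picv_sharp hU hU o4 aU aU (S2so_sharp hU hU).
have h2 := picv_sharp hU hT o4 aU aT (S2so_sharp hU hT).
have [[_ _ _ _] [_ cb] _ _ _] := st.
have k1 : 0 <= 2 * b + (n%:R - 2) * b ^+ 2 - 2 * b ^+ 2.
  have : 0 <= (N - 4) * b ^+ 2 by rewrite mulr_ge0 ?sqr_ge0 //; have := N6; lra.
  by rewrite /N; have := b0; lra.
have := @defect_pic R n a b g S x y z v hS n3 o4 two_nonnegH s0 (ltW g0) (ltW b0) c0 cb
  (a_eq n3 b0) (kappa_gamma n3 b0) k1.
rewrite -/s; lra.
Qed.

Lemma difference_velocity x y t : orthonormal [:: x; y] -> 0 <= t <= 1 ->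
  t ^+ 2 * (om * scal S) + (1 - t) ^+ 2 * nplane T x y
       - 2 * t * (1 - t) * (bform (ric S) y y - bform (ric S) x x) = 0 ->
  0 < t ^+ 2 * (om * scal first_velocity) + (1 - t) ^+ 2 * nplane auxiliary_velocity x y
       - 2 * t * (1 - t) * (bform (ric first_velocity) y y - bform (ric first_velocity) x x).
Proof.
move=> oxy /andP[t0 t1] z0.
have N0 : 0 <= nplane T x y by exact: nplane_ge0.
have W0 : 0 < om * scal S by rewrite mulr_gt0.
have sq0 : 0 <= nplane (square S) x y.
  by apply: nplane_ge0 => //; [exact: S2so_square|exact: nonneg_square].
have NA := nplane_auxiliary oxy.
(* At t = 0 the condition is N >= 0, whose derivative is positive thanks to the id /\ id term of T'.
   At t = 1 its value is omega scal > 0, so there is no zero. *)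
have [te|tn] := eqVneq t 0.
  by rewrite te expr0n /= mul0r add0r mulr0 !mul0r subr0 subr0 expr1n mul1r (le_lt_trans sq0).
have tp : 0 < t by rewrite lt_def tn.
have [te|tn1] := eqVneq t 1.
  by move: z0; rewrite te expr1n mul1r subrr expr0n /= !mul0r mulr0 mul0r addr0 subr0 => /eqP; rewrite gt_eqF.
have tp1 : 0 < 1 - t by rewrite subr_gt0 lt_def eq_sym tn1.
set d := bform (ric S) y y - bform (ric S) x x in z0 *.
have dp : 0 < d.
  have : 0 < (2 * t * (1 - t)) * d.
    have -> : 2 * t * (1 - t) * d = t ^+ 2 * (om * scal S) + (1 - t) ^+ 2 * nplane T x y by lra.
    by apply: ltr_pwDl; [exact: mulr_gt0 (exprn_gt0 2 tp) W0|exact: mulr_ge0 (sqr_ge0 _) N0].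
  by rewrite pmulr_rgt0 // !mulr_gt0.
have disc : d ^+ 2 <= om * scal S * nplane T x y.
  by apply: quadratic_disc => // [|t']; [exact: ltW|exact: diffS].
pose r := t / (1 - t).
have r0 : 0 < r by rewrite divr_gt0.
have tr : t = r * (1 - t) by rewrite /r divfK // gt_eqF.
(* By [disc] the form in (t, 1 - t) has nonpositive discriminant, so a zero is its double root: t
   omega scal = (1 - t) d. *)
have er : r * om * n%:R * s = d.
  have : (t * (om * scal S) - (1 - t) * d) ^+ 2 = - ((1 - t) ^+ 2 * (om * scal S * nplane T x y - d ^+ 2)).
    have e1 := congr1 (fun z => om * scal S * z) z0; move: e1; rewrite mulr0; lra.
  move=> e1; have : (t * (om * scal S) - (1 - t) * d) ^+ 2 <= 0.
    by rewrite e1 oppr_le0 mulr_ge0 ?sqr_ge0 // subr_ge0.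
  rewrite real_exprn_even_le0 //= ?num_real // => /eqP; rewrite scalE => e2.
  have : (1 - t) * (r * om * n%:R * s) = (1 - t) * d by rewrite -/N; move: e2; rewrite {1}tr; lra.
  by apply: mulfI; rewrite gt_eqF.
have [Q QQ rQ] := frame_of oxy n1.
pose i : 'I_n := Ordinal (ltnW n1); pose j : 'I_n := Ordinal n1.
have ri : row i Q = x by rewrite rQ. have rj : row j Q = y by rewrite rQ.
have ij : i != j by [].
have cS1 := rot_CB Q cS.
pose k := N - 2. pose q := ric (rot Q S) i i + ric (rot Q S) j j - 2 * s.
have ex : bform (ric S) x x = ric (rot Q S) i i by rewrite -ri bform_ric_row.
have ey : bform (ric S) y y = ric (rot Q S) j j by rewrite -rj bform_ric_row.
have sm : smean (rot Q S) = s by rewrite /smean (scal_rot _ (orthV QQ)).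
(* A shift by 4: the stage constant [G] bounds omega times the coefficient of |A|^2, which in
   [difference_evolution] is called G + 4. *)
pose G1 := om * (2 * (1 + (n%:R - 2) * b) ^+ 2 / coefm n a) - 4.
have [_ _ _ _ [_ _ _ hG he]] := st.
have k0 : 0 < k by rewrite /k; have := N6; lra.
pose sg := (1 + g) * s.
pose l p := ric (rot Q S) p p - s.
have l0 : \sum_p l p = 0.
  rewrite sumrB sumr_const card_ord -[s *+ n]mulr_natl -/N -scalE -(scal_rot S (orthV QQ)).
  by rewrite /scal /mxtrace subrr.
have lp p p' : p != p' -> - 2 * sg <= l p + l p'.
  move=> pp; have := @two_nonnegH (row p Q) (row p' Q).
  rewrite !bformA_scalar !orth_dot // !eqxx (negPf pp) !bform_ric_row // -[nat_of_bool true]/1%N mulr1n !mulr1 => /(_ erefl erefl erefl).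
  move=> h; rewrite -subr_ge0; apply: le_trans h _.
  by rewrite le_eqVlt; apply/orP; left; apply/eqP; rewrite /l /sg; ring.
have ji : j != i by [].
have [q1 q2] := pair_bounds n3 l0 lp ji.
have q0 := lp _ _ ij.
have qE : q = l i + l j by rewrite /q /l; ring.
have dE : d = l j - l i by rewrite /d ex ey /l; ring.
have key := @difference_evolution R n (rot Q S) i j cS1 ij a b r om k G1 d q s mn0 erefl k0.
have main : 0 < plane_sum (square (rot Q S)) i j + r ^+ 2 * om * scal (hamQ (rot Q S) + defect a b (rot Q S))
      - 2 * r * (ric (hamQ (rot Q S) + defect a b (rot Q S)) j j - ric (hamQ (rot Q S) + defect a b (rot Q S)) i i).
  apply: key => //.
  - by rewrite /d ex ey.
  - by rewrite /q; ring.
  - by rewrite /G1; lra.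
  - by rewrite /G1; have := G4; lra.
  - move=> X Y; have := @mixed (G1 + 4) X Y (r * X); rewrite /G1 subrK => /(_ hG).
    by rewrite /G1 -/k; lra.
  - move=> X Y; have := @mixed (G1 + 4) X Y (- (r * X)); rewrite /G1 subrK => /(_ hG).
    by rewrite /G1 -/k; lra.
  have G10 : 0 <= G1 by rewrite /G1; have := G4; lra.
  apply: (@difference_arith R k N b a om e) => //.
    by rewrite /G1 subrK /k; apply: le_trans he _; rewrite ler_pM2r.
  have dk : k * d <= 2 * N * sg + (N - 4) * (q + 2 * sg).
    by move: q2; rewrite dE qE /k /N; lra.
  have dD : d <= (2 * N * sg + (N - 4) * (q + 2 * sg)) / k by rewrite ler_pdivlMr // mulrC.
  have dN : d <= N * sg.
    rewrite -(ler_pM2l k0); apply: le_trans dk _.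
    have : (N - 4) * (q + 2 * sg) <= (N - 4) * (N * sg).
      by apply: ler_wpM2l; [have := N6; lra|move: q1; rewrite qE /N; lra].
    by rewrite /k; lra.
  have N0' : 0 < N by have := N6; lra.
  have g1 : 0 <= 1 + g by have := g0; lra.
  have er' : r * om * N * s = d by exact: er.
  have := difference_linear w0 wom e0 s0 N0' r0 er' dN g1 dD.
  have q0' : 0 <= q + 2 * sg by rewrite qE; lra.
  have := linear s0 q0'; rewrite -/k -/sg.
  have -> : q + 2 * sg - 2 * sg = q by ring.
  have : w * N * s / k <= om * N * s / k.
    by rewrite ler_pM2r ?invr_gt0 // !ler_pM2r.
  by move=> u1 u2 u3; apply: lt_le_trans u2 _; apply: lerB => //; rewrite lerD2r lerD2r.
have e1 : plane_sum (square (rot Q S)) i j = nplane (square S) x y.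
  by rewrite -rot_square ?(orthV QQ) // -nplane_frame // ?ri ?rj //; exact: S2so_square.
have e2 : hamQ (rot Q S) + defect a b (rot Q S) = rot Q first_velocity.
  by rewrite /first_velocity rotD rot_defect // rot_hamQ // orthV.
move: main; rewrite e1 e2 (scal_rot _ (orthV QQ)) -!bform_ric_row // ri rj => main.
have E1 : t ^+ 2 = r ^+ 2 * (1 - t) ^+ 2 by rewrite -exprMn -tr.
have E2 : t * (1 - t) = r * (1 - t) ^+ 2 by rewrite expr2 mulrA -tr.
rewrite E1 -(mulrA 2) E2.
set X := bform _ y y - _ in main *; set Y := scal first_velocity in main *.
set Z := nplane auxiliary_velocity _ _ in NA *.
have -> : r ^+ 2 * (1 - t) ^+ 2 * (om * Y) + (1 - t) ^+ 2 * Z - 2 * (r * (1 - t) ^+ 2) * X =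
  (1 - t) ^+ 2 * (nplane (square S) x y + r ^+ 2 * om * Y - 2 * r * X + (Z - nplane (square S) x y)) by ring.
by rewrite mulr_gt0 ?exprn_gt0 // addr_gt0 // subr_gt0.
Qed.

Lemma sum_velocity x y : orthonormal [:: x; y] ->
  bform (ric S) x x + bform (ric S) y y + 2 * g / N * scal S = 0 ->
  0 < bform (ric first_velocity) x x + bform (ric first_velocity) y y + 2 * g / N * scal first_velocity.
Proof.
move=> oxy z0; pose E := ric S + (g * s)%:M.
have ET : E^T = E by rewrite /E linearD /= ric_sym // tr_scalar_mx.
have /andP[/andP[/eqP xx /andP[/eqP yy _]] _] : orthonormal [:: x; y] by [].
have Nn0 : N != 0 by rewrite gt_eqF //; have := N6; lra.
have gs : 2 * g / N * scal S = 2 * (g * s) by rewrite scalE; field.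
have zE : bform E x x + bform E y y = 0.
  rewrite !bformA_scalar /dot xx yy -z0 gs; ring.
have n2 : (2 < n)%N by apply: ltn_trans n5.
have [Q [i [j [QQ ij dg inv]]]] := plane_diagonal n2 ET two_nonnegH oxy zE.
have rotE M : rotm Q (M + (g * s)%:M) = rotm Q M + (g * s)%:M.
  by rewrite /rotm mulmxDr mulmxDl mul_mx_scalar -scalemxAl QQ scalemx1.
have rE p q : rotm Q E p q = ric (rot Q S) p q + (g * s) *+ (p == q).
  by rewrite (ric_rot S (orthV QQ)) rotE mxE [X in _ + X]mxE.
have dgS p q : p != q -> ric (rot Q S) p q = 0.
  by move=> pq; have := dg p q pq; rewrite rE (negPf pq) mulr0n addr0.
pose h p := ric (rot Q S) p p + g * s.
have hE p : rotm Q E p p = h p by rewrite rE eqxx mulr1n.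
have hz : h i + h j = 0 by rewrite -!hE inv.
(* The two indices are ordered so that h is -x and x with x >= 0. *)
have [i1 [i2 [i12 [ex [hle inv']]]]] : exists i1 i2, i1 != i2 /\ (h i1 + h i2 = 0 /\ h i1 <= 0 /\
    forall M, rotm Q M i1 i1 + rotm Q M i2 i2 = bform M x x + bform M y y).
  have [hi|hi] := leP (h i) 0; first by exists i, j.
  exists j, i; rewrite eq_sym ij addrC hz; split=> //; split=> //; split; first lra.
  by move=> M; rewrite addrC inv.
have cS1 := rot_CB Q cS.
have sm : s = smean (rot Q S) by rewrite /smean (scal_rot _ (orthV QQ)).
have [[_ _ _ _] _ be0 bh _] := st.
have e2 : hamQ (rot Q S) + defect a b (rot Q S) = rot Q first_velocity.
  by rewrite /first_velocity rotD rot_defect // rot_hamQ // orthV.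
pose tN p := coord4 (rot Q T) i1 p i1 p + coord4 (rot Q T) i2 p i2 p.
have hpair p q : p != q -> 0 <= h p + h q.
  move=> pq; have := @two_nonnegH (row p Q) (row q Q).
  rewrite !bformA_scalar !orth_dot // !eqxx (negPf pq) !bform_ric_row // -[nat_of_bool true]/1%N mulr1n !mulr1.
  by move=> /(_ erefl erefl erefl); rewrite /h.
have := @sum_evolution R n (rot Q S) i1 i2 tN a b g om (rhoC n b) (h i2) s cS1 i12 m0 n2 dgS sm s0 (ltW g0).
rewrite e2 (scal_rot _ (orthV QQ)) !(ric_rot _ (orthV QQ)) inv'; apply.
- move=> p q /andP[p1 p2] /andP[q1 q2] pq.
  have u : uniq [:: i1; i2; p; q].
    by rewrite /= !inE !negb_or i12 ![i1 == _]eq_sym ![i2 == _]eq_sym p1 p2 q1 q2 pq.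
  have := sectional_quad hU pU QQ u; rewrite rotD rotN !coord4D !coord4N /tN; lra.
- by move=> p _; rewrite addr_ge0 // coord4_rot ev_rb; exact: nonneg_qf.
- by move=> p q pq; have := hpair p q pq; rewrite /h -(ric_rot _ (orthV QQ)).
- by rewrite -(ric_rot _ (orthV QQ)) -/(h i1); lra.
- by rewrite -(ric_rot _ (orthV QQ)).
- by lra.
- move=> p; rewrite -(ric_rot _ (orthV QQ)) -/N -scalE.
  have pS : PIC S.
    move=> u1 u2 u3 u4 o4; have := addr_ge0 (pU o4) (nonneg_picv u1 u2 u3 u4 hT pT).
    by rewrite -[_ + 2 * ev (S - T) _ _ _ _]/(picv (S - T) u1 u2 u3 u4) -picvD subrK.
  exact: (PIC_ric_le hS pS (ltnW n5) QQ).
- have <- : plane_sum (rot Q T) i1 i2 = \sum_(p | rest i1 i2 p) tN p by [].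
  rewrite -nplane_frame // -/N -scalE.
  have o12 : orthonormal [:: row i1 Q; row i2 Q].
    by rewrite /orthonormal /= -!/(dot _ _) !orth_dot // !eqxx (negPf i12) eqxx.
  have e12 : 2 * h i2 = bform (ric S) (row i2 Q) (row i2 Q) - bform (ric S) (row i1 Q) (row i1 Q).
    by rewrite !bform_ric_row //; move: ex; rewrite /h; lra.
  rewrite e12; apply: quadratic_disc; first by rewrite mulr_gt0.
    by rewrite -e12; lra.
  by move=> t; exact: diffS.
- exact: om0.
- exact: rho0.
- exact: gamma_eq.
- exact: a_eq.
- apply: addr_ge0; first exact: divr_ge0 (mulr_ge0 (ltW g0) bh) (ler0n _ _).
  by apply: mulr_ge0; [have := g0; lra|exact: be0].
- exact: rho_eq.
- exact: omu.
Qed.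

End FirstStage.

Section Weights.
Variables (R : realType) (I : finType).

Lemma weighted_sum_gt0 (P : pred I) (w f : I -> R) : (forall i, P i -> 0 <= w i) ->
  (forall i, P i -> 0 < f i) -> 0 < \sum_(i | P i) w i -> 0 < \sum_(i | P i) w i * f i.
Proof.
move=> w0 f0 sw; have p i : P i -> 0 <= w i * f i by move=> Pi; rewrite mulr_ge0 ?w0 // ltW // f0.
rewrite lt_def sumr_ge0 // andbT; apply: contraTneq sw => /eqP; rewrite psumr_eq0 // => /allP h.
rewrite -leNgt sumr_le0 // => i Pi; have := h i (mem_index_enum _).
by rewrite Pi mulf_eq0 (gt_eqF (f0 i Pi)) orbF => /eqP ->.
Qed.

(** These are the weights of a two-plane on an eigenbasis. At most one f k fails to be positive;
    pairing it with every other index uses it with total weight 2 - w k >= w k. *)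
Lemma weighted_pairs_gt0 (w f : I -> R) : (forall i j, i != j -> 0 < f i + f j) ->
  (forall i, 0 <= w i <= 1) -> \sum_i w i = 2 -> 0 < \sum_i w i * f i.
Proof.
move=> hf hw sw; have w0 i : 0 <= w i by case/andP: (hw i).
have [/existsP[k fk]|/existsPn fp] := boolP [exists k, f k <= 0]; last first.
  apply: weighted_sum_gt0 => // [i _|]; last by rewrite sw; lra.
  by have := fp i; rewrite -ltNge.
have [_ wk] := andP (hw k).
have sk : \sum_(i | i != k) w i = 2 - w k.
  by have := sw; rewrite (bigD1 k) //= => <-; rewrite addrAC subrr add0r.
have : 0 < \sum_(i | i != k) w i * (f i + f k).
  by apply: weighted_sum_gt0 => // [i ik|]; [exact: hf|rewrite sk; lra].
rewrite (eq_bigr (fun i => w i * f i + w i * f k)) => [|i _]; last by ring.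
rewrite big_split /= -mulr_suml sk [X in _ -> _ < X](bigD1 k) //= => h.
have : 0 <= (1 - w k) * - f k by rewrite mulr_ge0 // ?subr_ge0 // oppr_ge0.
lra.
Qed.

End Weights.

Section SecondStage.
Variables (R : realType) (n : nat) (b tau : R).
Let a := taC n b.
Let N : R := n%:R.
Let k := N - 2.
Hypothesis n5 : (5 < n)%N.
Hypothesis b0 : 0 < b.
Hypothesis tau0 : 0 <= tau.
Hypothesis tau1 : tau <= 1.
Hypothesis c0 : 0 < coefc n a b.
Hypothesis cond1 : 0 < (1 + k * b / 2) * (8 * (N - 1) - 8 * k * tau) - 2 * (4 + 4 * N ^+ 2 / k ^+ 2) * tau ^+ 2.
Hypothesis cond2 : 2 * tau * (k - 2) + 2 * N * tau * (1 - 4 / k ^+ 2) <= 4 * k.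

Variable S : tensor R n.
Hypothesis cS : CB S.
Let s := smean S.
Let A := tfric S.
Hypothesis s0 : 0 < s.
Let rt : R := Num.sqrt (2 * a).
Hypothesis lowric : forall x y, orthonormal [:: x; y] -> - 2 * tau * s <= bform A x x + bform A y y.
Hypothesis H : forall x y z w lam, orthonormal [:: x; y; z; w] -> 0 <= lam <= 1 ->
  0 <= picl S (rt *: ric S) x y z w lam.

Let N6 : 6 <= N. Proof. by rewrite /N ler_nat. Qed.
Let k4 : 4 <= k. Proof. by rewrite /k; have := N6; lra. Qed.
Let a0 : 0 < a.
Proof.
rewrite /a /taC ltr_pwDl // mulr_ge0 ?sqr_ge0 //.
by have := N6; rewrite /N; lra.
Qed.
Let m0 : 0 < coefm n a.
Proof.
have : 0 <= (n%:R - 1) * a by apply: mulr_ge0; [have := N6; rewrite /N; lra|exact: ltW].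
by rewrite /coefm; lra.
Qed.
Let rt0 : 0 < rt. Proof. by rewrite sqrtr_gt0 mulr_gt0. Qed.
Let rt2 : rt * rt = 2 * a. Proof. by rewrite -expr2 sqr_sqrtr // mulr_ge0 // ltW. Qed.
Let hS : S2so S. Proof. by case: cS. Qed.
Let n0 : n != 0%N. Proof. by rewrite -lt0n; apply: ltn_trans n5. Qed.
Let n3 : (3 < n)%N. Proof. by apply: ltn_trans n5. Qed.
Let AT : A^T = A. Proof. exact: tfric_sym. Qed.
Let kap2 : 2 * a = 2 * b + (n%:R - 2) * b ^+ 2. Proof. by rewrite /a /taC; field. Qed.

Definition second_velocity : tensor R n := hamQ S + defect a b S.

(** Pairs of eigenvectors of A are handled by [second_pair]. A general plane puts the weights
    (x.e_i)^2 + (y.e_i)^2 on the eigenvectors e_i, each at most 1 by Bessel's inequality and of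
    total 2. *)
Lemma ric_defect_pos x y z w : orthonormal [:: x; y; z; w] ->
  0 < bform (ric (defect a b S)) x x + bform (ric (defect a b S)) y y.
Proof.
move=> o4; have [Q [QQ dg]] := real_spectral AT.
have /ortho4_orthonormal := o4; rewrite /ortho4 !rdot_dot => -[[xx yy _ _] _ _].
pose l i := rotm Q A i i.
have QT := orthV QQ.
have form (M : 'M[R]_n) u : (forall i j, i != j -> rotm Q M i j = 0) ->
    bform M u u = \sum_i dot u (row i Q) ^+ 2 * rotm Q M i i.
  move=> dM; have -> : bform M u u = bform (rotm Q M) (u *m Q^T) (u *m Q^T).
    rewrite /bform /rotm trmx_mul trmxK -!mulmxA (mulmxA Q^T) QT mul1mx !mulmxA.
    by rewrite -(mulmxA (u *m M)) QT mulmx1.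
  rewrite bformE; apply: eq_bigr => i _; rewrite (bigD1 i) //= [X in _ + X]big1 ?addr0.
    by rewrite /dot tr_row colE mulmxA -colE !mxE; ring.
  by move=> j ji; rewrite dM ?mul0r // eq_sym.
have d1 i j : i != j -> rotm Q 1%:M i j = 0 by move=> ij; rewrite rotm1 // mxE (negPf ij).
have dA2 i j : rotm Q (A *m A) i j = (l i ^+ 2) *+ (i == j).
  rewrite rotm_mul // mxE (bigD1 i) //= big1 ?addr0 => [|p pi].
    have [<-|ij] := eqVneq i j; first by rewrite -expr2.
    by rewrite (dg i j) // mulr0.
  by rewrite dg ?mul0r // eq_sym.
have dAA i j : i != j -> rotm Q (A *m A) i j = 0 by move=> ij; rewrite dA2 (negPf ij).
pose wt i := dot x (row i Q) ^+ 2 + dot y (row i Q) ^+ 2.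
have nrm u : dot u u = \sum_i dot u (row i Q) ^+ 2.
  by rewrite -bform1 form //; apply: eq_bigr => i _; rewrite rotm1 // mxE eqxx mulr1.
have sw : \sum_i wt i = 2 by rewrite big_split /= -!nrm xx yy.
have wt1 i : 0 <= wt i <= 1.
  rewrite addr_ge0 ?sqr_ge0 //=; have := bessel (row i Q) o4; rewrite orth_dot // eqxx.
  rewrite /wt ![dot _ (row i Q)]dotC => h; apply: le_trans h.
  by rewrite -addrA lerDl addr_ge0 ?sqr_ge0.
have lsum : \sum_i l i = 0.
  by apply: etrans (tr_tfric S n0); rewrite -(tr_rotm (tfric S) QT).
have lp i j : i != j -> - 2 * (tau * s) <= l i + l j.
  move=> ij; rewrite mulrA /l -!bform_row; apply: lowric.
  by rewrite /orthonormal /= -!/(dot _ _) !orth_dot // !eqxx (negPf ij) eqxx.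
have pos i j : i != j -> 0 < ric_symbol k N b s (l i) + ric_symbol k N b s (l j).
  move=> ij; have [q1 q2] := pair_bounds n3 lsum lp ij.
  have ji : j != i by rewrite eq_sym.
  have [_ q3] := pair_bounds n3 lsum lp ji.
  apply: (@second_pair _ k N b tau s) => //.
  - by rewrite /k; ring.
  - by have := k4; lra.
  - by have := lp i j ij; rewrite mulrA.
  - by rewrite addrC.
have main := weighted_pairs_gt0 pos wt1 sw.
have be0 : 0 <= 2 * (N ^+ 2 * b ^+ 2 - 2 * (N - 1) * (a - b) * (1 - 2 * b)) / (N * coefm n a).
  rewrite divr_ge0 //; last by rewrite mulr_ge0 ?ler0n // ltW.
  have -> : 2 * (N ^+ 2 * b ^+ 2 - 2 * (N - 1) * (a - b) * (1 - 2 * b)) =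
     2 * b ^+ 2 * (3 * N - 2 + 2 * b * ((N - 1) * (N - 2))) by rewrite /a /taC -/N; field.
  apply: mulr_ge0; first exact: mulr_ge0 (ler0n _ 2) (sqr_ge0 _).
  apply: addr_ge0; first by have := N6; lra.
  by apply: mulr_ge0; [have := b0; lra|apply: mulr_ge0; have := N6; lra].
have t0 := tr_square_ge0 AT.
rewrite ric_defect // ?gt_eqF // -/A -/s -/N.
set be := 2 * _ / _ in be0 *; set t := \tr (A *m A) in t0 *.
rewrite ![bform (_ + _ + _) _ _]bformDm ![bform (_ *: _ + _ *: _) _ _]bformDm !bformZm.
have sc (r : R) u : bform r%:M u u = r * dot u u by rewrite -scalemx1 bformZm bform1.
rewrite !sc xx yy !mulr1.
have tot : \sum_i wt i * ric_symbol k N b s (l i) =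
   (- 4 * b) * (bform (A *m A) x x + bform (A *m A) y y) + 4 * a * (N - 2) * s * (bform A x x + bform A y y)
   + 2 * (4 * a * (N - 1) * s ^+ 2).
  have w2 C : \sum_i wt i * C = 2 * C by rewrite -mulr_suml sw.
  rewrite -w2 !form // -!big_split /= !mulr_sumr -!big_split /=; apply: eq_bigr => i _.
  rewrite dA2 eqxx mulr1n /ric_symbol /wt -/(l i) /a /taC -/N -/k.
  by move: (dot x _) (dot y _) (l i) => X Y L; rewrite /k; field.
have bt := mulr_ge0 be0 t0.
apply: lt_le_trans main _; rewrite tot -subr_ge0; apply: le_trans (_ : 0 <= 2 * (be * t)) _.
  by rewrite mulr_ge0.
by rewrite le_eqVlt; apply/orP; left; apply/eqP; ring.
Qed.

Let ET : (rt *: ric S)^T = rt *: ric S. Proof. by rewrite linearZ /= ric_sym. Qed.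

Lemma qform_bform (M : 'M[R]_n) x : qform M x = bform M x x. Proof. by []. Qed.

Let two_nonneg_ric : two_nonneg (ric S).
Proof.
move=> x y xx yy xy; have o : orthonormal [:: x; y] by rewrite /orthonormal /= -!/(dot _ _) xx yy xy !eqxx.
have := lowric o; rewrite ricE -/A -/s !bformA_scalar xx yy.
have : 0 <= (1 - tau) * s by rewrite mulr_ge0 ?(ltW s0) // subr_ge0.
lra.
Qed.

Let remainder : tensor R n := (2 * b ^+ 2) *: wedge (A *m A) 1%:M
    + (coefc n a b * \tr (A *m A)) *: wedge 1%:M 1%:M.

Let defect_split : defect a b S = (2 * a) *: wedge (ric S) (ric S) + remainder.
Proof. by rewrite (defectE2 _ kap2) -addrA. Qed.

Let rem_ge0 : 0 <= coefc n a b * \tr (A *m A).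
Proof. by rewrite mulr_ge0 ?(ltW c0) // tr_square_ge0. Qed.

(** At lambda = 1 the Ricci term of the second cone vanishes and cannot supply strictness. It comes
    from the |A|^2 id /\ id part of D when A is nonzero, and from 2a Ric /\ Ric with Ric = s id
    otherwise. *)
Let picl_velocity1 x y z w : orthonormal [:: x; y; z; w] -> picv S x y z w = 0 ->
  0 < picv second_velocity x y z w.
Proof.
move=> o4 z0; have pS : PIC S.
  move=> u1 u2 u3 u4 o; have := H o (_ : 0 <= 1 <= 1); rewrite lexx ler01 => /(_ isT).
  by rewrite /picl expr1n subrr mul0r addr0 scale1r.
have aS : PICat S x y z w by right.
have h1 := picv_sharp hS hS o4 aS aS (S2so_sharp hS hS).
have h2 := nonneg_picv x y z w (S2so_square hS) (nonneg_square S).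
rewrite /second_velocity hamQE picvD [picv (square S + _) _ _ _ _]picvD.
apply: ltr_wpDl; first exact: addr_ge0.
rewrite defect_split picvD picvZ picv_wedge ?ric_sym //.
have h3 := remainder_pic b 1 AT rem_ge0 o4; rewrite scale1r -/remainder in h3.
have [m1 m2 hd] := two_nonneg_det (ric_sym hS) two_nonneg_ric o4.
have [A0|An] := eqVneq A 0.
  have rE : ric S = s%:M by rewrite ricE -/A -/s A0 add0r.
  have sc (r : R) u v : bform r%:M u v = r * dot u v by rewrite -scalemx1 bformZm bform1.
  have /ortho4_orthonormal := o4; rewrite /ortho4 !rdot_dot => -[[xx yy zz ww] [_ xz xw] [yz yw _]].
  rewrite rE !sc xx yy zz ww xz xw yz yw ltr_pwDl //; last by apply: le_trans h3; rewrite mulr_ge0.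
  by rewrite mulr_gt0 ?mulr_gt0 //; have := exprn_gt0 2 s0; lra.
apply: ltr_wpDl.
  rewrite mulr_ge0 //; first by rewrite mulr_ge0 // ltW.
  by move: hd; lra.
apply: lt_le_trans h3; rewrite mulr_gt0 // mulr_gt0 // lt_def tr_square_ge0 // andbT.
by apply: contraNneq An => t0; apply/eqP; apply: (tr_square_eq0 AT); rewrite t0.
Qed.

(** For lambda < 1, [picl_sharp] treats S # S, 2a Ric /\ Ric and Ric(Q(S)) together. Strictness
    comes from (1 - lambda^2) times the trace of Ric(D) over the plane. *)
Lemma picl_velocity x y z w lam : orthonormal [:: x; y; z; w] -> 0 <= lam <= 1 ->
  picl S (rt *: ric S) x y z w lam = 0 -> 0 < picl second_velocity (rt *: ric second_velocity) x y z w lam.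
Proof.
move=> o4 l01 z0; have [l1|l1] := eqVneq lam 1.
  rewrite /picl l1 expr1n subrr mul0r addr0 scale1r; apply: picl_velocity1 => //.
  by move: z0; rewrite /picl l1 expr1n subrr mul0r addr0 scale1r.
have [l0 l2] := andP l01.
have lp : 0 < 1 - lam ^+ 2.
  have : 0 < (1 - lam) * (1 + lam) by rewrite mulr_gt0 ?subr_gt0 ?lt_def 1?eq_sym ?l1 //; lra.
  by lra.
have h1 := picl_sharp n3 cS ET H o4 l01 z0.
have h2 := nonneg_picv x y z (lam *: w) (S2so_square hS) (nonneg_square S).
have h3 := remainder_pic b lam AT rem_ge0 o4.
have h4 := ric_defect_pos o4.
have e1 : second_velocity = square S + (sharp2 S S + wedge (rt *: ric S) (rt *: ric S)) + remainder.
  rewrite /second_velocity hamQE defect_split wedgeZl wedgeZr scalerA rt2.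
  by move: (sharp2 S S) (square S) remainder (wedge _ _) => X Y Z W; rewrite -!addrA.
have e2 : rt *: ric second_velocity = 2 *: act S (rt *: ric S) + rt *: ric (defect a b S).
  by rewrite /second_velocity ricD ric_hamQ // actZ scalerDr !scalerA [rt * 2]mulrC.
rewrite /picl e2 {1}e1 [picv (_ + remainder) _ _ _ _]picvD [picv (square S + _) _ _ _ _]picvD !qform_bform.
rewrite ![bform (2 *: _ + _) _ _]bformDm ![bform (rt *: ric (defect a b S)) _ _]bformZm.
move: h1; rewrite /picl !qform_bform.
set X1 := picv (square S) _ _ _ _; set X2 := picv (sharp2 S S + _) _ _ _ _; set X3 := picv remainder _ _ _ _.
set Y1 := bform _ x x; set Y2 := bform _ y y => h1.
have h5 : 0 < (1 - lam ^+ 2) * (rt * (bform (ric (defect a b S)) x x + bform (ric (defect a b S)) y y)).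
  by rewrite !mulr_gt0.
have h6 : 0 <= X3 by apply: le_trans h3; rewrite mulr_ge0.
have : 0 <= X1 by [].
move: h1 h5 h6; set Z1 := bform _ x x; set Z2 := bform _ y y; lra.
Qed.

End SecondStage.

(** * Compact parameter spaces and continuity *)

Section Coefficients.
Local Open Scope classical_set_scope.
Local Open Scope ring_scope.
Variables (R : realType) (n : nat).
Notation P := ('M[R]_n * R)%type.

(** The scalar in [0, 1] is the parameter t of clause (4) or the lambda of the second cone; carrying
    it everywhere gives all families one parameter type. *)
Definition unit_bivectors : set P :=
  [set p | (p.1^T = - p.1 /\ \sum_i \sum_j p.1 i j ^+ 2 = 1) /\ 0 <= p.2 <= 1].
Definition frames : set P := [set p | p.1 *m p.1^T = 1%:M /\ 0 <= p.2 <= 1].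

Lemma entry_continuous i j : continuous (fun p : P => p.1 i j).
Proof.
move=> p; apply: (@continuous_comp P 'M[R]_n R fst (fun M => M i j)); first exact: cvg_fst.
exact: coord_continuous.
Qed.

Lemma param_continuous : continuous (fun p : P => p.2).
Proof. by move=> p; exact: cvg_snd. Qed.

Lemma closed_eq_fun (f : P -> R) c : continuous f -> closed [set p | f p = c].
Proof. by move=> cf; exact: (closed_comp (fun x _ => @cf x) (@closed_eq R c)). Qed.

Lemma compact_parameters (K : set P) : closed K ->
  (forall p, K p -> (forall i j, `|p.1 i j| <= 1) /\ 0 <= p.2 <= 1) -> compact K.
Proof.
move=> cK bK.
apply: (subclosed_compact cK (compact_setX (@box_compact R n n 0 1) (@segment_compact R 0 1))).
by move=> p /bK [h1 h2]; split=> /= [i j|]; [rewrite mxE subr0; exact: h1|rewrite in_itv].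
Qed.

Lemma closed_param : closed [set p : P | 0 <= p.2 <= 1].
Proof.
have -> : [set p : P | 0 <= p.2 <= 1] = [set p | 0 <= p.2] `&` [set p | p.2 <= 1].
  by apply/seteqP; split=> p /=; [move=> /andP[]|move=> [-> ->]].
apply: closedI.
  exact: (closed_comp (fun x _ => @param_continuous x) (@closed_ge R 0)).
exact: (closed_comp (fun x _ => @param_continuous x) (@closed_le R 1)).
Qed.

Lemma compact_unit_bivectors : compact unit_bivectors.
Proof.
apply: compact_parameters.
  have -> : unit_bivectors = ((\bigcap_(q : 'I_n * 'I_n) [set p : P | p.1 q.1 q.2 + p.1 q.2 q.1 = 0])
     `&` [set p : P | \sum_i \sum_j p.1 i j * p.1 i j = 1]) `&` [set p : P | 0 <= p.2 <= 1].
    apply/seteqP; split=> p [[h1 h2] h3]; split=> //; split.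
    - by move=> [i j] _ /=; have /matrixP/(_ i j) := h1; rewrite !mxE => ->; rewrite subrr.
    - by rewrite -h2 /=; apply: eq_bigr => i _; apply: eq_bigr => j _; rewrite expr2.
    - apply/matrixP => i j; rewrite !mxE; apply/eqP; rewrite -addr_eq0.
      by have /= -> := h1 (j, i) I.
    - by rewrite -h2; apply: eq_bigr => i _; apply: eq_bigr => j _; rewrite expr2.
  apply: closedI; last exact: closed_param.
  apply: closedI.
    apply: closed_bigI => q _; apply: closed_eq_fun; apply: continuous_add; exact: entry_continuous.
  apply: closed_eq_fun; apply: continuous_bigsum => i; apply: continuous_bigsum => j.
  by apply: continuous_mul; exact: entry_continuous.
move=> p [[_ h] h2]; split=> // i j.
have : p.1 i j ^+ 2 <= 1.
  rewrite -h (bigD1 i) //= (bigD1 j) //= -addrA lerDl addr_ge0 ?sumr_ge0 // => [k _|k _]; first exact: sqr_ge0.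
  by apply: sumr_ge0 => l _; exact: sqr_ge0.
by rewrite -real_normK ?num_real // expr_le1.
Qed.

Lemma compact_frames : compact frames.
Proof.
apply: compact_parameters.
  have -> : frames = (\bigcap_(q : 'I_n * 'I_n) [set p : P | \sum_k p.1 q.1 k * p.1 q.2 k = (q.1 == q.2)%:R])
     `&` [set p : P | 0 <= p.2 <= 1].
    apply/seteqP; split=> p [h1 h3]; split=> //.
    - move=> [i j] _ /=; have /matrixP/(_ i j) := h1; rewrite !mxE => <-.
      by apply: eq_bigr => k _; rewrite mxE.
    - apply/matrixP => i j; rewrite !mxE; have /= <- := h1 (i, j) I.
      by apply: eq_bigr => k _; rewrite mxE.
  apply: closedI; last exact: closed_param.
  apply: closed_bigI => q _; apply: closed_eq_fun; apply: continuous_bigsum => k.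
  by apply: continuous_mul; exact: entry_continuous.
move=> p [h h2]; split=> // i j.
have : p.1 i j ^+ 2 <= 1.
  have := orth_dot i i h; rewrite eqxx dotE => /= e.
  rewrite -[X in _ <= X]/(true%:R) -e (bigD1 j) //= !mxE -expr2 lerDl sumr_ge0 // => k _.
  by rewrite -expr2 sqr_ge0.
by rewrite -real_normK ?num_real // expr_le1.
Qed.

Lemma continuous_ev (T : tensor R n) (x y z w : P -> 'rV[R]_n) :
  (forall i, continuous (fun p => x p 0 i)) -> (forall i, continuous (fun p => y p 0 i)) ->
  (forall i, continuous (fun p => z p 0 i)) -> (forall i, continuous (fun p => w p 0 i)) ->
  continuous (fun p => ev T (x p) (y p) (z p) (w p)).
Proof.
move=> cx cy cz cw; rewrite /ev; do 4 (apply: continuous_bigsum => ?).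
by do 4 (apply: continuous_mul => //); exact: continuous_const.
Qed.

Lemma continuous_bform (E : 'M[R]_n) (x y : P -> 'rV[R]_n) :
  (forall i, continuous (fun p => x p 0 i)) -> (forall i, continuous (fun p => y p 0 i)) ->
  continuous (fun p => bform E (x p) (y p)).
Proof.
move=> cx cy; rewrite (_ : (fun p => _) = fun p => \sum_i \sum_k E i k * (x p 0 i * y p 0 k)).
  do 2 (apply: continuous_bigsum => ?); apply: continuous_mul; first exact: continuous_const.
  exact: continuous_mul.
by apply/funext => p; rewrite bformE.
Qed.

Lemma continuous_row i j : continuous (fun p : P => row i p.1 0 j).
Proof.
rewrite (_ : (fun p => _) = fun p : P => p.1 i j); first exact: entry_continuous.
by apply/funext => p; rewrite mxE.
Qed.

Lemma continuous_picv (T : tensor R n) (x y z w : P -> 'rV[R]_n) :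
  (forall i, continuous (fun p => x p 0 i)) -> (forall i, continuous (fun p => y p 0 i)) ->
  (forall i, continuous (fun p => z p 0 i)) -> (forall i, continuous (fun p => w p 0 i)) ->
  continuous (fun p => picv T (x p) (y p) (z p) (w p)).
Proof.
move=> cx cy cz cw; rewrite /picv; repeat (apply: continuous_add); try exact: continuous_ev;
  by apply: continuous_mul; [exact: continuous_const|exact: continuous_ev].
Qed.

End Coefficients.

(** * The inverse of l_{a,b} *)

Section Unlab.
Local Open Scope classical_set_scope.
Local Open Scope ring_scope.
Variables (R : realType) (n : nat).
Hypothesis n0 : n != 0%N.
Implicit Types (S X : tensor R n) (a b : R).

Definition coefu b : R := 1 + (n%:R - 2) * b.
(** l_{a,b} multiplies the traceless Ricci tensor by [coefu b] and the scalar curvature by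
    [coefm n a], so its inverse has again the form of an l_{a',b'}. *)
Definition unlab a b X : tensor R n := lab (- (a / coefm n a)) (- (b / coefu b)) X.

Let nn0 : n%:R != 0 :> R. Proof. by rewrite pnatr_eq0. Qed.

Lemma labTE a b S : lab a b S = S + wedge (b *: tfric S + (a * smean S)%:M) 1%:M.
Proof.
have e : b *: ric S + ((a - b) * smean S)%:M = b *: tfric S + (a * smean S)%:M.
  rewrite [in LHS]ricE scalerDr -addrA scale_scalar_mx -raddfD /=.
  by have -> : b * smean S + (a - b) * smean S = a * smean S by ring.
by rewrite labE e.
Qed.

Lemma ric_lab a b S : ric (lab a b S) = coefu b *: tfric S + (coefm n a * smean S)%:M.
Proof.
rewrite labTE ricD ric_wedge1 mxtraceD mxtraceZ tr_tfric // mulr0 add0r mxtrace_scalar {1}ricE.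
move: (tfric S) (smean S) => A s; rewrite /coefu /coefm.
apply/matrixP => i j; rewrite !mxE; case: (i == j); rewrite ?mulr1n ?mulr0n; last by ring.
by rewrite -[(a * s) *+ n]mulr_natr; ring.
Qed.

Lemma smean_lab a b S : smean (lab a b S) = coefm n a * smean S.
Proof.
rewrite {1}/smean /scal ric_lab mxtraceD mxtraceZ tr_tfric // mulr0 add0r mxtrace_scalar.
by rewrite -[(_ * smean S) *+ n]mulr_natr mulfK.
Qed.

Lemma tfric_lab a b S : tfric (lab a b S) = coefu b *: tfric S.
Proof. by rewrite {1}/tfric ric_lab smean_lab addrK. Qed.

Lemma lab_lab a b a' b' S : b + b' * coefu b = 0 -> a + a' * coefm n a = 0 ->
  lab a' b' (lab a b S) = S.
Proof.
move=> eb ea; rewrite labTE tfric_lab smean_lab labTE -addrA -wedgeDl.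
have -> : b *: tfric S + (a * smean S)%:M + (b' *: (coefu b *: tfric S) + (a' * (coefm n a * smean S))%:M) = 0.
  rewrite addrACA scalerA -scalerDl eb scale0r add0r -raddfD /=.
  by rewrite mulrA -mulrDl ea mul0r raddf0.
have -> : wedge (0 : 'M[R]_n) 1%:M = 0; last by rewrite addr0.
by apply: ext4 => i j k l; rewrite coord4_wedge coord40 !mxE; ring.
Qed.

Lemma lab_unlab a b S : coefm n a != 0 -> coefu b != 0 -> unlab a b (lab a b S) = S.
Proof. by move=> m0 u0; apply: lab_lab; field. Qed.

Lemma unlab_lab a b X : coefm n a != 0 -> coefu b != 0 -> lab a b (unlab a b X) = X.
Proof.
move=> m0 u0; apply: lab_lab.
  by move: u0; rewrite /coefu => u0; field.
by move: m0; rewrite /coefm => m0; field.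
Qed.

Lemma CB_lab a b S : CB S -> CB (lab a b S).
Proof.
move=> cS; rewrite labTE; apply: CBD => //; apply: CB_wedge; last exact: trmx1.
by rewrite linearD linearZ /= tr_scalar_mx tfric_sym //; case: cS.
Qed.

Lemma lab_linear a b c S X : lab a b (c *: S + X) = c *: lab a b S + lab a b X.
Proof.
rewrite /lab !ricD !ricZ !scalD !scalZ !wedgeDl !wedgeZl; move: (wedge (ric S) _) (wedge (ric X) _) => W V.
by apply/matrixP => i j; rewrite !mxE; ring.
Qed.

Lemma unlab_linear a b c S X : unlab a b (c *: S + X) = c *: unlab a b S + unlab a b X.
Proof. exact: lab_linear. Qed.

Lemma unlab_hamQ a b S : CB S -> coefm n a != 0 -> coefu b != 0 ->
  unlab a b (hamQ (lab a b S)) = hamQ S + defect a b S.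
Proof. by move=> cS m0 u0; rewrite hamQ_lab // lab_unlab. Qed.

End Unlab.

Section SquareRoots.
Local Open Scope classical_set_scope.
Local Open Scope ring_scope.
Variable R : realType.

(* Makes the clause linear in the tensors, at the price of a compact parameter t. *)
Lemma sqrt_clause (W N d : R) : 0 <= W -> 0 <= N ->
  (d <= Num.sqrt W * Num.sqrt N <->
   (forall t, 0 <= t <= 1 -> 0 <= t ^+ 2 * W + (1 - t) ^+ 2 * N - 2 * t * (1 - t) * d)).
Proof.
move=> W0 N0; split=> [h t /andP[t0 t1]|h].
  have p : 0 <= t * (1 - t) * (Num.sqrt W * Num.sqrt N - d).
    by rewrite !mulr_ge0 // subr_ge0.
  have := sqr_ge0 (t * Num.sqrt W - (1 - t) * Num.sqrt N).
  have e1 := sqr_sqrtr W0; have e2 := sqr_sqrtr N0.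
  have -> : (t * Num.sqrt W - (1 - t) * Num.sqrt N) ^+ 2 =
    t ^+ 2 * W + (1 - t) ^+ 2 * N - 2 * (t * (1 - t) * (Num.sqrt W * Num.sqrt N)).
    by rewrite -{2}e1 -{2}e2; ring.
  lra.
have [d0|d0] := leP d 0; first by apply: le_trans d0 _; rewrite mulr_ge0 ?sqrtr_ge0.
have [We|Wn] := eqVneq W 0.
  (* For W = 0 a value of t near 1 refutes d > 0; with N + 1 in place of N the form takes the value
     - 4 d^2 / (N + 1 + 2d)^2 there. *)
  have s0 : 0 < N + 1 + 2 * d by lra.
  have b1 : 0 <= (N + 1) / (N + 1 + 2 * d) <= 1.
    by apply/andP; split; [apply: divr_ge0; lra|rewrite ler_pdivrMr // mul1r; lra].
  have p : 0 < 4 * d ^+ 2 / (N + 1 + 2 * d) ^+ 2.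
    by apply: divr_gt0; [apply: mulr_gt0 => //; exact: exprn_gt0|exact: exprn_gt0].
  have := h _ b1; rewrite We.
  have -> : ((N + 1) / (N + 1 + 2 * d)) ^+ 2 * 0 + (1 - (N + 1) / (N + 1 + 2 * d)) ^+ 2 * N
     - 2 * ((N + 1) / (N + 1 + 2 * d)) * (1 - (N + 1) / (N + 1 + 2 * d)) * d =
     - (4 * d ^+ 2 / (N + 1 + 2 * d) ^+ 2) by field; rewrite gt_eqF.
  by rewrite oppr_ge0 leNgt p.
have Wp : 0 < W by rewrite lt_def Wn.
have h2 := quadratic_disc Wp (ltW d0) h.
rewrite -sqrtrM // -(@ler_sqr R) ?nnegrE ?sqrtr_ge0 ?(ltW d0) // sqr_sqrtr // mulr_ge0 //.
Qed.

End SquareRoots.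

(** * The cones as families of linear inequalities *)

Section Cone.
Local Open Scope classical_set_scope.
Local Open Scope ring_scope.
Variables (R : realType) (n : nat) (b : R).
Hypothesis n5 : (5 < n)%N.
Let N : R := n%:R.
Let bm := bmax2 R n.
Let a0 := aC n bm.
Let g := gammaC n bm.
Let om := omegaC n bm.
Let a := taC n b.
Notation P := ('M[R]_n * R)%type.
Implicit Types (S T X : tensor R n).
Hypothesis om0 : 0 < om.
Hypothesis m0 : 0 < coefm n a0.
Hypothesis u0 : 0 < coefu n bm.
Hypothesis mt : 0 < coefm n a.
Hypothesis ut : 0 < coefu n b.

Let n0 : n != 0%N. Proof. by rewrite -lt0n; apply: ltn_trans n5. Qed.
Let i0 : 'I_n := Ordinal (ltn_trans (isT : 0 < 5)%N n5).
Let i1 : 'I_n := Ordinal (ltn_trans (isT : 1 < 5)%N n5).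
Let i2 : 'I_n := Ordinal (ltn_trans (isT : 2 < 5)%N n5).
Let i3 : 'I_n := Ordinal (ltn_trans (isT : 3 < 5)%N n5).

Definition first_tensor X : tensor R n := unlab a0 bm X.
Definition second_tensor X : tensor R n := unlab a b X.

(** Both preimages of X are linear in X, so the five functions are linear in (X, T). A frame is read
    off the top rows of an orthogonal matrix, which keeps the parameter sets compact. *)
Definition fam (i : 'I_5) (p : P) X T : R :=
  let r k := row k p.1 in
  match val i with
  | 0 => \sum_(i < n) \sum_(j < n) \sum_(k < n) \sum_(l < n) coord4 T i j k l * p.1 i j * p.1 k l
  | 1 => picv (first_tensor X - T) (r i0) (r i1) (r i2) (r i3)
  | 2 => bform (ric (first_tensor X)) (r i0) (r i0) + bform (ric (first_tensor X)) (r i1) (r i1)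
           + 2 * g / N * scal (first_tensor X)
  | 3 => p.2 ^+ 2 * (om * scal (first_tensor X)) + (1 - p.2) ^+ 2 * nplane T (r i0) (r i1)
       - 2 * p.2 * (1 - p.2) * (bform (ric (first_tensor X)) (r i1) (r i1) - bform (ric (first_tensor X)) (r i0) (r i0))
  | _ => picl (second_tensor X) (Num.sqrt (2 * a) *: ric (second_tensor X)) (r i0) (r i1) (r i2) (r i3) p.2
  end.
Definition dom (i : 'I_5) : set P := if val i is 0 then @unit_bivectors R n else @frames R n.

Lemma dom_compact i : compact (dom i).
Proof. by case: i => [[|m] hm]; [exact: compact_unit_bivectors|exact: compact_frames]. Qed.

Lemma fam_linear i p : bilinear_form (fam i p).
Proof.
move=> c X T X' T'; rewrite /fam; case: i => [[|[|[|[|[|m]]]]] hm] //=.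
- rewrite mulr_sumr -big_split; apply: eq_bigr => i _; rewrite mulr_sumr -big_split; apply: eq_bigr => j _.
  rewrite mulr_sumr -big_split; apply: eq_bigr => k _; rewrite mulr_sumr -big_split; apply: eq_bigr => l _ /=.
  by rewrite coord4D coord4Z; ring.
- rewrite /first_tensor unlab_linear.
  have -> : c *: unlab a0 bm X + unlab a0 bm X' - (c *: T + T') =
     c *: (unlab a0 bm X - T) + (unlab a0 bm X' - T').
    by rewrite opprD addrACA scalerBr.
  by rewrite [LHS]picvD picvZ.
- rewrite /first_tensor unlab_linear; move: (unlab a0 bm X) (unlab a0 bm X') => Y Y'.
  rewrite !ricD !ricZ !scalD !scalZ.
  rewrite ![bform (c *: _ + _) _ _]bformDm ![bform (c *: _) _ _]bformZm; ring.
- rewrite /first_tensor unlab_linear; move: (unlab a0 bm X) (unlab a0 bm X') => Y Y'.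
  rewrite !ricD !ricZ !scalD !scalZ nplaneD nplaneZ.
  rewrite ![bform (c *: _ + _) _ _]bformDm ![bform (c *: _) _ _]bformZm; ring.
- rewrite /second_tensor unlab_linear; move: (unlab a b X) (unlab a b X') => Y Y'.
  rewrite /picl !qform_bform !ricD !ricZ picvD picvZ.
  rewrite ![bform (Num.sqrt _ *: _) _ _]bformZm ![bform (c *: _ + _) _ _]bformDm ![bform (c *: _) _ _]bformZm; ring.
Qed.

Lemma fam_continuous i X T : continuous (fun p => fam i p X T).
Proof.
have cr k j : continuous (fun p : P => row k p.1 0 j) by exact: continuous_row.
have ct := @param_continuous R n.
have c1 : continuous (fun p : P => 1 - p.2).
  rewrite (_ : (fun p => _) = fun p : P => 1 + -1 * p.2); last by apply/funext => p; ring.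
  by apply: continuous_add; [exact: continuous_const|apply: continuous_mul => //; exact: continuous_const].
have sub (f h : P -> R) : continuous f -> continuous h -> continuous (fun p => f p - h p).
  move=> cf ch; rewrite (_ : (fun p => _) = fun p : P => f p + -1 * h p); last by apply/funext => p; ring.
  by apply: continuous_add => //; apply: continuous_mul => //; exact: continuous_const.
have sq (f : P -> R) : continuous f -> continuous (fun p => f p ^+ 2).
  by move=> cf; exact: continuous_mul.
have cc (c : R) : continuous (fun _ : P => c) by exact: continuous_const.
rewrite /fam; case: i => [[|[|[|[|[|m]]]]] hm] //=.
- do 4 (apply: continuous_bigsum => ?); do 2 (apply: continuous_mul; last exact: entry_continuous).
  exact: cc.
- by apply: continuous_picv.
- apply: continuous_add; last exact: cc.
  by apply: continuous_add; exact: continuous_bform.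
- apply: (sub _ _).
    apply: continuous_add; apply: continuous_mul; try exact: sq; first exact: cc.
    rewrite /nplane; apply: (sub _ _); first by apply: continuous_add; exact: continuous_bform.
    by apply: continuous_mul; [exact: cc|exact: continuous_ev].
  apply: continuous_mul; first by apply: continuous_mul => //; apply: continuous_mul.
  by apply: (sub _ _); exact: continuous_bform.
- rewrite /picl; apply: continuous_add.
    apply: continuous_picv => // j; rewrite (_ : (fun p => _) = fun p : P => p.2 * row i3 p.1 0 j).
      exact: continuous_mul.
    by apply/funext => p; rewrite mxE.
  apply: continuous_mul; first by apply: (sub _ _) => //; exact: sq.
  by apply: continuous_add; exact: continuous_bform.
Qed.

Definition member X T : Prop :=
  [/\ nonneg_def T, PIC (first_tensor X - T),
   forall x y, orthonormal [:: x; y] -> 0 <= bform (ric (first_tensor X)) x x + bform (ric (first_tensor X)) y y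
           + 2 * g / N * scal (first_tensor X),
   forall x y t, orthonormal [:: x; y] -> 0 <= t <= 1 ->
      0 <= t ^+ 2 * (om * scal (first_tensor X)) + (1 - t) ^+ 2 * nplane T x y
       - 2 * t * (1 - t) * (bform (ric (first_tensor X)) y y - bform (ric (first_tensor X)) x x) &
   forall x y z w t, orthonormal [:: x; y; z; w] -> 0 <= t <= 1 ->
      0 <= picl (second_tensor X) (Num.sqrt (2 * a) *: ric (second_tensor X)) x y z w t].

Let n4 : (4 <= n)%N. Proof. exact: leq_trans n5. Qed.
Let n2 : (2 <= n)%N. Proof. exact: leq_trans n5. Qed.

Lemma frame_rows4 (Q : 'M[R]_n) : Q *m Q^T = 1%:M ->
  orthonormal [:: row i0 Q; row i1 Q; row i2 Q; row i3 Q].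
Proof. by move=> QQ; exact: frame4. Qed.

Lemma frame_rows2 (Q : 'M[R]_n) : Q *m Q^T = 1%:M -> orthonormal [:: row i0 Q; row i1 Q].
Proof. by move=> QQ; rewrite /orthonormal /= -!/(dot _ _) !orth_dot // !eqxx. Qed.

Lemma familyP X T : family dom fam X T <-> member X T.
Proof.
have p01 (t : R) : t = 0 -> 0 <= t <= 1 by move=> ->; rewrite lexx ler01.
split=> [h|[h0 h1 h2 h3 h4]].
  split.
  - move=> phi ph; pose c := \sum_i \sum_j phi i j ^+ 2.
    have c0 : 0 <= c by apply: sumr_ge0 => i _; apply: sumr_ge0 => j _; exact: sqr_ge0.
    have [ce|cn] := eqVneq c 0.
      have z i j : phi i j = 0.
        move/eqP: ce; rewrite psumr_eq0 => [|k _]; last by apply: sumr_ge0 => l _; exact: sqr_ge0.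
        move=> /allP/(_ i (mem_index_enum _)) /=; rewrite psumr_eq0 => [|k _]; last exact: sqr_ge0.
        by move=> /allP/(_ j (mem_index_enum _)) /=; rewrite sqrf_eq0 => /eqP.
      apply: sumr_ge0 => i _; apply: sumr_ge0 => j _; apply: sumr_ge0 => k _; apply: sumr_ge0 => l _.
      by rewrite !z mulr0.
    have sc : Num.sqrt c != 0 by rewrite sqrtr_eq0 -ltNge lt_def cn.
    have := h (Ordinal (isT : 0 < 5)%N) ((Num.sqrt c)^-1 *: phi, 0).
    have hd : dom (Ordinal (isT : 0 < 5)%N) ((Num.sqrt c)^-1 *: phi, 0).
      split; last exact: p01.
      split; first by rewrite /= linearZ /= ph scalerN.
      rewrite /= (eq_bigr (fun i => \sum_j c^-1 * phi i j ^+ 2)) => [|i _].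
        by under eq_bigr do rewrite -mulr_sumr; rewrite -mulr_sumr mulVf.
      by apply: eq_bigr => j _; rewrite mxE exprMn exprVn sqr_sqrtr.
    move=> /(_ hd); rewrite /fam /=.
    rewrite (eq_bigr (fun i => c^-1 * \sum_(j < n) \sum_(k < n) \sum_(l < n) coord4 T i j k l * phi i j * phi k l)).
      by rewrite -mulr_sumr pmulr_rge0 // invr_gt0 lt_def cn.
    move=> i _; rewrite mulr_sumr; apply: eq_bigr => j _; rewrite mulr_sumr; apply: eq_bigr => k _.
    rewrite mulr_sumr; apply: eq_bigr => l _; rewrite !mxE -{3}(sqr_sqrtr c0); field; exact: sc.
  - move=> x y z w o4; have [Q QQ rQ] := frame_of o4 n4.
    have := h (Ordinal (isT : 1 < 5)%N) (Q, 0) (conj QQ (p01 _ erefl)).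
    by rewrite /fam /= !rQ.
  - move=> x y o2; have [Q QQ rQ] := frame_of o2 n2.
    have := h (Ordinal (isT : 2 < 5)%N) (Q, 0) (conj QQ (p01 _ erefl)).
    by rewrite /fam /= !rQ.
  - move=> x y t o2 ht; have [Q QQ rQ] := frame_of o2 n2.
    have := h (Ordinal (isT : 3 < 5)%N) (Q, t) (conj QQ ht).
    by rewrite /fam /= !rQ.
  - move=> x y z w t o4 ht; have [Q QQ rQ] := frame_of o4 n4.
    have := h (Ordinal (isT : 4 < 5)%N) (Q, t) (conj QQ ht).
    by rewrite /fam /= !rQ.
move=> [[|[|[|[|[|m]]]]] hm] p //= [] hp hp2; rewrite /fam /=.
- by case: hp => ph _; exact: h0.
- exact: h1 (frame_rows4 hp).
- exact: h2 (frame_rows2 hp).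
- exact: h3 (frame_rows2 hp) hp2.
- exact: h4 (frame_rows4 hp) hp2.
Qed.

Lemma member_PIC X T : S2so T -> nonneg_def T -> PIC (first_tensor X - T) -> PIC (first_tensor X).
Proof.
move=> hT pT pU x y z w o4; have := addr_ge0 (pU _ _ _ _ o4) (nonneg_picv x y z w hT pT).
by rewrite -[_ + 2 * ev (_ - T) _ _ _ _]/(picv (first_tensor X - T) x y z w) -picvD subrK.
Qed.

Let mn0 : coefm n a0 != 0. Proof. by rewrite gt_eqF. Qed.
Let un0 : coefu n bm != 0. Proof. by rewrite gt_eqF. Qed.
Let mtn0 : coefm n a != 0. Proof. by rewrite gt_eqF. Qed.
Let utn0 : coefu n b != 0. Proof. by rewrite gt_eqF. Qed.

Lemma first_tensor_scal X : scal X = coefm n a0 * scal (first_tensor X).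
Proof.
have nn : n%:R != 0 :> R by rewrite pnatr_eq0.
have := smean_lab n0 a0 bm (first_tensor X); rewrite /first_tensor unlab_lab // /smean => e.
by rewrite -[LHS](divfK nn) e mulrA divfK.
Qed.

Lemma scal_ge0_of_PIC S : S2so S -> PIC S -> 0 <= scal S.
Proof.
by move=> hS pS; apply: (PIC_scal_ge0 hS pS (ltnW n5) (Q := 1%:M)); rewrite trmx1 mulmx1.
Qed.

(** S - T has nonnegative isotropic, hence scalar, curvature. So |T_ijkl| <= scal T <= scal S, and
    scal S is a fixed multiple of scal X. *)
Lemma fam_bound X T : CB X -> S2so T -> family dom fam X T ->
  forall i j, `|T i j| <= (coefm n a0)^-1 * N ^+ 2 * \sum_k \sum_l `|X k l|.
Proof.
move=> cX hT /familyP [pT pU _ _ _] I J.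
have [hF _] := CB_lab (- (a0 / coefm n a0)) (- (bm / coefu n bm)) cX.
have hU : S2so (first_tensor X - T).
  by have := S2so_comb (-1) hT hF; rewrite scaleN1r addrC.
have sU := scal_ge0_of_PIC hU pU.
have sT : scal T <= scal (first_tensor X).
  by have := sU; rewrite scalD -scaleN1r scalZ; lra.
have [i [j ->]] := mxvec_index_ex I; have [k [l ->]] := mxvec_index_ex J.
apply: le_trans (nonneg_bound i j k l hT pT) _; apply: le_trans sT _.
have -> : scal (first_tensor X) = (coefm n a0)^-1 * scal X.
  by rewrite (first_tensor_scal X) mulKf.
rewrite -mulrA ler_pM2l ?invr_gt0 //.
have entry p q : X p q <= \sum_k \sum_l `|X k l|.
  apply: le_trans (ler_norm _) _; rewrite (bigD1 p) //= (bigD1 q) //= -addrA lerDl addr_ge0 ?sumr_ge0 // => u _.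
  by rewrite sumr_ge0.
rewrite /scal /mxtrace; apply: le_trans (_ : \sum_(i < n) \sum_(p < n) (\sum_k \sum_l `|X k l|) <= _).
  by apply: ler_sum => u _; rewrite mxE; apply: ler_sum => v _; exact: entry.
by rewrite !sumr_const card_ord -mulrnA -[X in X <= _]mulr_natl natrM expr2.
Qed.

Lemma sum_complement T x y (s : seq 'rV[R]_n) : S2so T -> size [:: x, y & s] = n ->
  orthonormal [:: x, y & s] -> \sum_(p <- s) (ev T x p x p + ev T y p y p) = nplane T x y.
Proof.
move=> hT sz os; pose Q : 'M[R]_n := \matrix_(i < n) nth 0 [:: x, y & s] i.
have QQ : Q *m Q^T = 1%:M by exact: orth_of_seq.
have r0 : row i0 Q = x by rewrite rowK. have r1 : row i1 Q = y by rewrite rowK.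
have tot z i : row i Q = z -> bform (ric T) z z = \sum_(p <- [:: x, y & s]) ev T z p z p.
  move=> <-; rewrite bform_ric_row // mxE (big_nth 0) sz big_mkord; apply: eq_bigr => p _.
  by rewrite coord4_rot !rowK.
rewrite /nplane (tot x i0) // (tot y i1) // !big_cons big_split /=.
rewrite !ev_same // (ev_antil x y y x) // (ev_antir x y x y) //; ring.
Qed.

(** The root of a negative number is zero, so clause (4) is replaced by its linear form only after
    scal S >= 0 is known; this holds because S = (S - T) + T has nonnegative isotropic curvature. *)
Lemma tconeC_pcone : @tconeC R n b = pcone dom fam.
Proof.
have picE S x y z w t : CB S -> picl S (Num.sqrt (2 * a) *: ric S) x y z w t =
   ev S x z x z + t ^+ 2 * ev S x w x w + ev S y z y z + t ^+ 2 * ev S y w y w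
   - 2 * t * ev S x y z w + Num.sqrt (2 * taC n b) * (1 - t ^+ 2) * (Ric S x x + Ric S y y).
  move=> cS; rewrite /picl picv_scaled // !qform_bform !bformZm -/a.
  rewrite -[Ric S x x]/(bform (ric S) x x) -[Ric S y y]/(bform (ric S) y y); ring.
have sq S : 0 <= scal S -> Num.sqrt om * Num.sqrt (scal S) = Num.sqrt (om * scal S).
  by move=> _; rewrite [RHS]sqrtrM ?(ltW om0).
apply/seteqP; split=> [X [S2 [cS2 [S [cS [T [hT [pT pU hR hD]]]] eS] hP] <-]|X [cX [T [hT /familyP hm]]]].
  split; first exact: CB_lab.
  exists T; split=> //; apply/familyP.
  have e2 : second_tensor (lab a b S2) = S2 by rewrite /second_tensor lab_unlab.
  have e1 : first_tensor (lab a b S2) = S by rewrite -eS /first_tensor lab_unlab.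
  have [hS _] := cS.
  have s0 : 0 <= scal S.
    apply: scal_ge0_of_PIC => // x y z w o4.
    have := addr_ge0 (pU _ _ _ _ o4) (nonneg_picv x y z w hT pT).
    by rewrite -[_ + 2 * ev (_ - T) _ _ _ _]/(picv (S - T) x y z w) -picvD subrK.
  rewrite /member e1 e2; split=> //.
  - move=> x y t o2 ht; have N0 := nplane_ge0 n2 hT pT o2.
    have W0 : 0 <= om * scal S by rewrite mulr_ge0 // ltW.
    have [s [os sz]] := orthonormal_complete o2 n2.
    have := hD x y s sz os; rewrite (sum_complement hT sz os) sq //.
    by move=> /(sqrt_clause _ W0 N0)/(_ t ht).
  - by move=> x y z w t o4 ht; rewrite picE //; exact: hP.
have [pT pU hR hD hP] := hm.
have cF : CB (first_tensor X) by exact: CB_lab.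
have c2 : CB (second_tensor X) by exact: CB_lab.
exists (second_tensor X); last by rewrite /second_tensor unlab_lab.
split=> //.
- exists (first_tensor X); last by rewrite /first_tensor /second_tensor !unlab_lab.
  split=> //; exists T; split=> //; split=> //.
  move=> x y s sz os; rewrite (sum_complement hT sz os) sq; last first.
    by apply: scal_ge0_of_PIC; [case: cF|exact: member_PIC hT pT pU].
  have o2 : orthonormal [:: x; y].
    move: os; rewrite /orthonormal /= => /andP[/and3P[-> -> _] /andP[/andP[-> _] _]] //.
  have N0 := nplane_ge0 n2 hT pT o2.
  have W0 : 0 <= om * scal (first_tensor X).
    by rewrite mulr_ge0 ?(ltW om0) //; apply: scal_ge0_of_PIC; [case: cF|exact: member_PIC hT pT pU].
  by apply/(sqrt_clause _ W0 N0) => t ht; exact: hD.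
- by move=> x y z w t o4 ht; rewrite -picE //; exact: hP.
Qed.

End Cone.

(** * Transversality of the second cone family *)

Section Transversality.
Local Open Scope classical_set_scope.
Local Open Scope ring_scope.
Variables (R : realType) (n : nat) (b w e G : R).
Let N : R := n%:R.
Let bm := bmax2 R n.
Let a0 := aC n bm.
Let g := gammaC n bm.
Let om := omegaC n bm.
Let a := taC n b.
Let k := N - 2.
(** For the first cone, condition (3) reads A_11 + A_22 >= - 2 (1 + g) s. Passing from S to X
    multiplies A by [coefu] and s by [coefm], and passing on to the second preimage divides by the
    corresponding factors; [tau] is the constant that results. *)
Let tau := (1 + g) * (coefu n bm / coefm n a0) * (coefm n a / coefu n b).
Hypothesis n5 : (5 < n)%N.
Hypothesis st : stage1 n bm a0 g (rhoC n bm) om w e G.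
Hypothesis eps01 : 0 < eps R n < 1.
Hypothesis mixed : forall H x y z : R, G <= H ->
  0 <= 2 * y ^+ 2 + 2 / (N - 2) * (x - y) ^+ 2 - 8 * y * z - 8 * bm * x * z + 2 * H * z ^+ 2.
Hypothesis linear : forall s q : R, 0 < s -> 0 <= q ->
  0 < w * N * s / (N - 2) + (q - 2 * ((1 + g) * s)) * (4 / (N - 2) + 2 + 8 * bm)
    + s * (2 * coefm n a0 - 8 * a0 * (N - 2))
    - e * ((1 + g) / w) * ((2 * N * ((1 + g) * s) + (N - 4) * q) / (N - 2)).
Hypothesis G4 : 4 <= G.
Hypothesis b0 : 0 < b.
Hypothesis c0 : 0 < coefc n a b.
Hypothesis cond : [/\ tau <= 1, 0 < (1 + k * b / 2) * (8 * (N - 1) - 8 * k * tau) - 2 * (4 + 4 * N ^+ 2 / k ^+ 2) * tau ^+ 2 &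
   2 * tau * (k - 2) + 2 * N * tau * (1 - 4 / k ^+ 2) <= 4 * k].

Let bm0 : 0 < bm. Proof. by case: st => -[]. Qed.
Let g0 : 0 < g. Proof. by case: st => -[]. Qed.
Let m0 : 0 < coefm n a0. Proof. by case: st => -[]. Qed.
Let rho0 : 0 < rhoC n bm. Proof. by case: st => -[]. Qed.
Let om0 : 0 < om. Proof. by case: st => _ _ _ _ [h1 h2 _ _ _]; exact: lt_le_trans h2 h1. Qed.
Let N6 : 6 <= N. Proof. by rewrite /N ler_nat. Qed.
Let n0 : n != 0%N. Proof. by rewrite -lt0n; apply: ltn_trans n5. Qed.
Let coefu_gt0 (c : R) : 0 < c -> 0 < coefu n c.
Proof.
move=> cp; have h : 0 <= (N - 2) * c by apply: mulr_ge0; [have := N6; lra|exact: ltW].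
by rewrite /coefu -/N; lra.
Qed.
Let u0 : 0 < coefu n bm. Proof. exact: coefu_gt0. Qed.
Let ut : 0 < coefu n b. Proof. exact: coefu_gt0. Qed.
Let a00 : 0 < a.
Proof.
have h : 0 <= (N - 2) / 2 * b ^+ 2 by apply: mulr_ge0; [have := N6; lra|exact: sqr_ge0].
by rewrite /a /taC -/N ltr_pwDl.
Qed.
Let mt : 0 < coefm n a.
Proof.
have h : 0 <= (N - 1) * a by apply: mulr_ge0; [have := N6; lra|exact: ltW].
by rewrite /coefm -/N; lra.
Qed.
Let n4 : (4 <= n)%N. Proof. exact: leq_trans n5. Qed.
Let mn0 : coefm n a0 != 0. Proof. by rewrite gt_eqF. Qed.
Let un0 : coefu n bm != 0. Proof. by rewrite gt_eqF. Qed.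
Let mtn0 : coefm n a != 0. Proof. by rewrite gt_eqF. Qed.
Let utn0 : coefu n b != 0. Proof. by rewrite gt_eqF. Qed.

Let tau0 : 0 <= tau.
Proof.
rewrite /tau mulr_ge0 // ?divr_ge0 ?(ltW mt) ?(ltW ut) //.
by apply: mulr_ge0; [have := g0; lra|exact: divr_ge0 (ltW u0) (ltW m0)].
Qed.

Lemma omega_strict : 32 / 27 * rhoC n bm ^+ 3 * om ^+ 2 * N ^+ 2 <
   4 * (1 + g) * (g + (N - 2) * bm ^+ 2 * (1 + g)).
Proof. by case/andP: eps01 => h1 h2; apply: omega_upper. Qed.

Lemma tcone_transversal : transversally_invariant (@tconeC R n b).
Proof.
have K := @dom_compact R n.
have lin := @fam_linear R n b n5.
have cont := @fam_continuous R n b n5.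
have C0 : 0 <= (coefm n a0)^-1 * N ^+ 2 by rewrite mulr_ge0 ?sqr_ge0 // invr_ge0 ltW.
have bd := @fam_bound R n b n5 m0 u0.
have -> := @tconeC_pcone R n b n5 om0 m0 u0 mt ut.
split.
- by move=> X [].
- exact: (pcone_closed_convex_cone lin C0 bd).
move=> X pX Xn0; have [cX [T [hT hf]]] := pX.
have [pT pU hR hD hP] := (@familyP R n b n5 X T).1 hf.
set S := first_tensor X in pU hR hD; set S2 := second_tensor b X in hP.
have cS : CB S by exact: CB_lab.
have cS2 : CB S2 by exact: CB_lab.
have hS : S2so S by case: cS.
have XE : X = lab a0 bm S by rewrite /S /first_tensor unlab_lab.
have XE2 : X = lab a b S2 by rewrite /S2 /second_tensor unlab_lab.
have pS : PIC S by exact: member_PIC hT pT pU.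
(* A nonzero X has a nonzero S, and [PIC_flat] excludes zero scalar curvature. *)
have sc0 : 0 < scal S.
  rewrite lt_def (scal_ge0_of_PIC n5 hS pS) andbT; apply: contra_not_neq Xn0 => z.
  rewrite XE (PIC_flat (ltnW n5) cS pS z).
  by have := lab_linear a0 bm (-1) (0 : tensor R n) 0; rewrite scaler0 addr0 scaleN1r addNr.
have s0 : 0 < smean S by rewrite divr_gt0 // ltr0n lt0n.
have sE : coefm n a * smean S2 = coefm n a0 * smean S.
  by rewrite -(smean_lab n0 a b S2) -(smean_lab n0 a0 bm S) -XE -XE2.
have s20 : 0 < smean S2 by rewrite -(pmulr_rgt0 _ mt) sE mulr_gt0.
have tE : coefu n b *: tfric S2 = coefu n bm *: tfric S.
  by rewrite -(tfric_lab n0 a b S2) -(tfric_lab n0 a0 bm S) -XE -XE2.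
have low x y : orthonormal [:: x; y] -> - 2 * tau * smean S2 <= bform (tfric S2) x x + bform (tfric S2) y y.
  move=> o2; have := hR x y o2; rewrite ricE !bformA_scalar.
  have /andP[/andP[/eqP xx /andP[/eqP yy _]] _] := o2; rewrite /dot xx yy !mulr1.
  have -> : 2 * gammaC n (bmax2 R n) / n%:R * scal S = 2 * g * smean S by rewrite /smean -/bm -/g; ring.
  have ex v : coefu n b * bform (tfric S2) v v = coefu n bm * bform (tfric S) v v by rewrite -!bformZm tE.
  set B := bform (tfric S) x x; set B' := bform (tfric S) y y => h.
  rewrite -(ler_pM2l ut) mulrDr !ex -/B -/B'.
  have -> : coefu n b * (- 2 * tau * smean S2) = coefu n bm * (- 2 * (1 + g) * smean S).
    have -> : smean S2 = coefm n a0 * smean S / coefm n a by rewrite -sE mulrC mulKf.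
    by rewrite /tau; field; rewrite mtn0 utn0 mn0.
  by rewrite -mulrDr ler_pM2l //; lra.
have [t1 cn1 cn2] := cond.
have V1 : first_tensor (hamQ X) = first_velocity bm S.
  by have := unlab_hamQ n0 cS mn0 un0; rewrite -XE.
have V2 : second_tensor b (hamQ X) = second_velocity b S2.
  by have := unlab_hamQ n0 cS2 mtn0 utn0; rewrite -XE2.
apply: (@pcone_transversal R n 5 _ _ _ K lin cont _ _ _ _ cX hT hf (CB_hamQ cX) (auxiliary_S2so bm cS hT)).
move=> [[|[|[|[|[|m]]]]] hm] p //= [] hp hp2; rewrite /fam /= ?V1 ?V2.
- by case: hp => ph p1 _; exact: (auxiliary_pos st hT pT s0).
- exact: (pic_velocity n5 st cS hT pT pU s0 hR (frame_rows4 n5 hp)).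
- exact: (sum_velocity n5 st omega_strict cS hT pT pU s0 hR hD (frame_rows2 n5 hp)).
- exact: (difference_velocity n5 st mixed linear G4 cS hT pT s0 hR hD (frame_rows2 n5 hp)).
- exact: (picl_velocity n5 b0 tau0 t1 c0 cn1 cn2 cS2 s20 low hP (frame_rows4 n5 hp) hp2).
Qed.

End Transversality.

(** * Coefficients of the second family and conclusion *)

Section SecondCoefficient.
Variables (R : realType) (n : nat) (b : R).
Let N : R := n%:R.
Hypothesis (n2 : (2 <= n)%N) (b0 : 0 < b).

Let N2 : 0 <= N - 2. Proof. by rewrite /N subr_ge0 ler_nat. Qed.

Lemma taC_gt0 : 0 < taC n b.
Proof.
have h : 0 <= (N - 2) / 2 * b ^+ 2 by apply: mulr_ge0; [apply: divr_ge0|exact: sqr_ge0].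
by rewrite /taC -/N ltr_pwDl.
Qed.

Lemma coefm_taC_gt0 : 0 < coefm n (taC n b).
Proof.
have N1 : 0 <= N - 1 by have := N2; lra.
have h : 0 <= 2 * (N - 1) * taC n b by rewrite !mulr_ge0 // ltW // taC_gt0.
by rewrite /coefm -/N ltr_pwDl.
Qed.

Lemma coefc_taC_gt0 : N * (N - 2) * b ^+ 2 < 2 * (1 - 2 * b) -> 0 < coefc n (taC n b) b.
Proof.
move=> h; have m0 := coefm_taC_gt0.
have N0 : 0 < N by have := N2; lra.
rewrite /coefc -/N divr_gt0 ?mulr_gt0 //.
have -> : N * b ^+ 2 * (1 - 2 * b) - 2 * (taC n b - b) * (1 - 2 * b + N * b ^+ 2) =
   b ^+ 2 * (2 * (1 - 2 * b) - N * (N - 2) * b ^+ 2) by rewrite /taC -/N; field.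
by rewrite mulr_gt0 ?exprn_gt0 // subr_gt0.
Qed.

Lemma coef_ratio : coefm n (taC n b) / coefu n b <= 1 + N * b.
Proof.
have u0 : 0 < coefu n b by rewrite /coefu -/N ltr_pwDl // mulr_ge0 // ltW.
rewrite ler_pdivrMr // -subr_ge0.
have -> : (1 + N * b) * coefu n b - coefm n (taC n b) = (N - 2) * b ^+ 2.
  by rewrite /coefu /coefm /taC -/N; field.
by rewrite mulr_ge0 ?sqr_ge0.
Qed.

End SecondCoefficient.

Lemma tau_bound (R : realType) (K g u m r x : R) : 0 < m -> 0 <= r -> 0 <= K ->
  (1 + g) * u <= K * m -> r <= x -> (1 + g) * (u / m) * r <= K * x.
Proof.
move=> m0 r0 K0 h rx; apply: (@le_trans _ _ (K * r)); last exact: ler_wpM2l.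
by apply: ler_wpM2r => //; rewrite mulrA ler_pdivrMr.
Qed.

Theorem theorem3p5 (R : realType) (n : nat) (b : R) :
  n = 7%N \/ n = 8%N -> 0 < b -> b <= tbmax2 R n ->
  transversally_invariant (@tconeC R n b).
Proof.
move=> [->|->] b0 bt.
- have b1 : b <= 3 / 125 by exact: bt.
  have [st [ha hK]] := stage1_7 R.
  have n4 : (3 < 7)%N by [].
  have bm0 : 0 < bmax2 R 7 by case: st => -[].
  have m0 : 0 < coefm 7 (aC 7 (bmax2 R 7)) by case: st => -[].
  have bmE : bmax2 R 7 = 131 / 2000 by [].
  have hg : gammaC 7 (bmax2 R 7) = 131 / 4524.
    by have := gamma_eq n4 bm0; rewrite bmE; clear; lra.
  have e2 : 7 - 2 = 5 :> R by clear; ring.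
  have cr : 0 <= coefm 7 (taC 7 b) / coefu 7 b.
    apply: divr_ge0; first by apply: ltW; exact: coefm_taC_gt0.
    by rewrite /coefu e2; clear -b0; lra.
  apply: (tcone_transversal (isT : (5 < 7)%N) st).
  - by have -> : eps R 7 = 1 / 10000 by []; apply/andP; split; clear; lra.
  - by move=> H x y z hH; rewrite e2 bmE; exact: mixed_form7.
  - move=> s q s0 q0; rewrite hg e2 bmE /coefm; move: (aC 7 _) ha => a ha.
    (* The coefficient of a in this inequality is negative, so an upper bound for a is enough. *)
    have h : 0 <= (785 / 1000 / 10 - a) * s by rewrite mulr_ge0 ?subr_ge0 // ltW.
    by clear -h s0 q0; lra.
  - by clear; lra.
  - exact: b0.
  - apply: coefc_taC_gt0; [by []|exact: b0|]; have h : 0 <= b * (3 / 125 - b) by rewrite mulr_ge0 ?subr_ge0 // ltW.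
    by rewrite e2; clear -h b0 b1; lra.
  - rewrite e2; apply: second_cond7; [exact: b0|exact: b1| |].
      apply: mulr_ge0; last exact: cr.
      apply: mulr_ge0; first by rewrite hg; clear; lra.
      by apply: divr_ge0; [rewrite /coefu e2 bmE; clear; lra|exact: ltW].
    apply: tau_bound; [exact: m0|exact: cr|by clear; lra| |exact: (coef_ratio (isT : (2 <= 7)%N) b0)].
    by rewrite /coefu e2; exact: hK.
- have b1 : b <= 1 / 40 by exact: bt.
  have [st [ha hK]] := stage1_8 R.
  have n4 : (3 < 8)%N by [].
  have bm0 : 0 < bmax2 R 8 by case: st => -[].
  have m0 : 0 < coefm 8 (aC 8 (bmax2 R 8)) by case: st => -[].
  have bmE : bmax2 R 8 = 1 / 18 by [].
  have hg : gammaC 8 (bmax2 R 8) = 1 / 41.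
    by have := gamma_eq n4 bm0; rewrite bmE; clear; lra.
  have e2 : 8 - 2 = 6 :> R by clear; ring.
  have cr : 0 <= coefm 8 (taC 8 b) / coefu 8 b.
    apply: divr_ge0; first by apply: ltW; exact: coefm_taC_gt0.
    by rewrite /coefu e2; clear -b0; lra.
  apply: (tcone_transversal (isT : (5 < 8)%N) st).
  - by have -> : eps R 8 = 1 / 1000 by []; apply/andP; split; clear; lra.
  - by move=> H x y z hH; rewrite e2 bmE; exact: mixed_form8.
  - move=> s q s0 q0; rewrite hg e2 bmE /coefm; move: (aC 8 _) ha => a ha.
    have h : 0 <= (67 / 1000 - a) * s by rewrite mulr_ge0 ?subr_ge0 // ltW.
    by clear -h s0 q0; lra.
  - by clear; lra.
  - exact: b0.
  - apply: coefc_taC_gt0; [by []|exact: b0|]; have h : 0 <= b * (1 / 40 - b) by rewrite mulr_ge0 ?subr_ge0 // ltW.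
    by rewrite e2; clear -h b0 b1; lra.
  - rewrite e2; apply: second_cond8; [exact: b0|exact: b1| |].
      apply: mulr_ge0; last exact: cr.
      apply: mulr_ge0; first by rewrite hg; clear; lra.
      by apply: divr_ge0; [rewrite /coefu e2 bmE; clear; lra|exact: ltW].
    apply: tau_bound; [exact: m0|exact: cr|by clear; lra| |exact: (coef_ratio (isT : (2 <= 8)%N) b0)].
    by rewrite /coefu e2; exact: hK.
Qed.
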